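(* Let $\lambda>-1$. The set of all operators $\varphi(\mathbf{K})$, defined by (the equivalence classes of) $E$-measurable functions $\varphi\in L_\infty(\mathbb{R},E)$, constitutes the class of bounded mutually commuting vertical operators in $\mathcal{A}^2_\lambda(\Pi)$, and thus coincides with the von Neumann algebra $\mathcal{J}(L_\infty(\mathbb{R},E))$ of bounded vertical operators in $\mathcal{A}^2_\lambda(\Pi)$, where $\mathcal{J}(\varphi):=\varphi(\mathbf{K})$.
   Context: $\Pi\subset\mathbb{C}$ is the upper half-plane, $z=x+iy$. For $\lambda>-1$, $\mathcal{A}^2_\lambda(\Pi)$ is the weighted Bergman space: the closed subspace of analytic functions in $L_2(\Pi,d\nu_\lambda)$, where $d\nu_\lambda(z)=\frac{\lambda+1}{\pi}(2y)^\lambda dA(z)$ and $dA$ is Lebesgue measure. An operator in $\mathcal{A}^2_\lambda(\Pi)$ is called vertical if it commutes with all horizontal translation operators $(\tau_hf)(z)=f(z-h)$, $h\in\mathbb{R}$. The operator $\mathbf{K}=\frac1i\frac{\partial}{\partial z}$ acts in $\mathcal{A}^2_\lambda(\Pi)$ on the domain $\mathcal{D}(\mathbf{K})=\{f\in\mathcal{A}^2_\lambda(\Pi):\frac1i f'\in\mathcal{A}^2_\lambda(\Pi)\}$. It is self-adjoint, being unitarily equivalent to multiplication by the independent variable $\xi$ in $L_2(\mathbb{R}_+)$ (Lebesgue measure): $\mathbf{K}=R^*\xi R$, where $R:\mathcal{A}^2_\lambda(\Pi)\to L_2(\mathbb{R}_+)$ is the unitary operator with $(R^*\psi)(z)=\frac{1}{\sqrt{\Gamma(\lambda+2)}}\int_{\mathbb{R}_+}\psi(\xi)\xi^{\frac{\lambda+1}{2}}e^{iz\xi}d\xi$.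 $E$ denotes the spectral measure of $\mathbf{K}$, $E(S)=R^*\chi_SR$ for Borel $S$ ($\chi_S$ the characteristic function), regarded as a measure on $\mathbb{R}$ with $E((-\infty,0])=0$; $\mathbf{E}(\eta)=E((-\infty,\eta))$. A function $\varphi:\mathbb{R}\to\mathbb{C}$ is $E$-measurable if it is measurable with respect to the Stieltjes measure of $\rho_f(\eta)=\langle f,\mathbf{E}(\eta)f\rangle$ for all $f\in\mathcal{A}^2_\lambda(\Pi)$. $L_\infty(\mathbb{R},E)$ is the algebra of $E$-essentially bounded $E$-measurable functions modulo equality outside sets of zero $E$-measure. The operator $\varphi(\mathbf{K})$ is $\int_{\mathbb{R}}\varphi(\eta)\,d\mathbf{E}(\eta)$. *)

(* Defs.v *)
From HB Require Import structures.
From mathcomp Require Import all_boot all_order all_algebra complex.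
From mathcomp Require Import all_classical all_reals all_analysis.
From mathcomp Require Import measurable_realfun ring.
Set Implicit Arguments.
Unset Strict Implicit.
Unset Printing Implicit Defensive.
Import Order.TTheory GRing.Theory Num.Theory.
Import numFieldNormedType.Exports.

Local Open Scope classical_set_scope.
Local Open Scope complex_scope.
Local Open Scope ring_scope.

Notation Re := (@complex.Re _).
Notation Im := (@complex.Im _).

Section analytic.
Context {K : numFieldType}.

Definition analytic_at (f : K -> K) (w : K) : Prop :=
  exists a : nat -> K, \forall z \near w,
    (fun n => \sum_(k < n) a k * (z - w) ^+ k) @ \oo --> f z.

Lemma analytic_at0 (w : K) : analytic_at (fun=> 0) w.
Proof.
exists (fun=> 0); near=> z.
rewrite (_ : (fun n => _) = (fun=> 0)); first exact: cvg_cst.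
by apply/funext => n; rewrite big1// => i _; rewrite mul0r.
Unshelve. all: by end_near.
Qed.

Lemma analytic_at_lin (c : K) (f g : K -> K) (w : K) :
  analytic_at f w -> analytic_at g w -> analytic_at (fun z => c * f z + g z) w.
Proof.
move=> [a fa] [b gb]; exists (fun n => c * a n + b n).
apply: filterS2 fa gb => z fz gz.
rewrite (_ : (fun n => _) = (fun n => c * (\sum_(k < n) a k * (z - w) ^+ k)
   + (\sum_(k < n) b k * (z - w) ^+ k))).
  by apply: cvgD => //; apply: cvgM => //; exact: cvg_cst.
apply/funext => n; rewrite mulr_sumr -big_split/=.
by apply: eq_bigr => i _; rewrite mulrDl mulrA.
Qed.

End analytic.

Section complex_functions.
Context {R : realType}.
Local Notation C := R[i].

Definition cexp (z : C) : C :=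
  (expR (Re z))%:C * (cos (Im z) +i* sin (Im z)).

Context {d} {T : measurableType d}.

Definition cmeasurable_fun (D : set T) (f : T -> C) : Prop :=
  measurable_fun D (Re \o f) /\ measurable_fun D (Im \o f).

(* [mu] is a mere set function because the measures <f, E(.) f> attached below
   to the spectral measure are not bundled as measures. *)
Definition cintegral (mu : set T -> \bar R) (D : set T) (f : T -> C) : C :=
  fine (\int[mu]_(x in D) (Re (f x))%:E) +i*
  fine (\int[mu]_(x in D) (Im (f x))%:E).

(* f is in L_2(D, w dmu) *)
Definition csquare_integrable (mu : set T -> \bar R) (D : set T)
    (w : T -> R) (f : T -> C) : Prop :=
  cmeasurable_fun D f /\
  (\int[mu]_(x in D) ((Re (f x) ^+ 2 + Im (f x) ^+ 2) * w x)%:E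
     < +oo)%E.

Lemma csquare_integrable0 (mu : {measure set T -> \bar R}) (D : set T)
    (w : T -> R) : csquare_integrable mu D w (fun=> 0).
Proof.
split; first by split; exact: measurable_cst.
by rewrite integral0_eq ?ltry// => x _ /=; rewrite expr0n/= addr0 mul0r.
Qed.

Lemma csquare_integrable_lin (mu : {measure set T -> \bar R}) (D : set T)
    (w : T -> R) (c : C) (f g : T -> C) :
  measurable D -> measurable_fun D w -> (forall x, D x -> 0 <= w x) ->
  csquare_integrable mu D w f -> csquare_integrable mu D w g ->
  csquare_integrable mu D w (fun x => c * f x + g x).
Proof.
move=> mD mw w0 [[mf1 mf2] If] [[mg1 mg2] Ig].
have ReE x : Re (c * f x + g x) = Re c * Re (f x) - Im c * Im (f x) + Re (g x).
  by case: (c) (f x) (g x) => [a b] [u v] [s t].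
have ImE x : Im (c * f x + g x) = Re c * Im (f x) + Im c * Re (f x) + Im (g x).
  by case: (c) (f x) (g x) => [a b] [u v] [s t] /=; rewrite [b * u]mulrC [X in X + t]addrC.
have m1 : measurable_fun D (Re \o (fun x => c * f x + g x)).
  rewrite (_ : _ \o _ = fun x => Re c * Re (f x) - Im c * Im (f x) + Re (g x)).
    by apply: measurable_funD => //; apply: measurable_funB;
      apply: measurable_funM => //; exact: measurable_cst.
  by apply/funext => x /=; rewrite ReE.
have m2 : measurable_fun D (Im \o (fun x => c * f x + g x)).
  rewrite (_ : _ \o _ = fun x => Re c * Im (f x) + Im c * Re (f x) + Im (g x)).
    by apply: measurable_funD => //; apply: measurable_funD;
      apply: measurable_funM => //; exact: measurable_cst.
  by apply/funext => x /=; rewrite ImE.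
have mS (h : T -> C) : measurable_fun D (Re \o h) -> measurable_fun D (Im \o h) ->
    measurable_fun D (fun x => (Re (h x) ^+ 2 + Im (h x) ^+ 2) * w x).
  move=> m3 m4; apply: measurable_funM => //; apply: measurable_funD.
    by apply: (measurable_funX 2 m3).
  by apply: (measurable_funX 2 m4).
split=> //.
set F := fun x => (Re (f x) ^+ 2 + Im (f x) ^+ 2) * w x.
set G := fun x => (Re (g x) ^+ 2 + Im (g x) ^+ 2) * w x.
set k : R := 2 * (Re c ^+ 2 + Im c ^+ 2).
have k0 : 0 <= k by rewrite mulr_ge0// addr_ge0// sqr_ge0.
have F0 x : D x -> 0 <= F x.
  by move=> /w0 ?; rewrite mulr_ge0// addr_ge0// sqr_ge0.
have G0 x : D x -> 0 <= G x.
  by move=> /w0 ?; rewrite mulr_ge0// addr_ge0// sqr_ge0.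
have mF : measurable_fun D F by exact: mS.
have mG : measurable_fun D G by exact: mS.
apply: (@le_lt_trans _ _ (\int[mu]_(x in D) (k%:E * (F x)%:E + 2%:E * (G x)%:E))%E).
  apply: ge0_le_integral => //.
  - by move=> x /w0 ?; rewrite lee_fin mulr_ge0// addr_ge0// sqr_ge0.
  - by apply/measurable_EFinP; exact: mS.
  - apply: emeasurable_funD; apply: measurable_funeM; exact/measurable_EFinP.
  - move=> x /w0 wx; rewrite -!EFinM -EFinD lee_fin /F /G /k ReE ImE.
    rewrite !mulrA -mulrDl; apply: ler_wpM2r => //.
    move: (Re c) (Im c) (Re (f x)) (Im (f x)) (Re (g x)) (Im (g x)).
    move=> a b u v s t; rewrite -subr_ge0.
    rewrite (_ : _ - _ = (a * u - b * v - s) ^+ 2 + (a * v + b * u - t) ^+ 2).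
      by rewrite addr_ge0// sqr_ge0.
    by ring.
rewrite ge0_integralD//=.
- rewrite !ge0_integralZl//=.
  + by rewrite lte_add_pinfty// lte_mul_pinfty// lee_fin.
  + exact/measurable_EFinP.
  + exact/measurable_EFinP.
- by move=> x Dx; rewrite mule_ge0// lee_fin F0.
- by apply: measurable_funeM; exact/measurable_EFinP.
- by move=> x Dx; rewrite mule_ge0// lee_fin G0.
- by apply: measurable_funeM; exact/measurable_EFinP.
Qed.

End complex_functions.

(* ip is a scalar product on H, linear in its first argument. *)
Section operators.
Context {R : realType} {H : lmodType R[i]}.
Variable ip : H -> H -> R[i].

Definition hnorm (f : H) : R := Num.sqrt (Re (ip f f)).

Definition bounded_operator (T : H -> H) : Prop :=
  linear T /\ exists M : R, forall f, hnorm (T f) <= M * hnorm f.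

Definition adjoint_of (T S : H -> H) : Prop :=
  forall f g, ip (T f) g = ip f (S g).

(* T lies in the closure of A for the weak operator topology *)
Definition wot_adherent (A : set (H -> H)) (T : H -> H) : Prop :=
  forall (s : seq (H * H)) (e : R), 0 < e ->
    exists2 S, A S &
      forall p, p \in s -> `|ip (T p.1) p.2 - ip (S p.1) p.2| < e%:C.

(* unital *-subalgebra of the bounded operators, closed for the weak operator
   topology *)
Definition von_neumann_algebra (A : set (H -> H)) : Prop :=
  [/\ A `<=` bounded_operator,
      A id,
      (forall (c : R[i]) S T, A S -> A T ->
         A (fun f => c *: S f + T f) /\ A (S \o T)),
      (forall T, A T -> exists2 S, A S & adjoint_of T S) &
      (forall T, bounded_operator T -> wot_adherent A T -> A T)].

End operators.

Section bergman_space.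
Context {R : realType}.
Local Notation C := R[i].
Variable lambda : R.

(* Planar sets are sets of pairs (x, y), standing for x + i y. *)
Definition to_complex (p : R * R) : C := p.1 +i* p.2.

Definition half_plane : set (R * R) := [set p | 0 < p.2].

Definition plane_measure := ((@lebesgue_measure R) \x (@lebesgue_measure R))%E.

HB.instance Definition _ := Measure.on plane_measure.

(* density of nu_lambda with respect to the planar Lebesgue measure *)
Definition bergman_weight (p : R * R) : R :=
  (lambda + 1) / pi * (2 * p.2) `^ lambda.

(* A function on the half-plane is represented by its extension by 0, so that
   Leibniz equality is equality of functions on the half-plane. *)
Definition bergman_set : set (C -> C) := [set f |
  [/\ (forall z, ~~ (0 < Im z) -> f z = 0),
      (forall z, 0 < Im z -> analytic_at f z) &
      csquare_integrable plane_measure half_plane bergman_weight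
        (f \o to_complex)]].

End bergman_space.

Section bergman_lmodule.
Context {R : realType}.
Local Notation C := R[i].
Variable lambda : R.

Lemma measurable_half_plane : measurable (@half_plane R).
Proof.
rewrite (_ : half_plane = setT `&` snd @^-1` `]0, +oo[%classic).
  by apply: measurable_snd => //; exact: measurable_itv.
by apply/seteqP; split => [[x y]|[x y] []] /=; rewrite ?in_itv/= ?andbT.
Qed.

Lemma measurable_bergman_weight :
  measurable_fun (@half_plane R) (bergman_weight lambda).
Proof.
apply: measurable_funTS; rewrite /bergman_weight.
apply: measurable_funM; first exact: measurable_cst.
apply: (measurableT_comp (measurable_powR _)).
by apply: measurable_funM; [exact: measurable_cst|exact: measurable_snd].
Qed.

Definition bergman_pred : {pred C -> C} := mem (bergman_set lambda).

Lemma bergman_submod_closed : submod_closed bergman_pred.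
Proof.
split=> [|c f g]; rewrite !inE.
  split=> //; last exact: csquare_integrable0.
  by move=> z _; exact: analytic_at0.
move=> [f0 fa [mf If]] [g0 ga [mg Ig]]; split.
- by move=> z z0; rewrite (_ : _ z = c * f z + g z)// f0// g0// addr0 mulr0.
- by move=> z z0; apply: analytic_at_lin; [exact: fa|exact: ga].
have [l0|l0] := leP 0 (lambda + 1).
  apply: (@csquare_integrable_lin _ _ _ plane_measure _ _ c
    (f \o to_complex) (g \o to_complex)) => //.
  - exact: measurable_half_plane.
  - exact: measurable_bergman_weight.
  - by move=> p _; rewrite mulr_ge0 ?powR_ge0// divr_ge0// pi_ge0.
have [mfg _] : csquare_integrable plane_measure half_plane (fun=> 0)
    (fun p => c * (f \o to_complex) p + (g \o to_complex) p).
  apply: csquare_integrable_lin => //; first exact: measurable_half_plane.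
    split=> //; rewrite integral0_eq ?ltry// => x _ /=; by rewrite mulr0.
  split=> //; rewrite integral0_eq ?ltry// => x _ /=; by rewrite mulr0.
split=> //; apply: (@le_lt_trans _ _ 0%E); last exact: ltry.
under eq_integral do rewrite -[X in X%:E]opprK EFinN.
rewrite integral_ge0N ?oppe_le0 => [|p _].
  apply: integral_ge0 => p _; rewrite lee_fin oppr_ge0 mulr_ge0_le0//.
    by rewrite addr_ge0// sqr_ge0.
  by rewrite mulr_le0_ge0 ?powR_ge0// mulr_le0_ge0 ?invr_ge0 ?pi_ge0// ltW.
rewrite lee_fin oppr_ge0 mulr_ge0_le0//; first by rewrite addr_ge0// sqr_ge0.
by rewrite mulr_le0_ge0 ?powR_ge0// mulr_le0_ge0 ?invr_ge0 ?pi_ge0// ltW.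
Qed.

HB.instance Definition _ := GRing.isSubmodClosed.Build R[i] (C -> C)
  bergman_pred bergman_submod_closed.

Record bergman := Bergman {
  bergman_fun :> C -> C ;
  _ : bergman_fun \in bergman_pred }.

HB.instance Definition _ := [isSub for bergman_fun].
HB.instance Definition _ := [Choice of bergman by <:].
HB.instance Definition _ := [SubChoice_isSubLmodule of bergman by <:].

End bergman_lmodule.

Section vertical_operators.
Context {R : realType}.
Local Notation C := R[i].
Variable lambda : R.
Local Notation bergman := (bergman lambda).

Definition bergman_inner (f g : bergman) : C :=
  cintegral plane_measure half_plane (fun p =>
    f (to_complex p) * conjc (g (to_complex p)) * (bergman_weight lambda p)%:C).

(* f itself if it belongs to the Bergman space, 0 otherwise; only used for
   functions that do belong to the Bergman space *)
Definition to_bergman (f : C -> C) : bergman := insubd (0 : bergman) f.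

Definition translation (h : R) (f : bergman) : bergman :=
  to_bergman (fun z => f (z - h%:C)).

Definition vertical (T : bergman -> bergman) : Prop :=
  forall h : R, T \o translation h = translation h \o T.

Definition Gamma (a : R) : R :=
  \int[lebesgue_measure]_(t in `]0, +oo[) (t `^ (a - 1) * expR (- t)).

(* representatives of the elements of L_2(R_+) *)
Definition L2_half_line (psi : R -> C) : Prop :=
  csquare_integrable lebesgue_measure `]0, +oo[ (fun=> 1) psi.

(* R^*, extended by 0 outside the half-plane *)
Definition bergman_Radj (psi : R -> C) (z : C) : C :=
  if 0 < Im z then
    ((Num.sqrt (Gamma (lambda + 2)))^-1)%:C *
    cintegral lebesgue_measure `]0, +oo[ (fun xi =>
      psi xi * (xi `^ ((lambda + 1) / 2))%:C * cexp ((0 +i* 1) * z * xi%:C))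
  else 0.

(* the unitary operator R, i.e. the inverse of R^*: R f is a representative of
   the unique class of L_2(R_+) that R^* maps to f *)
Definition bergman_R (f : bergman) : R -> C :=
  xget (fun=> 0) [set psi | L2_half_line psi /\ bergman_Radj psi = f].

(* the graph of K = (1/i) d/dz; f is in its domain if and only if
   (1/i) f' is some g in the Bergman space *)
Definition bergman_K (f g : bergman) : Prop :=
  forall z, 0 < Im z -> g z = (0 +i* 1)^-1 * derive1 (f : C -> C^o) z.

(* the graph of R^* xi R *)
Definition bergman_xi (f g : bergman) : Prop :=
  let xiRf := fun xi => xi%:C * bergman_R f xi in
  L2_half_line xiRf /\ bergman_Radj xiRf = g.

(* E(S) = R^* 1_S R for S a Borel set *)
Definition spectral_measure (S : set R) (f : bergman) : bergman :=
  to_bergman (bergman_Radj (fun xi => (\1_S xi)%:C * bergman_R f xi)).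

(* the Borel measure S |-> <f, E(S) f>, which is the Stieltjes measure of
   eta |-> <f, E(]-oo, eta[) f>; the scalar product is a nonnegative real *)
Definition spectral_rho (f : bergman) (S : set R) : \bar R :=
  (Re (bergman_inner f (spectral_measure S f)))%:E.

(* measurable for the completion of each of the measures spectral_rho f *)
Definition E_measurable (phi : R -> C) : Prop :=
  forall (f : bergman) (B : set R), measurable B ->
    completed_algebra_gen (spectral_rho f) ((Re \o phi) @^-1` B) /\
    completed_algebra_gen (spectral_rho f) ((Im \o phi) @^-1` B).

Definition E_null (N : set R) : Prop :=
  exists S : set R,
    [/\ measurable S, spectral_measure S = (fun=> 0) & N `<=` S].

(* representatives of the elements of L_oo(R, E) *)
Definition L_infty_E (phi : R -> C) : Prop :=
  E_measurable phi /\
  exists M : R, E_null [set eta | ~~ (`|phi eta| <= M%:C)].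

Definition E_equal (phi psi : R -> C) : Prop :=
  E_null [set eta | phi eta != psi eta].

(* T = \int phi dE, in the weak sense <T f, f> = \int phi d<f, E(.) f> for all f;
   as the scalars are complex, this determines T, by polarization. The integral
   of a function measurable only for the completion is its integral for the
   completed measure: the integral is a supremum over the simple Borel
   functions below the function. *)
Definition spectral_integral (phi : R -> C) (T : bergman -> bergman) : Prop :=
  linear T /\
  forall f, bergman_inner (T f) f = cintegral (spectral_rho f) setT phi.

Definition phi_K (phi : R -> C) : bergman -> bergman :=
  xget (fun=> 0) (spectral_integral phi).

End vertical_operators.

Arguments bergman_inner {R} lambda f g.
Arguments L_infty_E {R} lambda phi.
Arguments E_equal {R} lambda phi psi.
Arguments spectral_integral {R} lambda phi T.
Arguments phi_K {R} lambda phi _.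

(* Main.v *)
(* Under R, translation by h becomes multiplication by e^{-ih xi} on L_2(R_+),
   and phi(K) becomes multiplication by phi; so the point is that R^* is onto
   and that a bounded T commuting with all the multiplications by e^{-ih xi} is
   itself a multiplication.

   Surjectivity of R^* (Paley-Wiener): an f in the Bergman space is square
   integrable on almost every horizontal line, and is small on suitable far
   horizontal and vertical segments, so that Cauchy's formula on rectangles
   gives f above the line as the Cauchy integral of its values on it. The Cauchy
   kernel is a trigonometric transform of e^{-c xi}; hence, by Riesz
   representation and the boundedness of the trigonometric transform on L_2,
   f is a Laplace transform there. Plancherel on each horizontal line, followed
   by Tonelli, gives the norm of the resulting function of xi.

   Multiplications: by Riesz representation, psi |-> <T R^* psi, R^* e^{-xi}>
   is integration against some chi. Comparing its values at e^{-ih xi} psi for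
   all h, the injectivity of the Fourier transform gives
   e^{-xi} R T R^* psi = chi psi. Thus T is multiplication by e^xi chi, which is
   essentially bounded because T is bounded. *)

(* Everything is done with functions rather than classes, and on the half-line with real integrals:
   a Fourier transform is a pair of cosine and sine transforms. Two tools recur. A Riesz theorem
   drawn from Radon-Nikodym turns a bounded functional, possibly defined on some square integrable
   functions only, into integration; injectivity of the Fourier transform then identifies the
   density.

   Plancherel's identity is itself an instance. Damping by e^{-e x} turns the squared transforms
   into a quadratic form with the Poisson kernel, whence the inequality with constant pi; equality
   is computed on e^{-x} cos(h x) and e^{-x} sin(h x), which are enough to identify the density.

   The obstacle in Paley-Wiener is that a Bergman function is controlled on almost every line only.
   Each good line gives a representation above that line alone; these are glued by injectivity along
   lines that descend to the real axis.

   On the spectral side, an E-measurable function is replaced by a bounded Borel one off a null set,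
   after which integrals against [spectral_rho f] are integrals with density |R f|^2. *)
Require Import Defs.
From HB Require Import structures.
From mathcomp Require Import all_boot all_order all_algebra complex finmap.
From mathcomp Require Import all_classical all_reals all_analysis.
From mathcomp Require Import measurable_realfun ring lra.
Set Implicit Arguments.
Unset Strict Implicit.
Unset Printing Implicit Defensive.
Import Order.TTheory GRing.Theory Num.Theory.
Import numFieldNormedType.Exports.
Import HBNNSimple.
Local Open Scope classical_set_scope.
Local Open Scope ring_scope.

(** * Integration *)

Section integration.
Context d1 d2 (T1 : measurableType d1) (T2 : measurableType d2) (R : realType).
Variable m1 : {sigma_finite_measure set T1 -> \bar R}.
Variable m2 : {sigma_finite_measure set T2 -> \bar R}.
Variables (D1 : set T1) (D2 : set T2).
Hypotheses (mD1 : measurable D1) (mD2 : measurable D2).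

Lemma integral_restrict2 (f : T1 * T2 -> \bar R) x :
  (\int[m2]_y (f \_ (D1 `*` D2)) (x, y) =
   ((fun x => \int[m2]_(y in D2) f (x, y)) \_ D1) x)%E.
Proof.
rewrite patchE; case: ifPn => [|] xD1.
  rewrite [in RHS]integral_mkcond; apply: eq_integral => y _.
  rewrite !patchE; congr (if _ then _ else _).
  by apply/idP/idP; rewrite !inE/=; [case|move: xD1; rewrite inE].
rewrite integral0_eq// => y _; rewrite patchE ifF//.
by apply/negbTE; apply: contra xD1; rewrite !inE => -[].
Qed.

Lemma integral_restrict1 (f : T1 * T2 -> \bar R) y :
  (\int[m1]_x (f \_ (D1 `*` D2)) (x, y) =
   ((fun y => \int[m1]_(x in D1) f (x, y)) \_ D2) y)%E.
Proof.
rewrite patchE; case: ifPn => [|] yD2.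
  rewrite [in RHS]integral_mkcond; apply: eq_integral => x _.
  rewrite !patchE; congr (if _ then _ else _).
  by apply/idP/idP; rewrite !inE/=; [case|move: yD2; rewrite inE].
rewrite integral0_eq// => x _; rewrite patchE ifF//.
by apply/negbTE; apply: contra yD2; rewrite !inE => -[].
Qed.

Lemma measurable_restrict_prod (f : T1 * T2 -> \bar R) :
  measurable_fun (D1 `*` D2) f -> measurable_fun setT (f \_ (D1 `*` D2)).
Proof.
by move=> mf; apply/measurable_restrict; rewrite ?setTI//; exact: measurableX.
Qed.

Section tonelli.
Variable f : T1 -> T2 -> \bar R.
Let g z := f z.1 z.2.
Hypothesis mf : measurable_fun (D1 `*` D2) g.
Hypothesis f0 : forall x y, D1 x -> D2 y -> (0 <= f x y)%E.

Let g0 z : (0 <= (g \_ (D1 `*` D2)) z)%E.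
Proof.
by rewrite patchE; case: ifPn => //; rewrite inE => -[? ?]; exact: f0.
Qed.

Lemma tonelli_on :
  (\int[m1]_(x in D1) \int[m2]_(y in D2) f x y =
   \int[m2]_(y in D2) \int[m1]_(x in D1) f x y)%E.
Proof.
rewrite integral_mkcond [RHS]integral_mkcond.
transitivity (\int[m1]_x \int[m2]_y (g \_ (D1 `*` D2)) (x, y))%E.
  by apply: eq_integral => x _; rewrite integral_restrict2.
rewrite fubini_tonelli//; last exact: measurable_restrict_prod.
by apply: eq_integral => y _; rewrite integral_restrict1.
Qed.

Lemma tonelli_product :
  (\int[(m1 \x m2)%E]_(z in D1 `*` D2) f z.1 z.2 =
   \int[m2]_(y in D2) \int[m1]_(x in D1) f x y)%E.
Proof.
rewrite integral_mkcond [RHS]integral_mkcond.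
rewrite fubini_tonelli2//; last exact: measurable_restrict_prod.
by apply: eq_integral => y _; rewrite /fubini_G (integral_restrict1 g).
Qed.

Lemma measurable_fun_tonelli1 :
  measurable_fun D1 (fun x => \int[m2]_(y in D2) f x y)%E.
Proof.
rewrite -(setTI D1); apply/measurable_restrict => //.
rewrite (_ : _ \_ _ = fubini_F m2 (g \_ (D1 `*` D2))).
  by apply: measurable_fun_fubini_tonelli_F => //; exact: measurable_restrict_prod.
by apply/funext => x; rewrite /fubini_F integral_restrict2.
Qed.

End tonelli.

Variable f : T1 * T2 -> R.
Hypothesis mf : measurable_fun (D1 `*` D2) f.
Hypothesis f_fin :
  (\int[m1]_(x in D1) \int[m2]_(y in D2) (`|f (x, y)|)%:E < +oo)%E.

Let F := (EFin \o f) \_ (D1 `*` D2).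

Let intF : (m1 \x m2)%E.-integrable setT F.
Proof.
apply/integrable12ltyP.
  by apply: measurable_restrict_prod; exact/measurable_EFinP.
apply: le_lt_trans f_fin; rewrite [leRHS]integral_mkcond le_eqVlt; apply/orP; left.
apply/eqP; apply: eq_integral => x _.
rewrite -(integral_restrict2 (fun z => `|f z|%:E)).
by apply: eq_integral => y _; rewrite /F !patchE; case: ifPn => //; rewrite abse0.
Qed.

Let FE x : fubini_F m2 F x = ((fun x => \int[m2]_(y in D2) (f (x, y))%:E)%E \_ D1) x.
Proof. by rewrite /fubini_F integral_restrict2. Qed.

Let GE y : fubini_G m1 F y = ((fun y => \int[m1]_(x in D1) (f (x, y))%:E)%E \_ D2) y.
Proof. by rewrite /fubini_G integral_restrict1. Qed.

Lemma fubini_integrable1E :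
  m1.-integrable D1 (fun x => \int[m2]_(y in D2) (f (x, y))%:E)%E.
Proof.
apply/integrable_mkcond => //; have := integrable_fubini_F intF.
by apply: eq_integrable => // x _; rewrite FE.
Qed.

Lemma fubini_onE :
  (\int[m1]_(x in D1) \int[m2]_(y in D2) (f (x, y))%:E =
   \int[m2]_(y in D2) \int[m1]_(x in D1) (f (x, y))%:E)%E.
Proof.
rewrite integral_mkcond [RHS]integral_mkcond.
under eq_integral do rewrite -FE.
under [RHS]eq_integral do rewrite -GE.
exact: Fubini.
Qed.

End integration.

Section Rintegration.
Context d (T : measurableType d) (R : realType).
Variable m : {measure set T -> \bar R}.
Variables (D : set T).
Hypotheses (mD : measurable D).

(** An integrable function is finite almost everywhere, so [fine] alters it on a null set only.
    Fubini's theorem produces inner integrals in the extended reals; this brings them back to real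
    functions. *)
Lemma integrable_fine (F : T -> \bar R) : m.-integrable D F ->
  m.-integrable D (EFin \o (fine \o F)) /\
  (\int[m]_(x in D) F x)%E = (\int[m]_(x in D) fine (F x))%R%:E.
Proof.
move=> iF; have ae : ae_eq m D (EFin \o (fine \o F)) F.
  by have := integrable_ae mD iF; apply: filterS => x h Dx /=; rewrite fineK//; exact: h.
have mF := measurable_int _ iF.
have mfF : measurable_fun D (EFin \o (fine \o F)).
  by apply/measurable_EFinP; apply: (measurableT_comp _ mF); exact: fine_measurable.
have eqi := @ae_eq_integral _ _ _ _ _ _ _ mD mfF mF ae.
have iF' : m.-integrable D (EFin \o (fine \o F)).
  apply/integrableP; split => //; move/integrableP : iF => [_]; apply: le_lt_trans.
  rewrite le_eqVlt; apply/orP; left; apply/eqP; apply: ae_eq_integral => //.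
  - exact: measurableT_comp.
  - exact: measurableT_comp.
  - by apply: filterS ae => x h Dx; rewrite /= -(h Dx).
split => //; rewrite /Rintegral -eqi fineK//; exact: integrable_fin_num.
Qed.

End Rintegration.

Section Rfubini.
Context d1 d2 (T1 : measurableType d1) (T2 : measurableType d2) (R : realType).
Variable m1 : {sigma_finite_measure set T1 -> \bar R}.
Variable m2 : {sigma_finite_measure set T2 -> \bar R}.
Variables (D1 : set T1) (D2 : set T2).
Hypotheses (mD1 : measurable D1) (mD2 : measurable D2).
Variable f : T1 -> T2 -> R.
Hypothesis mf : measurable_fun (D1 `*` D2) (fun z => f z.1 z.2).
Hypothesis f_fin :
  (\int[m1]_(x in D1) \int[m2]_(y in D2) (`|f x y|)%:E < +oo)%E.

Lemma fubini_integrable1 :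
  m1.-integrable D1 (EFin \o (fun x => \int[m2]_(y in D2) f x y)).
Proof. by have /integrable_fine[] := fubini_integrable1E mD1 mD2 mf f_fin. Qed.

Let mfs : measurable_fun (D2 `*` D1) (fun z => f z.2 z.1).
Proof.
apply: (@measurable_comp _ _ _ _ _ _ (D1 `*` D2) (fun z => f z.1 z.2) _ (@unstable.swap T2 T1)) => //.
- exact: measurableX.
- by move=> _ [[y x] /= [? ?] <-].
- by apply: measurable_funTS; exact: measurable_swap.
Qed.

Let fs_fin : (\int[m2]_(y in D2) \int[m1]_(x in D1) (`|f x y|)%:E < +oo)%E.
Proof.
rewrite -(tonelli_on m1 m2 mD1 mD2 (f := fun x y => (`|f x y|)%:E))//.
by apply/measurable_EFinP; exact: measurableT_comp.
Qed.

Lemma fubini_integrable2 :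
  m2.-integrable D2 (EFin \o (fun y => \int[m1]_(x in D1) f x y)).
Proof. by have /integrable_fine[] := fubini_integrable1E mD2 mD1 mfs fs_fin. Qed.

Lemma fubini_R : \int[m1]_(x in D1) \int[m2]_(y in D2) f x y =
  \int[m2]_(y in D2) \int[m1]_(x in D1) f x y.
Proof.
have [_ h1] := integrable_fine mD1 (fubini_integrable1E mD1 mD2 mf f_fin).
have [_ h2] := integrable_fine mD2 (fubini_integrable1E mD2 mD1 mfs fs_fin).
by have := fubini_onE mD1 mD2 mf f_fin; rewrite h1 h2 => -[].
Qed.

End Rfubini.

(** * Real integrals and elementary Laplace transforms *)

Section half_line.
Context {R : realType}.
Local Notation mu := (@lebesgue_measure R).
Local Notation D := (`]0, +oo[%classic : set R).

Lemma integrable_dominated d (T : measurableType d) (m : {measure set T -> \bar R})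
    (A : set T) (f g : T -> R) : measurable A -> measurable_fun A f ->
  m.-integrable A (EFin \o g) -> (forall x, A x -> `|f x| <= g x) ->
  m.-integrable A (EFin \o f).
Proof.
move=> mA mf ig fg; apply: (le_integrable mA _ _ ig); first exact/measurable_EFinP.
by move=> x Ax /=; rewrite lee_fin (le_trans (fg _ Ax))// ler_norm.
Qed.

Section real_integrable.
Context d (T : measurableType d) (m : {measure set T -> \bar R}) (A : set T).
Hypothesis mA : measurable A.
Implicit Types f g : T -> R.
Local Notation int f := (m.-integrable A (EFin \o f)).

Lemma rintD f g : int f -> int g -> int (fun x => f x + g x).
Proof.
move=> i1 i2; rewrite (_ : _ \o _ = (EFin \o f) \+ (EFin \o g))%E; last first.
  by apply/funext => x; rewrite /= EFinD.
exact: integrableD.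
Qed.

Lemma rintN f : int f -> int (fun x => - f x).
Proof.
move=> i1; rewrite (_ : _ \o _ = \- (EFin \o f))%E; last first.
  by apply/funext => x; rewrite /= EFinN.
exact: integrableN.
Qed.

Lemma rintB f g : int f -> int g -> int (fun x => f x - g x).
Proof. by move=> i1 i2; apply: rintD => //; exact: rintN. Qed.

Lemma rintZ k f : int f -> int (fun x => k * f x).
Proof.
move=> i1; rewrite (_ : _ \o _ = (fun x => k%:E * (EFin \o f) x))%E; last first.
  by apply/funext => x; rewrite /= EFinM.
exact: integrableZl.
Qed.

Lemma rintabs f : int f -> int (fun x => `|f x|).
Proof.
move=> i1; rewrite (_ : _ \o _ = abse \o (EFin \o f))%E; last exact/funext.
exact: integrable_abse.
Qed.

Lemma rint_measurable f : int f -> measurable_fun A f.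
Proof. by move=> /measurable_int/measurable_EFinP. Qed.

Lemma rint_cst c : (m A < +oo)%E -> int (cst c).
Proof.
move=> Ay; apply/integrableP; split; first exact/measurable_EFinP.
rewrite (_ : (fun x => _) = cst (`|c|%:E))// integral_cst//.
by rewrite lte_mul_pinfty// lee_fin.
Qed.

Lemma rint_patch f : int f -> m.-integrable setT (EFin \o (f \_ A)).
Proof.
move=> i1; have := (integrable_mkcond (EFin \o f) mA).1 i1.
by apply: eq_integrable => // x _; rewrite /= !patchE; case: ifPn.
Qed.

Lemma RintD f g : int f -> int g ->
  \int[m]_(x in A) (f x + g x) = \int[m]_(x in A) f x + \int[m]_(x in A) g x.
Proof. by move=> i1 i2; rewrite RintegralD. Qed.

Lemma RintN f : int f -> \int[m]_(x in A) (- f x) = - \int[m]_(x in A) f x.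
Proof.
move=> i1; under eq_Rintegral do rewrite -mulN1r.
by rewrite RintegralZl// mulN1r.
Qed.

Lemma RintB f g : int f -> int g ->
  \int[m]_(x in A) (f x - g x) = \int[m]_(x in A) f x - \int[m]_(x in A) g x.
Proof. by move=> i1 i2; rewrite RintegralB. Qed.

Lemma RintZ k f : int f -> \int[m]_(x in A) (k * f x) = k * \int[m]_(x in A) f x.
Proof. by move=> i1; rewrite RintegralZl. Qed.

Lemma rint_ge0_lty f : measurable_fun A f -> (forall x, A x -> 0 <= f x) ->
  (\int[m]_(x in A) (f x)%:E < +oo)%E -> int f.
Proof.
move=> mf f0 fy; apply/integrableP; split; first exact/measurable_EFinP.
rewrite (_ : integral _ _ _ = \int[m]_(x in A) (f x)%:E)%E//.
by apply: eq_integral => x /set_mem Ax /=; rewrite ger0_norm// f0.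
Qed.

Lemma rint_lty f : int f -> (forall x, A x -> 0 <= f x) ->
  (\int[m]_(x in A) (f x)%:E < +oo)%E.
Proof. by move=> i1 f0; exact: integrable_lty. Qed.

Lemma RintE f : int f -> (\int[m]_(x in A) (f x)%:E)%E = (\int[m]_(x in A) f x)%:E.
Proof. by move=> i1; rewrite /Rintegral fineK//; exact: integrable_fin_num. Qed.

Lemma eq_rint f g : (forall x, A x -> f x = g x) -> int f -> int g.
Proof.
by move=> fg; apply: eq_integrable => // x /set_mem Ax /=; rewrite fg.
Qed.

Lemma eq_Rint f g : (forall x, A x -> f x = g x) ->
  \int[m]_(x in A) f x = \int[m]_(x in A) g x.
Proof. by move=> fg; apply: eq_Rintegral => x /set_mem Ax; exact: fg. Qed.

Lemma ae_eq_rint f g : ae_eq m A f g -> measurable_fun A g -> int f -> int g.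
Proof.
move=> fg mg i1; apply/integrableP; split; first exact/measurable_EFinP.
have /integrableP[mf] := i1; apply: le_lt_trans.
rewrite le_eqVlt; apply/orP; left; apply/eqP; apply: ae_eq_integral => //.
- by apply: measurableT_comp => //; exact/measurable_EFinP.
- exact: measurableT_comp.
- by apply: filterS fg => x h Dx /=; rewrite (h Dx).
Qed.

Lemma ae_eq_Rint f g : ae_eq m A f g -> measurable_fun A f -> measurable_fun A g ->
  \int[m]_(x in A) f x = \int[m]_(x in A) g x.
Proof.
move=> fg mf mg; rewrite /Rintegral; congr fine.
apply: ae_eq_integral => //; [exact/measurable_EFinP|exact/measurable_EFinP|].
by apply: filterS fg => x h Dx /=; rewrite (h Dx).
Qed.

Lemma Rint0_ae f : int f -> (forall x, A x -> 0 <= f x) ->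
  \int[m]_(x in A) f x = 0 -> ae_eq m A f (fun=> 0).
Proof.
move=> i1 f0 E.
have : (\int[m]_(x in A) `|(f x)%:E|)%E = 0.
  under eq_integral => x /set_mem Ax do rewrite gee0_abs ?lee_fin ?f0//.
  by rewrite RintE// E.
move=> /(ae_eq_integral_abs _ mA (measurable_int _ i1)).
by apply: filterS => x h Ax; have [] := h Ax.
Qed.

Lemma Rdct (f_ : nat -> T -> R) f g : (forall n, measurable_fun A (f_ n)) ->
  int g -> (forall n x, A x -> `|f_ n x| <= g x) ->
  (forall x, A x -> f_ n x @[n --> \oo] --> f x) ->
  int f /\ \int[m]_(x in A) f_ n x @[n --> \oo] --> \int[m]_(x in A) f x.
Proof.
move=> mf ig fg cf.
have mlim : measurable_fun A f by exact: (measurable_fun_cvg mf cf).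
have intf n : int (f_ n) by apply: (integrable_dominated (g := g)) => // x Ax; exact: fg.
have intlim : int f.
  apply: (integrable_dominated (g := g)) => // x Ax.
  have c : `|f_ n x| @[n --> \oo] --> `|f x| by apply: cvg_norm; exact: cf.
  rewrite -(cvg_lim _ c)//.
  apply: limr_le; first by apply/cvg_ex; eexists; exact: c.
  by apply: nearW => n; exact: fg.
split=> //.
have : (\int[m]_(x in A) (f_ n x)%:E)%E @[n --> \oo] --> (\int[m]_(x in A) (f x)%:E)%E.
  apply: (@dominated_cvg _ _ _ m A mA _ _ (EFin \o g)) => //.
  - by move=> n; exact/measurable_EFinP.
  - by move=> x Ax; apply: cvg_EFin; [exact: nearW|exact: cf].
rewrite RintE//; under eq_fun do rewrite RintE//.
by move=> /fine_cvg.
Qed.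

End real_integrable.

(** A nonnegative derivative yields integrability up to infinity together with the value. Integrands
    that change sign are first made nonnegative by adding an integrable function. *)
Lemma ftc_half_line (F f : R -> R) (l : R) :
  (forall x : R, is_derive x (1:R) F (f x)) -> (forall x, 0 <= f x) -> continuous f ->
  F x @[x --> +oo] --> l ->
  mu.-integrable D (EFin \o f) /\ \int[mu]_(x in D) f x = l - F 0.
Proof.
move=> dF f0 cf Fl.
have mf : measurable_fun setT f by exact: continuous_measurable_fun.
have dF' x : derivable F x 1 by have [] := dF x.
have E : (\int[mu]_(x in D) (f x)%:E = (l - F 0)%:E)%E.
  rewrite integral_itv_obnd_cbnd; last first.
    by apply/measurable_EFinP; exact: measurable_funTS.
  rewrite (@ge0_continuous_FTC2y _ f F 0 l)//.
  - exact: continuous_subspaceT.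
  - apply: cvg_at_right_filter; apply: differentiable_continuous.
    exact/derivable1_diffP.
  - by move=> x _; rewrite derive1E; have [_ ->] := dF x.
split; last by rewrite /Rintegral E.
apply/integrableP; split; first by apply/measurable_EFinP; exact: measurable_funTS.
by under eq_integral => x _ do rewrite /= ger0_norm//; rewrite E ltry.
Qed.

Lemma cvgr_expRM (e : R) : 0 < e -> expR (- (e * x)) @[x --> +oo] --> (0:R).
Proof.
move=> e0; apply: (@cvg_comp _ _ _ (fun x => e * x) (fun x => expR (- x)) _ +oo) => //.
  exact: gt0_cvgMry.
exact: cvgr_expR.
Qed.

Lemma is_derive_linear (e t x : R) : is_derive x (1:R) (fun x => e * x + t) e.
Proof.
have -> : (fun x => e * x + t) = (e \*: id + cst t) by [].
by apply: is_derive_eq; rewrite addr0 /GRing.scale/= mulr1.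
Qed.

(** The primitive is the real part of e^{(-e + i t) x + i th} / (-e + i t). The summand [+ 0] keeps
    the exponent in the shape of [is_derive_linear]. *)
Lemma is_derive_exp_cos (e t th x : R) : e ^+ 2 + t ^+ 2 != 0 ->
  is_derive x (1:R) (fun x => expR (- e * x + 0) *
      (t * sin (t * x + th) - e * cos (t * x + th)) / (e ^+ 2 + t ^+ 2))
    (expR (- e * x + 0) * cos (t * x + th)).
Proof.
move=> et0.
have d1 := is_derive1_comp (is_derive_expR _) (is_derive_linear (- e) 0 x).
have d2 := is_derive1_comp (is_derive_sin _) (is_derive_linear t th x).
have d3 := is_derive1_comp (is_derive_cos _) (is_derive_linear t th x).
have d4 := is_deriveB (is_deriveZ t d2) (is_deriveZ e d3).
have d5 := is_deriveM d1 d4.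
have d6 := is_deriveZ (e ^+ 2 + t ^+ 2)^-1 d5.
have -> : (fun x => expR (- e * x + 0) *
      (t * sin (t * x + th) - e * cos (t * x + th)) / (e ^+ 2 + t ^+ 2)) =
  ((e ^+ 2 + t ^+ 2)^-1 \*: ((expR \o (fun x => - e * x + 0)) *
      (t \*: (sin \o (fun x => t * x + th)) - e \*: (cos \o (fun x => t * x + th))))).
  by apply/funext => y /=; rewrite mulrC.
apply: is_derive_eq d6 _ => /=.
rewrite !fctE /GRing.scale /= /GRing.scale /=.
by field.
Qed.

Lemma continuous_is_derive (f f' : R -> R) :
  (forall x : R, is_derive x (1:R) f (f' x)) -> continuous f.
Proof.
move=> df x; apply: differentiable_continuous; apply/derivable1_diffP.
by have [] := df x.
Qed.

(** The phase [th] lets one computation serve for the cosine ([th = 0]) and for the sine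
    ([th = - (pi / 2)]). *)
Lemma laplace_cos (e t th : R) : 0 < e ->
  mu.-integrable D (EFin \o (fun x => expR (- e * x) * cos (t * x + th))) /\
  \int[mu]_(x in D) (expR (- e * x) * cos (t * x + th)) =
    (e * cos th - t * sin th) / (e ^+ 2 + t ^+ 2).
Proof.
move=> e0.
have et0 s : e ^+ 2 + s ^+ 2 != 0.
  by rewrite gt_eqF// ltr_pwDl ?exprn_gt0// sqr_ge0.
pose A (s th x : R) : R := expR (- e * x + 0) *
      (s * sin (s * x + th) - e * cos (s * x + th)) / (e ^+ 2 + s ^+ 2).
pose a (s th x : R) : R := expR (- e * x + 0) * cos (s * x + th).
have dA s r (x : R) : is_derive x (1:R) (A s r) (a s r x).
  exact: is_derive_exp_cos.
have Ay s r : A s r x @[x --> +oo] --> (0:R).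
  apply: (squeeze_cvgr (f := fun x => - (expR (- (e * x)) * ((`|s| + e) / (e ^+ 2 + s ^+ 2))))
    (h := fun x => expR (- (e * x)) * ((`|s| + e) / (e ^+ 2 + s ^+ 2)))).
  - have p : 0 < (e ^+ 2 + s ^+ 2)^-1.
      by rewrite invr_gt0 ltr_pwDl ?exprn_gt0 ?sqr_ge0.
    apply: nearW => x; rewrite -ler_norml /A addr0 mulNr -mulrA normrM.
    rewrite (ger0_norm (expR_ge0 _)) ler_pM2l ?expR_gt0// normrM (gtr0_norm p).
    rewrite ler_pM2r//.
    rewrite (le_trans (ler_normB _ _))// !normrM (gtr0_norm e0) lerD//.
      by rewrite ler_piMr ?sin_max.
    by rewrite ler_piMr ?cos_max// ltW.
  - rewrite -[X in _ --> X]oppr0 -(mul0r ((`|s| + e) / (e ^+ 2 + s ^+ 2))).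
    by apply: cvgN; apply: cvgM; [exact: cvgr_expRM|exact: cvg_cst].
  - rewrite -(mul0r ((`|s| + e) / (e ^+ 2 + s ^+ 2))).
    by apply: cvgM; [exact: cvgr_expRM|exact: cvg_cst].
have ca s r : continuous (a s r).
  move=> x; apply: cvgM.
    apply: continuous_comp; last exact: continuous_expR.
    exact: (continuous_is_derive (is_derive_linear _ _)).
  apply: continuous_comp; last exact: continuous_cos.
  exact: (continuous_is_derive (is_derive_linear _ _)).
have a0E x : a 0 0 x = expR (- e * x) by rewrite /a mul0r !addr0 cos0 mulr1.
have [i0 I0] : mu.-integrable D (EFin \o a 0 0) /\ \int[mu]_(x in D) (a 0 0 x) = 0 - A 0 0 0.
  by apply: ftc_half_line => // x; rewrite a0E expR_ge0.
(* [a 0 0] is the plain exponential. A cosine being at least -1, adding it makes the integrand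
   nonnegative, so that [ftc_half_line] applies; it is subtracted again at the end. *)
have [i1 I1] : mu.-integrable D (EFin \o (fun x => a 0 0 x + a t th x)) /\
   \int[mu]_(x in D) (a 0 0 x + a t th x) = (0 + 0) - (A 0 0 0 + A t th 0).
  apply: (@ftc_half_line (fun x => A 0 0 x + A t th x)).
  - move=> x; rewrite a0E /a addr0 -{1}(mulr1 (expR _)) -mulrDr mulr_ge0 ?expR_ge0//.
  - by move=> x; apply: cvgD; exact: ca.
  - by apply: cvgD; exact: Ay.
have aE : (fun x => expR (- e * x) * cos (t * x + th)) =
    (fun x : R => (a 0 0 x + a t th x) - a 0 0 x).
  by apply/funext => x; rewrite addrAC addrN add0r /a addr0.
have mD : measurable D by [].
rewrite aE; split; first exact: rintB.
rewrite RintB// I0 I1 /A !mulr0 !addr0 !add0r expR0 !mul1r.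
by rewrite opprD opprK addrAC addNr add0r -mulNr opprB.
Qed.

Lemma laplace_exp (e : R) : 0 < e ->
  mu.-integrable D (EFin \o (fun x => expR (- e * x))) /\
  \int[mu]_(x in D) expR (- e * x) = e^-1.
Proof.
move=> e0; have [i I] := laplace_cos 0 0 e0.
have E (x : R) : expR (- e * x) * cos (0 * x + 0) = expR (- e * x).
  by rewrite mul0r addr0 cos0 mulr1.
have mD : measurable D by [].
split; first by apply: eq_rint i => // x _; exact: E.
transitivity (\int[mu]_(x in D) (expR (- e * x) * cos (0 * x + 0))).
  by apply: eq_Rint => x _; rewrite E.
by rewrite I cos0 sin0 mulr1 mulr0 subr0 expr0n addr0 expr2 invfM mulrA divff ?mul1r// gt_eqF.
Qed.

Lemma measurable_fst_on d1 d2 d3 (T1 : measurableType d1) (T2 : measurableType d2)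
    (T3 : measurableType d3) (A : set T1) (B : set T2) (F : T1 -> T3) :
  measurable A -> measurable B -> measurable_fun A F ->
  measurable_fun (A `*` B) (fun z => F z.1).
Proof.
move=> mA mB mF; apply: (@measurable_comp _ _ _ _ _ _ A F _ fst) => //.
- by move=> _ [z [? ?] <-].
- by apply: measurable_funTS; exact: measurable_fst.
Qed.

Lemma measurable_snd_on d1 d2 d3 (T1 : measurableType d1) (T2 : measurableType d2)
    (T3 : measurableType d3) (A : set T1) (B : set T2) (F : T2 -> T3) :
  measurable A -> measurable B -> measurable_fun B F ->
  measurable_fun (A `*` B) (fun z => F z.2).
Proof.
move=> mA mB mF; apply: (@measurable_comp _ _ _ _ _ _ B F _ snd) => //.
- by move=> _ [z [? ?] <-].
- by apply: measurable_funTS; exact: measurable_snd.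
Qed.

Lemma measurable_cos : measurable_fun setT (@cos R).
Proof. by apply: continuous_measurable_fun => x; exact: continuous_cos. Qed.

Lemma measurable_sin : measurable_fun setT (@sin R).
Proof. by apply: continuous_measurable_fun => x; exact: continuous_sin. Qed.

Lemma measurable_atan : measurable_fun setT (@atan R).
Proof. by apply: continuous_measurable_fun => x; exact: continuous_atan. Qed.

Lemma measurable_invr : measurable_fun setT (@GRing.inv R).
Proof.
have o : open (~` [set (0:R)]) by apply: closed_openC; exact: (@closed_eq R 0).
rewrite -(setUv [set (0:R)]); apply/measurable_funU => //.
  exact: measurableC.
split.
  exact: measurable_fun_set1.
apply: open_continuous_measurable_fun => // x; rewrite inE /= => /eqP x0.
exact: inv_continuous.
Qed.

Lemma measurable_sg : measurable_fun setT (@Num.sg R).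
Proof.
rewrite (_ : Num.sg = fun x : R => x * `|x|^-1).
  apply: measurable_funM; first exact: measurable_id.
  by apply: measurableT_comp; [exact: measurable_invr|exact: normr_measurable].
apply/funext => x; have [->|x0] := eqVneq x 0; first by rewrite sgr0 mul0r.
by rewrite {2}(numEsg x) mulfK// normr_eq0.
Qed.

End half_line.

Ltac mfun := repeat (first [ assumption | exact: measurable_cst | exact: measurable_id
  | exact: measurable_fst | exact: measurable_snd
  | apply: measurable_funTS; exact: measurable_fst
  | apply: measurable_funTS; exact: measurable_snd
  | apply: measurable_funD | apply: measurable_funM | apply: measurable_funN
  | apply: measurable_funX
  | (apply: measurableT_comp; [exact: measurable_expR|])
  | (apply: measurableT_comp; [exact: measurable_cos|])
  | (apply: measurableT_comp; [exact: measurable_sin|])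
  | (apply: measurableT_comp; [exact: measurable_atan|])
  | (apply: measurableT_comp; [exact: measurable_invr|])
  | (apply: measurableT_comp; [exact: normr_measurable|]) ]).

(** * Injectivity of the Fourier transform on the half-line *)

Section half_line.
Context {R : realType}.
Local Notation mu := (@lebesgue_measure R).
Local Notation D := (`]0, +oo[%classic : set R).

Lemma rintM_bounded d (T : measurableType d) (m : {measure set T -> \bar R}) (A : set T)
    (f g : T -> R) (C : R) : measurable A -> m.-integrable A (EFin \o f) ->
  measurable_fun A g -> (forall x, A x -> `|g x| <= C) ->
  m.-integrable A (EFin \o (fun x => f x * g x)).
Proof.
move=> mA iF mg gC; apply: (integrable_dominated mA _ (rintZ mA C (rintabs iF))).
  by apply: measurable_funM => //; exact: rint_measurable iF.
by move=> x Ax; rewrite normrM mulrC ler_wpM2r// gC.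
Qed.

(** Domination by a product of two integrable functions bounds the iterated integral by the product
    of their integrals. This supplies the hypothesis of Fubini's theorem in most of the exchanges
    below. *)
Lemma fubini_fin_prod d1 d2 (T1 : measurableType d1) (T2 : measurableType d2)
    (m1 : {measure set T1 -> \bar R}) (m2 : {sigma_finite_measure set T2 -> \bar R})
    (A : set T1) (B : set T2) (f : T1 -> T2 -> R) (a : T1 -> R) (b : T2 -> R) :
  measurable A -> measurable B ->
  measurable_fun (A `*` B) (fun z => f z.1 z.2) ->
  m1.-integrable A (EFin \o a) -> m2.-integrable B (EFin \o b) ->
  (forall x y, A x -> B y -> `|f x y| <= a x * b y) ->
  (\int[m1]_(x in A) \int[m2]_(y in B) (`|f x y|)%:E < +oo)%E.
Proof.
move=> mA mB mf ia ib fab.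
have mab x : A x -> measurable_fun B (fun y => f x y).
  move=> Ax; apply: (@measurable_comp _ _ _ _ _ _ (A `*` B) (fun z => f z.1 z.2) _ (pair x)).
  - exact: measurableX.
  - by move=> _ [y By <-].
  - exact: mf.
  - by apply: measurable_funTS; exact: pair1_measurable.
apply: (@le_lt_trans _ _ (\int[m1]_(x in A) (`|a x| * \int[m2]_(y in B) `|b y|)%:E)%E); last first.
  apply: rint_lty => //.
    have := rintZ mA (\int[m2]_(y in B) `|b y|) (rintabs ia).
    by apply: eq_rint => // x _; rewrite mulrC.
  by move=> x _; rewrite mulr_ge0// Rintegral_ge0.
apply: ge0_le_integral => //.
- by move=> x Ax; exact: integral_ge0.
- apply: (measurable_fun_tonelli1 m2 mA mB (f := fun x y => (`|f x y|)%:E)) => //.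
  by apply/measurable_EFinP; apply: measurableT_comp => //.
- apply/measurable_EFinP; apply: measurable_funM; last exact: measurable_cst.
  exact: rint_measurable (rintabs ia).
- move=> x Ax; rewrite EFinM -RintE//; last exact: rintabs.
  rewrite -ge0_integralZl//; last by apply/measurable_EFinP; exact: rint_measurable (rintabs ib).
  apply: ge0_le_integral => //.
  + by apply/measurable_EFinP; apply: measurableT_comp => //; exact: mab.
  + by apply/measurable_EFinP; apply: measurable_funM => //; exact: rint_measurable (rintabs ib).
  + by move=> y By; rewrite -EFinM lee_fin -normrM (le_trans (fab _ _ Ax By))// ler_norm.
Qed.

(** The Poisson kernel is the Laplace transform in [h] of cos((x - xi) h). After the exchange of
    integrals, the addition formula leaves only the integrals of [F] against cos(h xi) and sin(h
    xi), which vanish. *)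
Lemma poisson_kernel_orth (F : R -> R) (e x : R) : 0 < e ->
  mu.-integrable D (EFin \o F) ->
  (forall h, \int[mu]_(xi in D) (F xi * cos (h * xi)) = 0) ->
  (forall h, \int[mu]_(xi in D) (F xi * sin (h * xi)) = 0) ->
  \int[mu]_(xi in D) (F xi * (e / (e ^+ 2 + (x - xi) ^+ 2))) = 0.
Proof.
move=> e0 iF Fc Fs.
have mF := rint_measurable iF.
have mD : measurable D by [].
pose f xi h := F xi * (expR (- e * h) * cos ((x - xi) * h + 0)).
have [ie Ie] := laplace_exp e0.
have -> : \int[mu]_(xi in D) (F xi * (e / (e ^+ 2 + (x - xi) ^+ 2))) =
  \int[mu]_(xi in D) \int[mu]_(h in D) f xi h.
  apply: eq_Rint => xi _; have [i1 I1] := laplace_cos (x - xi) 0 e0.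
  by rewrite RintZ// I1 sin0 cos0 mulr0 mulr1 subr0.
have mf : measurable_fun (D `*` D) (fun z => f z.1 z.2).
  by apply: measurable_funM; [exact: measurable_fst_on|mfun].
have ic h : mu.-integrable D (EFin \o (fun xi => F xi * cos (h * xi))).
  by apply: (rintM_bounded (C := 1)) => //; [mfun|move=> ? _; exact: cos_max].
have isn h : mu.-integrable D (EFin \o (fun xi => F xi * sin (h * xi))).
  by apply: (rintM_bounded (C := 1)) => //; [mfun|move=> ? _; exact: sin_max].
rewrite fubini_R//; last first.
  apply: (fubini_fin_prod _ _ _ (rintabs iF) ie) => // xi h Dx Dh.
  rewrite /f normrM ler_wpM2l// normrM.
  by rewrite ger0_norm ?expR_ge0// ler_piMr ?expR_ge0 ?cos_max.
transitivity (\int[mu]_(h in D) (0:R)); last by rewrite Rintegral_cst// mul0r.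
apply: eq_Rint => h _.
transitivity (\int[mu]_(xi in D) (expR (- e * h) * cos (h * x) * (F xi * cos (h * xi)) +
     expR (- e * h) * sin (h * x) * (F xi * sin (h * xi)))).
  apply: eq_Rint => xi _; rewrite /f addr0 mulrBl cosB.
  by rewrite (mulrC x) (mulrC xi); ring.
rewrite RintD// ?RintZ//; try exact: rintZ.
by rewrite Fc Fs !mulr0 addr0.
Qed.

Lemma atan_kernel (e x a b : R) : 0 < e -> a < b ->
  \int[mu]_(t in `[a, b]) (e / (e ^+ 2 + (t - x) ^+ 2)) =
  atan ((b - x) / e) - atan ((a - x) / e).
Proof.
move=> e0 ab.
have dF (t : R) : is_derive t (1:R) (fun t => atan (e^-1 * t + - x / e)) (e / (e ^+ 2 + (t - x) ^+ 2)).
  have d1 := is_derive1_comp (is_derive1_atan _) (is_derive_linear e^-1 (- x / e) t).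
  apply: is_derive_eq d1 _ => /=.
  have e1 : e != 0 by rewrite gt_eqF.
  have e2 : e ^+ 2 + (t - x) ^+ 2 != 0 by rewrite gt_eqF// ltr_pwDl ?exprn_gt0 ?sqr_ge0.
  field.
  by rewrite e1 /= e2.
have cf : continuous (fun t : R => e / (e ^+ 2 + (t - x) ^+ 2)).
  move=> t; apply: cvgM; first exact: cvg_cst.
  apply: cvgV; first by rewrite gt_eqF// ltr_pwDl ?exprn_gt0 ?sqr_ge0.
  apply: cvgD; first exact: cvg_cst.
  by apply: cvgM; apply: cvgB; [exact: cvg_id|exact: cvg_cst|exact: cvg_id|exact: cvg_cst].
rewrite /Rintegral (@continuous_FTC2 _ _ (fun t => atan (e^-1 * t + - x / e)) a b ab).
- have E u : e^-1 * u + - x / e = (u - x) / e by rewrite mulrDl (mulrC u).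
  by rewrite /= !E.
- exact: continuous_subspaceT.
- split.
  + by move=> t _; have [] := dF t.
  + by apply: cvg_at_right_filter; exact: continuous_is_derive dF _.
  + by apply: cvg_at_left_filter; exact: continuous_is_derive dF _.
- by move=> t _; rewrite derive1E; have [_ ->] := dF t.
Qed.

Lemma cvg_atan_scaled (t : R) :
  atan (t * n.+1%:R) @[n --> \oo] --> pi / 2 * Num.sg t.
Proof.
have cy : (fun n : nat => n.+1%:R : R) @ \oo --> +oo.
  by apply/cvgrnyP; exact: (cvg_addnl 1).
have pos (u : R) : 0 < u -> atan (u * n.+1%:R) @[n --> \oo] --> pi / 2.
  move=> u0; have c1 : (fun x : R => atan (u * x)) @ +oo --> pi / 2.
    apply: (@cvg_comp _ _ _ _ (@atan R) _ (pinfty_nbhs R)); last exact: cvgy_atan.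
    exact: gt0_cvgMry.
  exact: (cvg_comp _ _ cy c1).
have [t0|t0|->] := ltrgt0P t.
- by rewrite gtr0_sg// mulr1; exact: pos.
- rewrite ltr0_sg// mulrN1.
  rewrite (_ : (fun _ => _) = (fun n : nat => - atan (- t * n.+1%:R))); last first.
    by apply/funext => n; rewrite mulNr atanN opprK.
  by apply: cvgN; apply: pos; rewrite oppr_gt0.
- rewrite sgr0 mulr0 (_ : (fun _ => _) = (fun=> 0)); first exact: cvg_cst.
  by apply/funext => n; rewrite mul0r atan0.
Qed.

(** Lebesgue differentiation: almost everywhere [f] is the derivative of its primitive, here a
    constant function. *)
Lemma ae0_of_primitive (f : R -> R) : mu.-integrable setT (EFin \o f) ->
  (forall x, \int[mu]_(t in `]-oo, x]) f t = 0) -> ae_eq mu setT f (fun=> 0).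
Proof.
move=> intf f0.
have lf : locally_integrable setT f.
  by apply: open_integrable_locally => //; exact: openT.
have iy y : mu.-integrable `]-oo, y] (EFin \o f) by exact: integrableS intf.
have h := FTC1Ny iy lf.
apply: (@filterS _ _ (ae_filter_ringOfSetsType mu) _ _ _ h) => x [_]; rewrite (_ : (fun x => _) = cst 0); last exact/funext.
by rewrite derive1_cst.
Qed.

(** Integrating the Poisson kernel over [0, b] produces a difference of arctangents, which tends to
    a step function as the width [e] goes to 0. So [F] has integral 0 over every ]0, b], and
    Lebesgue differentiation concludes. *)
Lemma fourier_inj (F : R -> R) : mu.-integrable D (EFin \o F) ->
  (forall h, \int[mu]_(xi in D) (F xi * cos (h * xi)) = 0) ->
  (forall h, \int[mu]_(xi in D) (F xi * sin (h * xi)) = 0) ->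
  ae_eq mu D F (fun=> 0).
Proof.
move=> iF Fc Fs.
have mF := rint_measurable iF.
have mD : measurable D by [].
have atanb (x : R) : `|atan x| <= pi / 2.
  by rewrite ler_norml !ltW ?atan_ltpi2 ?atan_gtNpi2.
have kb (e x y : R) : 0 < e -> `|e / (e ^+ 2 + (x - y) ^+ 2)| <= e^-1.
  move=> e0; have p : 0 < e ^+ 2 + (x - y) ^+ 2.
    by rewrite ltr_pwDl ?exprn_gt0 ?sqr_ge0.
  rewrite ger0_norm; last by rewrite ltW// divr_gt0.
  rewrite ler_pdivrMr// mulrDr expr2 mulKf ?gt_eqF//.
  by rewrite lerDl mulr_ge0 ?sqr_ge0// invr_ge0 ltW.
have H1 (e b : R) : 0 < e -> 0 < b ->
    \int[mu]_(xi in D) (F xi * (atan ((b - xi) / e) - atan ((0 - xi) / e))) = 0.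
  move=> e0 b0; pose f xi x := F xi * (e / (e ^+ 2 + (x - xi) ^+ 2)).
  have mI : measurable `[0, b] by [].
  have intc : mu.-integrable `[0, b] (EFin \o cst e^-1).
    by apply: rint_cst => //; rewrite /= lebesgue_measure_itv/= lte_fin b0 -EFinB ltry.
  have ik x : mu.-integrable `[0, b] (EFin \o (fun t => e / (e ^+ 2 + (t - x) ^+ 2))).
    apply: (integrable_dominated (g := cst e^-1)) => // [|y _]; last exact: kb.
    by mfun.
  have mf : measurable_fun (D `*` `[0, b]) (fun z => f z.1 z.2).
    by apply: measurable_funM; [exact: measurable_fst_on|mfun].
  transitivity (\int[mu]_(xi in D) \int[mu]_(x in `[0, b]) f xi x).
    apply: eq_Rint => // xi _; rewrite -atan_kernel//.
    by rewrite -RintZ//; exact: ik.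
  rewrite fubini_R//; last first.
    apply: (fubini_fin_prod _ _ _ (rintabs iF) intc) => // xi x Dx _.
    by rewrite /f normrM ler_wpM2l// kb.
  transitivity (\int[mu]_(x in `[0, b]) (0:R)); last by rewrite Rintegral_cst// mul0r.
  by apply: eq_Rint => x _; exact: poisson_kernel_orth.
(* The widths are 1 / (n + 1). The arctangents tend to pi / 2 times signs and stay bounded by pi /
   2, so [F] times pi dominates. *)
have H2 (b : R) : 0 < b ->
    \int[mu]_(xi in D) (F xi * (pi / 2 * Num.sg (b - xi) - pi / 2 * Num.sg (0 - xi))) = 0.
  move=> b0.
  pose f n xi := F xi * (atan ((b - xi) * n.+1%:R) - atan ((0 - xi) * n.+1%:R)).
  have [] := @Rdct _ _ _ mu D mD f (fun xi => F xi * (pi / 2 * Num.sg (b - xi) - pi / 2 * Num.sg (0 - xi)))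
    (fun x => pi * `|F x|).
  - by move=> n; apply: measurable_funM => //; mfun.
  - by apply: rintZ => //; exact: rintabs.
  - move=> n x Dx; rewrite normrM mulrC ler_wpM2r//.
    by rewrite (le_trans (ler_normB _ _))// (splitr pi) lerD.
  - move=> x Dx; apply: cvgM; first exact: cvg_cst.
    by apply: cvgB; exact: cvg_atan_scaled.
  have f0 n : \int[mu]_(x in D) f n x = 0.
    have n0 : 0 < n.+1%:R^-1 :> R by rewrite invr_gt0.
    by have := H1 _ _ n0 b0; rewrite invrK.
  move=> _; rewrite (_ : (fun n => _) = cst 0); last exact/funext.
  by move=> /cvg_lim; rewrite lim_cst// => <-.
have pE : (F \_ D) = (fun x => (F \_ D) x) by [].
have iFD : mu.-integrable setT (EFin \o (F \_ D)).
  exact: rint_patch.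
have H3 b : \int[mu]_(xi in `]-oo, b]) (F \_ D) xi = 0.
  have [b0|b0] := leP b 0.
    transitivity (\int[mu]_(xi in `]-oo, b]) (0:R)).
      apply: eq_Rint => // x; rewrite /= in_itv/= => xb; rewrite patchE ifF//.
      apply: memNset; rewrite /= in_itv/= andbT => x0.
      by have := lt_le_trans x0 (le_trans xb b0); rewrite ltxx.
    by rewrite /Rintegral integral0.
  have := H2 b b0.
  have -> : \int[mu]_(xi in D) (F xi * (pi / 2 * Num.sg (b - xi) - pi / 2 * Num.sg (0 - xi))) =
      \int[mu]_(xi in D) (pi * (F \_ `]-oo, b]) xi).
    apply: ae_eq_Rint => //.
    (* On the half-line the limit is pi times the indicator of ]0, b], except at [b], where the sign
       of b - x is 0. *)
    - exists [set b]; split => //; first exact: lebesgue_measure_set1.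
      move=> x /= /not_implyP[]; rewrite in_itv/= andbT => x0; apply: contra_notP => /eqP xb.
      rewrite patchE; case: ifPn; rewrite ?inE ?notin_setE/= in_itv/= => xb'.
        have -> : Num.sg (b - x) = 1 by rewrite gtr0_sg// subr_gt0 lt_neqAle xb.
        have -> : Num.sg (0 - x) = -1 by rewrite ltr0_sg// sub0r oppr_lt0.
        by rewrite mulrN mulr1 opprK -splitr mulrC.
      have -> : Num.sg (b - x) = -1 by rewrite ltr0_sg// subr_lt0 ltNge; apply/negP.
      have -> : Num.sg (0 - x) = -1 by rewrite ltr0_sg// sub0r oppr_lt0.
      by rewrite subrr !mulr0.
    - apply: measurable_funM => //; apply: measurable_funB; apply: measurable_funM;
        mfun; apply: (measurableT_comp (f := @Num.sg R)); mfun; exact: measurable_sg.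
    - apply: measurable_funM => //; apply/measurable_restrict => //.
      by apply: measurable_funS mF.
  rewrite RintZ//; last first.
    apply: (@integrable_dominated _ _ _ mu D _ (fun x => `|F x|)) => //.
    - by apply/measurable_restrict => //; apply: measurable_funS mF.
    - exact: rintabs.
    - by move=> x _; rewrite patchE; case: ifPn => // _; rewrite normr0.
  move=> /eqP; rewrite mulf_eq0 gt_eqF ?pi_gt0//= => /eqP E0; rewrite -[RHS]E0.
  rewrite [LHS]Rintegral_mkcond [RHS]Rintegral_mkcond; apply: eq_Rint => // x _.
  by rewrite !patchE; do 2 case: ifPn.
have := ae0_of_primitive iFD H3.
apply: (@filterS _ _ (ae_filter_ringOfSetsType mu)) => x + Dx.
by move=> /(_ I); rewrite patchE mem_set.
Qed.

End half_line.

(* Fixing the measure first lets unification find the measurable structure of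
   the reals before it meets the proof that the domain is measurable. *)
Notation LrintD := (rintD (m := lebesgue_measure)) (only parsing).
Notation LrintB := (rintB (m := lebesgue_measure)) (only parsing).
Notation LrintZ := (rintZ (m := lebesgue_measure)) (only parsing).
Notation Lrintabs := (rintabs (m := lebesgue_measure)) (only parsing).
Notation Lrint_measurable := (rint_measurable (m := lebesgue_measure)) (only parsing).
Notation Leq_rint := (eq_rint (m := lebesgue_measure)) (only parsing).
Notation Leq_Rint := (eq_Rint lebesgue_measure) (only parsing).
Notation LRintD := (RintD (m := lebesgue_measure)) (only parsing).
Notation LRintB := (RintB (m := lebesgue_measure)) (only parsing).
Notation LRintN := (RintN (m := lebesgue_measure)) (only parsing).
Notation LRintZ := (RintZ (m := lebesgue_measure)) (only parsing).
Notation LRintE := (RintE (m := lebesgue_measure)) (only parsing).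
Notation Lrint_lty := (rint_lty (m := lebesgue_measure)) (only parsing).
Notation Lrint_ge0_lty := (rint_ge0_lty (m := lebesgue_measure)) (only parsing).
Notation Lle_Rint := (le_Rintegral (mu := lebesgue_measure)) (only parsing).
Notation Lintegrable_dominated := (integrable_dominated (m := lebesgue_measure)) (only parsing).
Notation Lfubini_fin_prod :=
  (fubini_fin_prod (m1 := lebesgue_measure) (m2 := lebesgue_measure)) (only parsing).
Notation Lfubini_integrable1 :=
  (fubini_integrable1 (m1 := lebesgue_measure) (m2 := lebesgue_measure)) (only parsing).
Notation Lfubini_integrable2 :=
  (fubini_integrable2 (m1 := lebesgue_measure) (m2 := lebesgue_measure)) (only parsing).
Notation Lfubini_R :=
  (fubini_R (m1 := lebesgue_measure) (m2 := lebesgue_measure)) (only parsing).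

Lemma Rfatou (R : realType) d (T : measurableType d) (m : {measure set T -> \bar R})
    (D : set T) (mD : measurable D) (f_ : nat -> T -> R) (f : T -> R) (M : \bar R) :
  (forall n, measurable_fun D (f_ n)) -> (forall n x, D x -> 0 <= f_ n x) ->
  (forall x, D x -> f_ n x @[n --> \oo] --> f x) ->
  (forall n, (\int[m]_(x in D) (f_ n x)%:E <= M)%E) ->
  (\int[m]_(x in D) (f x)%:E <= M)%E.
Proof.
move=> mf f0 cf fM.
have mf' n : measurable_fun D (fun x => (f_ n x)%:E) by exact/measurable_EFinP.
have f0' n x : D x -> (0 <= (f_ n x)%:E)%E by move=> Dx; rewrite lee_fin f0.
have := @fatou _ _ _ m D mD _ mf' f0'.
rewrite (_ : (\int[m]_(x in D) limn_einf _)%E = (\int[m]_(x in D) (f x)%:E)%E); last first.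
  apply: eq_integral => x /set_mem Dx.
  have c : (f_ n x)%:E @[n --> \oo] --> (f x)%:E.
    by apply: cvg_EFin; [exact: nearW|exact: cf].
  by have [-> _] := cvg_limn_einf_sup c.
move=> /le_trans; apply.
rewrite limn_einf_lim; apply: lime_le; first exact: is_cvg_einfs.
apply: nearW => n; apply: le_trans (fM n); apply: ereal_inf_lbound.
by exists n => /=.
Qed.

(** * Riesz representation *)

Section square_integrable.
Context {R : realType} d (T : measurableType d).
Variable (m : {measure set T -> \bar R}) (D : set T).
Hypothesis mD : measurable D.
Implicit Types f g : T -> R.
Local Notation int f := (m.-integrable D (EFin \o f)).

Definition sq_int f := measurable_fun D f /\ int (fun x => f x ^+ 2).

Lemma le_prod_sqr (a b : R) : `|a * b| <= a ^+ 2 + b ^+ 2.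
Proof.
have h : `|a| * `|b| *+ 2 <= `|a| ^+ 2 + `|b| ^+ 2.
  by rewrite -subr_ge0 addrAC -sqrrB sqr_ge0.
rewrite normrM -(real_normK (num_real a)) -(real_normK (num_real b)); apply: le_trans h.
by rewrite mulr2n lerDl mulr_ge0.
Qed.

Lemma sq_int_mul f g : sq_int f -> sq_int g -> int (fun x => f x * g x).
Proof.
move=> [mf f2] [mg g2].
apply: (@integrable_dominated _ _ _ m D _ (fun x => f x ^+ 2 + g x ^+ 2)) => //.
- exact: measurable_funM.
- exact: rintD.
- by move=> x _; exact: le_prod_sqr.
Qed.

Lemma sq_int_le f g : measurable_fun D f -> sq_int g ->
  (forall x, D x -> `|f x| <= `|g x|) -> sq_int f.
Proof.
move=> mf [mg g2] fg; split => //.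
apply: (@integrable_dominated _ _ _ m D _ (fun x => g x ^+ 2)) => //.
  by apply: measurable_funX.
by move=> x Dx; rewrite normrX -(real_normK (num_real (g x))) ler_sqr ?nnegrE ?fg.
Qed.

Lemma sq_intZ c f : sq_int f -> sq_int (fun x => c * f x).
Proof.
move=> [mf f2]; split; first by apply: measurable_funM => //; exact: measurable_cst.
by apply: eq_rint (rintZ mD (c ^+ 2) f2) => // x _; rewrite exprMn.
Qed.

Lemma sq_intD f g : sq_int f -> sq_int g -> sq_int (fun x => f x + g x).
Proof.
move=> f2 g2; split; first by apply: measurable_funD; [exact: f2.1|exact: g2.1].
have := rintD mD (rintD mD f2.2 g2.2) (rintZ mD 2 (sq_int_mul f2 g2)).
by apply: eq_rint => // x _; rewrite sqrrD; ring.
Qed.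

Lemma sq_intB f g : sq_int f -> sq_int g -> sq_int (fun x => f x - g x).
Proof.
move=> f2 g2; have := sq_intD f2 (sq_intZ (-1) g2).
by move=> h; rewrite (_ : (fun x => _) = (fun x => f x + -1 * g x))//; apply/funext => x; rewrite mulN1r.
Qed.

(** The square of f - f_n is at most 4 f^2, which is integrable, so dominated convergence applies to
    the squares. *)
Lemma cvg_sq_dominated (f_ : nat -> T -> R) f : (forall n, measurable_fun D (f_ n)) ->
  sq_int f -> (forall n x, D x -> `|f_ n x| <= `|f x|) ->
  (forall x, D x -> f_ n x @[n --> \oo] --> f x) ->
  \int[m]_(x in D) (f x - f_ n x) ^+ 2 @[n --> \oo] --> (0:R).
Proof.
move=> mf [mff f2] fle cf.
have mh n : measurable_fun D (fun x => (f x - f_ n x) ^+ 2).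
  by apply: measurable_funX; apply: measurable_funB.
have bh n x : D x -> `|(f x - f_ n x) ^+ 2| <= 4 * f x ^+ 2.
  move=> Dx; rewrite ger0_norm ?sqr_ge0//.
  have := fle n x Dx; rewrite -(real_normK (num_real (f x - f_ n x))) => h.
  have h2 : `|f x - f_ n x| <= 2 * `|f x|.
    by rewrite (le_trans (ler_normB _ _))// mulrC mulr_natr mulr2n lerD2l.
  apply: (@le_trans _ _ ((2 * `|f x|) ^+ 2)).
    by rewrite ler_sqr ?nnegrE ?mulr_ge0.
  by rewrite exprMn real_normK ?num_real// -natrX.
have ch x : D x -> (f x - f_ n x) ^+ 2 @[n --> \oo] --> (0:R).
  move=> Dx; rewrite [X in _ --> X](_ : 0 = (f x - f x) ^+ 2); last by rewrite subrr expr0n.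
  by apply: cvgM; apply: cvgB; [exact: cvg_cst|exact: cf|exact: cvg_cst|exact: cf].
have [_] := Rdct mD mh (rintZ mD 4 f2) bh ch.
by rewrite [X in _ --> X](_ : _ = 0)// /Rintegral integral0.
Qed.

End square_integrable.

Section riesz.
Context {R : realType} d (T : measurableType d).
Variable (m : {sigma_finite_measure set T -> \bar R}) (D : set T).
Hypothesis mD : measurable D.
Variable g0 : T -> R.
Hypothesis g0_gt0 : forall x, D x -> 0 < g0 x.
Hypothesis sq_g0 : sq_int m D g0.
Variables (dom : (T -> R) -> Prop) (l : (T -> R) -> R) (C : R).
Hypothesis dom_sq : forall f, dom f -> sq_int m D f.
Hypothesis dom_bnd : forall (f : T -> R) (M : R), measurable_fun D f ->
  (forall x, D x -> `|f x| <= M * g0 x) -> dom f.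
Hypothesis dom_lin : forall a f g, dom f -> dom g ->
  dom (fun x => a * f x + g x) /\ l (fun x => a * f x + g x) = a * l f + l g.
Hypothesis l_bnd : forall f, dom f -> l f ^+ 2 <= C * \int[m]_(x in D) f x ^+ 2.
Local Notation int f := (m.-integrable D (EFin \o f)).

Let dom0 : dom (fun=> 0).
Proof.
apply: (@dom_bnd _ 0); first exact: measurable_cst.
by move=> x _; rewrite normr0 mul0r.
Qed.

(** The functional acts on functions and not on classes; it is the bound by the norm over [D] that
    makes it blind to values outside [D]. *)
Let l_eq f g : dom f -> dom g -> (forall x, D x -> f x = g x) -> l f = l g.
Proof.
move=> df dg fg; have [dfg lfg] := dom_lin (-1) dg df.
have := l_bnd dfg; rewrite lfg.
rewrite (_ : Rintegral _ _ _ = 0) ?mulr0; last first.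
  transitivity (\int[m]_(x in D) (0:R)); last by rewrite /Rintegral integral0.
  by apply: eq_Rint => // x Dx; rewrite fg// mulN1r addNr expr0n.
move=> h; have /eqP : (-1 * l g + l f) ^+ 2 = 0 by apply/eqP; rewrite eq_le h sqr_ge0.
by rewrite sqrf_eq0 mulN1r addrC subr_eq0 => /eqP.
Qed.

Let l_cvg (f_ : nat -> T -> R) f : (forall n, dom (f_ n)) -> dom f ->
  \int[m]_(x in D) (f x - f_ n x) ^+ 2 @[n --> \oo] --> (0:R) ->
  l (f_ n) @[n --> \oo] --> l f.
Proof.
move=> df_ df cf.
have lin n : dom (fun x => -1 * f_ n x + f x) /\ l (fun x => -1 * f_ n x + f x) = -1 * l (f_ n) + l f.
  exact: dom_lin.
have b n : (l f - l (f_ n)) ^+ 2 <= C * \int[m]_(x in D) (f x - f_ n x) ^+ 2.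
  have [d1 e1] := lin n; have := l_bnd d1; rewrite e1 mulN1r addrC.
  congr (_ <= _ * _); apply: eq_Rint => // x _; by rewrite mulN1r addrC.
have c2 : (l f - l (f_ n)) ^+ 2 @[n --> \oo] --> (0:R).
  apply: (squeeze_cvgr (f := fun=> 0) (h := fun n => C * \int[m]_(x in D) (f x - f_ n x) ^+ 2)).
  - by apply: nearW => n; rewrite sqr_ge0 b.
  - exact: cvg_cst.
  - by rewrite -(mulr0 C); apply: cvgM; [exact: cvg_cst|].
have c3 : `|l f - l (f_ n)| @[n --> \oo] --> (0:R).
  rewrite (_ : (fun n => _) = (fun n => Num.sqrt ((l f - l (f_ n)) ^+ 2))); last first.
    by apply/funext => n; rewrite sqrtr_sqr.
  rewrite -(sqrtr0 R); apply: (@cvg_comp _ _ _ _ (@Num.sqrt R) _ (nbhs (0:R))) => //.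
  exact: sqrt_continuous.
apply: cvg_zero; apply/norm_cvg0P.
by move: c3; under eq_fun do rewrite distrC.
Qed.

Let domM S : measurable S -> dom (fun x => \1_S x * g0 x).
Proof.
move=> mS; apply: (@dom_bnd _ 1).
  apply: measurable_funM; last exact: sq_g0.1.
  by apply: measurable_funTS; exact: measurable_indic.
move=> x Dx; rewrite mul1r normrM (gtr0_norm (g0_gt0 Dx)) ler_piMl ?(ltW (g0_gt0 Dx))//.
by rewrite indicE; case: (_ \in _); rewrite ?normr1 ?normr0.
Qed.

(** The weight [g0], positive and square integrable, makes the indicator of every measurable set
    admissible, even when the set has infinite measure. Hence a finite charge, to which
    Radon-Nikodym applies. *)
Definition riesz_charge (S : set T) : \bar R := (l (fun x => \1_S x * g0 x))%:E.

Let charge0 : riesz_charge set0 = 0%E.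
Proof.
rewrite /riesz_charge; congr EFin.
have -> : (fun x => \1_set0 x * g0 x) = (fun x => (-1) * 0 + 0).
  by apply/funext => x; rewrite indic0 mul0r mulr0 addr0.
by have [_ ->] := dom_lin (-1) dom0 dom0; rewrite mulN1r addNr.
Qed.

Let chargeU A B : measurable A -> measurable B -> A `&` B = set0 ->
  l (fun x => \1_(A `|` B) x * g0 x) = l (fun x => \1_A x * g0 x) + l (fun x => \1_B x * g0 x).
Proof.
move=> mA mB AB; have [_] := dom_lin 1 (domM mA) (domM mB); rewrite mul1r => <-.
congr l; apply/funext => x; rewrite mul1r -mulrDl; congr (_ * _).
rewrite !indicE in_setU.
case: (boolP (x \in A)) => [xA|_] /=; last by rewrite add0r.
rewrite memNset ?addr0// => xB.
by move: xA; rewrite inE => xA; have : (A `&` B) x by []; rewrite AB.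
Qed.

(** Finite additivity is linearity. For a sequence, the indicators of the partial unions, times
    [g0], converge in L_2 by domination, and the bound makes [l] continuous for that convergence. *)
Let charge_sigma : semi_sigma_additive riesz_charge.
Proof.
move=> F mF tF mUF.
have partial n : (\sum_(0 <= i < n) riesz_charge (F i) = riesz_charge (\big[setU/set0]_(i < n) F i))%E.
  elim: n => [|n IH]; first by rewrite big_geq// big_ord0 charge0.
  rewrite big_nat_recr//= IH big_ord_recr/= /riesz_charge -EFinD chargeU//.
  - exact: bigsetU_measurable.
  - apply/seteqP; split => // x []; rewrite -bigcup_mkord => -[i /= lti Fix] Fnx.
    by have e := tF i n I I (ex_intro _ x (conj Fix Fnx)); rewrite e ltnn in lti.
rewrite (_ : (fun n => _) = (fun n => (l (fun x => \1_(\big[setU/set0]_(i < n) F i) x * g0 x))%:E)); last first.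
  by apply/funext => n; rewrite partial.
apply: cvg_EFin; first exact: nearW.
have mBU n : measurable (\big[setU/set0]_(i < n) F i) by exact: bigsetU_measurable.
apply: l_cvg; [by move=> n; exact: domM|exact: domM|].
apply: cvg_sq_dominated => //.
- by move=> n; have [] := dom_sq (domM (mBU n)).
- exact: dom_sq (domM _).
- move=> n x Dx; rewrite !normrM ler_wpM2r// !indicE.
  case: (boolP (x \in \big[setU/set0]_(i < n) F i)) => [xF|]; last by rewrite normr0.
  rewrite mem_set//; move: xF; rewrite inE.
  by rewrite -bigcup_mkord => -[i _ Fix]; exists i.
- move=> x Dx; apply: cvgM; last exact: cvg_cst.
  have [[i _ Fix]|nF] := pselect ((\bigcup_n F n) x).
    apply: cvg_near_cst; near=> n; rewrite !indicE.
    rewrite mem_set; last by rewrite -bigcup_mkord; exists i => //=; near: n; exact: nbhs_infty_gt.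
    by rewrite mem_set//; exists i.
  apply: cvg_near_cst; near=> n; rewrite !indicE memNset; last first.
    by rewrite -bigcup_mkord => -[i _ Fix]; apply: nF; exists i.
  by rewrite memNset.
Unshelve. all: by end_near.
Qed.

HB.instance Definition _ := isCharge.Build d T R riesz_charge charge0 (fun _ _ => erefl) charge_sigma.

Let dominated : riesz_charge `<< m.
Proof.
move=> A A0 B mB BA.
have dB := domM mB.
have : l (fun x => \1_B x * g0 x) ^+ 2 <= 0.
  rewrite (le_trans (l_bnd dB))//.
  rewrite (_ : Rintegral _ _ _ = 0) ?mulr0//.
  transitivity (\int[m]_(x in D) (0:R)); last by rewrite /Rintegral integral0.
  have mB0 : m B = 0 by exact: A0.
  apply: ae_eq_Rint => //; last first.
    by apply: measurable_funX; have [] := dom_sq dB.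
  exists B; split => // x /= /not_implyP[Dx].
  apply: contra_notP => nB; rewrite indicE memNset// mul0r expr0n//.
move=> h; rewrite /riesz_charge; congr EFin; apply/eqP.
by rewrite -sqrf_eq0 eq_le h sqr_ge0.
Qed.

Let nu : {charge set T -> \bar R} := riesz_charge.
Let h x := fine (Radon_Nikodym nu m x).

Let int_h : m.-integrable setT (EFin \o h).
Proof.
by have [] := integrable_fine measurableT (Radon_Nikodym_integrable dominated).
Qed.

Let int_hD : int h.
Proof. exact: integrableS int_h. Qed.

Let l_indic S : measurable S -> l (fun x => \1_S x * g0 x) = \int[m]_(x in D) (\1_S x * h x).
Proof.
move=> mS.
have mSD : measurable (S `&` D) by exact: measurableI.
have -> : l (fun x => \1_S x * g0 x) = l (fun x => \1_(S `&` D) x * g0 x).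
  apply: l_eq; [exact: domM|exact: domM|].
  by move=> x Dx; rewrite !indicE in_setI (mem_set Dx) andbT.
have := Radon_Nikodym_integral dominated mSD.
rewrite -[nu _]/((l (fun x => \1_(S `&` D) x * g0 x))%:E) => E; apply: EFin_inj; rewrite E.
rewrite -RintE//; last first.
  apply: (@integrable_dominated _ _ _ m D _ (fun x => `|h x|)) => //.
  - apply: measurable_funM; last exact: rint_measurable int_hD.
    by apply: measurable_funTS; exact: measurable_indic.
  - exact: rintabs.
  - move=> x _; rewrite normrM ler_piMl// indicE.
    by case: (_ \in _); rewrite ?normr1 ?normr0.
rewrite [LHS]integral_mkcond [RHS]integral_mkcond; apply: eq_integral => x _.
rewrite !patchE indicE in_setI.
case: (boolP (x \in S)); case: (boolP (x \in D)) => //= _ _.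
  by rewrite mul1r fineK//; exact: Radon_Nikodym_fin_num.
by rewrite mul0r.
Qed.

Let l_nnsfun (f : {nnsfun T >-> R}) : dom (fun x => f x * g0 x) /\
  l (fun x => f x * g0 x) = \int[m]_(x in D) (f x * h x).
Proof.
have intS S : measurable S -> int (fun x => \1_S x * h x).
  move=> mS; apply: (@integrable_dominated _ _ _ m D _ (fun x => `|h x|)) => //.
  - apply: measurable_funM; last exact: rint_measurable int_hD.
    by apply: measurable_funTS; exact: measurable_indic.
  - exact: rintabs.
  - move=> x _; rewrite normrM ler_piMl// indicE.
    by case: (_ \in _); rewrite ?normr1 ?normr0.
have E (s : seq R) : [/\ dom (fun x => (\sum_(y <- s) y * \1_(f @^-1` [set y]) x) * g0 x),
    int (fun x => (\sum_(y <- s) y * \1_(f @^-1` [set y]) x) * h x) &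
  l (fun x => (\sum_(y <- s) y * \1_(f @^-1` [set y]) x) * g0 x) =
  \int[m]_(x in D) ((\sum_(y <- s) y * \1_(f @^-1` [set y]) x) * h x)].
  elim: s => [|y s [IH1 IH2 IH3]].
    have e0 (k : T -> R) : (fun x => (\sum_(y <- [::]) y * \1_(f @^-1` [set y]) x) * k x) = (fun=> 0).
      by apply/funext => x; rewrite big_nil mul0r.
    rewrite !e0; split => //.
      apply: (@eq_rint _ _ _ m D _ (fun x => 0 * h x)) => //; last exact: rintZ.
      by move=> x _; rewrite mul0r.
    have := charge0; rewrite /riesz_charge => -[].
    rewrite (_ : (fun x => \1_set0 x * g0 x) = (fun=> 0)); last first.
      by apply/funext => x; rewrite indic0 mul0r.
    by move=> ->; rewrite /Rintegral integral0.
  have mS : measurable (f @^-1` [set y]) by exact: measurable_sfunP.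
  have ec (k : T -> R) : (fun x => (\sum_(y <- y :: s) y * \1_(f @^-1` [set y]) x) * k x) =
     (fun x => y * (\1_(f @^-1` [set y]) x * k x) + (\sum_(y <- s) y * \1_(f @^-1` [set y]) x) * k x).
    by apply/funext => x; rewrite big_cons mulrDl mulrA.
  rewrite !ec; have [d1 ->] := dom_lin y (domM mS) IH1; split => //.
    by apply: rintD => //; apply: rintZ => //; exact: intS.
  rewrite RintD//; last by apply: rintZ => //; exact: intS.
  by rewrite RintZ//; [rewrite l_indic// IH3|exact: intS].
have fE (k : T -> R) : (fun x => f x * k x) =
   (fun x => (\sum_(y <- fset_set (range f)) y * \1_(f @^-1` [set y]) x) * k x).
  by apply/funext => x; rewrite {1}fimfunE fsbig_finite.
by rewrite !fE; have [] := E (fset_set (range f)).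
Qed.

Let l_bounded_ge0 (a : T -> R) (M : R) : measurable_fun setT a ->
  (forall x, 0 <= a x <= M) ->
  l (fun x => a x * g0 x) = \int[m]_(x in D) (a x * h x).
Proof.
move=> ma a0M.
have ma' : measurable_fun setT (EFin \o a) by exact/measurable_EFinP.
pose f := nnsfun_approx measurableT ma'.
have a0 x : setT x -> (0 <= (EFin \o a) x)%E by move=> _; rewrite lee_fin; have /andP[] := a0M x.
have fa n x : 0 <= f n x <= a x.
  rewrite fun_ge0/= -lee_fin /f nnsfun_approxE; exact: le_approx.
have cf x : f n x @[n --> \oo] --> a x.
  have := cvg_nnsfun_approx measurableT ma' a0 I (x := x).
  by move=> /fine_cvg.
have dg0 := dom_sq (dom_bnd (M := M) _ _).
have da : dom (fun x => a x * g0 x).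
  apply: (@dom_bnd _ M).
    by apply: measurable_funM; [exact: measurable_funTS|exact: sq_g0.1].
  move=> x Dx; rewrite normrM (gtr0_norm (g0_gt0 Dx)) ler_wpM2r ?(ltW (g0_gt0 Dx))//.
  by have /andP[? ?] := a0M x; rewrite ger0_norm.
have c1 : l (fun x => f n x * g0 x) @[n --> \oo] --> l (fun x => a x * g0 x).
  apply: l_cvg => //; first by move=> n; have [] := l_nnsfun (f n).
  apply: cvg_sq_dominated => //.
  - by move=> n; have [/dom_sq[]] := l_nnsfun (f n).
  - exact: dom_sq.
  - move=> n x Dx; rewrite !normrM ler_wpM2r//.
    have /andP[f0 fle] := fa n x.
    by rewrite !ger0_norm//; have /andP[] := a0M x.
  - by move=> x Dx; apply: cvgM; [exact: cf|exact: cvg_cst].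
have [_ c2] := @Rdct _ _ _ m D mD (fun n x => f n x * h x) (fun x => a x * h x) (fun x => M * `|h x|)
  (fun n => measurable_funM (measurable_funTS (@measurable_funPT _ _ _ _ (f n))) (rint_measurable int_hD))
  (rintZ mD M (rintabs int_hD))
  (fun n x Dx => ltac:(rewrite normrM ler_wpM2r//; have /andP[f0 fle] := fa n x; rewrite ger0_norm//; have /andP[_] := a0M x; exact: le_trans))
  (fun x Dx => cvgM (cf x) (cvg_cst _)).
apply: (cvg_unique _ c1); first exact: Rhausdorff.
rewrite /= (_ : (fun n => l _) = (fun n => \int[m]_(x in D) (f n x * h x)))//.
by apply/funext => n; rewrite (l_nnsfun _).2.
Qed.

Let l_bounded (a : T -> R) (M : R) : 0 <= M -> measurable_fun setT a ->
  (forall x, `|a x| <= M) ->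
  l (fun x => a x * g0 x) = \int[m]_(x in D) (a x * h x).
Proof.
move=> M0 ma aM.
(* A function of variable sign is shifted by its bound [M] into the nonnegative case; the constant
   [M] is then removed as a nonnegative function of its own. *)
have l1 : l (fun x => (a x + M) * g0 x) = \int[m]_(x in D) ((a x + M) * h x).
  apply: (@l_bounded_ge0 (fun x => a x + M) (M + M)).
    by apply: measurable_funD => //; exact: measurable_cst.
  by move=> x; have := aM x; rewrite ler_norml => /andP[]; lra.
have l2 : l (fun x => M * g0 x) = \int[m]_(x in D) (M * h x).
  apply: (@l_bounded_ge0 (fun=> M) M); first exact: measurable_cst.
  by move=> x; rewrite M0 lexx.
have b (k : T -> R) (K : R) : measurable_fun setT k -> (forall x, `|k x| <= K) -> dom (fun x => k x * g0 x).
  move=> mk kK; apply: (@dom_bnd _ K).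
    by apply: measurable_funM; [exact: measurable_funTS|exact: sq_g0.1].
  by move=> x Dx; rewrite normrM (gtr0_norm (g0_gt0 Dx)) ler_wpM2r ?(ltW (g0_gt0 Dx)).
have d1 : dom (fun x => (a x + M) * g0 x).
  apply: (b _ (M + M)); first by apply: measurable_funD => //; exact: measurable_cst.
  by move=> x; rewrite (le_trans (ler_normD _ _))// lerD// ger0_norm.
have d2 : dom (fun x => M * g0 x).
  by apply: (b _ M); [exact: measurable_cst|move=> x; rewrite ger0_norm].
have [_] := dom_lin (-1) d2 d1.
rewrite (_ : (fun x => -1 * (M * g0 x) + (a x + M) * g0 x) = fun x => a x * g0 x); last first.
  by apply/funext => x; ring.
move=> ->; rewrite l1 l2.
have ia : int (fun x => h x * (a x + M)).
  apply: (@rintM_bounded _ _ _ m D h (fun x => a x + M) (M + M)) => //.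
    by apply: measurable_funTS; apply: measurable_funD => //; exact: measurable_cst.
  by move=> x Dx; rewrite (le_trans (ler_normD _ _))// lerD// ger0_norm.
rewrite (_ : \int[m]_(x in D) (a x * h x) = \int[m]_(x in D) (h x * (a x + M) - M * h x)); last first.
  by apply: eq_Rint => // x _; ring.
rewrite RintB//; last exact: rintZ.
rewrite mulN1r addrC; congr (_ - _); apply: eq_Rint => // x _; by rewrite mulrC.
Qed.

Let l_dom_bnd (f : T -> R) (M : R) : measurable_fun D f ->
  (forall x, D x -> `|f x| <= M * g0 x) ->
  l f = \int[m]_(x in D) (f x * (h x / g0 x)).
Proof.
move=> mf fM; pose a := (fun x => f x / g0 x) \_ D.
have ma : measurable_fun setT a.
  apply/measurable_restrict => //; rewrite setTI; apply: measurable_funM => //.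
  by apply: measurableT_comp; [exact: measurable_invr|exact: sq_g0.1].
have aE x : D x -> a x = f x / g0 x by move=> Dx; rewrite /a patchE mem_set.
have aM x : `|a x| <= Num.max 0 M.
  rewrite /a patchE; case: ifPn => [|_]; last by rewrite normr0 le_max lexx.
  rewrite inE => Dx; rewrite normrM normfV (gtr0_norm (g0_gt0 Dx)) le_max.
  by rewrite [X in _ || X]ler_pdivrMr ?g0_gt0// fM// orbT.
have da : dom (fun x => a x * g0 x).
  apply: (@dom_bnd _ (Num.max 0 M)).
    by apply: measurable_funM; [exact: measurable_funTS|exact: sq_g0.1].
  by move=> x Dx; rewrite normrM (gtr0_norm (g0_gt0 Dx)) ler_wpM2r ?(ltW (g0_gt0 Dx)).
rewrite (l_eq (dom_bnd mf fM) da); last first.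
  by move=> x Dx; rewrite aE// divfK// gt_eqF// g0_gt0.
have M0 : 0 <= Num.max 0 M by rewrite le_max lexx.
rewrite (l_bounded M0 ma aM); apply: eq_Rint => // x Dx.
by rewrite aE// mulrAC mulrA.
Qed.

(** The density is that of the charge divided by [g0]. Its square integrability is not visible from
    Radon-Nikodym: it comes from testing [l] on the truncations of the density itself. The class
    [dom] is a parameter because some functionals below are defined only on functions that are
    integrable as well as square integrable. *)
Lemma riesz : exists chi, sq_int m D chi /\
  forall f, dom f -> l f = \int[m]_(x in D) (f x * chi x).
Proof.
pose chi x := h x / g0 x.
have mchi : measurable_fun D chi.
  apply: measurable_funM; first exact: rint_measurable int_hD.
  by apply: measurableT_comp; [exact: measurable_invr|exact: sq_g0.1].
(* truncation of a function at a multiple of [g0] *)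
pose tr (f : T -> R) (n : nat) x := if `|f x| <= n%:R * g0 x then f x else 0.
have mtr f n : measurable_fun D f -> measurable_fun D (tr f n).
  move=> mf; apply: measurable_fun_if => //.
  - apply: measurable_fun_ler => //.
      by apply: measurableT_comp.
    by apply: measurable_funM; [exact: measurable_cst|exact: sq_g0.1].
  - by apply: measurable_funS mf.
have trle f n x : `|tr f n x| <= `|f x|.
  by rewrite /tr; case: ifPn => // _; rewrite normr0.
have trg f n x : D x -> `|tr f n x| <= n%:R * g0 x.
  by rewrite /tr; case: ifPn => // _ Dx; rewrite normr0 mulr_ge0// ltW// g0_gt0.
have trf f n x : tr f n x * f x = tr f n x ^+ 2.
  by rewrite /tr; case: ifPn => // _; rewrite mul0r expr0n.
have trcvg f x : D x -> tr f n x @[n --> \oo] --> f x.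
  move=> Dx; apply: cvg_near_cst.
  exists (Num.truncn (`|f x| / g0 x)).+1 => // n /= ltn.
  rewrite /tr ifT// -ler_pdivrMr ?g0_gt0//.
  apply: ltW; apply: lt_le_trans (truncnS_gt _) _; by rewrite ler_nat.
have trd f n : measurable_fun D f -> dom (tr f n).
  by move=> mf; apply: (@dom_bnd _ n%:R); [exact: mtr|move=> x Dx; exact: trg].
have E n : \int[m]_(x in D) (tr chi n x) ^+ 2 <= Num.max 0 C.
  set I := Rintegral _ _ _.
  have lI : l (tr chi n) = I.
    rewrite (@l_dom_bnd _ n%:R); [|exact: mtr|by move=> x; exact: trg].
    by apply: eq_Rint => // x _; rewrite -/(chi x) trf.
  have I0 : 0 <= I by apply: Rintegral_ge0 => x _; exact: sqr_ge0.
  have := l_bnd (trd _ n mchi); rewrite lI -/I expr2.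
  have [->|Ipos] := eqVneq I 0; first by rewrite le_max lexx.
  by rewrite ler_pM2r ?lt_neqAle 1?eq_sym ?Ipos// le_max => ->; rewrite orbT.
(* The bound just obtained is uniform in [n], so Fatou's lemma passes it from the truncations to
   [chi]. *)
have sqchi : sq_int m D chi.
  split => //; apply: rint_ge0_lty => //.
  - exact: measurable_funX.
  - by move=> x _; exact: sqr_ge0.
  - apply: (@le_lt_trans _ _ (Num.max 0 C)%:E); last exact: ltry.
    apply: (@Rfatou _ _ _ m D mD (fun n x => tr chi n x ^+ 2)) => //.
    + by move=> n; apply: measurable_funX; exact: mtr.
    + by move=> n x _; exact: sqr_ge0.
    + by move=> x Dx; apply: cvgM; exact: trcvg.
    + move=> n; rewrite RintE ?lee_fin//.
      by have [] := dom_sq (trd chi n mchi).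
exists chi; split => // f df.
have [mf f2] := dom_sq df.
have c1 : l (tr f n) @[n --> \oo] --> l f.
  apply: l_cvg => //; first by move=> n; exact: trd.
  apply: cvg_sq_dominated; [exact: mD|by move=> n; exact: mtr|exact: dom_sq|by move=> n x _; exact: trle|by move=> x; exact: trcvg].
have [_ c2] := @Rdct _ _ _ m D mD (fun n x => tr f n x * chi x) (fun x => f x * chi x)
  (fun x => `|f x * chi x|)
  (fun n => measurable_funM (mtr _ _ mf) mchi)
  (rintabs (sq_int_mul mD (dom_sq df) sqchi))
  (fun n x Dx => ltac:(rewrite !normrM ler_wpM2r//))
  (fun x Dx => cvgM (trcvg _ _ Dx) (cvg_cst _)).
apply: (cvg_unique _ c1); first exact: Rhausdorff.
rewrite (_ : (fun n => l _) = (fun n => \int[m]_(x in D) (tr f n x * chi x)))//.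
apply/funext => n; rewrite (@l_dom_bnd _ n%:R)//; first exact: mtr.
by move=> x; exact: trg.
Qed.

End riesz.

Notation Lsq_int_mul := (sq_int_mul (m := lebesgue_measure)) (only parsing).
Notation Lsq_intD := (sq_intD (m := lebesgue_measure)) (only parsing).
Notation Lsq_intB := (sq_intB (m := lebesgue_measure)) (only parsing).
Notation Lsq_intZ := (sq_intZ (m := lebesgue_measure)) (only parsing).

Opaque cos sin expR atan.

(** * Plancherel's identity on the half-line *)

Section plancherel.
Context {R : realType}.
Local Notation mu := (@lebesgue_measure R).
Local Notation D := (`]0, +oo[%classic : set R).
Local Notation int f := (mu.-integrable D (EFin \o f)).

Let mD : measurable D. Proof. by []. Qed.

Definition trig_transform (k u : R -> R) (x : R) := \int[mu]_(xi in D) (u xi * k (x * xi)).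

Definition L1_L2 (u : R -> R) := int u /\ sq_int mu D u.

Lemma quadratic_ge0 (a b c : R) : 0 <= a -> 0 <= c ->
  (forall t, 0 <= a + t * b *+ 2 + t ^+ 2 * c) -> b ^+ 2 <= a * c.
Proof.
move=> a0 c0 h; have [c1|c1] := eqVneq c 0.
  rewrite c1 mulr0; have [->|b0] := eqVneq b 0; first by rewrite expr0n.
  (* For c = 0 the expression is affine in [t], and this [t] gives it the value -1. In the other
     case the minimum is attained at t = -b / c. *)
  have := h (- (a + 1) / (2 * b)); rewrite c1 mulr0 addr0.
  rewrite (_ : a + _ = -1) ?oppr_ge0 ?ler10//.
  by rewrite -mulr_natr; field; rewrite b0.
have cp : 0 < c by rewrite lt_neqAle eq_sym c1.
have := h (- b / c); rewrite (_ : a + _ + _ = (a * c - b ^+ 2) / c).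
  by rewrite pmulr_lge0 ?invr_gt0// subr_ge0.
by rewrite -mulr_natr; field.
Qed.

Section kernel.
Variable k : R -> R.
Hypothesis mk : measurable_fun setT k.
Hypothesis k1 : forall x, `|k x| <= 1.
Local Notation T := (trig_transform k).

Lemma trig_kernel_int (u : R -> R) (x : R) : int u -> int (fun xi => u xi * k (x * xi)).
Proof.
move=> iu; apply: (rintM_bounded (C := 1)) => //.
by apply: measurable_funTS; apply: measurableT_comp => //; apply: measurable_funM => //.
Qed.

Lemma trig_transformD (a : R) (u w : R -> R) (x : R) : int u -> int w ->
  T (fun xi => a * u xi + w xi) x = a * T u x + T w x.
Proof.
move=> iu iw; rewrite /trig_transform.
have -> : \int[mu]_(xi in D) ((a * u xi + w xi) * k (x * xi)) =
   \int[mu]_(xi in D) (a * (u xi * k (x * xi)) + w xi * k (x * xi)).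
  by apply: Leq_Rint => // xi _; rewrite mulrDl mulrA.
rewrite LRintD ?LRintZ//; try exact: trig_kernel_int.
by apply: LrintZ => //; exact: trig_kernel_int.
Qed.

Lemma trig_transform_bound (u : R -> R) (x : R) : int u -> `|T u x| <= \int[mu]_(xi in D) `|u xi|.
Proof.
move=> iu; rewrite (le_trans (le_normr_Rintegral _ _))//; first exact: trig_kernel_int.
apply: Lle_Rint => //.
- by apply: Lrintabs; exact: trig_kernel_int.
- exact: Lrintabs.
- by move=> xi _; rewrite normrM ler_piMr.
Qed.

Let mker (c : R) : measurable_fun (D `*` D) (fun z => k (z.1 * z.2)).
Proof. by apply: measurable_funTS; apply: measurableT_comp => //; apply: measurable_funM. Qed.

Lemma trig_transform_damped (e : R) (u : R -> R) : 0 < e -> int u -> int (fun x => expR (- e * x) * T u x).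
Proof.
move=> e0 iu; have [ie _] := laplace_exp e0.
have mu_ := Lrint_measurable iu.
pose f (x xi : R) := expR (- e * x) * (u xi * k (x * xi)).
have mf : measurable_fun (D `*` D) (fun z => f z.1 z.2).
  apply: measurable_funM; first by mfun.
  by apply: measurable_funM; [exact: measurable_snd_on|exact: mker].
have fin : (\int[mu]_(x in D) \int[mu]_(y in D) (`|f x y|)%:E < +oo)%E.
  apply: (Lfubini_fin_prod mD mD mf ie (Lrintabs iu)) => x xi _ _.
  rewrite /f normrM ger0_norm ?expR_ge0// ler_wpM2l ?expR_ge0//.
  by rewrite normrM ler_piMr.
have h := Lfubini_integrable1 mD mD mf fin.
apply: (Leq_rint mD _ h) => x _; rewrite LRintZ//; exact: trig_kernel_int.
Qed.

(** Fubini's theorem makes the damped transform integrable, hence measurable; multiplication by e^x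
    removes the damping. *)
Lemma measurable_trig_transform (u : R -> R) : int u -> measurable_fun D (T u).
Proof.
move=> iu; have h := Lrint_measurable (trig_transform_damped ltr01 iu).
apply: (@eq_measurable_fun _ _ _ _ D (fun x => expR x * (expR (- 1 * x) * T u x))).
  by move=> x _; rewrite mulrA -expRD mulN1r subrr expR0 mul1r.
by apply: measurable_funM => //; apply: measurable_funTS; exact: measurable_expR.
Qed.

(** Writing first one factor of the square and then the other as an integral, and exchanging orders,
    brings the integral over [x] innermost, onto a product of two kernels. The damping makes these
    exchanges absolutely convergent. *)
Lemma damped_square (e : R) (u : R -> R) : 0 < e -> int u ->
  int (fun x => expR (- e * x) * T u x ^+ 2) /\
  int (fun eta => u eta * \int[mu]_(xi in D) (u xi *
    \int[mu]_(x in D) (expR (- e * x) * (k (x * eta) * k (x * xi))))) /\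
  \int[mu]_(x in D) (expR (- e * x) * T u x ^+ 2) =
  \int[mu]_(eta in D) (u eta * \int[mu]_(xi in D) (u xi *
    \int[mu]_(x in D) (expR (- e * x) * (k (x * eta) * k (x * xi))))).
Proof.
move=> e0 iu; have [ie _] := laplace_exp e0.
have mu_ := Lrint_measurable iu.
have iT := trig_transform_damped e0 iu.
have mT := measurable_trig_transform iu.
set M := \int[mu]_(xi in D) `|u xi|.
have TM x : `|T u x| <= M by exact: trig_transform_bound.
pose f (x eta : R) := expR (- e * x) * T u x * (u eta * k (x * eta)).
have mf : measurable_fun (D `*` D) (fun z => f z.1 z.2).
  apply: measurable_funM; first by apply: measurable_funM; [mfun|exact: measurable_fst_on].
  by apply: measurable_funM; [exact: measurable_snd_on|exact: mker].
have fin : (\int[mu]_(x in D) \int[mu]_(y in D) (`|f x y|)%:E < +oo)%E.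
  apply: (Lfubini_fin_prod mD mD mf (Lrintabs iT) (Lrintabs iu)) => x eta _ _.
  by rewrite /f normrM ler_wpM2l// normrM ler_piMr.
have E1 x : expR (- e * x) * T u x ^+ 2 = \int[mu]_(eta in D) f x eta.
  by rewrite LRintZ; [rewrite expr2 mulrA|exact: mD|exact: trig_kernel_int].
have E2 eta : D eta -> \int[mu]_(x in D) f x eta = u eta * \int[mu]_(xi in D) (u xi *
    \int[mu]_(x in D) (expR (- e * x) * (k (x * eta) * k (x * xi)))).
  move=> Deta.
  pose g (x xi : R) := expR (- e * x) * k (x * eta) * (u xi * k (x * xi)).
  have mg : measurable_fun (D `*` D) (fun z => g z.1 z.2).
    apply: measurable_funM.
      apply: measurable_funM; first by mfun.
      by apply: measurable_funTS; apply: measurableT_comp => //; apply: measurable_funM.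
    by apply: measurable_funM; [exact: measurable_snd_on|exact: mker].
  have fing : (\int[mu]_(x in D) \int[mu]_(y in D) (`|g x y|)%:E < +oo)%E.
    apply: (Lfubini_fin_prod mD mD mg ie (Lrintabs iu)) => x xi _ _.
    rewrite /g normrM ler_pM// normrM; last by rewrite ler_piMr.
    by rewrite ger0_norm ?expR_ge0// ler_piMr ?expR_ge0.
  have -> : \int[mu]_(x in D) f x eta = \int[mu]_(x in D) (u eta * \int[mu]_(xi in D) g x xi).
    apply: Leq_Rint => // x _; rewrite /f LRintZ//; last exact: trig_kernel_int.
    by rewrite -/(T u x); ring.
  rewrite LRintZ//; last exact: (Lfubini_integrable1).
  congr (_ * _); rewrite (Lfubini_R)//; apply: Leq_Rint => // xi _.
  rewrite -LRintZ//; first by apply: Leq_Rint => // x _; rewrite /g; ring.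
  apply: (rintM_bounded (C := 1)) => //.
    by apply: measurable_funTS; apply: measurable_funM; apply: measurableT_comp => //; apply: measurable_funM.
  by move=> x _; rewrite normrM mulr_ile1.
split.
  have := Lfubini_integrable1 mD mD mf fin.
  by apply: Leq_rint => // x _; rewrite E1.
split.
  have := Lfubini_integrable2 mD mD mf fin.
  by apply: Leq_rint => // eta Deta; rewrite E2.
transitivity (\int[mu]_(x in D) \int[mu]_(eta in D) f x eta).
  by apply: Leq_Rint.
by rewrite (Lfubini_R)//; apply: Leq_Rint.
Qed.

End kernel.

Local Notation Tc := (trig_transform (@cos R)).
Local Notation Ts := (trig_transform (@sin R)).

Lemma poisson_mass (e t : R) : 0 < e ->
  int (fun xi => e / (e ^+ 2 + (xi - t) ^+ 2)) /\
  \int[mu]_(xi in D) (e / (e ^+ 2 + (xi - t) ^+ 2)) = pi / 2 + atan (t / e).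
Proof.
move=> e0.
have p (x : R) : 0 < e ^+ 2 + (x - t) ^+ 2 by rewrite ltr_pwDl ?exprn_gt0 ?sqr_ge0.
have dF (x : R) : is_derive x (1:R) (fun x => atan (e^-1 * x + - t / e)) (e / (e ^+ 2 + (x - t) ^+ 2)).
  have d1 := is_derive1_comp (is_derive1_atan _) (is_derive_linear e^-1 (- t / e) x).
  apply: is_derive_eq d1 _ => /=.
  have e1 : e != 0 by rewrite gt_eqF.
  have e2 := lt0r_neq0 (p x).
  field.
  by rewrite e1 /= e2.
have [//|||i1 ->] := @ftc_half_line _ (fun x => atan (e^-1 * x + - t / e)) _ (pi / 2) dF.
- by move=> x; rewrite divr_ge0 ?ltW.
- move=> x; apply: cvgM; first exact: cvg_cst.
  apply: cvgV; first by rewrite gt_eqF.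
  apply: cvgD; first exact: cvg_cst.
  by apply: cvgM; apply: cvgB; [exact: cvg_id|exact: cvg_cst|exact: cvg_id|exact: cvg_cst].
- apply: (@cvg_comp _ _ _ _ (@atan R) _ (pinfty_nbhs R)); last exact: cvgy_atan.
  apply/cvgryPge => A; near=> x.
  rewrite -lerBlDr -ler_pdivrMl ?invr_gt0//; near: x.
by split => //; rewrite mulr0 add0r mulNr atanN opprK.
Unshelve. all: by end_near.
Qed.

Let K (e xi eta : R) := e / (e ^+ 2 + (xi - eta) ^+ 2).

Let K_ge0 e xi eta : 0 < e -> 0 <= K e xi eta.
Proof.
by move=> e0; rewrite divr_ge0 ?(ltW e0)// addr_ge0 ?sqr_ge0.
Qed.

Let K_sym e xi eta : K e xi eta = K e eta xi.
Proof. by rewrite /K -opprB sqrrN. Qed.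

Let K_bound e xi eta : 0 < e -> `|K e xi eta| <= e^-1.
Proof.
move=> e0; have p (x : R) : 0 < e ^+ 2 + (x - eta) ^+ 2 by rewrite ltr_pwDl ?exprn_gt0 ?sqr_ge0.
rewrite ger0_norm ?K_ge0// ler_pdivrMr// mulrDr expr2 mulKf ?gt_eqF//.
by rewrite lerDl mulr_ge0 ?sqr_ge0// invr_ge0 ltW.
Qed.

Let K_int e eta : 0 < e -> int (fun xi => K e xi eta).
Proof. by move=> e0; have [] := poisson_mass eta e0. Qed.

Let K_int' e xi : 0 < e -> int (fun eta => K e xi eta).
Proof. by move=> e0; apply: (Leq_rint mD _ (K_int xi e0)) => eta _; rewrite K_sym. Qed.

Let K_pi e xi : 0 < e -> \int[mu]_(eta in D) K e xi eta <= pi.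
Proof.
move=> e0; have [i1 E1] := poisson_mass xi e0.
rewrite (Leq_Rint (fun eta _ => K_sym e xi eta)).
by rewrite [leLHS]E1 [leRHS](splitr pi) lerD2l ltW ?atan_ltpi2.
Qed.

Let K_meas e : measurable_fun (D `*` D) (fun z : R * R => K e z.1 z.2).
Proof. by mfun. Qed.

Section schur.
Variables (e : R) (u : R -> R).
Hypotheses (e0 : 0 < e) (u12 : L1_L2 u).
Let f (xi eta : R) := u xi ^+ 2 * K e xi eta.

Let mf : measurable_fun (D `*` D) (fun z => f z.1 z.2).
Proof.
apply: measurable_funM; last exact: K_meas.
by apply: measurable_funX; apply: measurable_fst_on; [exact: mD|exact: mD|exact: u12.2.1].
Qed.

Let if1 xi : int (fun eta => f xi eta).
Proof. exact: (LrintZ mD (u xi ^+ 2) (K_int' xi e0)). Qed.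

Let inner xi : \int[mu]_(eta in D) f xi eta <= pi * u xi ^+ 2.
Proof.
rewrite (LRintZ mD _ (K_int' xi e0)) mulrC.
by apply: ler_wpM2r; [exact: sqr_ge0|exact: K_pi].
Qed.

Let fin : (\int[mu]_(xi in D) \int[mu]_(eta in D) (`|f xi eta|)%:E < +oo)%E.
Proof.
have f0 xi eta : 0 <= f xi eta by rewrite mulr_ge0 ?sqr_ge0// K_ge0.
apply: (@le_lt_trans _ _ (\int[mu]_(xi in D) (pi * u xi ^+ 2)%:E)%E); last first.
  apply: Lrint_lty; [exact: mD|exact: (LrintZ mD pi u12.2.2)|move=> x _].
  by rewrite mulr_ge0 ?pi_ge0 ?sqr_ge0.
apply: ge0_le_integral.
- exact: mD.
- by move=> x _; exact: integral_ge0.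
- apply: (measurable_fun_tonelli1 mu mD mD (f := fun x y => (`|f x y|)%:E)) => //.
  by apply/measurable_EFinP; apply: measurableT_comp; [exact: normr_measurable|exact: mf].
- apply/measurable_EFinP; apply: measurable_funM; first exact: measurable_cst.
  exact: (Lrint_measurable u12.2.2).
- move=> xi _; rewrite (LRintE mD (Lrintabs (if1 xi))) lee_fin.
  apply: le_trans (inner xi); rewrite le_eqVlt; apply/orP; left; apply/eqP.
  by apply: Leq_Rint => eta _; rewrite ger0_norm.
Qed.

Lemma schur_test : [/\ int (fun xi => \int[mu]_(eta in D) (u xi ^+ 2 * K e xi eta)),
  int (fun eta => \int[mu]_(xi in D) (u xi ^+ 2 * K e xi eta)),
  \int[mu]_(xi in D) \int[mu]_(eta in D) (u xi ^+ 2 * K e xi eta) =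
  \int[mu]_(eta in D) \int[mu]_(xi in D) (u xi ^+ 2 * K e xi eta) &
  \int[mu]_(xi in D) \int[mu]_(eta in D) (u xi ^+ 2 * K e xi eta) <=
  pi * \int[mu]_(xi in D) u xi ^+ 2].
Proof.
have i1 := Lfubini_integrable1 mD mD mf fin.
split.
- exact: i1.
- exact: (Lfubini_integrable2 mD mD mf fin).
- exact: (Lfubini_R mD mD mf fin).
- rewrite -(LRintZ mD pi u12.2.2); apply: Lle_Rint.
  + exact: mD.
  + exact: i1.
  + exact: (LrintZ mD pi u12.2.2).
  + by move=> xi _; exact: inner.
Qed.

(** Schur's test: the kernel is symmetric, nonnegative and of mass at most pi, and 2 u(xi) u(eta) <=
    u(xi)^2 + u(eta)^2. Each of the two squares contributes at most pi times the squared norm of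
    [u]. *)
Lemma quadratic_form_bound :
  int (fun eta => u eta * \int[mu]_(xi in D) (u xi * K e xi eta)) ->
  \int[mu]_(eta in D) (u eta * \int[mu]_(xi in D) (u xi * K e xi eta)) <=
  pi * \int[mu]_(xi in D) u xi ^+ 2.
Proof.
move=> iq; have [i1 i2 E12 b] := schur_test.
apply: le_trans b.
pose A xi := \int[mu]_(eta in D) (u xi ^+ 2 * K e xi eta).
pose B eta := \int[mu]_(xi in D) (u xi ^+ 2 * K e xi eta).
have iAB := LrintZ mD 2^-1 (LrintD mD i1 i2).
apply: (@le_trans _ _ (\int[mu]_(xi in D) (2^-1 * (A xi + B xi)))); last first.
  rewrite (LRintZ mD _ (LrintD mD i1 i2)) (LRintD mD i1 i2) -E12 -mulr2n.
  have half (I : R) : 2^-1 * (I *+ 2) = I by rewrite -[I *+ 2]mulr_natl mulKf.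
  by rewrite half.
apply: Lle_Rint; [exact: mD|exact: iq|exact: iAB|move=> eta _].
have iuK : int (fun xi => u xi * K e xi eta).
  apply: (@rintM_bounded _ _ _ mu D u (fun xi => K e xi eta) e^-1 mD u12.1).
    exact: (Lrint_measurable (K_int eta e0)).
  by move=> xi _; exact: K_bound.
have iu2K : int (fun xi => u xi ^+ 2 * K e xi eta).
  apply: (@rintM_bounded _ _ _ mu D (fun xi => u xi ^+ 2) (fun xi => K e xi eta) e^-1 mD u12.2.2).
    exact: (Lrint_measurable (K_int eta e0)).
  by move=> xi _; exact: K_bound.
have EA : A eta = \int[mu]_(xi in D) (u eta ^+ 2 * K e xi eta).
  by apply: Leq_Rint => xi _; rewrite K_sym.
have iA := LrintZ mD (u eta ^+ 2) (K_int eta e0).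
rewrite EA /B -(LRintD mD iA iu2K) -(LRintZ mD _ (LrintD mD iA iu2K)) -(LRintZ mD _ iuK).
apply: Lle_Rint; [exact: mD|exact: (LrintZ mD (u eta) iuK)|
  exact: (LrintZ mD 2^-1 (LrintD mD iA iu2K))|move=> xi _].
rewrite mulrA -mulrDl mulrA; apply: ler_wpM2r; first exact: K_ge0.
move: (u eta) (u xi) => a b; rewrite ler_pdivlMl// -subr_ge0.
by rewrite (_ : _ - _ = (a - b) ^+ 2) ?sqr_ge0//; ring.
Qed.

End schur.

(** The product of cosines plus the product of sines is the cosine of the difference, whose damped
    integral is a Poisson kernel. Taken separately, the products would also contain the cosine of
    the sum; this is why the two transforms are squared together. *)
Lemma trig_kernel_sum e xi eta : 0 < e ->
  \int[mu]_(x in D) (expR (- e * x) * (cos (x * eta) * cos (x * xi))) +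
  \int[mu]_(x in D) (expR (- e * x) * (sin (x * eta) * sin (x * xi))) = K e xi eta.
Proof.
move=> e0; have [ie _] := laplace_exp e0.
have [_ E] := laplace_cos (xi - eta) 0 e0.
rewrite cos0 sin0 mulr0 mulr1 subr0 in E; rewrite -[RHS]E.
have ic : int (fun x => expR (- e * x) * (cos (x * eta) * cos (x * xi))).
  apply: (@rintM_bounded _ _ _ mu D _ (fun x => cos (x * eta) * cos (x * xi)) 1 mD ie).
    by mfun.
  by move=> x _; rewrite normrM mulr_ile1 ?cos_max.
have is_ : int (fun x => expR (- e * x) * (sin (x * eta) * sin (x * xi))).
  apply: (@rintM_bounded _ _ _ mu D _ (fun x => sin (x * eta) * sin (x * xi)) 1 mD ie).
    by mfun.
  by move=> x _; rewrite normrM mulr_ile1 ?sin_max.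
rewrite -(LRintD mD ic is_); apply: Leq_Rint => x _.
rewrite addr0 mulrBl cosB -mulrDr (mulrC xi) (mulrC eta).
by rewrite (mulrC (cos (x * xi))) (mulrC (sin (x * xi))).
Qed.

Lemma damped_bound (e : R) (u : R -> R) : 0 < e -> L1_L2 u ->
  int (fun x => expR (- e * x) * (Tc u x ^+ 2 + Ts u x ^+ 2)) /\
  \int[mu]_(x in D) (expR (- e * x) * (Tc u x ^+ 2 + Ts u x ^+ 2)) <=
  pi * \int[mu]_(xi in D) u xi ^+ 2.
Proof.
move=> e0 u12; have iu := u12.1.
have [ic [jc Ec]] := damped_square measurable_cos (@cos_max R) e0 iu.
have [is_ [js Es]] := damped_square measurable_sin (@sin_max R) e0 iu.
have [ie _] := laplace_exp e0.
have EE x : expR (- e * x) * (Tc u x ^+ 2 + Ts u x ^+ 2) =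
  expR (- e * x) * Tc u x ^+ 2 + expR (- e * x) * Ts u x ^+ 2 by rewrite mulrDr.
split; first by apply: (Leq_rint mD _ (LrintD mD ic is_)) => x _; rewrite mulrDr.
rewrite (Leq_Rint (fun x _ => EE x)) (LRintD mD ic is_) Ec Es -(LRintD mD jc js).
pose kk (k : R -> R) eta xi := \int[mu]_(x in D) (expR (- e * x) * (k (x * eta) * k (x * xi))).
have ikk (k : R -> R) (mk : measurable_fun setT k) (k1 : forall x, `|k x| <= 1) eta :
    int (fun xi => u xi * kk k eta xi).
  have iv : int (fun x => expR (- e * x) * k (x * eta)).
    apply: (@rintM_bounded _ _ _ mu D _ (fun x => k (x * eta)) 1 mD ie) => //.
    by apply: measurable_funTS; apply: measurableT_comp => //; apply: measurable_funM.
  have kkE xi : kk k eta xi = trig_transform k (fun x => expR (- e * x) * k (x * eta)) xi.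
    by apply: Leq_Rint => x _; rewrite (mulrC xi) mulrA.
  apply: (@rintM_bounded _ _ _ mu D u (kk k eta) _ mD iu).
    apply: eq_measurable_fun (measurable_trig_transform mk k1 iv) => x _.
    by rewrite kkE.
  by move=> xi _; rewrite kkE; exact: trig_transform_bound.
have Ekk eta : u eta * \int[mu]_(xi in D) (u xi * kk cos eta xi) +
     u eta * \int[mu]_(xi in D) (u xi * kk sin eta xi) =
   u eta * \int[mu]_(xi in D) (u xi * K e xi eta).
  rewrite -mulrDr -(LRintD mD (ikk _ measurable_cos (@cos_max R) eta) (ikk _ measurable_sin (@sin_max R) eta)).
  congr (_ * _); apply: Leq_Rint => xi _.
  by rewrite -mulrDr trig_kernel_sum.
rewrite (Leq_Rint (fun eta _ => Ekk eta)).
apply: quadratic_form_bound => //.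
by apply: (Leq_rint mD _ (LrintD mD jc js)) => eta _; exact: Ekk.
Qed.

(** Half of the scalar product, over the whole line, of the Fourier transforms of [u] and [w]
    extended by 0: for real functions the integrand is the even real part, and the odd imaginary
    part cancels. *)
Definition energy u w := \int[mu]_(x in D) (Tc u x * Tc w x + Ts u x * Ts w x).

(** [damped_bound] is uniform in the damping, so Fatou's lemma along e = 1 / (n + 1) removes it. *)
Lemma energy_bound u : L1_L2 u ->
  int (fun x => Tc u x ^+ 2 + Ts u x ^+ 2) /\
  energy u u <= pi * \int[mu]_(xi in D) u xi ^+ 2.
Proof.
move=> u12; have iu := u12.1.
have mc := measurable_trig_transform measurable_cos (@cos_max R) iu.
have ms := measurable_trig_transform measurable_sin (@sin_max R) iu.
have mcs : measurable_fun D (fun x => Tc u x ^+ 2 + Ts u x ^+ 2).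
  by apply: measurable_funD; apply: measurable_funX.
have b : (\int[mu]_(x in D) (Tc u x ^+ 2 + Ts u x ^+ 2)%:E <=
   (pi * \int[mu]_(xi in D) u xi ^+ 2)%:E)%E.
  pose f n x := expR (- n.+1%:R^-1 * x) * (Tc u x ^+ 2 + Ts u x ^+ 2).
  apply: (@Rfatou _ _ _ mu D mD f).
  - move=> n; apply: measurable_funM => //; mfun.
  - by move=> n x _; rewrite mulr_ge0 ?expR_ge0// addr_ge0 ?sqr_ge0.
  - move=> x _; rewrite (_ : _ + _ = expR (- 0 * x) * (Tc u x ^+ 2 + Ts u x ^+ 2)); last first.
      by rewrite oppr0 mul0r expR0 mul1r.
    apply: cvgM; last exact: cvg_cst.
    apply: (@cvg_comp _ _ _ _ (@expR R) _ (nbhs (- 0 * x))); last exact: continuous_expR.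
    apply: cvgM; last exact: cvg_cst.
    by apply: cvgN; exact: cvg_harmonic.
  - move=> n; have n0 : 0 < n.+1%:R^-1 :> R by rewrite invr_gt0.
    by have [i1 h] := damped_bound n0 u12; rewrite (LRintE mD i1) lee_fin.
have i1 : int (fun x => Tc u x ^+ 2 + Ts u x ^+ 2).
  apply: (Lrint_ge0_lty mcs) => [x _|]; first by rewrite addr_ge0 ?sqr_ge0.
  exact: le_lt_trans b (ltry _).
split => //; move: b; rewrite (LRintE mD i1) lee_fin; apply: le_trans.
by rewrite le_eqVlt; apply/orP; left; apply/eqP; apply: Leq_Rint => x _; rewrite !expr2.
Qed.

Lemma L1_L2_lin a u w : L1_L2 u -> L1_L2 w -> L1_L2 (fun x => a * u x + w x).
Proof.
move=> [iu u2] [iw w2]; split; first by apply: (LrintD mD) => //; exact: (LrintZ mD).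
by apply: sq_intD => //; exact: sq_intZ.
Qed.

Lemma energy_int u w : L1_L2 u -> L1_L2 w -> int (fun x => Tc u x * Tc w x + Ts u x * Ts w x).
Proof.
move=> u12 w12.
have [iu _] := energy_bound u12; have [iw _] := energy_bound w12.
have mc := measurable_trig_transform measurable_cos (@cos_max R) u12.1.
have ms := measurable_trig_transform measurable_sin (@sin_max R) u12.1.
have mc' := measurable_trig_transform measurable_cos (@cos_max R) w12.1.
have ms' := measurable_trig_transform measurable_sin (@sin_max R) w12.1.
apply: (@integrable_dominated _ _ _ mu D _ _ mD _ (LrintD mD iu iw)).
  by apply: measurable_funD; apply: measurable_funM.
move=> x _; rewrite (le_trans (ler_normD _ _))//.
by rewrite addrACA lerD// le_prod_sqr.
Qed.

Lemma energy_sym u w : energy u w = energy w u.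
Proof. by apply: Leq_Rint => x _; rewrite (mulrC (Tc u x)) (mulrC (Ts u x)). Qed.

Lemma energy_lin a u v w : L1_L2 u -> L1_L2 v -> L1_L2 w ->
  energy (fun x => a * u x + v x) w = a * energy u w + energy v w.
Proof.
move=> u12 v12 w12; have iu := energy_int u12 w12; have iv := energy_int v12 w12.
rewrite /energy -(LRintZ mD a iu) -(LRintD mD (LrintZ mD a iu) iv).
apply: Leq_Rint => x _.
rewrite (trig_transformD measurable_cos (@cos_max R) a x u12.1 v12.1).
rewrite (trig_transformD measurable_sin (@sin_max R) a x u12.1 v12.1).
by ring.
Qed.

Lemma energy_ge0 u : 0 <= energy u u.
Proof. by apply: Rintegral_ge0 => x _; rewrite -!expr2 addr_ge0 ?sqr_ge0. Qed.

Lemma energy_quadratic t u w : L1_L2 u -> L1_L2 w ->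
  energy (fun x => t * w x + u x) (fun x => t * w x + u x) =
  energy u u + t * energy u w *+ 2 + t ^+ 2 * energy w w.
Proof.
move=> u12 w12; have tw := L1_L2_lin t w12 u12.
rewrite (energy_lin t w12 u12 tw) (energy_sym w) (energy_sym u).
rewrite (energy_lin t w12 u12 w12) (energy_lin t w12 u12 u12) (energy_sym w u).
by move: (energy u u) (energy u w) (energy w w) => a b c; rewrite mulr2n; ring.
Qed.

Lemma energy_CS u w : L1_L2 u -> L1_L2 w ->
  energy u w ^+ 2 <= energy u u * energy w w.
Proof.
move=> u12 w12; apply: quadratic_ge0; [exact: energy_ge0|exact: energy_ge0|move=> t].
by rewrite -energy_quadratic//; exact: energy_ge0.
Qed.

Local Notation dot u w := (\int[mu]_(xi in D) (u xi * w xi)).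

Lemma dot_quadratic (t : R) (u w : R -> R) : sq_int mu D u -> sq_int mu D w ->
  \int[mu]_(x in D) (t * w x + u x) ^+ 2 =
  dot u u + t * dot u w *+ 2 + t ^+ 2 * dot w w.
Proof.
move=> u2 w2.
have iuu := Lsq_int_mul mD u2 u2; have iuw := Lsq_int_mul mD u2 w2; have iww := Lsq_int_mul mD w2 w2.
rewrite -mulrnAl -(LRintZ mD _ iuw) -(LRintZ mD _ iww).
rewrite -(LRintD mD iuu (LrintZ mD _ iuw)) -(LRintD mD _ (LrintZ mD _ iww)).
  by apply: Leq_Rint => x _; rewrite -mulr_natr; ring.
exact: (LrintD mD iuu (LrintZ mD _ iuw)).
Qed.

(* The form [pi * dot - energy] is positive semidefinite, so a function that it
   annihilates is orthogonal to everything for it. *)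
Lemma energy_null u w : L1_L2 u -> L1_L2 w -> energy w w = pi * dot w w ->
  energy w u = pi * dot w u.
Proof.
move=> u12 w12 E.
have q t : 0 <= (pi * dot u u - energy u u) + t * (pi * dot u w - energy u w) *+ 2 + t ^+ 2 * 0.
  have tw := L1_L2_lin t w12 u12.
  have [_] := energy_bound tw; rewrite dot_quadratic ?energy_quadratic ?E//; last 2 first.
  - exact: u12.2.
  - exact: w12.2.
  rewrite -subr_ge0; congr (_ <= _).
  move: (energy u u) (energy u w) (dot u u) (dot u w) (dot w w) => a b c d f.
  by rewrite !mulr2n; ring.
have /quadratic_ge0 := q.
have uu : 0 <= pi * dot u u - energy u u.
  have [_] := energy_bound u12; rewrite -subr_ge0; congr (_ <= pi * _ - _).
move=> /(_ uu (lexx 0)); rewrite mulr0 => h.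
have /eqP : (pi * dot u w - energy u w) ^+ 2 = 0 by apply/eqP; rewrite eq_le h sqr_ge0.
rewrite sqrf_eq0 subr_eq0 => /eqP; rewrite (energy_sym u w) => <-.
by congr (_ * _); apply: Leq_Rint => x _; rewrite mulrC.
Qed.

(** Test functions for which both sides of Plancherel's identity can be computed. By [fourier_inj],
    a square integrable function orthogonal to all of them vanishes almost everywhere. *)
Definition expcos (h xi : R) := expR (- 1 * xi) * cos (h * xi).
Definition expsin (h xi : R) := expR (- 1 * xi) * sin (h * xi).

Lemma bounded_L1_L2 (f : R -> R) M : measurable_fun D f ->
  (forall x, D x -> `|f x| <= M * expR (- 1 * x)) -> L1_L2 f.
Proof.
move=> mf fM; have [i1 _] := laplace_exp (@ltr01 R).
have i2 : int (fun x => M ^+ 2 * expR (- 2 * x)).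
  by apply: (LrintZ mD); have [] := laplace_exp (@ltr0n R 2).
split; first by apply: (@integrable_dominated _ _ _ mu D _ _ mD mf (LrintZ mD M i1)).
split => //; apply: (@integrable_dominated _ _ _ mu D _ _ mD _ i2); first exact: measurable_funX.
move=> x Dx; have := fM x Dx => h.
rewrite normrX (_ : expR (- 2 * x) = expR (- 1 * x) ^+ 2); last first.
  by rewrite expr2 -expRD; congr expR; ring.
by rewrite -exprMn ler_sqr ?nnegrE// (le_trans _ h).
Qed.

Lemma L1_L2_expcos h : L1_L2 (expcos h).
Proof.
apply: (@bounded_L1_L2 _ 1); first by mfun.
by move=> x _; rewrite normrM ger0_norm ?expR_ge0// mulrC ler_wpM2r ?expR_ge0 ?cos_max.
Qed.

Lemma L1_L2_expsin h : L1_L2 (expsin h).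
Proof.
apply: (@bounded_L1_L2 _ 1); first by mfun.
by move=> x _; rewrite normrM ger0_norm ?expR_ge0// mulrC ler_wpM2r ?expR_ge0 ?sin_max.
Qed.

Lemma laplace_sin (e t : R) : 0 < e ->
  int (fun x => expR (- e * x) * sin (t * x)) /\
  \int[mu]_(x in D) (expR (- e * x) * sin (t * x)) = t / (e ^+ 2 + t ^+ 2).
Proof.
move=> e0; have [i E] := laplace_cos t (- (pi / 2)) e0.
have sE x : cos (t * x + - (pi / 2)) = sin (t * x).
  by rewrite cosB cos_pihalf sin_pihalf mulr0 mulr1 add0r.
split; first by apply: (Leq_rint mD _ i) => x _; rewrite sE.
transitivity (\int[mu]_(x in D) (expR (- e * x) * cos (t * x + - (pi / 2)))).
  by apply: Leq_Rint => x _; rewrite sE.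
by rewrite E cosN sinN cos_pihalf sin_pihalf mulr0 mulrN1 sub0r opprK.
Qed.

Lemma laplace_cos0 (e t : R) : 0 < e ->
  int (fun x => expR (- e * x) * cos (t * x)) /\
  \int[mu]_(x in D) (expR (- e * x) * cos (t * x)) = e / (e ^+ 2 + t ^+ 2).
Proof.
move=> e0; have [i E] := laplace_cos t 0 e0.
split; first by apply: (Leq_rint mD _ i) => x _; rewrite addr0.
transitivity (\int[mu]_(x in D) (expR (- e * x) * cos (t * x + 0))).
  by apply: Leq_Rint => x _; rewrite addr0.
by rewrite E cos0 sin0 mulr0 mulr1 subr0.
Qed.

(** With the next function, [p + i q] is 1 / (1 - i t), the integral of e^{-xi} e^{i t xi}. Its
    squared modulus is again [p], hence p^2 + q^2 = p. *)
Let p (t : R) := 1 / (1 ^+ 2 + t ^+ 2).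
Let q (t : R) := t / (1 ^+ 2 + t ^+ 2).

Let icos t : int (fun xi => expR (- 1 * xi) * cos (t * xi)).
Proof. by have [] := laplace_cos0 t (@ltr01 R). Qed.

Let isin t : int (fun xi => expR (- 1 * xi) * sin (t * xi)).
Proof. by have [] := laplace_sin t (@ltr01 R). Qed.

Let Ecos t : \int[mu]_(xi in D) (expR (- 1 * xi) * cos (t * xi)) = p t.
Proof. by have [] := laplace_cos0 t (@ltr01 R). Qed.

Let Esin t : \int[mu]_(xi in D) (expR (- 1 * xi) * sin (t * xi)) = q t.
Proof. by have [] := laplace_sin t (@ltr01 R). Qed.

Let half_sum (F G : R -> R) : int F -> int G ->
  \int[mu]_(x in D) (2^-1 * (F x + G x)) = 2^-1 * (\int[mu]_(x in D) F x + \int[mu]_(x in D) G x).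
Proof. by move=> iF iG; rewrite (LRintZ mD _ (LrintD mD iF iG)) (LRintD mD iF iG). Qed.

Let half_sub (F G : R -> R) : int F -> int G ->
  \int[mu]_(x in D) (2^-1 * (F x - G x)) = 2^-1 * (\int[mu]_(x in D) F x - \int[mu]_(x in D) G x).
Proof. by move=> iF iG; rewrite (LRintZ mD _ (LrintB mD iF iG)) (LRintB mD iF iG). Qed.

Lemma Tc_expcos h x : Tc (expcos h) x = 2^-1 * (p (x - h) + p (x + h)).
Proof.
rewrite -!Ecos -(half_sum (icos _) (icos _)); apply: Leq_Rint => xi _.
rewrite /expcos mulrBl mulrDl cosB cosD.
by move: (expR _) (cos _) (cos _) (sin _) (sin _) => a b c d f; field.
Qed.

Lemma Ts_expcos h x : Ts (expcos h) x = 2^-1 * (q (x + h) + q (x - h)).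
Proof.
rewrite -!Esin -(half_sum (isin _) (isin _)); apply: Leq_Rint => xi _.
rewrite /expcos mulrBl mulrDl sinB sinD.
by move: (expR _) (cos _) (sin _) (cos _) (sin _) => a b c d f; field.
Qed.

Lemma Tc_expsin h x : Tc (expsin h) x = 2^-1 * (q (x + h) - q (x - h)).
Proof.
rewrite -!Esin -(half_sub (isin _) (isin _)); apply: Leq_Rint => xi _.
rewrite /expsin mulrBl mulrDl sinB sinD.
by move: (expR _) (cos _) (sin _) (cos _) (sin _) => a b c d f; field.
Qed.

Lemma Ts_expsin h x : Ts (expsin h) x = 2^-1 * (p (x - h) - p (x + h)).
Proof.
rewrite -!Ecos -(half_sub (icos _) (icos _)); apply: Leq_Rint => xi _.
rewrite /expsin mulrBl mulrDl cosB cosD.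
by move: (expR _) (cos _) (sin _) (cos _) (sin _) => a b c d f; field.
Qed.

Let pq t : p t ^+ 2 + q t ^+ 2 = p t.
Proof.
have t0 : 1 ^+ 2 + t ^+ 2 != 0 :> R by rewrite gt_eqF// ltr_pwDl ?exprn_gt0 ?sqr_ge0.
rewrite /p /q !expr_div_n -mulrDl; move: t0; set e := 1 ^+ 2 + t ^+ 2 => t0.
by rewrite (expr2 e) invfM mulrA divff.
Qed.

(** In the sum of the two energies the mixed terms in x - h and x + h cancel, and p^2 + q^2 = p
    leaves half the Poisson kernels centred at [h] and [-h], whose masses on the half-line add up to
    pi. *)
Lemma energy_exptrig h :
  energy (expcos h) (expcos h) + energy (expsin h) (expsin h) = pi / 2.
Proof.
have cc := energy_int (L1_L2_expcos h) (L1_L2_expcos h).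
have ss := energy_int (L1_L2_expsin h) (L1_L2_expsin h).
rewrite -(LRintD mD cc ss).
have [i1 E1] := poisson_mass h (@ltr01 R).
have [i2 E2] := poisson_mass (- h) (@ltr01 R).
transitivity (\int[mu]_(x in D) (2^-1 * (1 / (1 ^+ 2 + (x - h) ^+ 2) + 1 / (1 ^+ 2 + (x - - h) ^+ 2)))).
  apply: Leq_Rint => x _; rewrite opprK -/(p (x - h)) -/(p (x + h)).
  rewrite Tc_expcos Ts_expcos Tc_expsin Ts_expsin.
  have := pq (x - h); have := pq (x + h).
  move: (p _) (q _) (p _) (q _) => a b c d Hab Hcd.
  transitivity (2^-1 * ((c ^+ 2 + d ^+ 2) + (a ^+ 2 + b ^+ 2))); first by field.
  by rewrite Hab Hcd addrC.
rewrite (half_sum i1 i2) E1 E2 !divr1 atanN.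
by move: (atan h) => a; field.
Qed.

Lemma dot_exptrig h :
  dot (expcos h) (expcos h) + dot (expsin h) (expsin h) = 2^-1.
Proof.
have cc := Lsq_int_mul mD (L1_L2_expcos h).2 (L1_L2_expcos h).2.
have ss := Lsq_int_mul mD (L1_L2_expsin h).2 (L1_L2_expsin h).2.
have [_ <-] := laplace_exp (@ltr0n R 2).
rewrite -(LRintD mD cc ss); apply: Leq_Rint => x _.
rewrite (_ : expR (- 2 * x) = expR (- 1 * x) * expR (- 1 * x)); last first.
  by rewrite -expRD; congr expR; ring.
rewrite /expcos /expsin; have := cos2Dsin2 (h * x).
move: (expR _) (cos _) (sin _) => a c d cd.
by rewrite -[RHS]mulr1 -cd; ring.
Qed.

(** Each energy is at most pi times the squared norm, and the sums of both sides agree; so both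
    inequalities are equalities, and the mixed terms never have to be integrated. *)
Lemma energy_exp h : energy (expcos h) (expcos h) = pi * dot (expcos h) (expcos h) /\
  energy (expsin h) (expsin h) = pi * dot (expsin h) (expsin h).
Proof.
have [_ hc] := energy_bound (L1_L2_expcos h).
have [_ hs] := energy_bound (L1_L2_expsin h).
have := energy_exptrig h; rewrite -(dot_exptrig h).
rewrite (_ : \int[mu]_(xi in D) expcos h xi ^+ 2 = dot (expcos h) (expcos h)) in hc; last first.
  by apply: Leq_Rint => x _; rewrite expr2.
rewrite (_ : \int[mu]_(xi in D) expsin h xi ^+ 2 = dot (expsin h) (expsin h)) in hs; last first.
  by apply: Leq_Rint => x _; rewrite expr2.
move: hc hs; rewrite mulrDr.
move: (energy _ _) (energy _ _) (pi * _) (pi * _) => a b c d; lra.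
Qed.

(** By Riesz, [energy u w] is the integral of [u chi] for some [chi]. The test functions attain
    equality in [energy_bound], so by [energy_null] they do not distinguish [chi] from [pi w];
    [fourier_inj] makes these equal almost everywhere. *)
Theorem plancherel u w : L1_L2 u -> L1_L2 w -> energy u w = pi * dot u w.
Proof.
move=> u12 w12.
have g0 x : D x -> 0 < expR (- 1 * x) :> R by move=> _; exact: expR_gt0.
have sg0 : sq_int mu D (fun x => expR (- 1 * x)).
  have [] // := @bounded_L1_L2 (fun x => expR (- 1 * x)) 1; first by mfun.
  by move=> x _; rewrite mul1r ger0_norm ?expR_ge0.
have bnd (f : R -> R) (M : R) : measurable_fun D f ->
  (forall x, D x -> `|f x| <= M * expR (- 1 * x)) -> L1_L2 f by exact: bounded_L1_L2.
have lin a f g : L1_L2 f -> L1_L2 g -> L1_L2 (fun x => a * f x + g x) /\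
    energy (fun x => a * f x + g x) w = a * energy f w + energy g w.
  by move=> f12 g12; split; [exact: L1_L2_lin|exact: energy_lin].
have lb f : L1_L2 f -> energy f w ^+ 2 <= (pi * energy w w) * \int[mu]_(x in D) f x ^+ 2.
  move=> f12; apply: (le_trans (energy_CS f12 w12)).
  by rewrite mulrAC; apply: ler_wpM2r; [exact: energy_ge0|have [] := energy_bound f12].
have [chi [schi Hchi]] := @riesz _ _ _ mu D mD _ g0 sg0 L1_L2 (fun f => energy f w) _
  (fun f h => h.2) bnd lin lb.
have swc : sq_int mu D (fun x => chi x - pi * w x).
  by apply: (Lsq_intB mD) => //; apply: (Lsq_intZ mD); exact: w12.2.
pose F x := expR (- 1 * x) * (chi x - pi * w x).
have iF : int F by exact: (Lsq_int_mul mD sg0 swc).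
have key (e : R -> R) : L1_L2 e -> energy e e = pi * dot e e ->
    \int[mu]_(x in D) (e x * (chi x - pi * w x)) = 0.
  move=> e12 Ee.
  have i1 := Lsq_int_mul mD e12.2 schi.
  have i2 := Lsq_int_mul mD e12.2 w12.2.
  rewrite (Leq_Rint (g := fun x => e x * chi x - pi * (e x * w x))); last first.
    by move=> x _; rewrite mulrBr mulrCA.
  rewrite (LRintB mD i1 (LrintZ mD pi i2)) (LRintZ mD pi i2) -Hchi//.
  by rewrite (energy_null w12 e12 Ee) subrr.
have Fc h : \int[mu]_(xi in D) (F xi * cos (h * xi)) = 0.
  have [Ec _] := energy_exp h; rewrite -[RHS](key _ (L1_L2_expcos h) Ec).
  by apply: Leq_Rint => x _; rewrite /F /expcos mulrAC.
have Fs h : \int[mu]_(xi in D) (F xi * sin (h * xi)) = 0.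
  have [_ Es] := energy_exp h; rewrite -[RHS](key _ (L1_L2_expsin h) Es).
  by apply: Leq_Rint => x _; rewrite /F /expsin mulrAC.
have F0 := fourier_inj iF Fc Fs.
rewrite Hchi// -(LRintZ mD pi (Lsq_int_mul mD u12.2 w12.2)).
apply: ae_eq_Rint.
- exact: mD.
- apply: (@filterS _ _ (ae_filter_ringOfSetsType mu) _ _ _ F0) => x + Dx.
  move=> /(_ Dx) /eqP; rewrite mulf_eq0 gt_eqF ?expR_gt0//= subr_eq0 => /eqP ->.
  by rewrite mulrCA.
- by apply: measurable_funM; [exact: u12.2.1|exact: schi.1].
- apply: measurable_funM; first exact: measurable_cst.
  by apply: measurable_funM; [exact: u12.2.1|exact: w12.2.1].
Qed.

End plancherel.

Local Open Scope complex_scope.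
Local Open Scope ring_scope.
Local Notation Re := (@complex.Re _).
Local Notation Im := (@complex.Im _).

(** * Complex differentiability *)

Section modulus.
Context {R : realType}.
Local Notation C := R[i].
Implicit Types z w : C.

(** The norm on [R[i]] takes its values in [R[i]]; this modulus is real, which keeps the estimates
    in the reals. *)
Definition cabs z : R := Num.sqrt (Re z ^+ 2 + Im z ^+ 2).

Lemma normcabs z : `|z| = (cabs z)%:C.
Proof. by rewrite normc_def. Qed.

Lemma cabsM z w : cabs (z * w) = cabs z * cabs w.
Proof. by apply: complexI; rewrite -normcabs normrM !normcabs rmorphM. Qed.

Lemma cabs_ge0 z : 0 <= cabs z. Proof. exact: sqrtr_ge0. Qed.

Lemma cabsD z w : cabs (z + w) <= cabs z + cabs w.
Proof. by rewrite -lecR rmorphD/= -!normcabs ler_normD. Qed.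

Lemma cabsN z : cabs (- z) = cabs z.
Proof. by apply: complexI; rewrite -!normcabs normrN. Qed.

Lemma cabsD_le z w (a b : R) : cabs z <= a -> cabs w <= b -> cabs (z + w) <= a + b.
Proof. by move=> h1 h2; rewrite (le_trans (cabsD _ _))// lerD. Qed.

Lemma cabsM_le z w (a b : R) : cabs z <= a -> cabs w <= b -> cabs (z * w) <= a * b.
Proof. by move=> h1 h2; rewrite cabsM ler_pM ?cabs_ge0. Qed.

Lemma cabsB z w : cabs (z - w) <= cabs z + cabs w.
Proof. by rewrite (le_trans (cabsD _ _))// cabsN. Qed.

Lemma cabs_sym z w : cabs (z - w) = cabs (w - z).
Proof. by rewrite -cabsN opprB. Qed.

Lemma cabs_real (x : R) : cabs x%:C = `|x|.
Proof. by rewrite /cabs/= expr0n/= addr0 sqrtr_sqr. Qed.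

Lemma cabs0 : cabs 0 = 0. Proof. by rewrite (cabs_real 0) normr0. Qed.

Lemma cabs1 : cabs 1 = 1. Proof. by rewrite (cabs_real 1) normr1. Qed.

Lemma cabs_i : cabs (0 +i* 1) = 1.
Proof. by rewrite /cabs/= expr0n/= add0r expr1n sqrtr1. Qed.

Lemma cabs_eq0 z : (cabs z == 0) = (z == 0).
Proof. by rewrite -(inj_eq (@complexI R)) -normcabs normr_eq0. Qed.

Lemma cabs_gt0 z : (0 < cabs z) = (z != 0).
Proof. by rewrite lt_neqAle cabs_ge0 andbT eq_sym cabs_eq0. Qed.

Lemma cabsV z : cabs z^-1 = (cabs z)^-1.
Proof. by apply: complexI; rewrite -normcabs normfV normcabs fmorphV. Qed.

Lemma cabsX z n : cabs (z ^+ n) = cabs z ^+ n.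
Proof. by apply: complexI; rewrite -normcabs normrX normcabs rmorphXn. Qed.

Lemma cabs_sqr z : cabs z ^+ 2 = Re z ^+ 2 + Im z ^+ 2.
Proof. by rewrite sqr_sqrtr// addr_ge0 ?sqr_ge0. Qed.

Lemma abs_Re z : `|Re z| <= cabs z.
Proof. by rewrite -sqrtr_sqr ler_wsqrtr// lerDl sqr_ge0. Qed.

Lemma abs_Im z : `|Im z| <= cabs z.
Proof. by rewrite -sqrtr_sqr ler_wsqrtr// lerDr sqr_ge0. Qed.

Lemma cabs_le z : cabs z <= `|Re z| + `|Im z|.
Proof.
rewrite -[leRHS]ger0_norm ?addr_ge0// -sqrtr_sqr ler_wsqrtr// sqrrD.
by rewrite !real_normK ?num_real// addrAC lerDl mulrn_wge0// mulr_ge0.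
Qed.

Lemma cabs_conj z : cabs (conjc z) = cabs z.
Proof. by case: z => a b; rewrite /cabs/= sqrrN. Qed.

Lemma cabs_sum (I : Type) (r : seq I) (P : pred I) (F : I -> C) :
  cabs (\sum_(i <- r | P i) F i) <= \sum_(i <- r | P i) cabs (F i).
Proof.
elim/big_ind2 : _ => //; first by rewrite cabs0.
by move=> ? ? ? ? h1 h2; rewrite (le_trans (cabsD _ _))// lerD.
Qed.

Lemma cabs_cexp z : cabs (cexp z) = expR (Re z).
Proof.
rewrite /cexp cabsM cabs_real ger0_norm ?expR_ge0//.
by rewrite /cabs/= cos2Dsin2 sqrtr1 mulr1.
Qed.

Lemma cexpD z w : cexp (z + w) = cexp z * cexp w.
Proof.
case: z w => a b [c d]; rewrite /cexp /= expRD cosD sinD.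
move: (expR a) (expR c) (cos b) (sin b) (cos d) (sin d) => A B c1 s1 c2 s2.
by apply/eqP; rewrite eq_complex /=; apply/andP; split; apply/eqP; ring.
Qed.

Lemma gt0_complexE (e : C) : 0 < e -> exists2 r : R, 0 < r & e = r%:C.
Proof.
by case: e => a b; rewrite ltcE /= => /andP[/eqP -> a0]; exists a.
Qed.

Lemma near_cabsP w (P : C -> Prop) :
  (\forall z \near (w : (C : numFieldType)), P z) <-> exists2 d : R, 0 < d & forall z, cabs (z - w) < d -> P z.
Proof.
split.
  move=> /nbhs_ballP[e /= /gt0_complexE[d d0 ->] dP]; exists d => // z zd.
  by apply: dP; rewrite /ball /= distrC normcabs ltcR.
move=> [d d0 dP]; apply/nbhs_ballP; exists d%:C => /=; first by rewrite ltcR.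
by move=> z; rewrite /ball /= distrC normcabs ltcR; exact: dP.
Qed.

Lemma ReB z w : Re (z - w) = Re z - Re w.
Proof. by case: z w => a b [c d]. Qed.

Lemma ImB z w : Im (z - w) = Im z - Im w.
Proof. by case: z w => a b [c d]. Qed.

Lemma cvg_cabsP (u : nat -> (C : numFieldType)) (l : (C : numFieldType)) :
  u @ \oo --> l <-> (fun n => cabs (u n - l)) @ \oo --> (0:R).
Proof.
split.
  move/(@cvgrPdist_lt _ (C : numFieldType)) => h; apply/cvgrPdist_lt => e e0.
  have : 0 < e%:C by rewrite ltcR.
  move/h; apply: filterS => n; rewrite sub0r normrN (ger0_norm (cabs_ge0 _)).
  by rewrite normcabs ltcR cabs_sym.
move=> /cvgrPdist_lt h; apply/(@cvgrPdist_lt _ (C : numFieldType)) => e.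
move=> /gt0_complexE[d d0 ->].
apply: filterS (h _ d0) => n; rewrite sub0r normrN (ger0_norm (cabs_ge0 _)).
by rewrite normcabs ltcR cabs_sym.
Qed.

Lemma cvg_ReIm (u : nat -> (C : numFieldType)) (l : (C : numFieldType)) :
  u @ \oo --> l <-> ((fun n => Re (u n)) @ \oo --> Re l) /\ ((fun n => Im (u n)) @ \oo --> Im l).
Proof.
split.
  move=> /cvg_cabsP h; split; apply/cvgrPdist_lt => e e0;
    move/cvgrPdist_lt : h => /(_ _ e0); apply: filterS => n;
    rewrite sub0r normrN (ger0_norm (cabs_ge0 _)) => h; apply: le_lt_trans h;
    rewrite cabs_sym.
  - by rewrite -ReB; exact: abs_Re.
  - by rewrite -ImB; exact: abs_Im.
move=> [hr hi]; apply/cvg_cabsP; apply/cvgrPdist_lt => e e0.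
have e2 : 0 < e / 2 by rewrite divr_gt0.
move/cvgrPdist_lt : hr => /(_ _ e2) hr; move/cvgrPdist_lt : hi => /(_ _ e2) hi.
apply: filterS2 hr hi => n h1 h2; rewrite sub0r normrN (ger0_norm (cabs_ge0 _)).
rewrite cabs_sym (le_lt_trans (cabs_le _))// (splitr e) ltrD//.
  by rewrite ReB.
by rewrite ImB.
Qed.

Lemma cvg_complexB (u v : nat -> (C : numFieldType)) (l m : (C : numFieldType)) :
  u @ \oo --> l -> v @ \oo --> m -> (fun n => u n - v n) @ \oo --> (l - m : (C : numFieldType)).
Proof.
move=> /cvg_ReIm[u1 u2] /cvg_ReIm[v1 v2]; apply/cvg_ReIm; rewrite ReB ImB; split.
  by under eq_fun do rewrite ReB; exact: cvgB.
by under eq_fun do rewrite ImB; exact: cvgB.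
Qed.

End modulus.

Section strict_derivative.
Context {R : realType}.
Local Notation C := R[i].
Implicit Types (f g h : C -> C) (z w c : C).

(* Strict differentiability: it provides at once the derivative at a point and,
   when it holds on an open set, the continuity of the derivative. *)
Definition sderiv f z c := forall e : R, 0 < e -> exists2 d : R, 0 < d &
  forall z1 z2, cabs (z1 - z) < d -> cabs (z2 - z) < d ->
    cabs (f z1 - f z2 - c * (z1 - z2)) <= e * cabs (z1 - z2).

Lemma sderiv_cst k z : sderiv (fun=> k) z 0.
Proof.
move=> e e0; exists 1 => // z1 z2 _ _.
by rewrite subrr mul0r subr0 cabs0 mulr_ge0 ?cabs_ge0// ltW.
Qed.

Lemma sderivD f g z c c' : sderiv f z c -> sderiv g z c' ->
  sderiv (fun x => f x + g x) z (c + c').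
Proof.
move=> hf hg e e0; have e2 : 0 < e / 2 by rewrite divr_gt0.
have [d1 d10 h1] := hf _ e2; have [d2 d20 h2] := hg _ e2.
exists (Num.min d1 d2); first by rewrite lt_min d10.
move=> z1 z2; rewrite !lt_min => /andP[a1 a2] /andP[b1 b2].
rewrite (_ : _ - _ = (f z1 - f z2 - c * (z1 - z2)) + (g z1 - g z2 - c' * (z1 - z2))); last by ring.
rewrite (le_trans (cabsD _ _))// (splitr e) mulrDl lerD//; [exact: h1|exact: h2].
Qed.

Lemma sderivZ k f z c : sderiv f z c -> sderiv (fun x => k * f x) z (k * c).
Proof.
move=> hf e e0; have k0 : 0 < cabs k + 1 by rewrite ltr_wpDl ?cabs_ge0.
have [d d0 h] := hf _ (divr_gt0 e0 k0).
exists d => // z1 z2 z1d z2d.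
rewrite (_ : _ - _ = k * (f z1 - f z2 - c * (z1 - z2))); last by ring.
rewrite cabsM (le_trans (ler_wpM2l (cabs_ge0 _) (h _ _ z1d z2d)))//.
rewrite mulrA ler_wpM2r ?cabs_ge0// mulrCA ler_piMr ?(ltW e0)//.
by rewrite ler_pdivrMr// mul1r lerDl.
Qed.

Lemma sderivB f g z c c' : sderiv f z c -> sderiv g z c' ->
  sderiv (fun x => f x - g x) z (c - c').
Proof.
move=> hf hg; rewrite -mulN1r (_ : (fun x => _) = (fun x => f x + -1 * g x)).
  exact: sderivD (sderivZ _ _).
by apply/funext => x; rewrite mulN1r.
Qed.

Lemma sderiv_lipschitz f z c : sderiv f z c -> exists2 d : R, 0 < d &
  forall z1 z2, cabs (z1 - z) < d -> cabs (z2 - z) < d ->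
    cabs (f z1 - f z2) <= (cabs c + 1) * cabs (z1 - z2).
Proof.
move=> hf; have [d d0 h] := hf _ ltr01; exists d => // z1 z2 z1d z2d.
rewrite (_ : _ - _ = (f z1 - f z2 - c * (z1 - z2)) + c * (z1 - z2)); last by ring.
rewrite (le_trans (cabsD _ _))// addrC mulrDl lerD//; first by rewrite cabsM.
exact: h.
Qed.

Lemma sderivM f g z c c' : sderiv f z c -> sderiv g z c' ->
  sderiv (fun x => f x * g x) z (c * g z + f z * c').
Proof.
move=> hf hg e e0.
have [da da0 la] := sderiv_lipschitz hf; have [db db0 lb] := sderiv_lipschitz hg.
pose M := cabs (f z) + cabs (g z) + cabs c + cabs c' + 2.
have [f0 g0 c0 c'0] : [/\ 0 <= cabs (f z), 0 <= cabs (g z), 0 <= cabs c & 0 <= cabs c'].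
  by rewrite !cabs_ge0.
have M0 : 0 < M by rewrite /M; lra.
(* Both factors are approximated up to [r]. As r <= 1, products of two errors count as one, and the
   six terms of the expansion below add up to r M |z1 - z2|; the 2 in [M] accounts for the two
   products of errors. *)
pose r := Num.min 1 (e / M).
have r0 : 0 < r by rewrite lt_min ltr01 divr_gt0.
have r1 : r <= 1 by rewrite ge_min lexx.
have rM : r * M <= e by rewrite -ler_pdivlMr// ge_min lexx orbT.
have [d1 d10 h1] := hf _ r0; have [d2 d20 h2] := hg _ r0.
have cM : cabs c + 1 <= M by rewrite /M; lra.
have c'M : cabs c' + 1 <= M by rewrite /M; lra.
exists (Num.min (Num.min da db) (Num.min (Num.min d1 d2) (r / M))).
  by rewrite !lt_min da0 db0 d10 d20 divr_gt0.
move=> z1 z2; rewrite !lt_min => /andP[/andP[a1 b1] /andP[/andP[c1 e1] s1]].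
move=> /andP[/andP[a2 b2] /andP[/andP[c2 e2] s2]].
have zz (k : R) : 0 < k -> cabs (z - z) < k by rewrite subrr cabs0.
have rs x : cabs (x - z) < r / M -> M * cabs (x - z) <= r.
  by move=> h; rewrite mulrC -ler_pdivlMr// ltW.
have gz1 : cabs (g z1 - g z) <= r.
  apply: le_trans (lb _ _ b1 (zz _ db0)) _; apply: le_trans (rs _ s1).
  by rewrite ler_wpM2r ?cabs_ge0.
have fz2 : cabs (f z2 - f z) <= r.
  apply: le_trans (la _ _ a2 (zz _ da0)) _; apply: le_trans (rs _ s2).
  by rewrite ler_wpM2r ?cabs_ge0.
have uD := h1 _ _ c1 c2; have vD := h2 _ _ e1 e2.
rewrite (_ : f z1 * g z1 - _ - _ = (f z1 - f z2 - c * (z1 - z2)) * (g z1 - g z)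
  + (f z1 - f z2 - c * (z1 - z2)) * g z + c * (z1 - z2) * (g z1 - g z)
  + (f z2 - f z) * (g z1 - g z2 - c' * (z1 - z2)) + f z * (g z1 - g z2 - c' * (z1 - z2))
  + (f z2 - f z) * c' * (z1 - z2)); last by ring.
apply: le_trans (cabsD_le (cabsD_le (cabsD_le (cabsD_le (cabsD_le (cabsM_le uD (le_trans gz1 r1))
  (cabsM_le uD (lexx _))) (cabsM_le (lexx _) gz1)) (cabsM_le (le_trans fz2 r1) vD))
  (cabsM_le (lexx _) vD)) (cabsM_le (cabsM_le fz2 (lexx _)) (lexx _))) _.
rewrite !cabsM; apply: le_trans (ler_wpM2r (cabs_ge0 _) rM).
rewrite le_eqVlt; apply/orP; left; apply/eqP; rewrite /M.
by move: (cabs (f z)) (cabs (g z)) (cabs c) (cabs c') (cabs (z1 - z2)) => *; ring.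
Qed.

Lemma sderiv_inv z w : z != w -> sderiv (fun x => (x - w)^-1) z (- (z - w) ^- 2).
Proof.
move=> zw e e0; pose m := cabs (z - w).
have m0 : 0 < m by rewrite cabs_gt0 subr_eq0.
(* The radius m / 2 keeps z1 and z2 at distance at least m / 2 from [w]; with e m^3 / 8 the two
   error terms are e / 4 and e / 2. *)
exists (Num.min (m / 2) (e * m ^+ 3 / 8)).
  by rewrite lt_min !divr_gt0// mulr_gt0// exprn_gt0.
have far x : cabs (x - z) < m / 2 -> m / 2 <= cabs (x - w).
  move=> xz; have : m <= cabs (x - w) + cabs (x - z).
    by rewrite /m (_ : z - w = (x - w) - (x - z)); [exact: cabsB|ring].
  by move: xz; rewrite {1}[X in X <= _ -> _](_ : m = m / 2 + m / 2); [lra|field].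
move=> z1 z2; rewrite !lt_min => /andP[/far f1 s1] /andP[/far f2 s2].
have m2 : 0 < m / 2 by rewrite divr_gt0.
have [n1 n2 n3] : [/\ z1 - w != 0, z2 - w != 0 & z - w != 0].
  by split; rewrite -?cabs_gt0//; exact: lt_le_trans m2 _.
rewrite (_ : _ - _ = (z1 - z2) * ((z2 - z) * ((z2 - w)^-1 * ((z - w)^-1 * (z - w)^-1)) +
   (z1 - z) * ((z1 - w)^-1 * (z2 - w)^-1 * (z - w)^-1))); last first.
  by field; rewrite n1 n2 n3.
rewrite cabsM mulrC; apply: ler_wpM2r; first exact: cabs_ge0.
have i1 : cabs (z1 - w)^-1 <= 2 / m.
  by rewrite cabsV -[2 / m]invf_div lef_pV2// posrE// (lt_le_trans m2).
have i2 : cabs (z2 - w)^-1 <= 2 / m.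
  by rewrite cabsV -[2 / m]invf_div lef_pV2// posrE// (lt_le_trans m2).
have i3 : cabs (z - w)^-1 <= m^-1 by rewrite cabsV.
apply: le_trans (cabsD_le (cabsM_le (ltW s2) (cabsM_le i2 (cabsM_le i3 i3)))
  (cabsM_le (ltW s1) (cabsM_le (cabsM_le i1 i2) i3))) _.
rewrite (_ : _ + _ = e * (3 / 4)); first by rewrite ler_piMr// ?ltW//; lra.
by field; rewrite gt_eqF.
Qed.

Lemma sderiv_eq f g z c : (exists2 d : R, 0 < d & forall x, cabs (x - z) < d -> f x = g x) ->
  sderiv f z c -> sderiv g z c.
Proof.
move=> [d d0 fg] hf e e0; have [d' d'0 h] := hf _ e0.
exists (Num.min d d'); first by rewrite lt_min d0.
by move=> z1 z2; rewrite !lt_min => /andP[? ?] /andP[? ?]; rewrite -!fg//; exact: h.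
Qed.

(** The bound is asked from index 2 on because the estimate of a power series splits off its terms
    of degree 0 and 1, which must be present in the partial sum. *)
Lemma cabs_limit_le (u : nat -> (C : numFieldType)) (l : (C : numFieldType)) (a : C) (K : R) :
  u @ \oo --> l -> (forall n, cabs (u n.+2 - a) <= K) -> cabs (l - a) <= K.
Proof.
move=> ul uK; have {ul} : (fun n => u (n + 2)%N) @ \oo --> l by rewrite cvg_shiftn.
move=> /cvg_cabsP/cvgrPdist_lt ul; apply/ler_addgt0Pr => e e0.
near \oo => n.
have : cabs (u (n + 2)%N - l) < e.
  by near: n; apply: filterS (ul _ e0) => n; rewrite sub0r normrN (ger0_norm (cabs_ge0 _)).
move=> h; rewrite (_ : l - a = (u (n + 2)%N - a) - (u (n + 2)%N - l)); last by ring.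
apply: le_trans (cabsB _ _) _; apply: lerD; last exact: ltW.
by rewrite addn2.
Unshelve. all: by end_near. Qed.

Lemma cabs_pow_sub x y (s : R) n : cabs x <= s -> cabs y <= s ->
  cabs (x ^+ n.+1 - y ^+ n.+1) <= cabs (x - y) * (n.+1%:R * s ^+ n).
Proof.
move=> xs ys; rewrite subrXX cabsM ler_wpM2l ?cabs_ge0//.
rewrite (le_trans (cabs_sum _ _ _))//.
have -> : n.+1%:R * s ^+ n = \sum_(i < n.+1) s ^+ n.
  by rewrite sumr_const card_ord mulr_natl.
apply: ler_sum => i _; rewrite cabsM !cabsX.
have -> : s ^+ n = s ^+ (n.+1.-1 - i) * s ^+ i by rewrite -exprD subnK// -ltnS.
by rewrite ler_pM ?exprn_ge0 ?cabs_ge0// lerXn2r ?nnegrE ?cabs_ge0 ?(le_trans (cabs_ge0 x)).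
Qed.

(** The sums stay below 6, which is the 6 in the radius chosen in [sderiv_power_series]. *)
Lemma sum_geometric_derivative m :
  \sum_(j < m) (j.+2%:R * 2^-1 ^+ j) = 6 - (2 * m%:R + 6) * 2^-1 ^+ m :> R.
Proof.
elim: m => [|m ih]; first by rewrite big_ord0 expr0; ring.
by rewrite big_ord_recr/= ih exprS -!natr1; field.
Qed.

(** Convergence at the single point w + rho bounds the coefficients by M / rho^k, and x^k - y^k has
    the factor x - y. So the terms of degree at least 2 together contribute a small multiple of |z1
    - z2|. *)
Lemma sderiv_power_series f w (a : nat -> C) :
  (\forall z \near (w : (C : numFieldType)),
    (fun n => \sum_(k < n) a k * (z - w) ^+ k) @ \oo --> (f z : (C : numFieldType))) ->
  sderiv f w (a 1%N).
Proof.
move=> /near_cabsP[r r0 fr].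
pose rho := r / 2; have rho0 : 0 < rho by rewrite divr_gt0.
pose p := w + rho%:C.
have /fr cp : cabs (p - w) < r.
  by rewrite /p addrC addKr cabs_real gtr0_norm// /rho; lra.
have [M M0 aM] : exists2 M : R, 0 < M & forall k, cabs (a k) <= M / rho ^+ k.
  have /cvgP/cvg_seq_bounded/ex_strict_bound_gt0 [K K0 hK] : (fun n => cabs (\sum_(k < n) a k * (p - w) ^+ k - f p)) @ \oo --> (0 : R).
    exact/cvg_cabsP.
  exists (2 * K); first by rewrite mulr_gt0.
  move=> k; rewrite ler_pdivlMr ?exprn_gt0//.
  have -> : cabs (a k) * rho ^+ k = cabs (a k * (p - w) ^+ k).
    by rewrite cabsM cabsX /p addrC addKr cabs_real gtr0_norm.
  (* A term of the series is the difference of two consecutive partial sums, both at distance at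
     most [K] from the limit. *)
  rewrite (_ : a k * _ = (\sum_(k < k.+1) a k * (p - w) ^+ k - f p) - (\sum_(k < k) a k * (p - w) ^+ k - f p)); last first.
    by rewrite big_ord_recr/=; move: (\sum_(_ < _) _) => x; ring.
  have := hK k I; have := hK k.+1 I; rewrite /= !(ger0_norm (cabs_ge0 _)) => h1 h2.
  by rewrite (le_trans (cabsB _ _))//; lra.
move=> e e0.
(* The bound rho / 2 makes the terms geometric of ratio 1/2, up to a linear factor. Their sum is at
   most 6 M d / rho^2 times |z1 - z2|, and the second bound makes 6 M d / rho^2 at most [e]. *)
pose d := Num.min (rho / 2) (e * rho ^+ 2 / (6 * M)).
have d0 : 0 < d by rewrite lt_min !divr_gt0 ?mulr_gt0 ?exprn_gt0.
exists d => // z1 z2 z1d z2d.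
have drho : d <= rho / 2 by rewrite ge_min lexx.
have dM : 6 * M * d <= e * rho ^+ 2.
  by rewrite mulrC -ler_pdivlMr ?mulr_gt0// ge_min lexx orbT.
have dr : d < r by rewrite (le_lt_trans drho)// /rho; lra.
have c1 := fr _ (lt_trans z1d dr); have c2 := fr _ (lt_trans z2d dr).
apply: (cabs_limit_le (cvg_complexB c1 c2)) => n.
rewrite !big_ord_recl/= !expr0 /bump/= !add1n !expr1.
set S1 := \sum_(_ < _) _; set S2 := \sum_(_ < _) _.
have -> : a 0%N * 1 + (a 1%N * (z1 - w) + S1) - (a 0%N * 1 + (a 1%N * (z2 - w) + S2)) - a 1%N * (z1 - z2) =
  S1 - S2 by ring.
rewrite -sumrB (le_trans (cabs_sum _ _ _))//.
have term (i : 'I_n) : cabs (a (1 + (1 + i))%N * (z1 - w) ^+ (1 + (1 + i)) -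
    a (1 + (1 + i))%N * (z2 - w) ^+ (1 + (1 + i))) <=
    M * d / rho ^+ 2 * cabs (z1 - z2) * (i.+2%:R * 2^-1 ^+ i).
  rewrite !add1n -mulrBr.
  apply: le_trans (cabsM_le (aM _) (cabs_pow_sub _ (ltW z1d) (ltW z2d))) _.
  have -> : z1 - w - (z2 - w) = z1 - z2 by ring.
  rewrite (exprS d i).
  have dp : d ^+ i <= (rho / 2) ^+ i by rewrite lerXn2r ?nnegrE// ltW// divr_gt0.
  have -> : M / rho ^+ i.+2 * (cabs (z1 - z2) * (i.+2%:R * (d * d ^+ i))) =
     (M * d / rho ^+ 2 * cabs (z1 - z2)) * (i.+2%:R * (d ^+ i / rho ^+ i)).
    rewrite !exprS; move: (cabs _) (d ^+ i) (rho ^+ i) (i.+2%:R : R) (expf_neq0 i (lt0r_neq0 rho0)) => A B E F E0.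
    by field; rewrite E0 gt_eqF.
  rewrite ler_wpM2l//; first by rewrite !mulr_ge0 ?invr_ge0 ?exprn_ge0 ?cabs_ge0// ltW.
  rewrite ler_wpM2l// ler_pdivrMr ?exprn_gt0//.
  by rewrite -exprMn mulrC.
apply: le_trans (ler_sum _ (fun i _ => term i)) _.
rewrite -mulr_sumr sum_geometric_derivative.
have q0 : 0 <= M * d / rho ^+ 2 by rewrite !mulr_ge0 ?invr_ge0 ?exprn_ge0// ltW.
rewrite mulrAC ler_wpM2r ?cabs_ge0//.
apply: (@le_trans _ _ (M * d / rho ^+ 2 * 6)).
  by rewrite ler_wpM2l// gerBl mulr_ge0// ?exprn_ge0// addr_ge0// mulr_ge0.
rewrite (_ : _ * 6 = 6 * M * d / rho ^+ 2); last by field; rewrite gt_eqF.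
by rewrite ler_pdivrMr// exprn_gt0.
Qed.

Lemma analytic_sderiv f w : analytic_at (f : (C : numFieldType) -> (C : numFieldType)) w ->
  exists c, sderiv f w c.
Proof. by move=> [a fa]; exists (a 1%N); exact: sderiv_power_series. Qed.

(** Shifting the coefficients of [f] at [w] by one index gives a power series for the difference
    quotient, whose value at [w] is the coefficient of degree 1. The singularity of the quotient is
    thus removable, in the strict sense of [sderiv]. *)
Lemma analytic_quotient f w : analytic_at (f : (C : numFieldType) -> (C : numFieldType)) w ->
  exists k c, sderiv (fun z => if z == w then k else (f z - f w) / (z - w)) w c.
Proof.
move=> [a fa]; exists (a 1%N), (a 2%N).
apply: (@sderiv_power_series _ _ (fun k => a k.+1)).
have aw : a 0%N = f w.
  have /near_cabsP[r r0 /(_ w)] := fa; rewrite subrr cabs0 => /(_ r0) h.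
  have {}h : (fun n => \sum_(k < n.+1) a k * (0 : C) ^+ k) @ \oo --> (f w : (C : numFieldType)).
    exact: (cvg_comp _ _ (cvg_addnl 1) h).
  apply/eqP; rewrite -subr_eq0 -cabs_eq0 eq_le cabs_ge0 andbT cabs_sym.
  apply: (cabs_limit_le h) => n.
  rewrite big_ord_recl expr0 mulr1 big1 ?addr0 ?subrr ?cabs0// => i _.
  by rewrite lift0 expr0n mulr0.
move/near_cabsP : fa => [r r0 fr]; apply/near_cabsP; exists r; first exact: r0.
move=> z zr; have h := fr z zr.
case: eqVneq => [->|zw].
  apply/cvg_cabsP; apply: cvg_near_cst; near=> n.
  have -> : n = n.-1.+1 by rewrite prednK//; near: n; exact: nbhs_infty_gt.
  rewrite big_ord_recl expr0 mulr1 big1 ?addr0 ?subrr ?cabs0// => i _.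
  by rewrite lift0 expr0n mulr0.
have {}h : (fun n => \sum_(k < n.+1) a k * (z - w) ^+ k) @ \oo --> (f z : (C : numFieldType)).
  exact: (cvg_comp _ _ (cvg_addnl 1) h).
have zw0 : z - w != 0 by rewrite subr_eq0.
move/cvg_cabsP : h => h; apply/cvg_cabsP.
have : (fun n => (cabs (z - w))^-1 * cabs (\sum_(k < n.+1) a k * (z - w) ^+ k - f z)) @ \oo --> (cabs (z - w))^-1 * 0.
  by apply: cvgMr; exact: h.
rewrite mulr0; apply: cvg_trans; apply: near_eq_cvg; near=> n.
rewrite -cabsV -cabsM big_ord_recl expr0 mulr1 aw; congr cabs.
have -> : \sum_(i < n) a (lift ord0 i) * (z - w) ^+ lift ord0 i = (z - w) * \sum_(i < n) a i.+1 * (z - w) ^+ i.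
  rewrite mulr_sumr; apply: eq_bigr => i _; rewrite lift0 exprS.
  by move: (_ ^+ i) => x; ring.
by move: (\sum_(_ < _) _) => x; field.
Unshelve. all: by end_near. Qed.

Lemma sderiv_derive1 f z c : sderiv f z c -> derive1 (f : (C : numFieldType) -> C^o) z = c.
Proof.
move=> hf; rewrite /derive1.
apply/cvg_lim; first exact: norm_hausdorff.
apply/(@cvgrPdist_le _ (C^o)) => _ /gt0_complexE[e e0 ->].
have [d d0 hd] := hf _ e0.
apply/near_cabsP; exists d => // s; rewrite subr0 => sd s0.
have A1 : cabs (s + z - z) < d by rewrite addrK.
have A2 : cabs (z - z) < d by rewrite subrr cabs0.
have := hd _ _ A1 A2; rewrite addrK => h.
have s1 : 0 < cabs s by rewrite cabs_gt0.
rewrite normcabs lecR -(ler_pM2r s1) -cabsM.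
rewrite (_ : _ * s = - (f (s + z) - f z - c * s)) ?cabsN//.
rewrite (_ : s^-1 *: (f (s + z) - f z) = s^-1 * (f (s + z) - f z))//.
by move: (f (s + z)) (f z) => p q; field.
Qed.

(** Chain rule along an affine path with direction [u]. Real parts suffice: imaginary parts are real
    parts for -i times the function, whence the factors [k] below. *)
Lemma sderiv_path h (g : R -> C) (t : R) c u :
  (forall s s', g s - g s' = (s - s')%:C * u) -> sderiv h (g t) c ->
  is_derive t (1 : R) (fun s => Re (h (g s))) (Re (c * u)).
Proof.
move=> gE hc.
suff H : (fun s : R => s^-1 *: (Re (h (g (s *: 1 + t))) - Re (h (g t)))) @ 0^' --> Re (c * u).
  by apply: DeriveDef; [apply/cvg_ex; exists (Re (c * u))|exact/cvg_lim].
apply/cvgrPdist_le => e e0.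
pose K := cabs u + 1; have K0 : 0 < K by rewrite ltr_wpDl ?cabs_ge0.
have [d d0 hd] := hc _ (divr_gt0 e0 K0).
near=> s.
have s0 : s != 0 by near: s; exact: nbhs_dnbhs_neq.
have sd : `|s| < d / K.
  by near: s; apply: dnbhs0_lt; rewrite divr_gt0.
have E : g (s *: 1 + t) - g t = s%:C * u by rewrite gE scaler1 addrK.
have sK : `|s| * cabs u <= `|s| * K by rewrite ler_wpM2l// lerDl.
have a1 : cabs (g (s *: 1 + t) - g t) < d.
  rewrite E cabsM cabs_real (le_lt_trans sK)// -ltr_pdivlMr//.
have a2 : cabs (g t - g t) < d by rewrite subrr cabs0.
have := hd _ _ a1 a2; rewrite E cabsM cabs_real => h1.
have h2 := le_trans (abs_Re _) h1.
have s1 : 0 < `|s| by rewrite normr_gt0.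
rewrite -(ler_pM2l s1) -normrM.
have -> : s * (Re (c * u) - s^-1 *: (Re (h (g (s *: 1 + t))) - Re (h (g t)))) =
    - Re (h (g (s *: 1 + t)) - h (g t) - c * (s%:C * u)).
  rewrite mulrBr [s^-1 *: _]/(_ * _) mulVKf// !ReB.
  have -> : Re (c * (s%:C * u)) = s * Re (c * u).
    by case: (c) (u) => [a b] [a' b'] /=; ring.
  by move: (Re (c * u)) => q; ring.
rewrite normrN (le_trans h2)// mulrCA ler_wpM2l// -mulrA ler_piMr ?(ltW e0)//.
by rewrite mulrC ler_pdivrMr// mul1r lerDl.
Unshelve. all: by end_near. Qed.

(** The increment h(z + r) - h(z) is close to c(z) r and also, since strictness at [w] lets both end
    points vary, to c(w) r. Dividing by [r] compares the two derivatives. *)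
Lemma sderiv_continuous h (c : C -> C) (m : R) w :
  (forall z, m < Im z -> sderiv h z (c z)) -> m < Im w ->
  forall e : R, 0 < e -> exists2 d : R, 0 < d & forall z, cabs (z - w) < d -> cabs (c z - c w) <= e.
Proof.
move=> hc mw e e0; have e2 : 0 < e / 2 by rewrite divr_gt0.
have [d d0 hd] := hc _ mw _ e2.
exists (Num.min d (Im w - m)); first by rewrite lt_min d0 subr_gt0.
move=> z; rewrite lt_min => /andP[zd zm].
have mz : m < Im z.
  have := le_lt_trans (abs_Im _) zm; rewrite ImB ltr_norml; lra.
have [d' d'0 hd'] := hc _ mz _ e2.
pose r := Num.min (d' / 2) ((d - cabs (z - w)) / 2).
have r0 : 0 < r by rewrite lt_min !divr_gt0// subr_gt0.
have rd' : r < d' by rewrite (@le_lt_trans _ _ (d' / 2))// ?ge_min ?lexx//; lra.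
have rd : r < d - cabs (z - w).
  rewrite (@le_lt_trans _ _ ((d - cabs (z - w)) / 2))// ?ge_min ?lexx ?orbT//.
  by move: zd; move: (cabs _) => q; lra.
have Er : z + r%:C - z = r%:C by rewrite addrC addKr.
have cr : cabs r%:C = r by rewrite cabs_real gtr0_norm.
have A1 : cabs (z + r%:C - z) < d' by rewrite Er cr.
have A2 : cabs (z - z) < d' by rewrite subrr cabs0.
have B1 : cabs (z + r%:C - w) < d.
  rewrite (_ : _ - w = (z - w) + r%:C); last by ring.
  by rewrite (le_lt_trans (cabsD _ _))// cr -ltrBrDl.
have := hd _ _ B1 zd; have := hd' _ _ A1 A2; rewrite Er cr => h1 h2.
rewrite -(ler_pM2r r0) -{1}cr -cabsM.
rewrite (_ : (c z - c w) * r%:C = (h (z + r%:C) - h z - c w * r%:C) - (h (z + r%:C) - h z - c z * r%:C)); last by ring.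
by rewrite (le_trans (cabsB _ _))// (splitr e) mulrDl lerD.
Qed.

End strict_derivative.

(** * Cauchy's theorem on rectangles *)

Section rectangle.
Context {R : realType}.
Local Notation C := R[i].
Local Notation mu := (@lebesgue_measure R).

Lemma ftc_segment (f F : R -> R) (a b : R) : a < b ->
  (forall x, a <= x <= b -> is_derive x (1 : R) F (f x)) ->
  (forall x, a <= x <= b -> {for x, continuous f}) ->
  Rintegral mu `[a, b] f = F b - F a.
Proof.
move=> ab dF cf.
have cF x : a <= x <= b -> {for x, continuous F}.
  by move=> /dF xF; apply/differentiable_continuous/derivable1_diffP; apply: ex_derive.
rewrite /Rintegral (@continuous_FTC2 _ f F)//.
- by apply: continuous_in_subspaceT => x; rewrite inE/= in_itv => /cf.
- split.
  + by move=> x; rewrite in_itv/= => /andP[/ltW ax /ltW xb]; have := dF x; rewrite ax xb => /(_ isT) h; apply: ex_derive.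
  + by apply: cvg_at_right_filter; apply: cF; rewrite lexx ltW.
  + by apply: cvg_at_left_filter; apply: cF; rewrite lexx ltW.
- move=> x; rewrite in_itv/= => /andP[/ltW ax /ltW xb]; have := dF x; rewrite ax xb => /(_ isT) h.
  by rewrite derive1E; exact: derive_val.
Qed.

Lemma compact_bound (g : R * R -> R) (A : set (R * R)) : compact A ->
  (forall p, A p -> {for p, continuous g}) -> exists2 M : R, 0 <= M & forall p, A p -> `|g p| <= M.
Proof.
move=> cA cg.
have : compact (g @` A).
  apply: continuous_compact => //; apply: continuous_in_subspaceT => p; rewrite inE; exact: cg.
move=> /compact_bounded[M [_ hM]].
exists (`|M| + 1); first by rewrite addr_ge0.
by move=> p Ap; apply: (hM (`|M| + 1)); [rewrite (le_lt_trans (ler_norm M))// ltrDl|exists p].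
Qed.

Variables (h c : C -> C) (m : R).
Hypothesis hc : forall z, m < Im z -> sderiv h z (c z).

Lemma continuous_Re_derivative (k : C) (p : R * R) : m < p.2 ->
  {for p, continuous (fun q : R * R => Re (k * c (to_complex q)))}.
Proof.
move=> mp; apply/cvgrPdist_le => e e0.
have k0 : 0 < cabs k + 1 by rewrite ltr_wpDl ?cabs_ge0.
have [d d0 hd] := @sderiv_continuous _ h c m (to_complex p) hc mp _ (divr_gt0 e0 k0).
exists (ball p.1 (d / 2), ball p.2 (d / 2)) => /=.
  by split; apply: nbhsx_ballx; rewrite divr_gt0.
move=> q [/= q1 q2].
rewrite -ReB -mulrBr (le_trans (abs_Re _))// cabsM cabs_sym.
rewrite (le_trans (ler_wpM2l (cabs_ge0 _) (hd (to_complex q) _)))//.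
  rewrite (le_lt_trans (cabs_le _))// ReB ImB/= (splitr d) ltrD//.
    by rewrite distrC; exact: q1.
  by rewrite distrC; exact: q2.
by rewrite mulrCA ler_piMr ?(ltW e0)// ler_pdivrMr// mul1r lerDl.
Qed.

Let i : C := 0 +i* 1.

(** The derivative in [y] of the horizontal integral of Re h is the horizontal integral of Re (i
    h'), that is, the difference of Re (i h) between the two ends. Integrating in [y] closes the
    rectangle. Applied to multiples of [h], this is Cauchy's theorem. *)
Lemma rectangle_Re (a b y1 y2 : R) : a < b -> m < y1 -> y1 < y2 ->
  Rintegral mu `[a, b] (fun x => Re (h (x +i* y2))) - Rintegral mu `[a, b] (fun x => Re (h (x +i* y1))) =
  Rintegral mu `[y1, y2] (fun y => Re (i * h (b +i* y)) - Re (i * h (a +i* y))).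
Proof.
move=> ab my1 y12.
have dx k (x y : R) : m < y ->
    is_derive x (1 : R) (fun x => Re (k * h (x +i* y))) (Re (k * c (x +i* y))).
  move=> my; rewrite -[k * c _]mulr1.
  apply: (@sderiv_path _ (fun z => k * h z) (fun x => x +i* y)); last by apply: sderivZ; exact: hc.
  by move=> s s'; apply/eqP; rewrite eq_complex/=; apply/andP; split; apply/eqP; ring.
have dy k (x y : R) : m < y ->
    is_derive y (1 : R) (fun y => Re (k * h (x +i* y))) (Re (k * i * c (x +i* y))).
  move=> my; rewrite mulrAC.
  apply: (@sderiv_path _ (fun z => k * h z) (fun y => x +i* y)); last by apply: sderivZ; exact: hc.
  by move=> s s'; apply/eqP; rewrite eq_complex/=; apply/andP; split; apply/eqP; ring.
have cx k (x y : R) : m < y -> {for x, continuous (fun x => Re (k * c (x +i* y)))}.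
  move=> my; have := @continuous_Re_derivative k (x, y) my => cp.
  apply: (@continuous_comp _ _ _ (fun x : R => (x, y)) (fun q : R * R => Re (k * c (to_complex q)))) => //.
  move=> P [[A B] /= [xA yB] AB]; rewrite /nbhs/=; apply: filterS xA => t At.
  by apply: AB; split => //=; exact: nbhs_singleton.
have horizontal y : m < y ->
    Rintegral mu `[a, b] (fun x => Re (i * c (x +i* y))) = Re (i * h (b +i* y)) - Re (i * h (a +i* y)).
  by move=> my; exact: (@ftc_segment _ (fun x => Re (i * h (x +i* y))) _ _ ab
    (fun x _ => dx i x y my) (fun x _ => cx i x y my)).
have vertical y : m < y -> is_derive y (1:R) (fun y => Rintegral mu `[a, b] (fun x => Re (h (x +i* y))))
    (Re (i * h (b +i* y)) - Re (i * h (a +i* y))).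
  move=> my.
  have u1 : exists2 u, m < u & u < y by exists ((m + y) / 2); lra.
  have [u mu_ uy] := u1.
  (* A uniform bound of the derivative on a compact neighbourhood of the segment at height [y] is
     the domination needed to differentiate under the integral. *)
  have [M M0 hM] := @compact_bound (fun q : R * R => Re (i * c (to_complex q))) (`[a, b] `*` `[u, y + 1])
     (compact_setX (@segment_compact _ _ _) (@segment_compact _ _ _))
     (fun p Ap => @continuous_Re_derivative i p (lt_le_trans mu_ (proj1 (andP Ap.2)))).
  have Iy : `]u, (y + 1)[%classic y by rewrite /= in_itv/= uy ltrDl ltr01.
  have mI v : `]u, (y + 1)[%classic v -> m < v.
    by rewrite /= in_itv/= => /andP[uv _]; exact: lt_trans uv.
  have dv (v x : R) : `]u, (y + 1)[%classic v ->
      is_derive v (1:R) (fun y => Re (h (x +i* y))) (Re (i * c (x +i* v))).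
    by move=> /mI mv; have := dy 1 x v mv; rewrite mul1r; under eq_fun do rewrite mul1r.
  pose f (y x : R) := Re (h (x +i* y)).
  have mab : measurable `[a, b] by [].
  have intf v : `]u, (y + 1)[%classic v -> mu.-integrable `[a, b] (EFin \o f v).
    move=> /mI mv; apply: continuous_compact_integrable; first exact: segment_compact.
    apply: continuous_subspaceT; apply: continuous_is_derive => x.
    by have := dx 1 x v mv; rewrite mul1r; under eq_fun do rewrite mul1r.
  have derf v x : `]u, (y + 1)[%classic v -> `[a, b]%classic x -> derivable (f ^~ x) v 1.
    by move=> Iv _; have [] := dv v x Iv.
  have dE v x : `]u, (y + 1)[%classic v -> partial1of2 f v x = Re (i * c (x +i* v)).
    by move=> Iv; rewrite partial1of2E; have [_] := dv v x Iv.
  have intM : mu.-integrable `[a, b] (EFin \o (fun=> M)).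
    apply: continuous_compact_integrable; first exact: segment_compact.
    by apply: continuous_subspaceT; exact: cst_continuous.
  have fM v x : `]u, (y + 1)[%classic v -> `[a, b]%classic x -> `|partial1of2 f v x| <= M.
    move=> Iv abx; rewrite dE//; apply: (hM (x, v)); split => //=.
    by move: Iv; rewrite /= !in_itv/= => /andP[/ltW-> /ltW->].
  rewrite -horizontal//.
  apply: DeriveDef.
    have H := @derivable_under_integral R _ _ mu f `[a, b] mab y u (y + 1) Iy intf derf (fun=> M) (fun=> M0) intM fM.
    exact: H.
  rewrite -derive1E (@differentiation_under_integral R _ _ mu f `[a, b] mab y u (y + 1) Iy intf derf (fun=> M) (fun=> M0) intM fM).
  by apply: eq_Rintegral => x _; rewrite dE.
symmetry; apply: (@ftc_segment _ (fun y => Rintegral mu `[a, b] (fun x => Re (h (x +i* y)))) _ _ y12).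
  by move=> y /andP[y1y _]; apply: vertical; exact: lt_le_trans y1y.
move=> y /andP[y1y _]; have my : m < y by exact: lt_le_trans y1y.
have cy x : {for y, continuous (fun y => Re (i * h (x +i* y)))}.
  by apply/differentiable_continuous/derivable1_diffP; have [] := dy i x _ my.
exact: (cvgB (cy b) (cy a)).
Qed.

End rectangle.

(** * Complex integrals *)

Section complex_integral.
Context {R : realType} {d} {T : measurableType d}.
Local Notation C := R[i].
Variables (m : {measure set T -> \bar R}) (A : set T).
Hypothesis mA : measurable A.
Implicit Types (f g : T -> C) (c : C).
Local Notation int f := (m.-integrable A (EFin \o f)).
Local Notation I f := (cintegral m A f).

Definition cintegrable f := int (fun x => Re (f x)) /\ int (fun x => Im (f x)).

Lemma cintegralE f : I f = Rintegral m A (fun x => Re (f x)) +i* Rintegral m A (fun x => Im (f x)).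
Proof. by []. Qed.

Lemma cReD (z w : C) : Re (z + w) = Re z + Re w. Proof. by case: z w => ? ? []. Qed.
Lemma cImD (z w : C) : Im (z + w) = Im z + Im w. Proof. by case: z w => ? ? []. Qed.
Lemma cReM (z w : C) : Re (z * w) = Re z * Re w - Im z * Im w. Proof. by case: z w => ? ? []. Qed.
Lemma cImM (z w : C) : Im (z * w) = Re z * Im w + Im z * Re w. Proof. by case: z w => ? ? []. Qed.
Lemma complexE (z : C) : z = Re z +i* Im z. Proof. by case: z. Qed.

Lemma eq_cintegral f g : (forall x, A x -> f x = g x) -> I f = I g.
Proof.
by move=> fg; rewrite !cintegralE; congr (_ +i* _); apply: eq_Rint => x Ax; rewrite fg.
Qed.

Lemma eq_cintegrable f g : (forall x, A x -> f x = g x) -> cintegrable f -> cintegrable g.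
Proof.
move=> fg [i1 i2]; split; [apply: (eq_rint mA _ i1)|apply: (eq_rint mA _ i2)];
  by move=> x Ax; rewrite fg.
Qed.

Lemma cintegrable_lin c f g : cintegrable f -> cintegrable g -> cintegrable (fun x => c * f x + g x).
Proof.
move=> [f1 f2] [g1 g2]; split.
  by under [X in EFin \o X]eq_fun do rewrite cReD cReM; apply: rintD => //; apply: rintB => //; exact: rintZ.
by under [X in EFin \o X]eq_fun do rewrite cImD cImM; apply: rintD => //; apply: rintD => //; exact: rintZ.
Qed.

Lemma cintegral_lin c f g : cintegrable f -> cintegrable g ->
  I (fun x => c * f x + g x) = c * I f + I g.
Proof.
move=> [f1 f2] [g1 g2]; rewrite !cintegralE; apply/eqP; rewrite eq_complex cReD cImD cReM cImM /=.
have [a1 a2] := (rintZ mA (Re c) f1, rintZ mA (Im c) f2).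
have [b1 b2] := (rintZ mA (Re c) f2, rintZ mA (Im c) f1).
apply/andP; split; apply/eqP.
  under eq_Rintegral do rewrite cReD cReM.
  by rewrite RintD//; [rewrite RintB// !RintZ|exact: rintB].
under eq_Rintegral do rewrite cImD cImM.
by rewrite RintD//; [rewrite RintD// !RintZ|exact: rintD].
Qed.

Lemma cintegrable0 : cintegrable (fun=> 0).
Proof. by split; exact: integrable0. Qed.

Lemma cintegral0 : I (fun=> 0) = 0.
Proof. by rewrite cintegralE /Rintegral/= !integral0. Qed.

Lemma cintegrableZ c f : cintegrable f -> cintegrable (fun x => c * f x).
Proof.
by move=> fi; apply: eq_cintegrable (cintegrable_lin c fi cintegrable0) => x _; rewrite addr0.
Qed.

Lemma cintegralZ c f : cintegrable f -> I (fun x => c * f x) = c * I f.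
Proof.
move=> fi; rewrite -[RHS]addr0 -cintegral0 -(cintegral_lin c fi cintegrable0).
by apply: eq_cintegral => x _; rewrite addr0.
Qed.

Lemma cintegral_sum (n : nat) (c : nat -> C) (F : nat -> T -> C) :
  (forall k, cintegrable (F k)) ->
  I (fun x => \sum_(k < n) c k * F k x) = \sum_(k < n) c k * I (F k) /\
  cintegrable (fun x => \sum_(k < n) c k * F k x).
Proof.
move=> Fi; elim: n => [|n [ih1 ih2]].
  split; first by rewrite big_ord0 -[RHS]cintegral0; apply: eq_cintegral => x _; rewrite big_ord0.
  by apply: eq_cintegrable cintegrable0 => x _; rewrite big_ord0.
have E x : \sum_(k < n.+1) c k * F k x = c n * F n x + \sum_(k < n) c k * F k x.
  by rewrite big_ord_recr/= addrC.
split; last by apply: eq_cintegrable (cintegrable_lin (c n) (Fi n) ih2) => x _; rewrite E.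
by rewrite big_ord_recr/= addrC -ih1 -cintegral_lin//; apply: eq_cintegral => x _; rewrite E.
Qed.

Lemma cintegrable_dominated f (g : T -> R) : cmeasurable_fun A f -> int g ->
  (forall x, A x -> cabs (f x) <= g x) -> cintegrable f.
Proof.
move=> [f1 f2] ig fg; split.
  by apply: (integrable_dominated mA f1 ig) => x Ax; exact: le_trans (abs_Re _) (fg _ Ax).
by apply: (integrable_dominated mA f2 ig) => x Ax; exact: le_trans (abs_Im _) (fg _ Ax).
Qed.

Lemma cintegral_dct (f_ : nat -> T -> C) f (g : T -> R) :
  (forall n, cmeasurable_fun A (f_ n)) -> int g ->
  (forall n x, A x -> cabs (f_ n x) <= g x) ->
  (forall x, A x -> (fun n => f_ n x) @ \oo --> (f x : (C : numFieldType))) ->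
  cintegrable f /\ (fun n => I (f_ n)) @ \oo --> (I f : (C : numFieldType)).
Proof.
move=> mf ig fg cf.
have [i1 c1] := @Rdct _ _ _ m A mA (fun n x => Re (f_ n x)) (fun x => Re (f x)) g (fun n => (mf n).1) ig
  (fun n x Ax => le_trans (abs_Re _) (fg n x Ax)) (fun x Ax => proj1 ((cvg_ReIm _ _).1 (cf x Ax))).
have [i2 c2] := @Rdct _ _ _ m A mA (fun n x => Im (f_ n x)) (fun x => Im (f x)) g (fun n => (mf n).2) ig
  (fun n x Ax => le_trans (abs_Im _) (fg n x Ax)) (fun x Ax => proj2 ((cvg_ReIm _ _).1 (cf x Ax))).
by split => //; apply/cvg_ReIm.
Qed.

Lemma cmeasurable_cst c : cmeasurable_fun A (fun=> c).
Proof. by split; exact: measurable_cst. Qed.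

Lemma cmeasurableD f g : cmeasurable_fun A f -> cmeasurable_fun A g -> cmeasurable_fun A (fun x => f x + g x).
Proof.
move=> [f1 f2] [g1 g2]; split.
  by rewrite (_ : _ \o _ = fun x => Re (f x) + Re (g x)); [exact: measurable_funD|apply/funext => x /=; rewrite cReD].
by rewrite (_ : _ \o _ = fun x => Im (f x) + Im (g x)); [exact: measurable_funD|apply/funext => x /=; rewrite cImD].
Qed.

Lemma cmeasurableM f g : cmeasurable_fun A f -> cmeasurable_fun A g -> cmeasurable_fun A (fun x => f x * g x).
Proof.
move=> [f1 f2] [g1 g2]; split.
  rewrite (_ : _ \o _ = fun x => Re (f x) * Re (g x) - Im (f x) * Im (g x)).
    by apply: measurable_funB; exact: measurable_funM.
  by apply/funext => x /=; rewrite cReM.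
rewrite (_ : _ \o _ = fun x => Re (f x) * Im (g x) + Im (f x) * Re (g x)).
  by apply: measurable_funD; exact: measurable_funM.
by apply/funext => x /=; rewrite cImM.
Qed.

Lemma cmeasurableX f n : cmeasurable_fun A f -> cmeasurable_fun A (fun x => f x ^+ n).
Proof.
move=> mf; elim: n => [|n ih].
  by rewrite (_ : (fun x => _) = fun=> 1); [exact: cmeasurable_cst|apply/funext => x; rewrite expr0].
by rewrite (_ : (fun x => _) = fun x => f x * f x ^+ n); [exact: cmeasurableM|apply/funext => x; rewrite exprS].
Qed.

Lemma cmeasurable_real (f : T -> R) : measurable_fun A f -> cmeasurable_fun A (fun x => (f x)%:C).
Proof. by move=> mf; split => //; exact: measurable_cst. Qed.

Lemma cmeasurable_conj f : cmeasurable_fun A f -> cmeasurable_fun A (fun x => conjc (f x)).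
Proof.
move=> [f1 f2]; split.
  by rewrite (_ : _ \o _ = Re \o f)//; apply/funext => x /=; case: (f x).
rewrite (_ : _ \o _ = fun x => - Im (f x)); first exact: measurable_funN.
by apply/funext => x /=; case: (f x).
Qed.

Lemma cmeasurable_cexp f : cmeasurable_fun A f -> cmeasurable_fun A (fun x => cexp (f x)).
Proof.
move=> [f1 f2]; apply: cmeasurableM.
  by apply: cmeasurable_real; apply: measurableT_comp => //; exact: measurable_expR.
by split; [apply: (measurableT_comp measurable_cos f2)|apply: (measurableT_comp measurable_sin f2)].
Qed.

Lemma measurable_cabs f : cmeasurable_fun A f -> measurable_fun A (fun x => cabs (f x)).
Proof.
move=> [f1 f2]; rewrite /cabs.
apply: (measurableT_comp (continuous_measurable_fun (@sqrt_continuous R))).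
by apply: measurable_funD; exact: measurable_funX.
Qed.

End complex_integral.

(** * The power series of the complex exponential *)

Section exponential_series.
Context {R : realType}.
Local Notation C := R[i].

Definition cexp_sum (n : nat) (z : C) : C := \sum_(k < n) z ^+ k / k`!%:R.

(* derivative of a complex function of a real variable *)
Definition is_cderive (t : R) (g : R -> C) (g' : C) :=
  is_derive t (1:R) (fun s => Re (g s)) (Re g') /\ is_derive t (1:R) (fun s => Im (g s)) (Im g').

Lemma is_cderive_eq t (g1 g2 : R -> C) a b : g1 =1 g2 -> a = b -> is_cderive t g1 a -> is_cderive t g2 b.
Proof. by move=> /funext-> ->. Qed.

Lemma cabs_nat n : cabs (n%:R : C) = n%:R.
Proof. by apply: complexI; rewrite -normcabs normr_nat rmorph_nat. Qed.

Lemma exp_series_le n (x : R) : 0 <= x -> \sum_(k < n) x ^+ k / k`!%:R <= expR x.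
Proof.
move=> x0; apply: (@le_trans _ _ (series (exp_coeff x) n)).
  by rewrite /series/= big_mkord; apply: ler_sum => k _.
apply: nondecreasing_cvgn_le; last exact: is_cvg_series_exp_coeff.
by apply: nondecreasing_series => k _ _; exact: exp_coeff_ge0.
Qed.

Lemma exp_term_le n (x : R) : 0 <= x -> x ^+ n / n`!%:R <= expR x.
Proof.
move=> x0; apply: le_trans (exp_series_le n.+1 x0).
rewrite big_ord_recr/= lerDr sumr_ge0// => k _.
by rewrite divr_ge0// exprn_ge0.
Qed.

Lemma cexp0 : cexp (0 : C) = 1.
Proof. by rewrite /cexp/= expR0 cos0 sin0 mul1r. Qed.

Lemma is_cderiveM t g g' h h' : is_cderive t g g' -> is_cderive t h h' ->
  is_cderive t (fun s => g s * h s) (g' * h t + g t * h').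
Proof.
move=> [a1 a2] [b1 b2]; split.
  under [X in is_derive _ _ X]eq_fun do rewrite cReM.
  apply: (is_derive_eq (is_deriveB (is_deriveM a1 b1) (is_deriveM a2 b2))).
  by rewrite cReD !cReM /GRing.scale/=; ring.
under [X in is_derive _ _ X]eq_fun do rewrite cImM.
apply: (is_derive_eq (is_deriveD (is_deriveM a1 b2) (is_deriveM a2 b1))).
by rewrite cImD !cImM /GRing.scale/=; ring.
Qed.

Lemma is_cderiveD t g g' h h' : is_cderive t g g' -> is_cderive t h h' ->
  is_cderive t (fun s => g s + h s) (g' + h').
Proof.
move=> [a1 a2] [b1 b2]; split.
  by under [X in is_derive _ _ X]eq_fun do rewrite cReD; rewrite cReD; exact: is_deriveD.
by under [X in is_derive _ _ X]eq_fun do rewrite cImD; rewrite cImD; exact: is_deriveD.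
Qed.

Lemma is_cderive_cst t (k : C) : is_cderive t (fun=> k) 0.
Proof. by split; exact: is_derive_cst. Qed.

Lemma is_cderive_line t (z : C) : is_cderive t (fun s => s%:C * z) z.
Proof.
split.
  under [X in is_derive _ _ X]eq_fun do rewrite cReM /= mul0r subr0 mulrC -[_ * _]addr0.
  exact: is_derive_linear.
under [X in is_derive _ _ X]eq_fun do rewrite cImM /= mul0r addr0 mulrC -[_ * _]addr0.
exact: is_derive_linear.
Qed.

Lemma is_cderive_cexp t (z : C) : is_cderive t (fun s => cexp (s%:C * z)) (z * cexp (t%:C * z)).
Proof.
have [d1 d2] := is_cderive_line t z.
have e1 : is_derive t (1:R) (fun s : R => expR (Re (s%:C * z))) (expR (Re (t%:C * z)) * Re z).
  exact: is_derive1_comp.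
have e2 : is_derive t (1:R) (fun s : R => cos (Im (s%:C * z))) (- sin (Im (t%:C * z)) * Im z).
  exact: (is_derive1_comp (is_derive_cos _) d2).
have e3 : is_derive t (1:R) (fun s : R => sin (Im (s%:C * z))) (cos (Im (t%:C * z)) * Im z).
  exact: (is_derive1_comp (is_derive_sin _) d2).
have m1 : is_cderive t (fun s => (expR (Re (s%:C * z)))%:C) ((expR (Re (t%:C * z)) * Re z)%:C).
  by split => //=; exact: is_derive_cst.
have m2 : is_cderive t (fun s => cos (Im (s%:C * z)) +i* sin (Im (s%:C * z)))
   ((- sin (Im (t%:C * z)) * Im z) +i* (cos (Im (t%:C * z)) * Im z)).
  by split.
apply: is_cderive_eq (is_cderiveM m1 m2) => //.
rewrite /cexp; move: (expR _) (cos _) (sin _) => a b c.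
by case: (z) => p q /=; apply/eqP; rewrite eq_complex /=; apply/andP; split; apply/eqP; ring.
Qed.

Lemma is_cderive_cexp_sum n t (z : C) :
  is_cderive t (fun s => cexp_sum n.+1 (s%:C * z)) (z * cexp_sum n (t%:C * z)).
Proof.
have pow k : is_cderive t (fun s => (s%:C * z) ^+ k) (k%:R * z * (t%:C * z) ^+ k.-1).
  elim: k => [|k ih].
    by apply: is_cderive_eq (is_cderive_cst t 1) => [s|]; rewrite ?expr0// !mul0r.
  apply: is_cderive_eq (is_cderiveM (is_cderive_line t z) ih) => [s|]; first by rewrite exprS.
  case: k {ih} => [|k]; first by rewrite !expr0; ring.
  rewrite /= !exprS -[k.+2%:R]natr1; move: (k.+1%:R : C) (_ ^+ k) => a b; ring.
elim: n => [|n ih].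
  apply: is_cderive_eq (is_cderive_cst t 1) => [s|].
    by rewrite /cexp_sum big_ord1 expr0 divr1.
  by rewrite /cexp_sum big_ord0 mulr0.
have := is_cderiveM (pow n.+1) (is_cderive_cst t (n.+1)`!%:R^-1).
move/(is_cderiveD ih); apply: is_cderive_eq => [s|]; first by rewrite /cexp_sum [in RHS]big_ord_recr.
rewrite mulr0 addr0 [in RHS]/cexp_sum big_ord_recr/= mulrDr; congr (_ + _).
rewrite factS natrM; have n0 : n.+1%:R != 0 :> C by rewrite pnatr_eq0.
have f0 : n`!%:R != 0 :> C by rewrite pnatr_eq0 -lt0n fact_gt0.
by move: n0 f0; move: (n.+1%:R : C) (n`!%:R : C) (_ ^+ n) => a b c a0 b0; field; rewrite a0 b0.
Qed.

Lemma mean_value_bound (g g' : R -> R) (M : R) :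
  (forall t : R, is_derive t (1:R) g (g' t)) -> (forall t : R, 0 <= t <= 1 -> `|g' t| <= M) ->
  `|g 1 - g 0| <= M.
Proof.
move=> dg gM.
have cg : {within `[0, 1], continuous g} by apply: continuous_subspaceT; exact: continuous_is_derive dg.
have [t t01 ->] := MVT_segment ler01 (fun t _ => dg t) cg.
by rewrite subr0 mulr1; apply: gM; move: t01; rewrite in_itv.
Qed.

Lemma cexp_sum_bound n (z : C) : cabs (cexp_sum n z) <= expR (cabs z).
Proof.
rewrite (le_trans (cabs_sum _ _ _))//; apply: le_trans (exp_series_le n (cabs_ge0 z)).
by apply: ler_sum => k _; rewrite cabsM cabsX cabsV cabs_nat.
Qed.

(** The derivative of s |-> e^{-s z} S_{n+1}(s z) telescopes to -z e^{-s z} (s z)^n / n!, which is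
    small on [0, 1], and the value at 0 is 1. So e^{-z} S_{n+1}(z) is close to 1. *)
Lemma cvg_cexp_sum (z : C) : (fun n => cexp_sum n z) @ \oo --> (cexp z : (C : numFieldType)).
Proof.
pose F n (s : R) := cexp (s%:C * (- z)) * cexp_sum n.+1 (s%:C * z).
have dF n t : is_cderive t (F n) (- z * cexp (t%:C * - z) * ((t%:C * z) ^+ n / n`!%:R)).
  apply: is_cderive_eq (is_cderiveM (is_cderive_cexp t (- z)) (is_cderive_cexp_sum n t z)) => //.
  rewrite [in X in X + _]/cexp_sum big_ord_recr/= -/(cexp_sum n _).
  by move: (cexp _) (cexp_sum _ _) (_ / _) => a b c; ring.
pose M n := cabs z * expR (cabs z) * (cabs z ^+ n / n`!%:R).
have bd n (t : R) : 0 <= t <= 1 -> cabs (- z * cexp (t%:C * - z) * ((t%:C * z) ^+ n / n`!%:R)) <= M n.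
  move=> /andP[t0 t1].
  have tz : cabs (t%:C * z) <= cabs z.
    by rewrite cabsM cabs_real ger0_norm// ler_piMl ?cabs_ge0.
  apply: cabsM_le.
    rewrite cabsM cabsN ler_wpM2l ?cabs_ge0// cabs_cexp ler_expR mulrN.
    by apply: le_trans tz; apply: le_trans (ler_norm _) _; rewrite -cabsN; exact: abs_Re.
  rewrite cabsM cabsX cabsV ler_pM ?exprn_ge0 ?invr_ge0 ?cabs_ge0//.
    by rewrite lerXn2r ?nnegrE ?cabs_ge0.
  by rewrite cabs_nat.
have F0 n : F n 0 = 1.
  rewrite /F !mul0r cexp0 mul1r /cexp_sum big_ord_recl expr0 divr1 big1 ?addr0//.
  by move=> i _; rewrite lift0 expr0n mul0r.
(* The mean value inequality is used for the real and imaginary parts separately, hence twice the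
   bound. *)
have FM n : cabs (F n 1 - 1) <= M n + M n.
  rewrite -(F0 n) (le_trans (cabs_le _))// lerD//.
    rewrite ReB; apply: (mean_value_bound (fun t => (dF n t).1)) => t t01.
    by apply: le_trans (abs_Re _) _; exact: bd.
  rewrite ImB; apply: (mean_value_bound (fun t => (dF n t).2)) => t t01.
  by apply: le_trans (abs_Im _) _; exact: bd.
have c0 : (fun n => expR (cabs z) * (M n + M n)) @ \oo --> (0 : R).
  have h : (fun n => cabs z ^+ n / n`!%:R) @ \oo --> (0 : R).
    exact: (cvg_series_cvg_0 (is_cvg_series_exp_coeff (cabs z))).
  rewrite -(mulr0 (expR (cabs z))) -(addr0 0) -(mulr0 (cabs z * expR (cabs z))).
  by apply: cvgMr; apply: cvgD; apply: cvgMr.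
suff : (fun n => cabs (cexp_sum n.+1 z - cexp z)) @ \oo --> (0 : R).
  move=> h; apply/cvg_cabsP; rewrite -(cvg_shiftn 1).
  by under eq_fun do rewrite addn1.
apply: (squeeze_cvgr (f := fun=> 0) _ _ c0); last exact: cvg_cst.
apply: nearW => n; rewrite cabs_ge0/=.
have -> : cexp_sum n.+1 z - cexp z = cexp z * (F n 1 - 1).
  by rewrite /F !mul1r mulrBr mulr1 mulrA -cexpD subrr cexp0 mul1r.
by rewrite cabsM cabs_cexp ler_pM ?expR_ge0 ?cabs_ge0// ler_expR (le_trans (ler_norm _) (abs_Re _)).
Qed.

End exponential_series.

Notation Lcintegrable_dominated := (cintegrable_dominated (m := lebesgue_measure)) (only parsing).
Notation LcintegrableZ := (cintegrableZ (m := lebesgue_measure)) (only parsing).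
Notation LcintegralZ := (cintegralZ (m := lebesgue_measure)) (only parsing).
Notation Lcintegral_sum := (cintegral_sum (m := lebesgue_measure)) (only parsing).
Notation Leq_cintegrable := (eq_cintegrable (m := lebesgue_measure)) (only parsing).
Notation Leq_cintegral := (eq_cintegral lebesgue_measure) (only parsing).

(** * Laplace transforms *)

Section laplace_transform.
Context {R : realType}.
Local Notation C := R[i].
Local Notation mu := (@lebesgue_measure R).
Local Notation D := (`]0, +oo[%classic : set R).
Local Notation int f := (mu.-integrable D (EFin \o f)).
Let i : C := 0 +i* 1.
Let mD : measurable D. Proof. by []. Qed.
Implicit Types (Psi : R -> C) (z w : C).

Definition laplace Psi z : C := cintegral mu D (fun xi => Psi xi * cexp (i * z * xi%:C)).

(** Absolute convergence of the Laplace integral at every point of the half-plane. Square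
    integrability is kept apart: the functions xi^{(lambda+1)/2} psi(xi) to be transformed are in
    general square integrable only after damping. *)
Definition laplace_admissible Psi := cmeasurable_fun D Psi /\
  forall y : R, 0 < y -> int (fun xi => cabs (Psi xi) * expR (- y * xi)).

Lemma cabs_laplace_kernel z (xi : R) : cabs (cexp (i * z * xi%:C)) = expR (- Im z * xi).
Proof.
rewrite cabs_cexp; congr expR; rewrite /i.
by case: z => x y /=; ring.
Qed.

Lemma cmeasurable_id : cmeasurable_fun D (fun xi : R => xi%:C).
Proof. by apply: cmeasurable_real; exact: measurable_id. Qed.

Lemma cmeasurable_laplace_kernel z : cmeasurable_fun D (fun xi : R => cexp (i * z * xi%:C)).
Proof. by apply: cmeasurable_cexp; apply: cmeasurableM; [exact: cmeasurable_cst|exact: cmeasurable_id]. Qed.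

Lemma laplace_integrable Psi z : laplace_admissible Psi -> 0 < Im z ->
  cintegrable mu D (fun xi => Psi xi * cexp (i * z * xi%:C)).
Proof.
move=> [mPsi iPsi] z0; apply: (Lcintegrable_dominated mD _ (iPsi _ z0)).
  by apply: cmeasurableM => //; exact: cmeasurable_laplace_kernel.
by move=> xi _; rewrite cabsM cabs_laplace_kernel.
Qed.

(** Half of the damping absorbs the power: xi^n is at most n! (2 / y)^n e^{y xi / 2}, by one term of
    the exponential series. *)
Lemma laplace_admissibleX Psi n : laplace_admissible Psi ->
  laplace_admissible (fun xi => xi%:C ^+ n * Psi xi).
Proof.
move=> [mPsi iPsi]; have mX : cmeasurable_fun D (fun xi => xi%:C ^+ n * Psi xi).
  by apply: cmeasurableM => //; apply: cmeasurableX; exact: cmeasurable_id.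
split=> // y y0; have y2 : 0 < y / 2 by rewrite divr_gt0.
have ib := LrintZ mD (n`!%:R / (y / 2) ^+ n) (iPsi _ y2).
apply: (Lintegrable_dominated mD _ ib).
  by apply: measurable_funM; [exact: measurable_cabs|mfun].
move=> xi; rewrite /= in_itv/= andbT => xi0.
rewrite ger0_norm ?mulr_ge0 ?cabs_ge0 ?expR_ge0// cabsM cabsX cabs_real gtr0_norm//.
have := @exp_term_le _ n (y / 2 * xi) (mulr_ge0 (ltW y2) (ltW xi0)).
rewrite exprMn => h.
have fn : 0 < n`!%:R :> R by rewrite ltr0n fact_gt0.
have yn : 0 < (y / 2) ^+ n by rewrite exprn_gt0.
have -> : - y * xi = (- (y / 2) * xi) + (- (y / 2 * xi)) by field.
rewrite expRD [expR (- (y / 2 * xi))]expRN.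
have e0 : 0 < expR (y / 2 * xi) by exact: expR_gt0.
have -> : xi ^+ n * cabs (Psi xi) * (expR (- (y / 2) * xi) / expR (y / 2 * xi)) =
   (xi ^+ n / expR (y / 2 * xi)) * (cabs (Psi xi) * expR (- (y / 2) * xi)).
  move: (expR (- (y / 2) * xi)) (expR (y / 2 * xi))^-1 (xi ^+ n) (cabs (Psi xi)) => a b c q; ring.
apply: ler_wpM2r; first by rewrite mulr_ge0 ?cabs_ge0 ?expR_ge0.
by move: h; rewrite ler_pdivrMr// ler_pdivrMr// => h; rewrite mulrAC ler_pdivlMr// mulrC [X in _ <= X]mulrC.
Qed.

(** For |z - w| < Im w / 2, all partial sums of e^{i xi (z - w)} are at most e^{xi Im w / 2}. This
    uses half of the decay at [w]; the other half dominates, and the series may be integrated term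
    by term. *)
Lemma laplace_series Psi w z : laplace_admissible Psi -> cabs (z - w) < Im w / 2 ->
  (fun n => \sum_(k < n) cintegral mu D (fun xi => Psi xi * cexp (i * w * xi%:C) * ((i * xi%:C) ^+ k / k`!%:R))
     * (z - w) ^+ k) @ \oo --> (laplace Psi z : (C : numFieldType)).
Proof.
move=> aPsi zw; have w0 : 0 < Im w.
  by have := le_lt_trans (cabs_ge0 _) zw; rewrite pmulr_lgt0.
pose F k xi := Psi xi * cexp (i * w * xi%:C) * ((i * xi%:C) ^+ k / k`!%:R).
have Fi k : cintegrable mu D (F k).
  have := LcintegrableZ mD (i ^+ k / k`!%:R) (laplace_integrable (laplace_admissibleX k aPsi) w0).
  apply: (Leq_cintegrable mD) => xi _; rewrite /F exprMn.
  by move: (Psi xi) (cexp _) (i ^+ k) (_ ^-1) (_ ^+ k) => *; ring.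
have S n := Lcintegral_sum mD n (fun k => (z - w) ^+ k) Fi.
have -> : (fun n => \sum_(k < n) cintegral mu D (F k) * (z - w) ^+ k) =
    fun n => cintegral mu D (fun xi => \sum_(k < n) (z - w) ^+ k * F k xi).
  by apply/funext => n; rewrite (S n).1; apply: eq_bigr => k _; rewrite mulrC.
have E n xi : \sum_(k < n) (z - w) ^+ k * F k xi =
    Psi xi * cexp (i * w * xi%:C) * cexp_sum n (i * xi%:C * (z - w)).
  rewrite /cexp_sum mulr_sumr; apply: eq_bigr => k _; rewrite /F [(_ * (z - w)) ^+ k]exprMn.
  by move: (Psi xi) (cexp _) (_ ^-1) (_ ^+ k) (_ ^+ k) => *; ring.
have w2 : 0 < Im w / 2 by rewrite divr_gt0.
refine (proj2 (@cintegral_dct _ _ _ mu D mD (fun n xi => \sum_(k < n) (z - w) ^+ k * F k xi)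
  (fun xi => Psi xi * cexp (i * z * xi%:C)) _ _ (aPsi.2 _ w2) _ _)).
- move=> n; have [_ [h1 h2]] := S n.
  by split; [exact: Lrint_measurable h1|exact: Lrint_measurable h2].
- move=> n xi; rewrite /= in_itv/= andbT => xi0.
  rewrite E 2!cabsM cabs_laplace_kernel -mulrA ler_wpM2l ?cabs_ge0//.
  rewrite (le_trans (ler_wpM2l (expR_ge0 _) (cexp_sum_bound _ _)))// -expRD ler_expR.
  rewrite !cabsM cabs_i mul1r cabs_real gtr0_norm//.
  rewrite [xi * _]mulrC -mulrDl ler_wpM2r ?(ltW xi0)//.
  by move: zw; move: (cabs _) => q; lra.
- move=> xi _; under eq_fun do rewrite E.
  have -> : Psi xi * cexp (i * z * xi%:C) = Psi xi * cexp (i * w * xi%:C) * cexp (i * xi%:C * (z - w)).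
    by rewrite -[RHS]mulrA -cexpD; congr (_ * cexp _); ring.
  apply/cvg_cabsP.
  have /cvg_cabsP := @cvg_cexp_sum _ (i * xi%:C * (z - w)).
  move=> h; rewrite -(mulr0 (cabs (Psi xi * cexp (i * w * xi%:C)))).
  by under eq_fun do rewrite -mulrBr cabsM; apply: cvgMr.
Qed.

Lemma laplace_analytic Psi w : laplace_admissible Psi -> 0 < Im w ->
  analytic_at (laplace Psi : (C : numFieldType) -> (C : numFieldType)) w.
Proof.
move=> aPsi w0.
exists (fun k => cintegral mu D (fun xi => Psi xi * cexp (i * w * xi%:C) * ((i * xi%:C) ^+ k / k`!%:R))).
apply/near_cabsP; exists (Im w / 2); first by rewrite divr_gt0.
by move=> z; exact: laplace_series.
Qed.

Lemma sderiv_laplace Psi w : laplace_admissible Psi -> 0 < Im w ->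
  sderiv (laplace Psi) w (i * laplace (fun xi => xi%:C * Psi xi) w).
Proof.
move=> aPsi w0; rewrite /laplace -(LcintegralZ mD); last first.
  apply: laplace_integrable => //.
  by have := laplace_admissibleX 1 aPsi; under eq_fun do rewrite expr1.
pose a k := cintegral mu D (fun xi => Psi xi * cexp (i * w * xi%:C) * ((i * xi%:C) ^+ k / k`!%:R)).
have : sderiv (laplace Psi) w (a 1%N).
  apply: sderiv_power_series; apply/near_cabsP; exists (Im w / 2); first by rewrite divr_gt0.
  by move=> z; exact: laplace_series.
rewrite /a (_ : cintegral _ _ _ = cintegral mu D (fun xi => i * (xi%:C * Psi xi * cexp (i * w * xi%:C))))//.
apply: Leq_cintegral => xi _; rewrite expr1 divr1.
by move: (cexp _) => e; ring.
Qed.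

End laplace_transform.

Section laplace_slices.
Context {R : realType}.
Local Notation C := R[i].
Local Notation mu := (@lebesgue_measure R).
Local Notation D := (`]0, +oo[%classic : set R).
Local Notation int f := (mu.-integrable D (EFin \o f)).
Local Notation Tc := (trig_transform (@cos R)).
Local Notation Ts := (trig_transform (@sin R)).
Let mD : measurable D. Proof. by []. Qed.
Implicit Types (Psi : R -> C).

Definition damped_Re Psi (y xi : R) := Re (Psi xi) * expR (- y * xi).
Definition damped_Im Psi (y xi : R) := Im (Psi xi) * expR (- y * xi).

Lemma integrable_damped Psi (y : R) : laplace_admissible Psi -> 0 < y ->
  int (damped_Re Psi y) /\ int (damped_Im Psi y).
Proof.
move=> [[m1 m2] iPsi] y0; split; apply: (Lintegrable_dominated mD _ (iPsi _ y0)).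
- by rewrite /damped_Re; mfun.
- by move=> x _; rewrite normrM (ger0_norm (expR_ge0 _)) ler_wpM2r ?expR_ge0 ?abs_Re.
- by rewrite /damped_Im; mfun.
- by move=> x _; rewrite normrM (ger0_norm (expR_ge0 _)) ler_wpM2r ?expR_ge0 ?abs_Im.
Qed.

Lemma laplace_kernelE Psi (x y xi : R) :
  let K := Psi xi * cexp ((0 +i* 1) * (x +i* y) * xi%:C) in
  Re K = damped_Re Psi y xi * cos (x * xi) - damped_Im Psi y xi * sin (x * xi) /\
  Im K = damped_Re Psi y xi * sin (x * xi) + damped_Im Psi y xi * cos (x * xi).
Proof.
rewrite /cexp /damped_Re /damped_Im cReM cImM.
have -> : Re ((0 +i* 1) * (x +i* y) * xi%:C) = - y * xi by rewrite /=; ring.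
have -> : Im ((0 +i* 1) * (x +i* y) * xi%:C) = x * xi by rewrite /=; ring.
rewrite /=; move: (expR _) (cos _) (sin _) (Re _) (Im _) => e c s a b.
by split; ring.
Qed.

Lemma laplace_lineE Psi (x y : R) : laplace_admissible Psi -> 0 < y ->
  laplace Psi (x +i* y) = (Tc (damped_Re Psi y) x - Ts (damped_Im Psi y) x) +i*
    (Ts (damped_Re Psi y) x + Tc (damped_Im Psi y) x).
Proof.
move=> aPsi y0; have [iu iv] := integrable_damped aPsi y0.
have [uc us] := (trig_kernel_int measurable_cos (@cos_max R) x iu, trig_kernel_int measurable_sin (@sin_max R) x iu).
have [vc vs] := (trig_kernel_int measurable_cos (@cos_max R) x iv, trig_kernel_int measurable_sin (@sin_max R) x iv).
rewrite /laplace cintegralE /trig_transform -(LRintB mD uc vs) -(LRintD mD us vc).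
by congr (_ +i* _); apply: Leq_Rint => xi _; have [h1 h2] := laplace_kernelE Psi x y xi.
Qed.

Lemma laplace_admissible_lin (c : C) Psi Phi : laplace_admissible Psi -> laplace_admissible Phi ->
  laplace_admissible (fun xi => c * Psi xi + Phi xi).
Proof.
move=> [m1 i1] [m2 i2].
have m3 : cmeasurable_fun D (fun xi => c * Psi xi + Phi xi).
  by apply: cmeasurableD => //; apply: cmeasurableM => //; exact: cmeasurable_cst.
split=> // y y0; apply: (Lintegrable_dominated mD _ (LrintD mD (LrintZ mD (cabs c) (i1 _ y0)) (i2 _ y0))).
  by apply: measurable_funM; [exact: measurable_cabs|mfun].
move=> xi _; rewrite normrM (ger0_norm (cabs_ge0 _)) (ger0_norm (expR_ge0 _)).
by rewrite mulrA -mulrDl ler_wpM2r ?expR_ge0// (le_trans (cabsD _ _))// cabsM.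
Qed.

Lemma laplace_lin (c : C) Psi Phi z : laplace_admissible Psi -> laplace_admissible Phi -> 0 < Im z ->
  laplace (fun xi => c * Psi xi + Phi xi) z = c * laplace Psi z + laplace Phi z.
Proof.
move=> a1 a2 z0; rewrite /laplace -(cintegral_lin (m := mu)) //; try exact: laplace_integrable.
by apply: Leq_cintegral => xi _; move: (cexp _) => e; ring.
Qed.

(** Cosine transforms are even in [x] and sine transforms odd, so the equations at [x] and [-x]
    separate the four transforms, and [fourier_inj] applies to [u] and to [v]. *)
Lemma trig_transform_inj (u v : R -> R) : int u -> int v ->
  (forall x, Tc u x - Ts v x = 0 /\ Ts u x + Tc v x = 0) ->
  ae_eq mu D u (fun=> 0) /\ ae_eq mu D v (fun=> 0).
Proof.
move=> iu iv L0.
have H x : [/\ Tc u x = 0, Ts u x = 0, Tc v x = 0 & Ts v x = 0].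
  have [h1 h2] := L0 x; have [h3 h4] := L0 (- x).
  have ce f : Tc f (- x) = Tc f x by apply: Leq_Rint => xi _; rewrite mulNr cosN.
  have se f : int f -> Ts f (- x) = - Ts f x.
    move=> fi; rewrite /trig_transform -(LRintN mD (trig_kernel_int measurable_sin (@sin_max R) x fi)).
    by apply: Leq_Rint => xi _; rewrite mulNr sinN mulrN.
  move: h1 h2 h3 h4; rewrite !ce !se//.
  by move: (Tc _ _) (Ts _ _) (Tc _ _) (Ts _ _) => *; split; lra.
by split; apply: fourier_inj => // h; have [] := H h.
Qed.

Lemma laplace_null Psi (y : R) : laplace_admissible Psi -> 0 < y ->
  (forall x, laplace Psi (x +i* y) = 0) -> ae_eq mu D Psi (fun=> 0).
Proof.
move=> aPsi y0 L0; have [iu iv] := integrable_damped aPsi y0.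
have [U V] : ae_eq mu D (damped_Re Psi y) (fun=> 0) /\ ae_eq mu D (damped_Im Psi y) (fun=> 0).
  apply: trig_transform_inj => // x; have := L0 x; rewrite laplace_lineE// => /eqP.
  by rewrite eq_complex/= => /andP[/eqP h1 /eqP h2].
apply: (@filterS2 _ _ (ae_filter_ringOfSetsType mu) _ _ _ _ U V) => xi h1 h2 Dxi.
have e0 : expR (- y * xi) != 0 by rewrite gt_eqF ?expR_gt0.
move/eqP : (h1 Dxi); rewrite mulf_eq0 (negbTE e0) orbF => /eqP r0.
move/eqP : (h2 Dxi); rewrite mulf_eq0 (negbTE e0) orbF => /eqP i0.
by rewrite [LHS]complexE r0 i0.
Qed.

Lemma laplace_inj Psi Phi (y : R) : laplace_admissible Psi -> laplace_admissible Phi -> 0 < y ->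
  (forall x, laplace Psi (x +i* y) = laplace Phi (x +i* y)) -> ae_eq mu D Psi Phi.
Proof.
move=> a1 a2 y0 L.
have := @laplace_null (fun xi => -1 * Phi xi + Psi xi) y (laplace_admissible_lin (-1) a2 a1) y0 _.
move=> H; have {}H : ae_eq mu D (fun xi => -1 * Phi xi + Psi xi) (fun=> 0).
  by apply: H => x; rewrite laplace_lin// L mulN1r addNr.
apply: (@filterS _ _ (ae_filter_ringOfSetsType mu) _ _ _ H) => xi h Dxi.
by apply/eqP; rewrite -subr_eq0 addrC -mulN1r h.
Qed.

Lemma integral_line_split (f : R -> R) : (forall x, 0 <= f x) -> continuous f ->
  (\int[mu]_x (f x)%:E = \int[mu]_(x in D) (f x + f (- x))%:E)%E.
Proof.
move=> f0 cf; have mf : measurable_fun [set: R] f by exact: continuous_measurable_fun.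
have cg : continuous (fun x => f (- x)).
  by move=> x; apply: (@continuous_comp _ _ _ -%R f); [exact: opp_continuous|exact: cf].
have mg : measurable_fun [set: R] (fun x => f (- x)) by exact: continuous_measurable_fun.
have mposnums : measurable [set x : R | 0 <= x]%R by rewrite -set_itvcy.
rewrite -(setUv [set x : R | 0 <= x]%R) ge0_integral_setU//= ; last 4 first.
- exact: measurableC.
- by apply/measurable_EFinP; rewrite setUv.
- by move=> x _; rewrite lee_fin.
- exact/disj_setPCl.
rewrite -set_itvcy// setCitvr.
rewrite integral_itv_bndo_bndc; last exact/measurable_EFinP/measurable_funTS.
rewrite [X in (_ + X)%E](_ : _ = \int[mu]_(x in `]-oo, (- 0)%R]) (f x)%:E)%E; last by rewrite oppr0.
rewrite ge0_integration_by_substitutionNy//; last exact: continuous_subspaceT.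
rewrite -!integral_itv_obnd_cbnd; try exact/measurable_EFinP/measurable_funTS.
under [RHS]eq_integral do rewrite EFinD.
rewrite ge0_integralD//.
- by move=> x _; rewrite lee_fin.
- exact/measurable_EFinP/measurable_funTS.
- by move=> x _; rewrite lee_fin.
- exact/measurable_EFinP/measurable_funTS.
Qed.

Lemma laplace_line_continuous Psi (y : R) : laplace_admissible Psi -> 0 < y ->
  continuous (fun x : R => Re (laplace Psi (x +i* y))) /\
  continuous (fun x : R => Im (laplace Psi (x +i* y))).
Proof.
move=> aPsi y0.
have H k : continuous (fun x : R => Re (k * laplace Psi (x +i* y))).
  apply: (@continuous_is_derive _ _ (fun x : R => Re (k * ((0 +i* 1) * laplace (fun xi => xi%:C * Psi xi) (x +i* y)) * 1))) => x.
  apply: (@sderiv_path _ (fun z => k * laplace Psi z) (fun x => x +i* y)).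
    by move=> s s'; apply/eqP; rewrite eq_complex/=; apply/andP; split; apply/eqP; ring.
  by apply: sderivZ; exact: sderiv_laplace.
split.
  by have := H 1; under eq_fun do rewrite mul1r.
have := H (0 -i* 1); rewrite (_ : (fun x => _) = fun x : R => Im (laplace Psi (x +i* y)))//.
by apply/funext => x; case: (laplace _ _) => a b /=; ring.
Qed.

(** Folding the line onto the half-line, the products mixing real and imaginary parts of [Psi]
    cancel between [x] and [-x] and the squares double: this gives the 2. The pi comes from
    [plancherel]. *)
Lemma laplace_line_plancherel Psi (y : R) : laplace_admissible Psi -> 0 < y ->
  sq_int mu D (damped_Re Psi y) -> sq_int mu D (damped_Im Psi y) ->
  (\int[mu]_x (cabs (laplace Psi (x +i* y)) ^+ 2)%:E =
   (2 * pi)%:E * \int[mu]_(xi in D) (cabs (Psi xi) ^+ 2 * expR (- (2 * y) * xi))%:E)%E.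
Proof.
move=> aPsi y0 squ sqv; have [iu iv] := integrable_damped aPsi y0.
have [u12 v12] : L1_L2 (damped_Re Psi y) /\ L1_L2 (damped_Im Psi y) by [].
have [cr ci] := laplace_line_continuous aPsi y0.
rewrite integral_line_split; last 2 first.
- by move=> x; rewrite exprn_ge0 ?cabs_ge0.
- under eq_fun do rewrite cabs_sqr !expr2.
  by move=> x; apply: cvgD; [apply: (cvgM (cr x) (cr x))|apply: (cvgM (ci x) (ci x))].
have Eu := energy_int u12 u12; have Ev := energy_int v12 v12.
transitivity (\int[mu]_(x in D) (2 * ((Tc (damped_Re Psi y) x * Tc (damped_Re Psi y) x + Ts (damped_Re Psi y) x * Ts (damped_Re Psi y) x) +
   (Tc (damped_Im Psi y) x * Tc (damped_Im Psi y) x + Ts (damped_Im Psi y) x * Ts (damped_Im Psi y) x)))%:E)%E.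
  apply: eq_integral => x _; congr EFin; rewrite !cabs_sqr !laplace_lineE//=.
  have ce u : Tc u (- x) = Tc u x by apply: Leq_Rint => xi _; rewrite mulNr cosN.
  have se u : int u -> Ts u (- x) = - Ts u x.
    move=> ui; rewrite /trig_transform -(LRintN mD (trig_kernel_int measurable_sin (@sin_max R) x ui)).
    by apply: Leq_Rint => xi _; rewrite mulNr sinN mulrN.
  by rewrite !ce !se//; move: (Tc _ _) (Ts _ _) (Tc _ _) (Ts _ _) => *; ring.
rewrite (LRintE mD (LrintZ mD 2 (LrintD mD Eu Ev))) (LRintZ mD 2 (LrintD mD Eu Ev)) (LRintD mD Eu Ev).
rewrite -/(energy _ _) -/(energy (damped_Im Psi y) _) !plancherel//.
have iuu := Lsq_int_mul mD squ squ; have ivv := Lsq_int_mul mD sqv sqv.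
rewrite -mulrDr mulrA -(LRintD mD iuu ivv) EFinM -(LRintE mD (LrintD mD iuu ivv)); congr (_ * _)%E.
apply: eq_integral => xi _; rewrite cabs_sqr /damped_Re /damped_Im; congr EFin.
rewrite (_ : - (2 * y) * xi = - y * xi + - y * xi) ?expRD; last by ring.
by move: (expR _) (Re _) (Im _) => *; ring.
Qed.

End laplace_slices.

(** * Norm of a Laplace transform over the half-plane *)

Section gamma.
Context {R : realType}.
Local Notation mu := (@lebesgue_measure R).
Local Notation D := (`]0, +oo[%classic : set R).
Local Notation int f := (mu.-integrable D (EFin \o f)).
Let mD : measurable D. Proof. by []. Qed.

(** The half-line is exhausted by compact intervals away from 0, where [f] may be singular. The
    parameter [c] allows the images of these intervals under a dilation. *)
Lemma half_line_cvg (f : R -> R) (c : R) : 0 < c -> measurable_fun D f -> (forall x, D x -> 0 <= f x) ->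
  (\int[mu]_(x in `[(c / n.+1%:R)%R, (c * n.+1%:R)%R]) (f x)%:E @[n --> \oo] -->
   \int[mu]_(x in D) (f x)%:E)%E.
Proof.
move=> c0 mf f0.
pose A n := `[c / n.+1%:R, c * n.+1%:R]%classic : set R.
have AD n : A n `<=` D.
  by move=> x; rewrite /A /= !in_itv/= andbT => /andP[+ _]; apply: lt_le_trans; rewrite divr_gt0.
have -> : D = \bigcup_n A n.
  apply/seteqP; split; last by move=> x [n _] /AD.
  move=> x; rewrite /= in_itv/= andbT => x0.
  have [n1 hn1] : exists n1 : nat, c / x < n1%:R.
    by exists (Num.bound (c / x)); rewrite archi_boundP// divr_ge0 ?ltW.
  have [n2 hn2] : exists n2 : nat, x / c < n2%:R.
    by exists (Num.bound (x / c)); rewrite archi_boundP// divr_ge0 ?ltW.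
  exists (n1 + n2)%N => //; rewrite /A/= in_itv/=; apply/andP; split.
    rewrite ler_pdivrMr// mulrC -ler_pdivrMr// (le_trans (ltW hn1))// ler_nat.
    by rewrite -addnS leq_addr.
  rewrite mulrC -ler_pdivrMr// (le_trans (ltW hn2))// ler_nat.
  by rewrite -addSn leq_addl.
apply: ge0_nondecreasing_set_cvg_integral => //.
- apply/nondecreasing_seqP => n; apply/subsetPset => x; rewrite /A/= !in_itv/= => /andP[h1 h2].
  apply/andP; split.
    by apply: le_trans h1; rewrite ler_pM2l// lef_pV2 ?posrE// ler_nat.
  by apply: le_trans h2 _; rewrite ler_pM2l// ler_nat.
- by move=> n; apply/measurable_EFinP; exact: (measurable_funS mD (AD n) mf).
- by move=> n x /AD Dx; rewrite lee_fin f0.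
Qed.

Lemma half_line_scale (f : R -> R) (s : R) : 0 < s -> (forall x, 0 < x -> {for x, continuous f}) ->
  (forall x, 0 < x -> 0 <= f x) ->
  (\int[mu]_(x in D) (f x)%:E = s%:E * \int[mu]_(x in D) (f (s * x)%R)%:E)%E.
Proof.
move=> s0 cf f0.
have cg x : 0 < x -> {for x, continuous (fun x => f (s * x))}.
  move=> x0; apply: (@continuous_comp _ _ _ ( *%R s) f); first exact: mulrl_continuous.
  by apply: cf; rewrite mulr_gt0.
have mf (g : R -> R) : (forall x, 0 < x -> {for x, continuous g}) -> measurable_fun D g.
  move=> cg'; apply: open_continuous_measurable_fun; first exact: interval_open.
  by move=> x; rewrite inE/= in_itv/= andbT; exact: cg'.
have D0 x : D x -> 0 < x by rewrite /= in_itv/= andbT.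
have c1 := half_line_cvg s0 (mf _ cf) (fun x Dx => f0 x (D0 x Dx)).
have c2 := half_line_cvg (@ltr01 R) (mf _ cg) (fun x Dx => f0 _ (mulr_gt0 s0 (D0 x Dx))).
have c3 := cvgeZl (isT : s%:E \is a fin_num) c2.
apply: (cvg_unique _ c1); first exact: ereal_hausdorff.
apply: cvg_trans c3; apply: near_eq_cvg; near=> n.
have a0 : 0 < 1 / n.+1%:R :> R by rewrite divr_gt0.
have ab : 1 / n.+1%:R <= 1 * n.+1%:R :> R.
  by rewrite (@le_trans _ _ 1)// ?mul1r ?ler1n// invf_le1// ler1n.
have F' : derive1 (fun x : R => s * x) = fun=> s.
  apply/funext => x; rewrite derive1E; have := is_derive_linear s 0 x.
  by under [X in is_derive _ _ X]eq_fun do rewrite addr0; case.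
have -> : s / n.+1%:R = s * (1 / n.+1%:R) by rewrite mul1r.
have -> : s * n.+1%:R = s * (1 * n.+1%:R) by rewrite mul1r.
rewrite (@integration_by_substitution_increasing _ (fun x => s * x))//.
- rewrite -ge0_integralZl//.
  + by apply: eq_integral => x _; rewrite /= F' fctE -EFinM mulrC.
  + apply/measurable_EFinP; apply: measurable_funS (mf _ cg) => //.
    by move=> x; rewrite /= !in_itv/= andbT => /andP[+ _]; exact: lt_le_trans.
  + move=> x; rewrite /= in_itv/= => /andP[+ _] => h.
    by rewrite lee_fin f0// mulr_gt0// (lt_le_trans a0).
  + by rewrite lee_fin ltW.
- by move=> x y _ _ xy; rewrite ltr_pM2l.
- by rewrite F' => ? _; exact: cst_continuous.
- by rewrite F'; apply: is_cvg_cst.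
- by rewrite F'; apply: is_cvg_cst.
- split.
  + by move=> x _; apply: derivableM => //; exact: derivable_cst.
  + by apply: cvg_at_right_filter; exact: mulrl_continuous.
  + by apply: cvg_at_left_filter; exact: mulrl_continuous.
- apply: continuous_in_subspaceT => x; rewrite inE/= in_itv/= => /andP[h _].
  by apply: cf; apply: lt_le_trans h; rewrite mulr_gt0.
Unshelve. all: by end_near. Qed.

Variable p : R.
Hypothesis p0 : 0 < p.
Let f1 (t : R) := p * t `^ (p - 1) * expR (- t).
Let f2 (t : R) := t `^ p * expR (- t).

Lemma is_derive_gamma (t : R) : 0 < t -> is_derive t (1:R) f2 (f1 t - f2 t).
Proof.
move=> t0; have d1 := is_derive1_powR p t0.
have d2 := is_derive1_comp (is_derive_expR _) (is_derive_linear (-1) 0 t).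
have f2E : (powR (R:=R))^~ p * (expR \o (fun x => -1 * x + 0)) = f2.
  by apply/funext => x; rewrite /f2 fctE/= mulN1r addr0.
have := is_deriveM d1 d2; rewrite f2E; move/is_derive_eq; apply.
by rewrite /f1 /f2 /GRing.scale/= mulN1r addr0; ring.
Qed.

Lemma gamma_bound : exists2 K : R, 0 < K & forall t, 0 < t -> f2 t <= K * expR (- 2^-1 * t).
Proof.
have [k pk] : exists k : nat, p < k%:R by exists (Num.bound p); rewrite archi_boundP// ltW.
(* Up to 1 the power t^p is at most 1. Beyond 1 it is at most t^k, as p < k, and t^k <= k! 2^k
   e^{t/2} by one term of the exponential series. *)
exists (1 + k`!%:R * 2 ^+ k); first by rewrite ltr_wpDr// mulr_ge0// exprn_ge0.
move=> t t0; rewrite /f2.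
have -> : expR (- t) = expR (- 2^-1 * t) * expR (- 2^-1 * t).
  by rewrite -expRD; congr expR; field.
rewrite mulrA ler_wpM2r ?expR_ge0//.
have -> : - 2^-1 * t = - (t / 2) by ring.
rewrite expRN ler_pdivrMr ?expR_gt0//.
have t2 : 0 <= t / 2 by rewrite divr_ge0// ltW.
have h1 : 1 <= expR (t / 2) by rewrite -[X in X <= _]expR0 ler_expR.
have h2 : t ^+ k <= k`!%:R * 2 ^+ k * expR (t / 2).
  have := exp_term_le k t2; rewrite ler_pdivrMr ?ltr0n ?fact_gt0// exprMn exprVn ler_pdivrMr ?exprn_gt0// => h.
  by apply: le_trans h _; rewrite le_eqVlt; apply/orP; left; apply/eqP; ring.
rewrite mulrDl mul1r; have [t1|t1] := leP t 1.
  apply: (@le_trans _ _ 1); last by rewrite (le_trans h1)// lerDl mulr_ge0 ?expR_ge0// mulr_ge0// exprn_ge0.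
  have e1 : 1 `^ p = 1 :> R by rewrite powR1.
  rewrite -[X in _ <= X]e1.
  by apply: ge0_ler_powR => //; rewrite ?nnegrE ltW.
apply: (@le_trans _ _ (t ^+ k)); last by rewrite (le_trans h2)// lerDr expR_ge0.
by rewrite -powR_mulrn ?ler_powR ?ltW.
Qed.

Let cf2 (t : R) : 0 < t -> {for t, continuous f2}.
Proof.
by move=> /is_derive_gamma[d _]; apply/differentiable_continuous/derivable1_diffP.
Qed.

Let cf1 (t : R) : 0 < t -> {for t, continuous f1}.
Proof.
move=> t0; have h : {for t, continuous ((powR (R:=R))^~ (p - 1))}.
  by apply: differentiable_continuous; apply/derivable1_diffP; have [] := is_derive1_powR (p - 1) t0.
apply: cvgM; last first.
  by apply: (@continuous_comp _ _ _ -%R expR); [exact: opp_continuous|exact: continuous_expR].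
apply: cvgM; first exact: cvg_cst.
exact: h.
Qed.

Let D0 (x : R) : D x -> 0 < x. Proof. by rewrite /= in_itv/= andbT. Qed.

Lemma measurable_continuous_half_line (g : R -> R) : (forall x, 0 < x -> {for x, continuous g}) -> measurable_fun D g.
Proof.
move=> cg'; apply: open_continuous_measurable_fun; first exact: interval_open.
by move=> x; rewrite inE => /D0; exact: cg'.
Qed.

Let f2_ge0 (t : R) : 0 <= f2 t. Proof. by rewrite mulr_ge0 ?powR_ge0 ?expR_ge0. Qed.
Let f1_ge0 (t : R) : 0 <= f1 t. Proof. by rewrite mulr_ge0 ?mulr_ge0 ?powR_ge0 ?expR_ge0 ?ltW. Qed.

Lemma gamma_int : int f2.
Proof.
have [K K0 hK] := gamma_bound; have h2 : 0 < 2^-1 :> R by [].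
have [ie _] := laplace_exp h2.
apply: (Lintegrable_dominated mD _ (LrintZ mD K ie)); first exact: measurable_continuous_half_line.
by move=> x /D0 x0; rewrite ger0_norm// hK.
Qed.

(** The derivative of [f2] is [f1 - f2] and [f2] vanishes at both ends: this is the functional
    equation of Gamma. For p < 1 the function [f1] is unbounded near 0, so the identity is taken on
    compact intervals and to the limit in the extended reals. *)
Lemma gamma_ibp : (\int[mu]_(x in D) (f1 x)%:E = \int[mu]_(x in D) (f2 x)%:E)%E.
Proof.
have c1 := half_line_cvg (@ltr01 R) (measurable_continuous_half_line cf1) (fun x _ => f1_ge0 x).
have c2 := half_line_cvg (@ltr01 R) (measurable_continuous_half_line cf2) (fun x _ => f2_ge0 x).
have l0 : (fun n : nat => f2 (1 * n.+1%:R) - f2 (1 / n.+1%:R)) @ \oo --> (0 : R).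
  rewrite -[X in _ --> X](subr0 (0 : R)); apply: cvgB.
    have [K K0 hK] := gamma_bound.
    apply: (squeeze_cvgr (f := fun=> 0) (h := fun n : nat => K * expR (- (2^-1 * n.+1%:R)))).
    - by apply: nearW => n; rewrite f2_ge0/= mul1r (le_trans (hK _ _))// mulNr.
    - exact: cvg_cst.
    - rewrite -(mulr0 K); apply: cvgMr.
      apply: (@cvg_comp _ _ _ (fun n : nat => n.+1%:R : R) (fun x => expR (- (2^-1 * x))) _ (pinfty_nbhs R)).
        by apply/cvgrnyP; exact: (cvg_addnl 1).
      exact: cvgr_expRM.
  apply/cvgrPdist_lt => e e0.
  have [d d0 hd] := (cvgrPdist_lt _ _).1 (@powR_cvg0 R p p0) e e0.
  have [N _ hN] := near_infty_natSinv_lt (PosNum d0).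
  exists N => // n /hN /= nd.
  have n0 : 0 < n.+1%:R^-1 :> R by [].
  rewrite sub0r normrN ger0_norm// mul1r /f2.
  have := hd n.+1%:R^-1; rewrite /ball_/= !sub0r !normrN !ger0_norm ?powR_ge0 ?invr_ge0// => /(_ nd n0).
  by apply: le_lt_trans; rewrite ler_piMr ?powR_ge0// -[X in _ <= X]expR0 ler_expR oppr_le0.
have c3 : (fun n => (\int[mu]_(x in `[(1 / n.+1%:R)%R, (1 * n.+1%:R)%R]) (f2 x)%:E + (f2 (1 * n.+1%:R) - f2 (1 / n.+1%:R))%:E)%E) @ \oo
    --> (\int[mu]_(x in D) (f2 x)%:E + 0)%E.
  apply: cvgeD => //; first by rewrite fin_num_adde_defl.
  by apply: cvg_EFin => //; exact: nearW.
rewrite adde0 in c3.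
apply: (cvg_unique _ c1); first exact: ereal_hausdorff.
apply: cvg_trans c3; apply: near_eq_cvg; near=> n.
have a0 : 0 < 1 / n.+1%:R :> R by rewrite divr_gt0.
have [ab|ab] := eqVneq (1 / n.+1%:R : R) (1 * n.+1%:R).
  by rewrite ab subrr adde0 !set_itv1 !integral_set1.
have {}ab : 1 / n.+1%:R < 1 * n.+1%:R :> R.
  by rewrite lt_neqAle ab/= (@le_trans _ _ 1)// ?mul1r ?ler1n// invf_le1// ler1n.
move: (1 / n.+1%:R) (1 * n.+1%:R) a0 ab => a b a0 ab.
have ge x : `[a, b]%classic x -> 0 < x by rewrite /= in_itv/= => /andP[h _]; exact: lt_le_trans h.
have ci (g : R -> R) : (forall x, 0 < x -> {for x, continuous g}) -> mu.-integrable `[a, b] (EFin \o g).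
  move=> cg; apply: continuous_compact_integrable; first exact: segment_compact.
  by apply: continuous_in_subspaceT => x; rewrite inE => /ge; exact: cg.
have := @ftc_segment _ (fun x => f1 x - f2 x) f2 a b ab.
move=> H; have {}H : \int[mu]_(x in `[a, b]) (f1 x - f2 x) = f2 b - f2 a.
  apply: H => x /andP[ax _]; first by apply: is_derive_gamma; exact: lt_le_trans ax.
  by apply: cvgB; [apply: cf1|apply: cf2]; exact: lt_le_trans ax.
have mab : measurable `[a, b] by [].
rewrite (LRintB mab (ci _ cf1) (ci _ cf2)) in H.
by rewrite (LRintE mab (ci _ cf1)) (LRintE mab (ci _ cf2)) -EFinD -H; congr EFin; ring.
Unshelve. all: by end_near. Qed.

Lemma GammaE : Gamma (p + 1) = \int[mu]_(t in D) f2 t.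
Proof. by apply: Leq_Rint => t _; rewrite addrK. Qed.

Lemma Gamma_gt0 : 0 < Gamma (p + 1).
Proof.
have g0 : 0 <= Gamma (p + 1).
  by rewrite GammaE; apply: Rintegral_ge0 => t _; exact: f2_ge0.
rewrite lt_neqAle eq_sym g0 andbT; apply/eqP; rewrite GammaE => E.
have := Rint0_ae (m := mu) mD gamma_int (fun x _ => f2_ge0 x) E.
move=> [N [mN N0 hN]].
have DN : D `<=` N.
  move=> x Dx; apply: hN => /(_ Dx) /eqP; rewrite gt_eqF// mulr_gt0 ?expR_gt0//.
  by rewrite powR_gt0// D0.
have : (mu D <= 0)%E by rewrite -N0 le_measure// inE.
by rewrite lebesgue_measure_itv/= ltry.
Qed.

(** With p = lambda + 1 this integrates over the heights [y] the Bergman weight against the factor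
    e^{-2 y xi} left by Plancherel on the line at height [y]. The substitution t = 2 xi y turns it
    into a Gamma integral. *)
Lemma powR_expR_integral (xi : R) : 0 < xi ->
  (\int[mu]_(y in D) ((p / pi * (2 * y) `^ (p - 1)) * expR (- (2 * y) * xi))%:E =
   (Gamma (p + 1) / (2 * pi * xi `^ p))%:E)%E.
Proof.
move=> xi0; have s0 : 0 < 2 * xi by rewrite mulr_gt0.
have G : (\int[mu]_(x in D) (f1 x)%:E = (Gamma (p + 1))%:E)%E.
  by rewrite gamma_ibp GammaE (LRintE mD gamma_int).
have pi0 := pi_gt0 R.
have x0 : 0 < xi `^ p by exact: powR_gt0.
move: G; rewrite (half_line_scale s0 cf1 (fun x _ => f1_ge0 x)) => G.
have iE y : D y -> (p / pi * (2 * y) `^ (p - 1)) * expR (- (2 * y) * xi) =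
    ((2 * pi * xi `^ p)^-1 * (2 * xi)) * f1 (2 * xi * y).
  move=> /D0 y0; rewrite /f1 (_ : 2 * xi * y = xi * (2 * y)); last by ring.
  rewrite !powRM ?mulr_ge0 ?(ltW xi0) ?(ltW y0)// (_ : - (xi * (2 * y)) = - (2 * y) * xi); last by ring.
  rewrite -(@mulr_powRB1 _ xi p (ltW xi0) p0).
  have x1 : xi `^ (p - 1) != 0 by rewrite gt_eqF ?powR_gt0.
  move: (expR _) (2 `^ _) (y `^ _) (xi `^ _) x1 => a b b' c c0.
  have n1 : pi != 0 :> R by rewrite gt_eqF.
  have n2 : xi != 0 by rewrite gt_eqF.
  by move: (pi : R) n1 => P n1; field; rewrite ?c0 ?n1 ?n2.
have f1m : measurable_fun D (fun y => f1 (2 * xi * y)).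
  apply: measurable_continuous_half_line => x xp.
  apply: (@continuous_comp _ _ _ ( *%R (2 * xi)) f1); first exact: mulrl_continuous.
  by apply: cf1; rewrite mulr_gt0.
under eq_integral => y /set_mem Dy do rewrite (iE y Dy) EFinM EFinM -muleA.
have c0 : 0 <= (2 * pi * xi `^ p)^-1 by rewrite invr_ge0 !mulr_ge0 ?pi_ge0 ?powR_ge0.
rewrite ge0_integralZl//=; last 2 first.
- by apply: measurable_funeM; exact/measurable_EFinP.
- by move=> x _; rewrite mule_ge0// lee_fin ?f1_ge0 ?(ltW s0).
rewrite ge0_integralZl//=.
- by rewrite G -EFinM mulrC.
- exact/measurable_EFinP.
- by move=> x _; rewrite lee_fin f1_ge0.
- by rewrite lee_fin ltW.
Qed.

End gamma.

Section plane_norm.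
Context {R : realType}.
Local Notation C := R[i].
Local Notation mu := (@lebesgue_measure R).
Local Notation D := (`]0, +oo[%classic : set R).
Local Notation H := (@half_plane R).
Let mD : measurable D. Proof. by []. Qed.
Implicit Types (Psi : R -> C).

Lemma half_planeE : H = [set: R] `*` D.
Proof. by apply/seteqP; split => [[x y]|[x y] []] /=; rewrite ?in_itv/= ?andbT//; split. Qed.

Lemma measurable_fun_integral d1 d2 (T1 : measurableType d1) (T2 : measurableType d2)
    (m2 : {sigma_finite_measure set T2 -> \bar R}) (D1 : set T1) (D2 : set T2) (f : T1 -> T2 -> R) :
  measurable D1 -> measurable D2 -> measurable_fun (D1 `*` D2) (fun z => f z.1 z.2) ->
  measurable_fun D1 (fun x => \int[m2]_(y in D2) f x y).
Proof.
move=> mD1 mD2 mf; apply: (@measurableT_comp _ _ _ _ _ _ fine) => //.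
have E x : (\int[m2]_(y in D2) (f x y)%:E = \int[m2]_(y in D2) (Num.max (f x y) 0)%:E - \int[m2]_(y in D2) (Num.max (- f x y) 0)%:E)%E.
  rewrite integralE; congr (_ - _)%E; apply: eq_integral => y _.
    by rewrite funeposE EFin_max.
  by rewrite funenegE EFin_max.
rewrite (funext E); apply: emeasurable_funB.
  apply: (measurable_fun_tonelli1 m2 mD1 mD2 (f := fun x y => (Num.max (f x y) 0)%:E)).
    by apply/measurable_EFinP; apply: measurable_maxr => //; exact: measurable_cst.
  by move=> x y _ _; rewrite lee_fin le_max lexx orbT.
apply: (measurable_fun_tonelli1 m2 mD1 mD2 (f := fun x y => (Num.max (- f x y) 0)%:E)).
  by apply/measurable_EFinP; apply: measurable_maxr; [exact: measurable_funN|exact: measurable_cst].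
by move=> x y _ _; rewrite lee_fin le_max lexx orbT.
Qed.

Lemma measurable_laplace Psi : laplace_admissible Psi -> cmeasurable_fun H (laplace Psi \o to_complex).
Proof.
move=> [[m1 m2] _].
have mH : measurable H by exact: measurable_half_plane.
have mr : measurable_fun (H `*` D) (fun z => Re (Psi z.2)).
  exact: (@measurable_snd_on _ _ _ _ _ _ H D (fun xi => Re (Psi xi))).
have mi : measurable_fun (H `*` D) (fun z => Im (Psi z.2)).
  exact: (@measurable_snd_on _ _ _ _ _ _ H D (fun xi => Im (Psi xi))).
have me : measurable_fun (H `*` D) (fun z : (R * R) * R => expR (- z.1.2 * z.2)).
  apply: measurable_funTS; apply: measurableT_comp; first exact: measurable_expR.
  apply: measurable_funM; last exact: measurable_snd.
  apply: measurable_funN; apply: measurableT_comp; [exact: measurable_snd|exact: measurable_fst].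
have mx : measurable_fun setT (fun z : (R * R) * R => z.1.1 * z.2).
  apply: measurable_funM; last exact: measurable_snd.
  apply: measurableT_comp; [exact: measurable_fst|exact: measurable_fst].
have mc : measurable_fun (H `*` D) (fun z : (R * R) * R => cos (z.1.1 * z.2)).
  by apply: measurable_funTS; apply: measurableT_comp => //; exact: measurable_cos.
have ms : measurable_fun (H `*` D) (fun z : (R * R) * R => sin (z.1.1 * z.2)).
  by apply: measurable_funTS; apply: measurableT_comp => //; exact: measurable_sin.
have E (z : (R * R) * R) := laplace_kernelE Psi z.1.1 z.1.2 z.2.
split.
  apply: (@measurable_fun_integral _ _ _ _ mu H D (fun p xi => Re (Psi xi * cexp ((0 +i* 1) * to_complex p * xi%:C)))) => //.
  rewrite (_ : (fun z => _) = (fun z => Re (Psi z.2) * expR (- z.1.2 * z.2) * cos (z.1.1 * z.2)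
    - Im (Psi z.2) * expR (- z.1.2 * z.2) * sin (z.1.1 * z.2))); last by apply/funext => z; exact: (E z).1.
  by mfun.
apply: (@measurable_fun_integral _ _ _ _ mu H D (fun p xi => Im (Psi xi * cexp ((0 +i* 1) * to_complex p * xi%:C)))) => //.
rewrite (_ : (fun z => _) = (fun z => Re (Psi z.2) * expR (- z.1.2 * z.2) * sin (z.1.1 * z.2)
  + Im (Psi z.2) * expR (- z.1.2 * z.2) * cos (z.1.1 * z.2))); last by apply/funext => z; exact: (E z).2.
by mfun.
Qed.

Variable lambda : R.
Hypothesis hlambda : -1 < lambda.

(** Both sides may be infinite, so finiteness passes either way: from the half-line it puts R^* psi
    into the Bergman space, from the half-plane it makes the preimage of a Bergman function square
    integrable. *)
Lemma laplace_plane_norm Psi : laplace_admissible Psi ->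
  (forall y, 0 < y -> sq_int mu D (damped_Re Psi y) /\ sq_int mu D (damped_Im Psi y)) ->
  (\int[plane_measure]_(z in H) (cabs (laplace Psi (to_complex z)) ^+ 2 * bergman_weight lambda z)%:E =
   \int[mu]_(xi in D) (cabs (Psi xi) ^+ 2 * (Gamma (lambda + 2) / xi `^ (lambda + 1)))%:E)%E.
Proof.
move=> aPsi sPsi; have [mL1 mL2] := measurable_laplace aPsi.
have l0 : 0 < lambda + 1 by rewrite -ltrBlDr sub0r.
have w0 (y : R) : 0 <= (lambda + 1) / pi * (2 * y) `^ lambda.
  by rewrite mulr_ge0 ?powR_ge0// divr_ge0 ?pi_ge0 ?ltW.
have mw : measurable_fun setT (fun y : R => (lambda + 1) / pi * (2 * y) `^ lambda).
  apply: measurable_funM; first exact: measurable_cst.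
  by apply: (measurableT_comp (measurable_powR _)); apply: measurable_funM; [exact: measurable_cst|exact: measurable_id].
have mcL : measurable_fun H (fun z => cabs (laplace Psi (to_complex z))).
  by apply: measurable_cabs.
rewrite half_planeE in mcL *.
rewrite (@tonelli_product _ _ _ _ _ mu mu setT D measurableT mD
  (fun x y => (cabs (laplace Psi (x +i* y)) ^+ 2 * bergman_weight lambda (x, y))%:E)); last 2 first.
- apply/measurable_EFinP; apply: measurable_funM; first exact: (measurable_funX 2 mcL).
  by apply: measurable_funTS; apply: (measurableT_comp mw); exact: measurable_snd.
- by move=> x y _ _; rewrite lee_fin mulr_ge0 ?w0// exprn_ge0 ?cabs_ge0.
pose g (y xi : R) := ((2 * pi) * ((lambda + 1) / pi * (2 * y) `^ lambda) * (cabs (Psi xi) ^+ 2 * expR (- (2 * y) * xi)))%:E.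
have mPsi : measurable_fun D (fun xi => cabs (Psi xi) ^+ 2).
  by apply: (measurable_funX 2); apply: measurable_cabs; exact: aPsi.1.
have pi2 : 0 <= 2 * pi :> R by rewrite mulr_ge0 ?pi_ge0.
have mg : measurable_fun (D `*` D) (fun z => g z.1 z.2).
  apply/measurable_EFinP; apply: measurable_funM.
    apply: measurable_funM; first exact: measurable_cst.
    by apply: measurable_funTS; apply: (measurableT_comp mw); exact: measurable_fst.
  apply: measurable_funM; first by apply: (@measurable_snd_on _ _ _ _ _ _ D D (fun xi => cabs (Psi xi) ^+ 2)).
  by apply: measurable_funTS; mfun.
have g0 y xi : D y -> D xi -> (0 <= g y xi)%E.
  by move=> _ _; rewrite /g lee_fin mulr_ge0 ?(mulr_ge0 pi2 (w0 y))// mulr_ge0 ?expR_ge0 ?exprn_ge0 ?cabs_ge0.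
transitivity (\int[mu]_(y in D) \int[mu]_(xi in D) g y xi)%E.
  apply: eq_integral => y; rewrite inE/= in_itv/= andbT => y0.
  have [s1 s2] := sPsi y y0.
  under eq_integral do rewrite mulrC EFinM.
  have mLy : measurable_fun [set: R] (fun x => cabs (laplace Psi (x +i* y))).
    have [c1 c2] := laplace_line_continuous aPsi y0.
    by apply: measurable_cabs; split; exact: continuous_measurable_fun.
  transitivity ((bergman_weight lambda (0, y))%:E * \int[mu]_x (cabs (laplace Psi (x +i* y)) ^+ 2)%:E)%E.
    have m0 : measurable_fun [set: R] (fun x : R => (cabs (laplace Psi (x +i* y)) ^+ 2)%:E).
      by apply/measurable_EFinP; exact: (measurable_funX 2 mLy).
    have p0 (x : R) : [set: R] x -> (0%:E <= (cabs (laplace Psi (x +i* y)) ^+ 2)%:E)%E.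
      by move=> _; rewrite lee_fin exprn_ge0 ?cabs_ge0.
    have k0 : (0 <= (bergman_weight lambda (0, y))%:E)%E by rewrite lee_fin; exact: w0.
    have K := @ge0_integralZl _ _ _ mu setT measurableT _ m0 (bergman_weight lambda (0, y))%:E p0 k0.
    exact: K.
  rewrite laplace_line_plancherel// muleA -EFinM /g.
  under [RHS]eq_integral do rewrite EFinM.
  rewrite ge0_integralZl//=.
  - by rewrite [in RHS]mulrC.
  - by apply/measurable_EFinP; apply: measurable_funM => //; mfun.
  - by move=> xi _; rewrite lee_fin mulr_ge0 ?expR_ge0 ?exprn_ge0 ?cabs_ge0.
  - by rewrite lee_fin (mulr_ge0 pi2 (w0 y)).
rewrite (@tonelli_on _ _ _ _ _ mu mu D D mD mD g mg g0).
apply: eq_integral => xi; rewrite inE/= in_itv/= andbT => xi0.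
pose k (y : R) := ((lambda + 1) / pi * (2 * y) `^ (lambda + 1 - 1)) * expR (- (2 * y) * xi).
have kE y : g y xi = ((2 * pi * cabs (Psi xi) ^+ 2)%:E * (k y)%:E)%E.
  by rewrite /g /k addrK -EFinM; congr EFin; move: (expR _) (_ `^ _) => a b; ring.
under eq_integral do rewrite kE.
have mk : measurable_fun D k.
  by rewrite /k addrK; apply: measurable_funTS; apply: measurable_funM => //; mfun.
rewrite ge0_integralZl//=; last 3 first.
- exact/measurable_EFinP.
- by move=> y _; rewrite lee_fin /k addrK mulr_ge0 ?expR_ge0.
- by rewrite lee_fin mulr_ge0// exprn_ge0 ?cabs_ge0.
rewrite (powR_expR_integral l0 xi0) -EFinM; congr EFin.
rewrite (_ : lambda + 1 + 1 = lambda + 2); last by ring.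
have x0 : xi `^ (lambda + 1) != 0 by rewrite gt_eqF ?powR_gt0.
have p0 : pi != 0 :> R by rewrite gt_eqF ?pi_gt0.
by move: (_ `^ _) x0 (pi : R) p0 (Gamma _) => a a0 P p0 b; field; rewrite ?a0 ?p0.
Qed.

End plane_norm.

(** Otherwise the integral would be at least K m(A), which is infinite. It serves with a finite
    threshold on a set of infinite measure, and with K = +oo on a set of finite positive measure. *)
Lemma exists_lt_integral d (T : measurableType d) (R : realType) (m : {measure set T -> \bar R})
    (A : set T) (g : T -> \bar R) (K : \bar R) : measurable A -> measurable_fun A g ->
  (forall x, A x -> (0 <= g x)%E) -> (0 <= K)%E -> (\int[m]_(x in A) g x < +oo)%E ->
  (K * m A = +oo)%E -> exists2 x, A x & (g x < K)%E.
Proof.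
move=> mA mg g0 K0 gy KA; apply: contrapT => /forall2NP h.
suff : (+oo <= \int[m]_(x in A) g x)%E by rewrite leye_eq => /eqP E; rewrite E ltxx in gy.
rewrite -KA -integral_cst//; apply: ge0_le_integral => //.
by move=> x Ax; have [] := h x => // /negP; rewrite -leNgt.
Qed.

(** * Duality for the trigonometric transforms *)

Section dual_representation.
Context {R : realType}.
Local Notation mu := (@lebesgue_measure R).
Local Notation D := (`]0, +oo[%classic : set R).
Local Notation Tc := (trig_transform (@cos R)).
Local Notation Ts := (trig_transform (@sin R)).
Let mD : measurable D. Proof. by []. Qed.

Lemma sq_int_trig u : L1_L2 u -> sq_int mu D (Tc u) /\ sq_int mu D (Ts u).
Proof.
move=> u12; have mc := measurable_trig_transform measurable_cos (@cos_max R) u12.1.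
have ms := measurable_trig_transform measurable_sin (@sin_max R) u12.1.
have [i _] := energy_bound u12.
split; split => //; apply: (Lintegrable_dominated mD _ i).
- exact: (measurable_funX 2 mc).
- by move=> x _; rewrite ger0_norm ?sqr_ge0// lerDl sqr_ge0.
- exact: (measurable_funX 2 ms).
- by move=> x _; rewrite ger0_norm ?sqr_ge0// lerDr sqr_ge0.
Qed.

(** [chi] plays the part of the adjoint transform of the pair (a, b), whose defining integral need
    not converge since [a] and [b] are only square integrable. The Riesz theorem provides it,
    [energy_bound] giving continuity. *)
Lemma dual_representation (a b : R -> R) : sq_int mu D a -> sq_int mu D b ->
  exists chi, sq_int mu D chi /\ forall u, L1_L2 u ->
    \int[mu]_(x in D) (a x * Tc u x + b x * Ts u x) = \int[mu]_(x in D) (u x * chi x).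
Proof.
move=> sa sb.
have g0 x : D x -> 0 < expR (- 1 * x) :> R by move=> _; exact: expR_gt0.
have sg0 : sq_int mu D (fun x => expR (- 1 * x)).
  have [] // := @bounded_L1_L2 R (fun x => expR (- 1 * x)) 1; first by mfun.
  by move=> x _; rewrite mul1r ger0_norm ?expR_ge0.
have il u : L1_L2 u -> mu.-integrable D (EFin \o (fun x => a x * Tc u x)) /\
   mu.-integrable D (EFin \o (fun x => b x * Ts u x)).
  by move=> /sq_int_trig[h1 h2]; split; exact: (Lsq_int_mul mD).
pose l u := \int[mu]_(x in D) (a x * Tc u x + b x * Ts u x).
have lin (k : R) (f g : R -> R) : L1_L2 f -> L1_L2 g -> L1_L2 (fun x => k * f x + g x) /\
    l (fun x => k * f x + g x) = k * l f + l g.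
  move=> f12 g12; split; first exact: L1_L2_lin.
  have [f1 f2] := il _ f12; have [g1 g2] := il _ g12.
  rewrite /l -(LRintZ mD k (LrintD mD f1 f2)) -(LRintD mD (LrintZ mD k (LrintD mD f1 f2)) (LrintD mD g1 g2)).
  apply: Leq_Rint => x _.
  rewrite (trig_transformD measurable_cos (@cos_max R) k x f12.1 g12.1).
  rewrite (trig_transformD measurable_sin (@sin_max R) k x f12.1 g12.1).
  by move: (Tc f x) (Ts f x) (Tc g x) (Ts g x) => *; ring.
pose N := \int[mu]_(x in D) (a x ^+ 2 + b x ^+ 2).
have iN : mu.-integrable D (EFin \o (fun x => a x ^+ 2 + b x ^+ 2)) by exact: (LrintD mD sa.2 sb.2).
have N0 : 0 <= N by apply: Rintegral_ge0 => x _; rewrite addr_ge0 ?sqr_ge0.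
have lb f : L1_L2 f -> l f ^+ 2 <= (N * pi) * \int[mu]_(x in D) f x ^+ 2.
  move=> f12; have [iE bE] := energy_bound f12; have [f1 f2] := il _ f12.
  (* Cauchy-Schwarz for pairs: the functional pairs (a, b), of squared norm [N], with the two
     transforms of [f], of squared norm [energy f f], itself at most pi times that of [f]. *)
  rewrite -mulrA; apply: (@le_trans _ _ (N * energy f f)); last exact: ler_wpM2l.
  apply: quadratic_ge0 => //; first exact: energy_ge0.
  move=> t; rewrite /energy -mulrnAl.
  have iE' := energy_int f12 f12.
  rewrite -(LRintZ mD _ (LrintD mD f1 f2)) -(LRintZ mD _ iE').
  have i3 := LrintD mD iN (LrintZ mD (t *+ 2) (LrintD mD f1 f2)).
  rewrite -(LRintD mD iN (LrintZ mD (t *+ 2) (LrintD mD f1 f2))) -(LRintD mD i3 (LrintZ mD (t ^+ 2) iE')).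
  apply: Rintegral_ge0 => x _.
  rewrite (_ : _ + _ + _ = (a x + t * Tc f x) ^+ 2 + (b x + t * Ts f x) ^+ 2).
    by rewrite addr_ge0 ?sqr_ge0.
  by move: (a x) (b x) (Tc f x) (Ts f x) => p q r s; rewrite mulr2n; ring.
have bnd (f : R -> R) (M : R) : measurable_fun D f ->
  (forall x, D x -> `|f x| <= M * expR (- 1 * x)) -> L1_L2 f by exact: bounded_L1_L2.
exact: (@riesz _ _ _ mu D mD _ g0 sg0 L1_L2 l _ (fun f h => h.2) bnd lin lb).
Qed.

End dual_representation.

Section segments.
Context {R : realType}.
Local Notation mu := (@lebesgue_measure R).
Local Notation D := (`]0, +oo[%classic : set R).
Let mD : measurable D. Proof. by []. Qed.

Lemma continuous_segment_integrable (g : R -> R) (a b : R) : continuous g ->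
  mu.-integrable `[a, b] (EFin \o g).
Proof.
move=> cg; apply: continuous_compact_integrable; first exact: segment_compact.
exact: continuous_subspaceT.
Qed.

Lemma segment_split (g : R -> R) (X Y : R) : continuous g -> 0 < X -> 0 < Y ->
  \int[mu]_(x in `[- Y, X]) g x = \int[mu]_(x in `[0, X]) g x + \int[mu]_(x in `[0, Y]) g (- x).
Proof.
move=> cg X0 Y0.
have iYX := @continuous_segment_integrable g (- Y) X cg.
have := @Rintegral_itvB R g (BLeft (- Y)) (BRight X) 0 iYX.
rewrite !bnd_simp oppr_le0 (ltW X0) (ltW Y0) => /(_ isT isT).
have -> : \int[mu]_(x in `]0, X]) g x = \int[mu]_(x in `[0, X]) g x.
  apply: Rintegral_itv_obnd_cbnd.
  by apply: integrableS (continuous_segment_integrable 0 X cg) => //; exact: subset_itv_oc_cc.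
have -> : \int[mu]_(x in `[- Y, 0]) g x = \int[mu]_(x in `[0, Y]) g (- x).
  rewrite /Rintegral -[in LHS]oppr0 integration_by_substitution_oppr ?ltW//.
  exact: continuous_subspaceT.
by move=> /eqP; rewrite subr_eq => /eqP.
Qed.

Lemma half_line_limit (g : R -> R) (X : nat -> R) : mu.-integrable D (EFin \o g) ->
  (forall n, n%:R <= X n) -> \int[mu]_(x in `[0, X n]) g x @[n --> \oo] --> \int[mu]_(x in D) g x.
Proof.
move=> ig Xn.
have mg := Lrint_measurable ig.
pose A n := `]0, X n]%classic : set R.
have AD n : A n `<=` D by move=> x; rewrite /A /= !in_itv/= andbT => /andP[].
have mA n : measurable (A n) by exact: measurable_itv.
have E n : \int[mu]_(x in `[0, X n]) g x = \int[mu]_(x in D) (g \_ (A n)) x.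
  rewrite -Rintegral_mkcondr (setIidr (AD n)).
  apply/esym; apply: Rintegral_itv_obnd_cbnd.
  have K : mu.-integrable (A n) (EFin \o g) by apply: integrableS ig; [exact: mD|exact: mA|exact: AD].
  exact: K.
rewrite (funext E).
refine (proj2 (@Rdct _ _ _ mu D mD (fun n => g \_ (A n)) g (fun x => `|g x|) _ (Lrintabs ig) _ _)).
- move=> n; apply/(measurable_restrict g (mA n) mD).
  by rewrite (setIidr (AD n)); exact: (measurable_funS mD (AD n) mg).
- by move=> n x _; rewrite patchE; case: ifP => _ //; rewrite normr0.
- move=> x; rewrite /= in_itv/= andbT => x0; apply: cvg_near_cst.
  near=> n; rewrite patchE mem_set// /A/= in_itv/= x0 (le_trans _ (Xn n))//.
  by near: n; exact: nbhs_infty_ger.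
Unshelve. all: by end_near. Qed.

End segments.

(** * Cauchy's formula in the half-plane *)

Section bergman_slices.
Context {R : realType}.
Local Notation C := R[i].
Local Notation mu := (@lebesgue_measure R).
Local Notation D := (`]0, +oo[%classic : set R).
Local Notation H := (@half_plane R).
Let mD : measurable D. Proof. by []. Qed.
Variable lambda : R.
Hypothesis hlambda : -1 < lambda.
Variable f : C -> C.
Hypothesis fa : forall z : C, 0 < Im z -> analytic_at (f : (C : numFieldType) -> (C : numFieldType)) z.
Hypothesis f2 : csquare_integrable plane_measure half_plane (bergman_weight lambda) (f \o to_complex).
Local Notation F x y := (cabs (f (x +i* y)) ^+ 2).
Local Notation w y := ((lambda + 1) / pi * (2 * y) `^ lambda).

Let l0 : 0 < lambda + 1. Proof. by rewrite -ltrBlDr sub0r. Qed.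
Let w0 (y : R) : 0 <= w y.
Proof. by rewrite mulr_ge0 ?powR_ge0// divr_ge0 ?pi_ge0 ?ltW. Qed.
Let F0 (x y : R) : 0 <= F x y. Proof. by rewrite exprn_ge0 ?cabs_ge0. Qed.

Lemma measurable_weight : measurable_fun setT (fun y : R => w y).
Proof.
apply: measurable_funM; first exact: measurable_cst.
by apply: (measurableT_comp (measurable_powR _)); apply: measurable_funM; [exact: measurable_cst|exact: measurable_id].
Qed.

Definition slice (y : R) : \bar R := (\int[mu]_x (F x y)%:E)%E.

Let mF : measurable_fun ([set: R] `*` D) (fun z : R * R => F z.1 z.2).
Proof.
rewrite -half_planeE; apply: (measurable_funX 2); apply: (@measurable_cabs _ _ _ _ (fun z : R * R => f (z.1 +i* z.2))).
exact: f2.1.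
Qed.

Let mFw : measurable_fun ([set: R] `*` D) (fun z : R * R => (w z.2 * F z.1 z.2)%:E).
Proof.
apply/measurable_EFinP; apply: measurable_funM => //.
by apply: measurable_funTS; apply: (measurableT_comp measurable_weight); exact: measurable_snd.
Qed.

Lemma slice_ge0 y : (0 <= slice y)%E.
Proof. by apply: integral_ge0 => x _; rewrite lee_fin. Qed.

Lemma measurable_line y : 0 < y -> measurable_fun setT (fun x : R => F x y).
Proof.
move=> y0; apply: (@measurable_comp _ _ _ _ _ _ ([set: R] `*` D) (fun z => F z.1 z.2) _ (fun x : R => (x, y))) => //.
- by apply: measurableX.
- by move=> _ [x _ <-]; split => //=; rewrite in_itv/= y0.
Qed.

Lemma weighted_slice y : 0 < y -> (\int[mu]_x (w y * F x y)%:E = (w y)%:E * slice y)%E.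
Proof.
move=> y0; under eq_integral do rewrite EFinM.
have m0 : measurable_fun [set: R] (fun x : R => (F x y)%:E) by apply/measurable_EFinP; exact: measurable_line.
have k0 : (0 <= (w y)%:E)%E by rewrite lee_fin; exact: w0.
have p0 (x : R) : [set: R] x -> (0%:E <= (F x y)%:E)%E by rewrite lee_fin.
exact: (@ge0_integralZl _ _ _ mu setT measurableT _ m0 (w y)%:E p0 k0).
Qed.

Lemma measurable_slice : measurable_fun D slice.
Proof.
apply: (measurable_fun_tonelli1 mu mD measurableT (f := fun y x => (F x y)%:E)).
  apply: (@measurable_comp _ _ _ _ _ _ ([set: R] `*` D) (fun z : R * R => (F z.1 z.2)%:E) _ (@unstable.swap R R)) => //.
  - exact: measurableX.
  - by move=> _ [[x y] [/= xD yD] <-].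
  - by apply/measurable_EFinP.
  - by apply: measurable_funTS; exact: measurable_swap.
by move=> y x _ _; rewrite lee_fin.
Qed.

Lemma slices_lty : (\int[mu]_(y in D) ((w y)%:E * slice y) < +oo)%E /\
  measurable_fun D (fun y => (w y)%:E * slice y)%E.
Proof.
have := f2.2; rewrite half_planeE.
under eq_integral => z _ do rewrite -cabs_sqr mulrC.
rewrite (@tonelli_product _ _ _ _ _ mu mu setT D measurableT mD (fun x y => (w y * F x y)%:E) mFw); last first.
  by move=> x y _ _; rewrite lee_fin mulr_ge0.
move=> h; split.
  apply: le_lt_trans h; rewrite le_eqVlt; apply/orP; left; apply/eqP.
  by apply: eq_integral => y; rewrite inE/= in_itv/= andbT => y0; rewrite weighted_slice.
apply: emeasurable_funM; last exact: measurable_slice.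
by apply/measurable_EFinP; apply: measurable_funTS; exact: measurable_weight.
Qed.

(** Up to the constant, the weight times [y] is (2 y)^{lambda+1}, and lambda + 1 > 0. The weight
    itself may decay, so it is bounded below only after this multiplication. *)
Lemma weight_lower (y : R) : 1 <= y -> (lambda + 1) / (2 * pi) <= w y * y.
Proof.
move=> y1; have y0 : 0 < y by exact: lt_le_trans y1.
have := @mulr_powRB1 _ (2 * y) (lambda + 1) (mulr_ge0 (ler0n R 2) (ltW y0)) l0; rewrite addrK => E.
have -> : w y * y = (lambda + 1) / (2 * pi) * (2 * y) `^ (lambda + 1).
  rewrite -E; have p0 : pi != 0 :> R by rewrite gt_eqF ?pi_gt0.
  by move: (_ `^ _) (pi : R) p0 => a P p0; field; rewrite ?p0.
apply: ler_peMr.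
  by rewrite divr_ge0 ?mulr_ge0 ?pi_ge0// ltW.
have e1 : 1 `^ (lambda + 1) = 1 :> R by rewrite powR1.
rewrite -[X in X <= _]e1; apply: ge0_ler_powR; rewrite ?nnegrE//; first exact: ltW.
  by rewrite mulr_ge0// ltW.
by rewrite (le_trans y1)// mulr_natl mulr2n lerDl ltW.
Qed.

(** If the slices beyond [Y] were all at least [d y], the weighted slices would be bounded below by
    a positive constant and could not be integrable. A slice of size o(y) is what the top edge of
    the contour requires. *)
Lemma small_slice_exists (Y d : R) : 0 < d -> exists2 y, Y < y & (slice y < (d * y)%:E)%E.
Proof.
move=> d0; pose Y1 := Num.max Y 1.
have [sl ms] := slices_lty.
pose A := `]Y1, +oo[%classic : set R.
have mA : measurable A by exact: measurable_itv.
have Y11 : 1 <= Y1 by rewrite le_max lexx orbT.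
have AD : A `<=` D.
  move=> y; rewrite /A/= !in_itv/= !andbT; apply: lt_trans; exact: lt_le_trans Y11.
pose K := d * ((lambda + 1) / (2 * pi)).
have K0 : 0 < K by rewrite mulr_gt0// divr_gt0// mulr_gt0// pi_gt0.
have [y Ay h] : exists2 y, A y & ((w y)%:E * slice y < K%:E)%E.
  apply: (@exists_lt_integral _ _ _ mu) => //.
  - exact: measurable_funS ms.
  - by move=> y _; rewrite mule_ge0 ?slice_ge0// lee_fin.
  - by rewrite lee_fin ltW.
  - by apply: le_lt_trans sl; apply: ge0_subset_integral => // y _; rewrite mule_ge0 ?slice_ge0// lee_fin.
  - have muA : (@lebesgue_measure R) `]Y1, +oo[%classic = +oo%E by rewrite lebesgue_measure_itv/= ltry.
    transitivity (K%:E * +oo)%E; first by congr (_ * _)%E; exact: muA.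
    by rewrite gt0_muley// lte_fin.
move: Ay; rewrite /A/= in_itv/= andbT gt_max => /andP[Yy y1].
exists y => //; rewrite ltNge; apply/negP => h2.
have y0 : 0 < y by exact: lt_trans y1.
move: h; rewrite ltNge => /negP; apply.
apply: (@le_trans _ _ ((w y)%:E * (d * y)%:E)%E).
  rewrite -EFinM lee_fin /K [X in _ <= X]mulrCA; apply: ler_wpM2l; first exact: ltW.
  exact: weight_lower (ltW y1).
by rewrite lee_wpmul2l// lee_fin.
Qed.

(** The weighted slices are integrable on ]0, e[, where the weight is positive, so they are not all
    infinite. Such heights close to the real axis are what the gluing in [paley_wiener] descends
    along. *)
Lemma finite_slice_exists (e : R) : 0 < e -> exists2 y, 0 < y < e & (slice y < +oo)%E.
Proof.
move=> e0.
have [sl ms] := slices_lty.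
pose A := `]0, e[%classic : set R.
have mA : measurable A by exact: measurable_itv.
have AD : A `<=` D by move=> y; rewrite /A/= !in_itv/= !andbT => /andP[].
have [y Ay h] : exists2 y, A y & ((w y)%:E * slice y < +oo)%E.
  apply: (@exists_lt_integral _ _ _ mu) => //.
  - exact: measurable_funS ms.
  - by move=> y _; rewrite mule_ge0 ?slice_ge0// lee_fin.
  - by apply: le_lt_trans sl; apply: ge0_subset_integral => // y _; rewrite mule_ge0 ?slice_ge0// lee_fin.
  - have muA : (@lebesgue_measure R) `]0, e[%classic = e%:E by rewrite lebesgue_measure_itv/= lte_fin e0 oppr0 adde0.
    transitivity (+oo * e%:E)%E; first by congr (_ * _)%E; exact: muA.
    by rewrite gt0_mulye// lte_fin.
move: Ay; rewrite /A/= in_itv/= => ye; exists y => //.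
have y0 : 0 < y by have /andP[] := ye.
have wy : 0 < w y.
  by apply: mulr_gt0; [exact: divr_gt0 l0 (pi_gt0 R)|rewrite powR_gt0// mulr_gt0].
by rewrite ltey; apply/eqP => E; move: h; rewrite E gt0_muley.
Qed.

Variables y0 y1 : R.
Hypotheses (y00 : 0 < y0) (y01 : y0 < y1).

Definition vertical_mass (x : R) : \bar R := (\int[mu]_(y in `[y0, y1]) (F x y)%:E)%E.

Let B : set R := `[y0, y1]%classic.
Let BD : B `<=` D.
Proof. by move=> y; rewrite /B/= !in_itv/= andbT => /andP[h _]; exact: lt_le_trans h. Qed.
Let mB : measurable B. Proof. exact: measurable_itv. Qed.

Let mFB : measurable_fun ([set: R] `*` B) (fun z : R * R => (F z.1 z.2)%:E).
Proof.
apply/measurable_EFinP; apply: measurable_funS mF; first exact: measurableX.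
by move=> [x y] [? ?]; split => //; exact: BD.
Qed.

Lemma vertical_mass_lty : (\int[mu]_x vertical_mass x < +oo)%E /\ measurable_fun setT vertical_mass.
Proof.
split; last first.
  apply: (measurable_fun_tonelli1 mu measurableT mB (f := fun x y => (F x y)%:E)); first exact: mFB.
  by move=> x y _ _; rewrite lee_fin.
rewrite (@tonelli_on _ _ _ _ _ mu mu setT B measurableT mB (fun x y => (F x y)%:E) mFB); last first.
  by move=> x y _ _; rewrite lee_fin.
have [sl ms] := slices_lty.
(* The power (2 y)^lambda is written as (2 y)^{lambda+1} / (2 y), with the numerator taken at [y0]
   and the denominator at [y1]. This lower bound is valid whatever the sign of [lambda]. *)
pose c := (lambda + 1) / pi * ((2 * y0) `^ (lambda + 1) / (2 * y1)).
have y10 : 0 < y1 by exact: lt_trans y01.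
have c0 : 0 < c.
  by apply: mulr_gt0; [exact: divr_gt0 l0 (pi_gt0 R)|rewrite divr_gt0 ?powR_gt0 ?mulr_gt0].
have wc y : B y -> c <= w y.
  rewrite /B/= in_itv/= => /andP[h1 h2].
  have yp : 0 < y by exact: lt_le_trans h1.
  rewrite ler_wpM2l ?divr_ge0 ?pi_ge0 ?(ltW l0)// ler_pdivrMr ?mulr_gt0//.
  have := @mulr_powRB1 _ (2 * y) (lambda + 1) (mulr_ge0 (ler0n R 2) (ltW yp)) l0; rewrite addrK => E.
  apply: (@le_trans _ _ ((2 * y) `^ (lambda + 1))).
    by apply: ge0_ler_powR; rewrite ?nnegrE ?mulr_ge0 ?(ltW l0) ?(ltW y00) ?(ltW yp)// ler_pM2l.
  by rewrite -E mulrC ler_wpM2l ?powR_ge0// ler_pM2l.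
have H : (c%:E * \int[mu]_(y in B) slice y < +oo)%E.
  have ms' : measurable_fun B slice by exact: (measurable_funS mD BD measurable_slice).
  rewrite -ge0_integralZl//; last 2 first.
  - by move=> y _; exact: slice_ge0.
  - by rewrite lee_fin ltW.
  apply: (@le_lt_trans _ _ (\int[mu]_(y in B) ((w y)%:E * slice y))%E).
    apply: ge0_le_integral => //.
    - by move=> y _; rewrite mule_ge0 ?slice_ge0// lee_fin ltW.
    - exact: measurable_funeM.
    - exact: measurable_funS ms.
    - by move=> y By; rewrite lee_wpmul2r ?slice_ge0// lee_fin wc.
  by apply: le_lt_trans sl; apply: ge0_subset_integral => // y _; rewrite mule_ge0 ?slice_ge0// lee_fin.
rewrite ltey; apply/eqP => E; move: H; rewrite [X in (_ * X)%E](_ : _ = +oo%E)//.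
by rewrite gt0_muley// lte_fin.
Qed.

(** The vertical masses are integrable over the line, so they cannot remain at least 1 on a
    half-line. *)
Lemma small_vertical_exists (X : R) : exists2 x, X < x & (vertical_mass x < 1)%E.
Proof.
have [sl ms] := vertical_mass_lty.
pose A := `]X, +oo[%classic : set R.
have [x Ax h] : exists2 x, A x & (vertical_mass x < 1)%E.
  apply: (@exists_lt_integral _ _ _ mu) => //.
  - exact: measurable_itv.
  - exact: measurable_funTS.
  - by move=> x _; apply: integral_ge0 => y _; rewrite lee_fin.
  - apply: le_lt_trans sl; apply: ge0_subset_integral => //; first exact: measurable_itv.
    by move=> x _; apply: integral_ge0 => y _; rewrite lee_fin.
  - have muA : (@lebesgue_measure R) `]X, +oo[%classic = +oo%E by rewrite lebesgue_measure_itv/= ltry.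
    transitivity ((1 : \bar R) * +oo)%E; first by congr (_ * _)%E; exact: muA.
    by rewrite mul1e.
by exists x => //; move: Ax; rewrite /A/= in_itv/= andbT.
Qed.

Lemma small_vertical_exists_neg (X : R) : exists2 x, X < x & (vertical_mass (- x) < 1)%E.
Proof.
have [sl ms] := vertical_mass_lty.
pose A := `]-oo, (- X)[%classic : set R.
have [x Ax h] : exists2 x, A x & (vertical_mass x < 1)%E.
  apply: (@exists_lt_integral _ _ _ mu) => //.
  - exact: measurable_itv.
  - exact: measurable_funTS.
  - by move=> x _; apply: integral_ge0 => y _; rewrite lee_fin.
  - apply: le_lt_trans sl; apply: ge0_subset_integral => //; first exact: measurable_itv.
    by move=> x _; apply: integral_ge0 => y _; rewrite lee_fin.
  - have muA : (@lebesgue_measure R) `]-oo, (- X)[%classic = +oo%E by rewrite lebesgue_measure_itv/= ltNyr.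
    transitivity ((1 : \bar R) * +oo)%E; first by congr (_ * _)%E; exact: muA.
    by rewrite mul1e.
exists (- x); last by rewrite opprK.
by move: Ax; rewrite /A/= in_itv/= ltrNr.
Qed.

End bergman_slices.

Section strict_lines.
Context {R : realType}.
Local Notation C := R[i].
Variables (h c : C -> C) (m : R).
Hypothesis hc : forall z, m < Im z -> sderiv h z (c z).

Lemma strict_horizontal_continuous (k : C) (y : R) : m < y -> continuous (fun x : R => Re (k * h (x +i* y))).
Proof.
move=> my; apply: (@continuous_is_derive _ _ (fun x : R => Re (k * c (x +i* y) * 1))) => x.
apply: (@sderiv_path _ (fun z => k * h z) (fun x => x +i* y)); last by apply: sderivZ; exact: hc.
by move=> s s'; apply/eqP; rewrite eq_complex/=; apply/andP; split; apply/eqP; ring.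
Qed.

Lemma strict_vertical_continuous (k : C) (x y : R) : m < y -> {for y, continuous (fun y : R => Re (k * h (x +i* y)))}.
Proof.
move=> my; apply: differentiable_continuous; apply/derivable1_diffP.
suff [] : is_derive y (1:R) (fun y => Re (k * h (x +i* y))) (Re (k * c (x +i* y) * (0 +i* 1))) by [].
apply: (@sderiv_path _ (fun z => k * h z) (fun y => x +i* y)); last by apply: sderivZ; exact: hc.
by move=> s s'; apply/eqP; rewrite eq_complex/=; apply/andP; split; apply/eqP; ring.
Qed.

Lemma cabs_sqrE (z : C) : cabs z ^+ 2 = Re (1 * z) ^+ 2 + Re ((0 -i* 1) * z) ^+ 2.
Proof. by rewrite cabs_sqr; case: z => a b /=; ring. Qed.

Lemma cabs_horizontal_continuous (y : R) : m < y -> continuous (fun x : R => cabs (h (x +i* y)) ^+ 2).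
Proof.
move=> my; under eq_fun do rewrite cabs_sqrE !expr2.
have c1 := @strict_horizontal_continuous 1 y my; have c2 := @strict_horizontal_continuous (0 -i* 1) y my.
by move=> x; apply: cvgD; [apply: (cvgM (c1 x) (c1 x))|apply: (cvgM (c2 x) (c2 x))].
Qed.

Lemma cabs_vertical_continuous (x y : R) : m < y -> {for y, continuous (fun y : R => cabs (h (x +i* y)) ^+ 2)}.
Proof.
move=> my; have -> : (fun y : R => cabs (h (x +i* y)) ^+ 2) = fun y : R =>
    Re (1 * h (x +i* y)) * Re (1 * h (x +i* y)) + Re ((0 -i* 1) * h (x +i* y)) * Re ((0 -i* 1) * h (x +i* y)).
  by apply/funext => t; rewrite cabs_sqrE !expr2.
have c1 := @strict_vertical_continuous 1 x y my; have c2 := @strict_vertical_continuous (0 -i* 1) x y my.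
by apply: cvgD; [apply: (cvgM c1 c1)|apply: (cvgM c2 c2)].
Qed.

End strict_lines.

Lemma norm_Rintegral_le d (T : measurableType d) (R : realType) (m : {measure set T -> \bar R})
    (A : set T) (g G : T -> R) : measurable A -> m.-integrable A (EFin \o g) -> m.-integrable A (EFin \o G) ->
  (forall x, A x -> `|g x| <= G x) -> `|\int[m]_(x in A) g x| <= \int[m]_(x in A) G x.
Proof.
move=> mA ig iG gG; rewrite (le_trans (le_normr_Rintegral mA ig))//.
by apply: le_Rintegral => //; exact: rintabs.
Qed.

Lemma Rintegral_le_ereal d (T : measurableType d) (R : realType) (m : {measure set T -> \bar R})
    (A : set T) (g : T -> R) (K : R) : measurable A -> m.-integrable A (EFin \o g) ->
  (\int[m]_(x in A) (g x)%:E <= K%:E)%E -> \int[m]_(x in A) g x <= K.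
Proof. by move=> mA ig; rewrite (RintE mA ig) lee_fin. Qed.

Notation Lnorm_Rintegral_le := (norm_Rintegral_le (m := lebesgue_measure)) (only parsing).
Notation LRintegral_le_ereal := (Rintegral_le_ereal (m := lebesgue_measure)) (only parsing).

Section cauchy_half_plane.
Context {R : realType}.
Local Notation C := R[i].
Local Notation mu := (@lebesgue_measure R).
Local Notation D := (`]0, +oo[%classic : set R).
Let mD : measurable D. Proof. by []. Qed.
Variable f : C -> C.
Hypothesis fa : forall z : C, 0 < Im z -> analytic_at (f : (C : numFieldType) -> (C : numFieldType)) z.
Variables (y0 : R) (w : C).
Hypotheses (y00 : 0 < y0) (y0w : y0 < Im w).
Hypothesis small_slices : forall Y d : R, 0 < d -> exists2 y, Y < y & (slice f y < (d * y)%:E)%E.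
Hypothesis small_verticals : forall y1 : R, y0 < y1 -> forall X : R,
  (exists2 x, X < x & (vertical_mass f y0 y1 x < 1)%E) /\
  (exists2 x, X < x & (vertical_mass f y0 y1 (- x) < 1)%E).
Hypothesis slice_y0 : (slice f y0 < +oo)%E.

(* The reflection of [w] in the line [Im z = y0]; it lies below the contours, and
   [1 / (z - w) - 1 / (z - w')] is [O(|z|^-2)] with an explicit integral on the line. *)
Let w' : C := Re w +i* (2 * y0 - Im w).
Let A : R := cabs (f w) * cabs (w - w').
Let A0 : 0 <= A. Proof. by rewrite mulr_ge0 ?cabs_ge0. Qed.

(* [f z / (z - w)] with its pole at [w] removed by subtracting
   [f w * (1 / (z - w) - 1 / (z - w'))], so that Cauchy's theorem on rectangles
   around [w] applies without indentation. *)
Definition cauchy_kernel_fun (k0 : C) (z : C) : C :=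
  (if z == w then k0 else (f z - f w) / (z - w)) + f w * (z - w')^-1.

(** At [w] strict differentiability comes from [analytic_quotient], elsewhere from the quotient of
    functions. The height 2 y0 - Im w is that of the reflected pole [w'], which stays below the
    domain. *)
Lemma cauchy_kernel_sderiv : exists k0 (c : C -> C), forall z, Num.max 0 (2 * y0 - Im w) < Im z ->
  sderiv (cauchy_kernel_fun k0) z (c z).
Proof.
have w0 : 0 < Im w by exact: lt_trans y0w.
have [k0 [cw hw]] := analytic_quotient (fa w0).
exists k0.
suff : forall z, exists c : C, Num.max 0 (2 * y0 - Im w) < Im z -> sderiv (cauchy_kernel_fun k0) z c.
  by move=> /choice[c hc]; exists c.
move=> z; have [zm|] := boolP (Num.max 0 (2 * y0 - Im w) < Im z); last by exists 0.
move: zm; rewrite gt_max => /andP[z0 zw'].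
have zw'0 : z != w' by apply: contraTneq zw' => ->; rewrite /w'/= ltxx.
have d2 := sderivZ (f w) (sderiv_inv zw'0).
have [zw|zw] := eqVneq z w.
  by subst z; eexists => _; exact: (sderivD hw d2).
have [c1 d1] := analytic_sderiv (fa z0).
have d3 := sderivM (sderivB d1 (sderiv_cst (f w) z)) (sderiv_inv zw).
eexists => _; apply: (sderivD _ d2); apply: sderiv_eq d3.
exists (cabs (z - w)); first by rewrite cabs_gt0 subr_eq0.
move=> x; case: eqVneq => // ->; by rewrite cabs_sym ltxx.
Qed.

Lemma cauchy_kernelE k0 z : z != w -> z != w' ->
  cauchy_kernel_fun k0 z = f z / (z - w) - f w * ((w - w') / ((z - w) * (z - w'))).
Proof.
move=> zw zw'; rewrite /cauchy_kernel_fun (negbTE zw).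
have n1 : z - w != 0 by rewrite subr_eq0.
have n2 : z - w' != 0 by rewrite subr_eq0.
by field; rewrite n1 n2.
Qed.

(** |f(z)| / |z - w| is split by the inequality of means with a free parameter [t], fitted to each
    edge: 1 / (e y1) on the top, the inverse distance on the sides, 1 on the base. In the
    correction, |z - w| <= |z - w'| because [z] lies on the side of [w] of the mirror line. *)
Lemma cauchy_kernel_bound k0 (t : R) z : 0 < t -> y0 <= Im z -> z != w ->
  cabs (cauchy_kernel_fun k0 z) <= t * cabs (f z) ^+ 2 + (t^-1 + A) * (cabs (z - w) ^+ 2)^-1.
Proof.
move=> t0 y0z zw.
have zw' : z != w'.
  by apply: contraTneq y0z => ->; rewrite /w'/= -ltNge; move: y0w; lra.
rewrite cauchy_kernelE//.
have q0 : 0 < cabs (z - w) by rewrite cabs_gt0 subr_eq0.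
have far : cabs (z - w) <= cabs (z - w').
  rewrite -(@ler_pXn2r _ 2%N)// ?nnegrE ?cabs_ge0// !cabs_sqr !ReB !ImB /w'/= lerD2l.
  rewrite -subr_ge0 (_ : _ - _ = 4 * ((Im z - y0) * (Im w - y0))); last by ring.
  by rewrite mulr_ge0// mulr_ge0 ?subr_ge0// ltW.
rewrite [(t^-1 + A) * _]mulrDl addrA; apply: le_trans (cabsB _ _) _; apply: lerD.
  rewrite cabsM cabsV; move: q0; move: (cabs (f z)) (cabs (z - w)) => a q q0.
  rewrite -subr_ge0 -exprVn -[X in 0 <= X](_ : 2^-1 * ((t * a - q^-1) ^+ 2 / t + t * a ^+ 2 + q^-1 ^+ 2 / t) = _).
    have t1 := ltW t0; have t2 : 0 <= t^-1 by rewrite invr_ge0.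
    apply: mulr_ge0 => //; apply: addr_ge0; last by rewrite mulr_ge0// sqr_ge0.
    by apply: addr_ge0; rewrite mulr_ge0// sqr_ge0.
  by field; rewrite gt_eqF//= gt_eqF.
rewrite 2!cabsM mulrA cabsV cabsM -/A ler_wpM2l// lef_pV2 ?posrE ?mulr_gt0 ?exprn_gt0//.
  by rewrite expr2 ler_pM2l.
exact: lt_le_trans far.
Qed.

Lemma half_plane_kernel_integral (a b y : R) : a < b -> y != Im w ->
  mu.-integrable `[a, b] (EFin \o (fun x => (cabs (x +i* y - w) ^+ 2)^-1)) /\
  \int[mu]_(x in `[a, b]) (cabs (x +i* y - w) ^+ 2)^-1 <= pi / `|y - Im w|.
Proof.
move=> ab yw; pose e := `|y - Im w|.
have e0 : 0 < e by rewrite normr_gt0 subr_eq0.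
have pos (x : R) : 0 < e ^+ 2 + (x - Re w) ^+ 2 by rewrite ltr_pwDl ?exprn_gt0 ?sqr_ge0.
have E (x : R) : (cabs (x +i* y - w) ^+ 2)^-1 = e^-1 * (e / (e ^+ 2 + (x - Re w) ^+ 2)).
  rewrite cabs_sqr ReB ImB/= mulrA mulVf ?mul1r ?gt_eqF// addrC /e.
  by rewrite real_normK ?num_real.
have ik : mu.-integrable `[a, b] (EFin \o (fun x => e / (e ^+ 2 + (x - Re w) ^+ 2))).
  apply: continuous_segment_integrable => x; apply: cvgM; first exact: cvg_cst.
  apply: cvgV; first by rewrite gt_eqF.
  apply: cvgD; first exact: cvg_cst.
  under eq_fun do rewrite expr2.
  have c1 : (fun x : R => x - Re w) @ x --> x - Re w by apply: cvgB; [exact: cvg_id|exact: cvg_cst].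
  exact: cvgM.
have mab : measurable `[a, b] by exact: measurable_itv.
split; first by apply: (Leq_rint mab _ (LrintZ mab e^-1 ik)) => x _; rewrite E.
rewrite (Leq_Rint (fun x _ => E x)) (LRintZ mab e^-1 ik) atan_kernel// mulrC ler_wpM2r ?invr_ge0 ?(ltW e0)//.
rewrite [leRHS](splitr pi) lerD//; first exact: ltW (atan_ltpi2 _).
by rewrite lerNl; exact: ltW (atan_gtNpi2 _).
Qed.

(** Cauchy's theorem on a rectangle with base at height [y0] bounds the integral over the base by
    the other three edges: the top contributes (1 + 4 pi) e, each side [e]. The factor [k] selects
    the real or the imaginary part. *)
Lemma cauchy_segment_small k0 (c : C -> C) (k : C) (e n : R) :
  (forall z, Num.max 0 (2 * y0 - Im w) < Im z -> sderiv (cauchy_kernel_fun k0) z (c z)) ->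
  cabs k = 1 -> 0 < e -> exists X Y : R, [/\ n < X, n < Y &
  `|\int[mu]_(x in `[- Y, X]) Re (k * cauchy_kernel_fun k0 (x +i* y0))| <= (3 + 4 * pi) * e].
Proof.
move=> hc k1 e0; have w0 : 0 < Im w by exact: lt_trans y0w.
(* On the top edge, a slice below e^2 y1 gives [e] when t = 1 / (e y1). With y1 > A / e and y1 > 2
   Im w, the remainder (e y1 + A) pi / (y1 - Im w) is at most 2 e y1 pi times 2 / y1. *)
have [y1 Yy1 sl] := small_slices (Num.max (2 * Im w) (A / e)) (exprn_gt0 2 e0).
move: Yy1; rewrite gt_max => /andP[y1w y1A].
have y10 : 0 < y1 by apply: lt_trans y1w; rewrite mulr_gt0.
have y01 : y0 < y1 by apply: lt_trans y1w; move: y0w w0; lra.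
(* A side at horizontal distance rho >= 1 from [w] contributes at most (1 + (1 + A) (y1 - y0)) /
   rho, so rho >= N makes it at most [e]. The abscissas are taken so large that rho >= N + 1, which
   secures both. *)
pose N := (1 + (1 + A) * (y1 - y0)) / e.
have [e0' y01'] := (ltW e0, ltW y01).
have dy0 : 0 <= y1 - y0 by rewrite subr_ge0.
have N0 : 0 <= N by rewrite divr_ge0// addr_ge0// mulr_ge0// addr_ge0.
pose n0 := Num.max (Num.max n 0) (`|Re w| + N + 1).
have [[X nX sX] [Y nY sY]] := small_verticals y01 n0.
move: nX nY; rewrite !gt_max => /andP[/andP[nX X0] XN] /andP[/andP[nY Y0] YN].
exists X, Y; split => //.
pose m := Num.max 0 (2 * y0 - Im w).
have my0 : m < y0 by rewrite gt_max y00/=; move: y0w; lra.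
have YX : - Y < X by lra.
have hck z : m < Im z -> sderiv (fun z => k * cauchy_kernel_fun k0 z) z (k * c z).
  by move=> /hc; exact: sderivZ.
have fder : exists cf : C -> C, forall z, 0 < Im z -> sderiv f z (cf z).
  suff /choice[cf hcf] : forall z, exists c : C, 0 < Im z -> sderiv f z c by exists cf.
  move=> z; have [z0|] := boolP (0 < Im z); last by exists 0.
  by have [c1 d1] := analytic_sderiv (fa z0); exists c1.
have [cf fd] := fder.
have rect := rectangle_Re hck YX my0 y01.
have mseg (a b : R) : measurable `[a, b] by exact: measurable_itv.
have vseg (g : R -> R) : (forall y, y0 <= y -> {for y, continuous g}) -> mu.-integrable `[y0, y1] (EFin \o g).
  move=> cg; apply: continuous_compact_integrable; first exact: segment_compact.
  by apply: continuous_in_subspaceT => y; rewrite inE/= in_itv/= => /andP[/cg].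
have top : `|\int[mu]_(x in `[- Y, X]) Re (k * cauchy_kernel_fun k0 (x +i* y1))| <= (1 + 4 * pi) * e.
  have y1w' : y1 != Im w by rewrite gt_eqF// (lt_trans _ y1w)//; move: w0; lra.
  have t0 : 0 < (e * y1)^-1 by rewrite invr_gt0 mulr_gt0.
  have [iK bK] := half_plane_kernel_integral YX y1w'.
  have iF : mu.-integrable `[- Y, X] (EFin \o (fun x => cabs (f (x +i* y1)) ^+ 2)).
    by apply: continuous_segment_integrable; exact: (cabs_horizontal_continuous fd).
  have i1 := LrintZ (mseg _ _) (e * y1)^-1 iF; have i2 := LrintZ (mseg _ _) ((e * y1)^-1^-1 + A) iK.
  have ih : mu.-integrable `[- Y, X] (EFin \o (fun x => Re (k * cauchy_kernel_fun k0 (x +i* y1)))).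
    by apply: continuous_segment_integrable; apply: (strict_horizontal_continuous hc); exact: lt_trans y01.
  apply: le_trans (Lnorm_Rintegral_le (mseg _ _) ih (LrintD (mseg _ _) i1 i2) _) _.
    move=> x _; apply: le_trans (abs_Re _) _; rewrite cabsM k1 mul1r.
    apply: cauchy_kernel_bound => //=.
    by apply: contraTneq y1w' => <-/=; rewrite eqxx.
  rewrite (LRintD (mseg _ _) i1 i2) (LRintZ (mseg _ _) _ iF) (LRintZ (mseg _ _) _ iK).
  have bF : \int[mu]_(x in `[- Y, X]) cabs (f (x +i* y1)) ^+ 2 <= e ^+ 2 * y1.
    apply: (LRintegral_le_ereal (mseg _ _) iF); apply: le_trans (ltW sl).
    apply: ge0_subset_integral => //.
    - by apply/measurable_EFinP; apply: continuous_measurable_fun; exact: (cabs_horizontal_continuous fd).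
    - by move=> x _; rewrite lee_fin exprn_ge0 ?cabs_ge0.
  have dy : 0 < y1 - Im w by rewrite subr_gt0 (lt_trans _ y1w)//; move: w0; lra.
  rewrite (gtr0_norm dy) invrK in bK *.
  have h1 : (e * y1)^-1 * \int[mu]_(x in `[- Y, X]) cabs (f (x +i* y1)) ^+ 2 <= e.
    apply: le_trans (ler_wpM2l (ltW t0) bF) _.
    have -> : (e * y1)^-1 * (e ^+ 2 * y1) = e by field; rewrite (gt_eqF e0) (gt_eqF y10).
    exact: lexx.
  have eA : A <= e * y1 by move: y1A; rewrite ltr_pdivrMr// mulrC => /ltW.
  have eyA : 0 <= e * y1 + A by rewrite addr_ge0// mulr_ge0// ltW.
  have pi0 := pi_gt0 R.
  have h2 : (e * y1 + A) * \int[mu]_(x in `[- Y, X]) (cabs (x +i* y1 - w) ^+ 2)^-1 <= 4 * pi * e.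
    apply: le_trans (ler_wpM2l eyA bK) _.
    rewrite mulrA ler_pdivrMr//.
    apply: (@le_trans _ _ (2 * (e * y1) * pi)).
      by rewrite ler_wpM2r ?(ltW pi0)// mulr_natl mulr2n lerD2l.
    rewrite (_ : 4 * pi * e * _ = (2 * e * pi) * (2 * (y1 - Im w))); last by ring.
    rewrite (_ : 2 * (e * y1) * pi = (2 * e * pi) * y1); last by ring.
    rewrite ler_wpM2l//; first by rewrite !mulr_ge0// ltW.
    by rewrite mulrBr lerBrDl [2 * y1]mulr_natl mulr2n lerD2r ltW.
  clear -h1 h2; move: h1 h2; move: (_ * Rintegral _ _ _) (_ * Rintegral _ _ _) pi => p q P; lra.
have side (a : R) : `|Re w| + N + 1 < `|a| -> (vertical_mass f y0 y1 a < 1)%E ->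
    `|\int[mu]_(y in `[y0, y1]) Re ((0 +i* 1) * (k * cauchy_kernel_fun k0 (a +i* y)))| <= e.
  move=> ha va; pose rho := `|a - Re w|.
  have rN : N + 1 <= rho.
    have := ler_normD (a - Re w) (Re w); rewrite subrK -/rho => h.
    by clear -ha h; move: ha h; move: (`|a|) (`|Re w|) => p q; lra.
  have r1 : 1 <= rho by apply: le_trans rN; rewrite lerDr.
  have r0 : 0 < rho by exact: lt_le_trans r1.
  have iF : mu.-integrable `[y0, y1] (EFin \o (fun y => cabs (f (a +i* y)) ^+ 2)).
    by apply: vseg => y y0y; apply: (cabs_vertical_continuous fd); exact: lt_le_trans y0y.
  have i1 := LrintZ (mseg _ _) rho^-1 iF.
  have ic : mu.-integrable `[y0, y1] (EFin \o (fun=> (rho + A) * (rho ^+ 2)^-1)).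
    by apply: vseg => y _; exact: cst_continuous.
  have ih : mu.-integrable `[y0, y1] (EFin \o (fun y => Re ((0 +i* 1) * (k * cauchy_kernel_fun k0 (a +i* y))))).
    apply: vseg => y y0y.
    rewrite (_ : (fun y => _) = (fun y => Re ((0 +i* 1) * k * cauchy_kernel_fun k0 (a +i* y)))); last by apply/funext => t; rewrite mulrA.
    by apply: (strict_vertical_continuous hc); exact: lt_le_trans y0y.
  apply: le_trans (Lnorm_Rintegral_le (mseg _ _) ih (LrintD (mseg _ _) i1 ic) _) _.
    move=> y; rewrite /= in_itv/= => /andP[y0y _].
    apply: le_trans (abs_Re _) _; rewrite cabsM cabs_i mul1r cabsM k1 mul1r.
    have rz : rho <= cabs (a +i* y - w) by apply: le_trans (abs_Re _); rewrite ReB.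
    have aw : a +i* y != w by rewrite -subr_eq0 -cabs_gt0 (lt_le_trans r0).
    have ir0 : 0 < rho^-1 by rewrite invr_gt0.
    apply: le_trans (cauchy_kernel_bound k0 ir0 _ aw) _ => //.
    rewrite invrK lerD2l ler_wpM2l ?addr_ge0 ?(ltW r0)//.
    rewrite lef_pV2 ?posrE ?exprn_gt0// ?(lt_le_trans r0)//.
    by rewrite lerXn2r ?nnegrE ?cabs_ge0 ?(ltW r0).
  rewrite (LRintD (mseg _ _) i1 ic) (LRintZ (mseg _ _) _ iF).
  have bF : \int[mu]_(y in `[y0, y1]) cabs (f (a +i* y)) ^+ 2 <= 1.
    by apply: (LRintegral_le_ereal (mseg _ _) iF); exact: ltW.
  have bc : \int[mu]_(y in `[y0, y1]) ((rho + A) * (rho ^+ 2)^-1) = (rho + A) * (rho ^+ 2)^-1 * (y1 - y0).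
    rewrite Rintegral_cst//; congr (_ * _).
    have muA : (@lebesgue_measure R) `[y0, y1]%classic = (y1 - y0)%:E.
      by rewrite lebesgue_measure_itv/= lte_fin y01 -EFinD.
    by transitivity (fine (y1 - y0)%:E); first by congr fine; exact: muA.
  rewrite bc.
  apply: (@le_trans _ _ ((1 + (1 + A) * (y1 - y0)) / rho)).
    rewrite [X in _ <= X]mulrDl mul1r; apply: lerD.
      by rewrite -[X in _ <= X]mulr1 ler_wpM2l// invr_ge0 ltW.
    rewrite [X in _ <= X]mulrAC; apply: ler_wpM2r => //.
    rewrite expr2 invfM mulrA ler_wpM2r ?invr_ge0 ?(ltW r0)//.
    by rewrite ler_pdivrMr// mulrDl mul1r lerD2l ler_peMr.
  rewrite ler_pdivrMr// -ler_pdivrMl// mulrC.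
  by apply: le_trans rN; rewrite /N lerDl.
have vi (a : R) : mu.-integrable `[y0, y1] (EFin \o (fun y => Re ((0 +i* 1) * (k * cauchy_kernel_fun k0 (a +i* y))))).
  apply: vseg => y y0y.
  rewrite (_ : (fun y => _) = (fun y => Re ((0 +i* 1) * k * cauchy_kernel_fun k0 (a +i* y)))); last by apply/funext => t; rewrite mulrA.
  by apply: (strict_vertical_continuous hc); exact: lt_le_trans y0y.
have sX' := side X (lt_le_trans XN (ler_norm _)) sX.
have sY' : `|\int[mu]_(y in `[y0, y1]) Re ((0 +i* 1) * (k * cauchy_kernel_fun k0 (- Y +i* y)))| <= e.
  by apply: side => //; rewrite normrN; exact: lt_le_trans YN (ler_norm _).
rewrite (LRintB (mseg _ _) (vi _) (vi _)) in rect.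
move: rect top sX' sY'.
move: (Rintegral _ _ _) (Rintegral _ _ _) (Rintegral _ _ _) (Rintegral _ _ _) => I1 I0 IX IY.
clear; rewrite !ler_norml => rect /andP[? ?] /andP[? ?] /andP[? ?].
by apply/andP; split; lra.
Qed.

Local Notation u := (Re w).
Local Notation e := (Im w - y0).
Local Notation fr x := (Re (f (x +i* y0))).
Local Notation fi x := (Im (f (x +i* y0))).
(** [poisson_P + i poisson_Q] is 1 / (i (z - w)) at z = x + i y0: the Poisson kernel of the line and
    its conjugate. *)
Definition poisson_P (x : R) := e / (e ^+ 2 + (x - u) ^+ 2).
Definition poisson_Q (x : R) := (u - x) / (e ^+ 2 + (x - u) ^+ 2).
Local Notation P := poisson_P.
Local Notation Q := poisson_Q.

Let e0 : 0 < e. Proof. by rewrite subr_gt0. Qed.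

Lemma poisson_P_int : mu.-integrable D (EFin \o P) /\ mu.-integrable D (EFin \o (fun x => P (- x))) /\
  \int[mu]_(x in D) P x + \int[mu]_(x in D) P (- x) = pi.
Proof.
have [i1 E1] := poisson_mass u e0; have [i2 E2] := poisson_mass (- u) e0.
have E (x : R) : P (- x) = e / (e ^+ 2 + (x - - u) ^+ 2).
  by rewrite /P (_ : (- x - u) ^+ 2 = (x - - u) ^+ 2)//; ring.
split; first exact: i1.
split; first by apply: (Leq_rint mD _ i2) => x _; rewrite E.
rewrite [X in X + _]E1 (Leq_Rint (fun x _ => E x)) E2 mulNr atanN.
by move: (atan _) => t; field.
Qed.

(** On the line, z - w' is the conjugate of z - w, so the correction term is exactly 2 i f(w) P.
    This is what the choice of [w'] as a reflection achieves. *)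
Lemma cauchy_kernel_line k0 (x : R) :
  Re (1 * cauchy_kernel_fun k0 (x +i* y0)) = - (fr x * Q x + fi x * P x) + 2 * Im (f w) * P x /\
  Re ((0 -i* 1) * cauchy_kernel_fun k0 (x +i* y0)) = (fr x * P x - fi x * Q x) - 2 * Re (f w) * P x.
Proof.
have zw : x +i* y0 != w by apply: contraTneq y0w => <-/=; rewrite ltxx.
have zw' : x +i* y0 != w'.
  by apply/eqP => /(congr1 (@complex.Im R)) /=; move: y0w; lra.
rewrite cauchy_kernelE// /P /Q.
have q0 : 0 < e ^+ 2 + (x - u) ^+ 2 by rewrite ltr_pwDl ?exprn_gt0 ?sqr_ge0.
have q1 : (e ^+ 2 + (x - u) ^+ 2)%:C != 0 :> C by rewrite eq_complex/= gt_eqF.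
have h1 : (x +i* y0 - w)^-1 = ((x - u) +i* e) / (e ^+ 2 + (x - u) ^+ 2)%:C.
  apply/eqP; rewrite eq_sym -(inj_eq (mulIf (_ : x +i* y0 - w != 0))) ?subr_eq0//.
  rewrite mulVf ?subr_eq0// mulrAC.
  rewrite (_ : _ * (_ - w) = (e ^+ 2 + (x - u) ^+ 2)%:C) ?divff//.
  by case: (w) => a b /=; apply/eqP; rewrite eq_complex/=; apply/andP; split; apply/eqP; ring.
have h2 : (w - w') / ((x +i* y0 - w) * (x +i* y0 - w')) = (0 +i* (2 * e)) / (e ^+ 2 + (x - u) ^+ 2)%:C.
  congr (_ / _).
    by rewrite /w'; case: (w) => a b /=; apply/eqP; rewrite eq_complex/=; apply/andP; split; apply/eqP; ring.
  by rewrite /w'; case: (w) => a b /=; apply/eqP; rewrite eq_complex/=; apply/andP; split; apply/eqP; ring.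
rewrite h1 h2.
have iC : (e ^+ 2 + (x - u) ^+ 2)%:C^-1 = ((e ^+ 2 + (x - u) ^+ 2)^-1)%:C :> C by rewrite fmorphV.
rewrite iC; move: (_^-1) => q.
case: (f (x +i* y0)) (f w) => a b [c d] /=.
by split; ring.
Qed.

Lemma slice_integrable : continuous (fun x : R => cabs (f (x +i* y0)) ^+ 2) /\
  mu.-integrable D (EFin \o (fun x => cabs (f (x +i* y0)) ^+ 2)) /\
  mu.-integrable D (EFin \o (fun x => cabs (f (- x +i* y0)) ^+ 2)).
Proof.
have [cf fd] : exists cf : C -> C, forall z, 0 < Im z -> sderiv f z (cf z).
  suff /choice[cf hcf] : forall z, exists c : C, 0 < Im z -> sderiv f z c by exists cf.
  move=> z; have [z0|] := boolP (0 < Im z); last by exists 0.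
  by have [c1 d1] := analytic_sderiv (fa z0); exists c1.
have cF : continuous (fun x : R => cabs (f (x +i* y0)) ^+ 2) by exact: (cabs_horizontal_continuous fd).
have cG : continuous (fun x : R => cabs (f (- x +i* y0)) ^+ 2).
  by move=> x; apply: (@continuous_comp _ _ _ -%R (fun x : R => cabs (f (x +i* y0)) ^+ 2)); [exact: opp_continuous|exact: cF].
split => //; have := slice_y0.
rewrite /slice integral_line_split//; last by move=> x; rewrite exprn_ge0 ?cabs_ge0.
move=> h.
have mS (g : R -> R) : continuous g -> measurable_fun D g.
  by move=> cg; apply: measurable_funTS; exact: continuous_measurable_fun.
have iS := Lrint_ge0_lty (measurable_funD (mS _ cF) (mS _ cG)) _ h.
have {}iS : mu.-integrable D (EFin \o (fun x => cabs (f (x +i* y0)) ^+ 2 + cabs (f (- x +i* y0)) ^+ 2)).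
  by apply: iS => x _; rewrite addr_ge0// exprn_ge0 ?cabs_ge0.
split; apply: (Lintegrable_dominated mD _ iS); try exact: mS.
- by move=> x _; rewrite ger0_norm ?exprn_ge0 ?cabs_ge0// lerDl exprn_ge0 ?cabs_ge0.
- by move=> x _; rewrite ger0_norm ?exprn_ge0 ?cabs_ge0// lerDr exprn_ge0 ?cabs_ge0.
Qed.

(** The kernel has integral 0 over the line. Its main part is f times i (P + i Q), its correction 2
    i f(w) P, and P has mass pi; so 2 pi f(w) is the integral of f (P + i Q). Each integral over the
    line is given as two over the half-line. *)
Lemma cauchy_formula :
  [/\ mu.-integrable D (EFin \o (fun x => fr x * P x - fi x * Q x)),
   mu.-integrable D (EFin \o (fun x => fr (- x) * P (- x) - fi (- x) * Q (- x))),
   mu.-integrable D (EFin \o (fun x => fr x * Q x + fi x * P x)) &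
   mu.-integrable D (EFin \o (fun x => fr (- x) * Q (- x) + fi (- x) * P (- x)))] /\
  2 * pi * Re (f w) = \int[mu]_(x in D) (fr x * P x - fi x * Q x) + \int[mu]_(x in D) (fr (- x) * P (- x) - fi (- x) * Q (- x)) /\
  2 * pi * Im (f w) = \int[mu]_(x in D) (fr x * Q x + fi x * P x) + \int[mu]_(x in D) (fr (- x) * Q (- x) + fi (- x) * P (- x)).
Proof.
have [k0 [c hc]] := cauchy_kernel_sderiv.
have my0 : Num.max 0 (2 * y0 - Im w) < y0 by rewrite gt_max y00/=; move: y0w; lra.
pose g k (x : R) := Re (k * cauchy_kernel_fun k0 (x +i* y0)).
have cg k : continuous (g k) by exact: (strict_horizontal_continuous hc).
have ig k : cabs k = 1 -> mu.-integrable D (EFin \o g k) /\ mu.-integrable D (EFin \o (fun x => g k (- x))).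
  move=> k1; have [_ [s1 s2]] := slice_integrable; have [p1 [p2 _]] := poisson_P_int.
  have kE (x : R) : (cabs (x +i* y0 - w) ^+ 2)^-1 = e^-1 * P x.
    rewrite cabs_sqr ReB ImB/= /P mulrA mulVf ?mul1r ?gt_eqF// addrC.
    by congr (_ ^-1); ring.
  have bd (x : R) : `|g k x| <= 1 * cabs (f (x +i* y0)) ^+ 2 + (1^-1 + A) * (e^-1 * P x).
    rewrite -kE; apply: le_trans (abs_Re _) _; rewrite cabsM k1 mul1r.
    apply: cauchy_kernel_bound => //.
    by apply: contraTneq y0w => <-/=; rewrite ltxx.
  split.
    apply: (Lintegrable_dominated mD _ (LrintD mD (LrintZ mD 1 s1) (LrintZ mD (1^-1 + A) (LrintZ mD e^-1 p1)))).
      by apply: measurable_funTS; exact: continuous_measurable_fun.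
    by move=> x _.
  apply: (Lintegrable_dominated mD _ (LrintD mD (LrintZ mD 1 s2) (LrintZ mD (1^-1 + A) (LrintZ mD e^-1 p2)))).
    apply: measurable_funTS; apply: continuous_measurable_fun => x.
    by apply: (@continuous_comp _ _ _ -%R (g k)); [exact: opp_continuous|exact: cg].
  by move=> x _; exact: bd.
(* Bases reaching beyond [n] on both sides exist with integrals at most (3 + 4 pi) / (n + 1); along
   them the two half-line integrals converge. *)
have zero k : cabs k = 1 -> \int[mu]_(x in D) g k x + \int[mu]_(x in D) g k (- x) = 0.
  move=> k1; have [i1 i2] := ig k k1.
  have ex n : exists XY : R * R, [/\ n%:R < XY.1, n%:R < XY.2 &
      `|\int[mu]_(x in `[- XY.2, XY.1]) g k x| <= (3 + 4 * pi) * n.+1%:R^-1].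
    have n0 : 0 < n.+1%:R^-1 :> R by [].
    by have [X [Y h]] := cauchy_segment_small n%:R hc k1 n0; exists (X, Y).
  have [XY hXY] := choice ex.
  have hX n : n%:R <= (XY n).1 by have [/ltW] := hXY n.
  have hY n : n%:R <= (XY n).2 by have [_ /ltW] := hXY n.
  have cX := half_line_limit i1 hX; have cY := half_line_limit i2 hY.
  have cZ := cvgD cX cY.
  have c0 : (fun n => \int[mu]_(x in `[0, (XY n).1]) g k x + \int[mu]_(x in `[0, (XY n).2]) g k (- x)) @ \oo --> (0 : R).
    apply/cvgrPdist_le => d d0.
    have K0 : 0 < d / (3 + 4 * pi) by rewrite divr_gt0// addr_gt0// mulr_gt0 ?pi_gt0.
    have [N _ hN] := near_infty_natSinv_lt (PosNum K0).
    exists (maxn N 1) => // n /=; rewrite geq_max => /andP[Nn n1].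
    have [h1 h2 h3] := hXY n.
    have n0 : 0 < n%:R :> R by rewrite ltr0n.
    rewrite sub0r normrN -segment_split//; last 2 first.
    - exact: lt_trans h1.
    - exact: lt_trans h2.
    apply: le_trans h3 _; have /= := hN n Nn.
    by rewrite ltr_pdivlMr ?addr_gt0// ?mulr_gt0 ?pi_gt0// mulrC => /ltW.
  apply: (cvg_unique _ _ c0); first exact: Rhausdorff.
  exact: cZ.
have k1 : cabs (1 : C) = 1 by exact: cabs1.
have ki : cabs (0 -i* 1 : C) = 1 by rewrite /cabs/= expr0n sqrrN expr1n add0r sqrtr1.
have [p1 [p2 pE]] := poisson_P_int.
have [r1 r2] := ig _ ki; have [m1 m2] := ig _ k1.
have rE (x : R) : fr x * P x - fi x * Q x = g (0 -i* 1) x + 2 * Re (f w) * P x.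
  by rewrite /g (cauchy_kernel_line k0 x).2 subrK.
have iE (x : R) : fr x * Q x + fi x * P x = 2 * Im (f w) * P x - g 1 x.
  by rewrite /g (cauchy_kernel_line k0 x).1; ring.
have j1 := LrintZ mD (2 * Re (f w)) p1; have j2 := LrintZ mD (2 * Re (f w)) p2.
have l1 := LrintZ mD (2 * Im (f w)) p1; have l2 := LrintZ mD (2 * Im (f w)) p2.
split.
  split.
  - by apply: (Leq_rint mD _ (LrintD mD r1 j1)) => x _; rewrite rE.
  - by apply: (Leq_rint mD _ (LrintD mD r2 j2)) => x _; rewrite rE.
  - by apply: (Leq_rint mD _ (LrintB mD l1 m1)) => x _; rewrite iE.
  - by apply: (Leq_rint mD _ (LrintB mD l2 m2)) => x _; rewrite iE.
split.
  rewrite (Leq_Rint (fun x _ => rE x)) (Leq_Rint (fun x _ => rE (- x))).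
  rewrite (LRintD mD r1 j1) (LRintD mD r2 j2) (LRintZ mD _ p1) (LRintZ mD _ p2).
  have := zero _ ki; move: pE; move: (Rintegral _ _ _) (Rintegral _ _ _) (Rintegral _ _ _) (Rintegral _ _ _) => a b c' d.
  by move=> <- h; rewrite addrACA h add0r; ring.
rewrite (Leq_Rint (fun x _ => iE x)) (Leq_Rint (fun x _ => iE (- x))).
rewrite (LRintB mD l1 m1) (LRintB mD l2 m2) (LRintZ mD _ p1) (LRintZ mD _ p2).
have := zero _ k1; move: pE; move: (Rintegral _ _ _) (Rintegral _ _ _) (Rintegral _ _ _) (Rintegral _ _ _) => a b c' d.
by move=> <- h; rewrite addrACA -opprD h oppr0 addr0; ring.
Qed.

End cauchy_half_plane.

(** * The Paley-Wiener theorem *)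

Section L2_laplace.
Context {R : realType}.
Local Notation C := R[i].
Local Notation mu := (@lebesgue_measure R).
Local Notation D := (`]0, +oo[%classic : set R).
Let mD : measurable D. Proof. by []. Qed.
Implicit Types Phi : R -> C.

Lemma L2_half_lineP Phi : L2_half_line Phi <->
  sq_int mu D (fun x => Re (Phi x)) /\ sq_int mu D (fun x => Im (Phi x)).
Proof.
have E x : (Re (Phi x) ^+ 2 + Im (Phi x) ^+ 2) * 1 = Re (Phi x) ^+ 2 + Im (Phi x) ^+ 2 by rewrite mulr1.
split.
  move=> [[m1 m2]]; under eq_integral do rewrite E.
  have mS := measurable_funD (measurable_funX 2 m1) (measurable_funX 2 m2).
  move=> h; have iS : mu.-integrable D (EFin \o (fun x => Re (Phi x) ^+ 2 + Im (Phi x) ^+ 2)).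
    by apply: Lrint_ge0_lty => // x _; rewrite addr_ge0 ?sqr_ge0.
  split; split => //; apply: (Lintegrable_dominated mD _ iS).
  - exact: (measurable_funX 2 m1).
  - by move=> x _; rewrite ger0_norm ?sqr_ge0// lerDl sqr_ge0.
  - exact: (measurable_funX 2 m2).
  - by move=> x _; rewrite ger0_norm ?sqr_ge0// lerDr sqr_ge0.
move=> [[m1 i1] [m2 i2]]; split; first by split.
under eq_integral do rewrite E.
by apply: (Lrint_lty mD (LrintD mD i1 i2)) => x _; rewrite addr_ge0 ?sqr_ge0.
Qed.

Lemma sq_int_bounded (u b : R -> R) (M : R) : sq_int mu D u -> measurable_fun D b ->
  (forall x, D x -> `|b x| <= M) -> sq_int mu D (fun x => u x * b x).
Proof.
move=> [mu_ iu] mb bM; have mub := measurable_funM mu_ mb; split => //.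
apply: (Lintegrable_dominated mD _ (LrintZ mD (M ^+ 2) iu)); first exact: (measurable_funX 2 mub).
move=> x Dx; rewrite ger0_norm ?sqr_ge0// exprMn mulrC ler_wpM2r ?sqr_ge0//.
have := bM x Dx; rewrite -real_normK ?num_real// => h.
by rewrite lerXn2r ?nnegrE// (le_trans (normr_ge0 (b x))).
Qed.

Lemma sq_int_expR (y : R) : 0 < y -> sq_int mu D (fun x => expR (- y * x)).
Proof.
move=> y0; split; first by mfun.
have [i _] := laplace_exp (mulr_gt0 (ltr0n R 2) y0).
apply: (Leq_rint mD _ i) => x _; rewrite expr2 -expRD; congr expR; ring.
Qed.

Lemma expR_le1 (y x : R) : 0 <= y -> D x -> `|expR (- y * x)| <= 1.
Proof.
move=> y0; rewrite /= in_itv/= andbT => x0.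
by rewrite ger0_norm ?expR_ge0// -expR0 ler_expR mulNr oppr_le0 mulr_ge0// ltW.
Qed.

Lemma L2_laplace_admissible Phi : L2_half_line Phi -> laplace_admissible Phi /\
  forall y, 0 < y -> sq_int mu D (damped_Re Phi y) /\ sq_int mu D (damped_Im Phi y).
Proof.
move=> /L2_half_lineP[s1 s2]; split.
  have mP : cmeasurable_fun D Phi by split; [exact: s1.1|exact: s2.1].
  split => // y y0; have se := sq_int_expR y0.
  apply: (Lsq_int_mul mD _ se); split; first exact: measurable_cabs.
  by apply: (Leq_rint mD _ (LrintD mD s1.2 s2.2)) => x _; rewrite cabs_sqr.
move=> y y0; split; rewrite /damped_Re /damped_Im.
  by apply: (@sq_int_bounded _ _ 1) => //; [mfun|move=> x; apply: expR_le1; exact: ltW].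
by apply: (@sq_int_bounded _ _ 1) => //; [mfun|move=> x; apply: expR_le1; exact: ltW].
Qed.

Lemma ae_eq_laplace Psi Phi (z : C) : laplace_admissible Psi -> laplace_admissible Phi -> 0 < Im z ->
  ae_eq mu D Psi Phi -> laplace Psi z = laplace Phi z.
Proof.
move=> a1 a2 z0 E; have [i1 i2] := laplace_integrable a1 z0; have [j1 j2] := laplace_integrable a2 z0.
rewrite /laplace !cintegralE; congr (_ +i* _).
  apply: (ae_eq_Rint (m := mu)) => //; [|exact: Lrint_measurable i1|exact: Lrint_measurable j1].
  by apply: (@filterS _ _ (ae_filter_ringOfSetsType mu) _ _ _ E) => x h Dx; rewrite (h Dx).
apply: (ae_eq_Rint (m := mu)) => //; [|exact: Lrint_measurable i2|exact: Lrint_measurable j2].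
by apply: (@filterS _ _ (ae_filter_ringOfSetsType mu) _ _ _ E) => x h Dx; rewrite (h Dx).
Qed.

Definition damp (y : R) Phi (xi : R) : C := Phi xi * (expR (- y * xi))%:C.

Lemma laplace_damp y Phi (z : C) : laplace (damp y Phi) z = laplace Phi (z + (0 +i* y)).
Proof.
apply: Leq_cintegral => xi _; rewrite /damp -mulrA; congr (_ * _).
have -> : (expR (- y * xi))%:C = cexp ((- y * xi)%:C) :> C.
  by rewrite /cexp/= cos0 sin0 -[LHS]mulr1.
rewrite -cexpD; congr cexp.
by case: z => a b; apply/eqP; rewrite eq_complex/=; apply/andP; split; apply/eqP; ring.
Qed.

End L2_laplace.

Section paley_wiener.
Context {R : realType}.
Local Notation C := R[i].
Local Notation mu := (@lebesgue_measure R).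
Local Notation D := (`]0, +oo[%classic : set R).
Local Notation Tc := (trig_transform (@cos R)).
Local Notation Ts := (trig_transform (@sin R)).
Let mD : measurable D. Proof. by []. Qed.
Variable lambda : R.
Hypothesis hlambda : -1 < lambda.
Variable f : C -> C.
Hypothesis fa : forall z : C, 0 < Im z -> analytic_at (f : (C : numFieldType) -> (C : numFieldType)) z.
Hypothesis f2 : csquare_integrable plane_measure half_plane (bergman_weight lambda) (f \o to_complex).

(** [p1 + i p2] is e^{-c xi + i u xi}, and the integral of e^{-c xi} e^{i (u - x) xi} is 1 / (c - i
    (u - x)). Its real and imaginary parts are the Poisson kernel and its conjugate. *)
Lemma poisson_trig (c u x : R) : 0 < c ->
  let p1 := fun xi => expR (- c * xi) * cos (u * xi) in
  let p2 := fun xi => expR (- c * xi) * sin (u * xi) in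
  [/\ L1_L2 p1, L1_L2 p2,
    Tc p1 x + Ts p2 x = c / (c ^+ 2 + (x - u) ^+ 2) &
    Tc p2 x - Ts p1 x = (u - x) / (c ^+ 2 + (x - u) ^+ 2)].
Proof.
move=> c0 p1 p2.
have [ie _] := laplace_exp c0; have se := sq_int_expR c0.
have l1 : L1_L2 p1.
  split; first by have [] := laplace_cos0 u c0.
  by apply: (@sq_int_bounded _ _ _ 1) => //; [mfun|move=> ? _; exact: cos_max].
have l2 : L1_L2 p2.
  split; first by have [] := laplace_sin u c0.
  by apply: (@sq_int_bounded _ _ _ 1) => //; [mfun|move=> ? _; exact: sin_max].
have [c1 c2] := (trig_kernel_int measurable_cos (@cos_max R) x l1.1, trig_kernel_int measurable_cos (@cos_max R) x l2.1).
have [s1 s2] := (trig_kernel_int measurable_sin (@sin_max R) x l1.1, trig_kernel_int measurable_sin (@sin_max R) x l2.1).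
split => //.
  have [_ <-] := laplace_cos0 (x - u) c0.
  rewrite /trig_transform -(LRintD mD c1 s2); apply: Leq_Rint => xi _.
  rewrite mulrBl cosB /p1 /p2; move: (expR _) (cos _) (cos _) (sin _) (sin _) => *; ring.
have [ii E] := laplace_sin (x - u) c0.
rewrite (_ : (u - x) / _ = - ((x - u) / (c ^+ 2 + (x - u) ^+ 2))); last by rewrite -mulNr opprB.
rewrite -E -(LRintN mD ii).
rewrite /trig_transform -(LRintB mD c2 s1); apply: Leq_Rint => xi _.
rewrite mulrBl sinB /p1 /p2; move: (expR _) (cos _) (cos _) (sin _) (sin _) => *; ring.
Qed.

(** In Cauchy's formula the kernels are trigonometric transforms of [p1] and [p2]; duality moves the
    transforms onto the boundary values of [f], leaving integrals of exponentials against fixed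
    densities. This is a Laplace transform. *)
Lemma slice_representation (y0 : R) : 0 < y0 -> (slice f y0 < +oo)%E ->
  exists Phi, L2_half_line Phi /\ forall z, 0 < Im z -> f (z + (0 +i* y0)) = laplace Phi z.
Proof.
move=> y00 sl.
have sv y1 : y0 < y1 -> forall X : R,
  (exists2 x, X < x & (vertical_mass f y0 y1 x < 1)%E) /\
  (exists2 x, X < x & (vertical_mass f y0 y1 (- x) < 1)%E).
  by move=> y01 X; split; [exact: (small_vertical_exists hlambda f2)|exact: (small_vertical_exists_neg hlambda f2)].
have ss := small_slice_exists hlambda f2.
have CF (w : C) (h : y0 < Im w) := cauchy_formula fa y00 h ss sv sl.
have [cF [i1 i2]] := slice_integrable fa y00 sl.
pose a x := Re (f (x +i* y0)); pose b x := Im (f (x +i* y0)).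
have [ca cb] : continuous a /\ continuous b.
  have [cf fd] : exists cf : C -> C, forall z, 0 < Im z -> sderiv f z (cf z).
    suff /choice[cf hcf] : forall z, exists c : C, 0 < Im z -> sderiv f z c by exists cf.
    move=> z; have [z0|] := boolP (0 < Im z); last by exists 0.
    by have [c1 d1] := analytic_sderiv (fa z0); exists c1.
  have c1 := strict_horizontal_continuous fd (k := 1) y00.
  have c2 := strict_horizontal_continuous fd (k := 0 -i* 1) y00.
  split.
    by rewrite (_ : a = fun x => Re (1 * f (x +i* y0)))//; apply/funext => x; rewrite mul1r.
  rewrite (_ : b = fun x => Re ((0 -i* 1) * f (x +i* y0)))//; apply/funext => x.
  by rewrite /b; case: (f _) => p q /=; ring.
have cN (g : R -> R) : continuous g -> continuous (fun x => g (- x)).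
  by move=> cg x; apply: (@continuous_comp _ _ _ -%R g); [exact: opp_continuous|exact: cg].
have sq (g G : R -> R) : continuous g -> mu.-integrable D (EFin \o G) -> (forall x, g x ^+ 2 <= G x) -> sq_int mu D g.
  move=> cg iG gG; have mg : measurable_fun D g by apply: measurable_funTS; exact: continuous_measurable_fun.
  split => //; apply: (Lintegrable_dominated mD _ iG); first exact: (measurable_funX 2 mg).
  by move=> x _; rewrite ger0_norm ?sqr_ge0.
have leR x : a x ^+ 2 <= cabs (f (x +i* y0)) ^+ 2 by rewrite cabs_sqr lerDl sqr_ge0.
have leI x : b x ^+ 2 <= cabs (f (x +i* y0)) ^+ 2 by rewrite cabs_sqr lerDr sqr_ge0.
have sa := sq _ _ ca i1 leR; have sb := sq _ _ cb i1 leI.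
have sa' := sq _ _ (cN _ ca) i2 (fun x => leR (- x)).
have sb' := sq _ _ (cN _ cb) i2 (fun x => leI (- x)).
have sBe : sq_int mu D (fun x => (-1) * (b x + b (- x))) by apply: (Lsq_intZ mD); exact: (Lsq_intD mD).
(* The parity of the transforms sorts the real part by test function: [p1] meets a(x) + a(-x)
   through the cosine and b(x) - b(-x) through the sine, [p2] meets -(b(x) + b(-x)) and a(x) -
   a(-x). These data, hence the two densities, depend on the line only; the point enters through
   [p1] and [p2]. *)
have [chi1 [sc1 H1]] := dual_representation (Lsq_intD mD sa sa') (Lsq_intB mD sb sb').
have [chi2 [sc2 H2]] := dual_representation sBe (Lsq_intB mD sa sa').
(* Up to the factor 2 pi this is chi1 - i chi2, since both parts of 2 pi f(w) are those of the
   integral of (chi1 - i chi2)(p1 + i p2). *)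
exists (fun xi => ((2 * pi)^-1 * chi1 xi) +i* ((2 * pi)^-1 * (-1 * chi2 xi))).
have sP : L2_half_line (fun xi => ((2 * pi)^-1 * chi1 xi) +i* ((2 * pi)^-1 * (-1 * chi2 xi))).
  apply/L2_half_lineP; split; first exact: (Lsq_intZ mD).
  by apply: (Lsq_intZ mD); exact: (Lsq_intZ mD).
split => // z z0; pose w := z + (0 +i* y0).
have wy : y0 < Im w by rewrite /w; case: (z) z0 => p q /=; rewrite ltrDr.
have [[r1 r2 m1 m2] [fR fI]] := CF w wy.
have c0 : 0 < Im w - y0 by rewrite subr_gt0.
pose p1 xi := expR (- Im z * xi) * cos (Re z * xi).
pose p2 xi := expR (- Im z * xi) * sin (Re z * xi).
have [l1 l2] : L1_L2 p1 /\ L1_L2 p2 by have [] := @poisson_trig (Im z) (Re z) 0 z0.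
have wE : Im w - y0 = Im z /\ Re w = Re z by rewrite /w; case: (z) => p q /=; split; ring.
have PE x : poisson_P y0 w x = Tc p1 x + Ts p2 x.
  by have [_ _ -> _] := @poisson_trig (Im z) (Re z) x z0; rewrite /poisson_P wE.1 wE.2.
have QE x : poisson_Q y0 w x = Tc p2 x - Ts p1 x.
  by have [_ _ _ ->] := @poisson_trig (Im z) (Re z) x z0; rewrite /poisson_Q wE.1 wE.2.
have ce u x : Tc u (- x) = Tc u x by apply: Leq_Rint => xi _; rewrite mulNr cosN.
have se u x : L1_L2 u -> Ts u (- x) = - Ts u x.
  move=> ui; rewrite /trig_transform -(LRintN mD (trig_kernel_int measurable_sin (@sin_max R) x ui.1)).
  by apply: Leq_Rint => xi _; rewrite mulNr sinN mulrN.
have ia u v p : sq_int mu D u -> sq_int mu D v -> L1_L2 p -> mu.-integrable D (EFin \o (fun x => u x * Tc p x + v x * Ts p x)).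
  by move=> su sv_ /sq_int_trig[h1 h2]; apply: (LrintD mD); exact: (Lsq_int_mul mD).
have j11 := ia _ _ _ (Lsq_intD mD sa sa') (Lsq_intB mD sb sb') l1.
have j12 := ia _ _ _ (Lsq_intD mD sa sa') (Lsq_intB mD sb sb') l2.
have j21 := ia _ _ _ sBe (Lsq_intB mD sa sa') l1.
have j22 := ia _ _ _ sBe (Lsq_intB mD sa sa') l2.
have FR : 2 * pi * Re (f w) = \int[mu]_(x in D) (p1 x * chi1 x) + \int[mu]_(x in D) (p2 x * chi2 x).
  rewrite -(H1 _ l1) -(H2 _ l2) fR -(LRintD mD r1 r2) -(LRintD mD j11 j22).
  apply: Leq_Rint => x _; rewrite !PE !QE !ce !se// -/(a x) -/(b x) -/(a (- x)) -/(b (- x)).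
  move: (a x) (b x) (a (- x)) (b (- x)) (Tc p1 x) (Ts p1 x) (Tc p2 x) (Ts p2 x) => *; ring.
have FI : 2 * pi * Im (f w) = \int[mu]_(x in D) (p2 x * chi1 x) - \int[mu]_(x in D) (p1 x * chi2 x).
  rewrite -(H1 _ l2) -(H2 _ l1) fI -(LRintD mD m1 m2) -(LRintB mD j12 j21).
  apply: Leq_Rint => x _; rewrite !PE !QE !ce !se// -/(a x) -/(b x) -/(a (- x)) -/(b (- x)).
  move: (a x) (b x) (a (- x)) (b (- x)) (Tc p1 x) (Ts p1 x) (Tc p2 x) (Ts p2 x) => *; ring.
have [aP _] := L2_laplace_admissible sP.
have zE : z = Re z +i* Im z by case: (z).
rewrite [in RHS]zE laplace_lineE// -/w.
have pi2 : 2 * pi != 0 :> R by rewrite mulf_neq0 ?gt_eqF ?pi_gt0.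
have [q11 q12] := (Lsq_int_mul mD l1.2 sc1, Lsq_int_mul mD l1.2 sc2).
have [q21 q22] := (Lsq_int_mul mD l2.2 sc1, Lsq_int_mul mD l2.2 sc2).
set Phi := fun xi : R => _ +i* _ in sP aP *.
have e1 : Tc (damped_Re Phi (Im z)) (Re z) = (2 * pi)^-1 * \int[mu]_(x in D) (p1 x * chi1 x).
  by rewrite -(LRintZ mD _ q11); apply: Leq_Rint => x _; rewrite /damped_Re /p1/=; move: (expR _) (cos _) => *; ring.
have e2 : Ts (damped_Re Phi (Im z)) (Re z) = (2 * pi)^-1 * \int[mu]_(x in D) (p2 x * chi1 x).
  by rewrite -(LRintZ mD _ q21); apply: Leq_Rint => x _; rewrite /damped_Re /p2/=; move: (expR _) (sin _) => *; ring.
have e3 : Tc (damped_Im Phi (Im z)) (Re z) = - (2 * pi)^-1 * \int[mu]_(x in D) (p1 x * chi2 x).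
  by rewrite -(LRintZ mD _ q12); apply: Leq_Rint => x _; rewrite /damped_Im /p1/=; move: (expR _) (cos _) => *; ring.
have e4 : Ts (damped_Im Phi (Im z)) (Re z) = - (2 * pi)^-1 * \int[mu]_(x in D) (p2 x * chi2 x).
  by rewrite -(LRintZ mD _ q22); apply: Leq_Rint => x _; rewrite /damped_Im /p2/=; move: (expR _) (sin _) => *; ring.
rewrite e1 e2 e3 e4 [LHS]complexE; congr (_ +i* _); apply: (mulfI pi2).
  rewrite FR; move: (2 * pi) pi2 (Rintegral _ _ _) (Rintegral _ _ _) => K k0 A B; field; exact: k0.
rewrite FI; move: (2 * pi) pi2 (Rintegral _ _ _) (Rintegral _ _ _) => K k0 A B; field; exact: k0.
Qed.

(** A first line determines the candidate; lower lines, arbitrarily close to the real axis, show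
    that it stays square integrable under arbitrarily weak damping and represents [f] on the whole
    half-plane. *)
Lemma paley_wiener : exists Psi, [/\ laplace_admissible Psi,
  (forall y, 0 < y -> sq_int mu D (damped_Re Psi y) /\ sq_int mu D (damped_Im Psi y)) &
  forall z, 0 < Im z -> f z = laplace Psi z].
Proof.
have [y0 /andP[y00 _] sl0] := finite_slice_exists hlambda f2 (@ltr01 R).
have [Phi [sPhi fPhi]] := slice_representation y00 sl0.
(* The factor e^{y0 xi} undoes the shift of [f] by i y0; at this point nothing controls its
   growth. *)
pose Psi := damp (- y0) Phi.
(* Below any height there is a line at y' < y0 with a representation of its own. Above the line at
   [y0] both represent [f], so injectivity identifies them once the damping e^{-(y0 - y') xi}
   accounts for the difference of heights. *)
have good y : 0 < y -> exists y', exists Phi', [/\ 0 < y', y' < y, L2_half_line Phi',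
   (forall z, 0 < Im z -> f (z + (0 +i* y')) = laplace Phi' z) & ae_eq mu D (damp y' Psi) Phi'].
  move=> yp; have m0 : 0 < Num.min y y0 by rewrite lt_min yp.
  have [y' /andP[y'0 +] sl'] := finite_slice_exists hlambda f2 m0.
  rewrite lt_min => /andP[y'y y'y0].
  have [Phi' [sPhi' fPhi']] := slice_representation y'0 sl'.
  exists y', Phi'; split => //.
  have d0 : 0 < y0 - y' by rewrite subr_gt0.
  have [aPhi _] := L2_laplace_admissible sPhi; have [aPhi' sqPhi'] := L2_laplace_admissible sPhi'.
  have aD : laplace_admissible (damp (y0 - y') Phi').
    apply: (L2_laplace_admissible _).1; apply/L2_half_lineP.
    have [h1 h2] := sqPhi' _ d0; split.
      by rewrite (_ : (fun x => _) = damped_Re Phi' (y0 - y'))//; apply/funext => x; rewrite /damp /damped_Re cReM/= mulr0 subr0.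
    by rewrite (_ : (fun x => _) = damped_Im Phi' (y0 - y'))//; apply/funext => x; rewrite /damp /damped_Im cImM/= mulr0 add0r.
  have E : ae_eq mu D Phi (damp (y0 - y') Phi').
    apply: (laplace_inj aPhi aD (@ltr01 R)) => x.
    rewrite laplace_damp -fPhi//= -fPhi'/=; last by rewrite addr_gt0.
    by congr f; apply/eqP; rewrite eq_complex/=; apply/andP; split; apply/eqP; ring.
  apply: (@filterS _ _ (ae_filter_ringOfSetsType mu) _ _ _ E) => x h Dx.
  rewrite /Psi /damp (h Dx) /damp -!mulrA -!rmorphM/= -!expRD.
  rewrite (_ : _ + (_ + _) = 0); last by ring.
  by rewrite expR0 mulr1.
have mPsi : cmeasurable_fun D Psi.
  apply: cmeasurableM; first exact: sPhi.1.
  by apply: cmeasurable_real; mfun.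
have PsiE y' x : Psi x = damp y' Psi x * (expR (y' * x))%:C.
  have e0 : - y' * x + y' * x = 0 by ring.
  by rewrite [in RHS]/damp -[RHS]mulrA -rmorphM/= -expRD e0 expR0 mulr1.
have sqPsi y : 0 < y -> sq_int mu D (damped_Re Psi y) /\ sq_int mu D (damped_Im Psi y).
  move=> yp; have [y' [Phi' [y'0 y'y sPhi' _ E]]] := good y yp.
  have [_ sq] := L2_laplace_admissible sPhi'.
  have d0 : 0 < y - y' by rewrite subr_gt0.
  have [h1 h2] := sq _ d0.
  have Er x : expR (y' * x) * expR (- y * x) = expR (- (y - y') * x) by rewrite -expRD; congr expR; ring.
  have mr : measurable_fun D (damped_Re Psi y) by apply: measurable_funM; [exact: mPsi.1|mfun].
  have mi : measurable_fun D (damped_Im Psi y) by apply: measurable_funM; [exact: mPsi.2|mfun].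
  split; split => //.
    apply: (ae_eq_rint (m := mu) mD _ _ h1.2); last exact: (measurable_funX 2 mr).
    apply: (@filterS _ _ (ae_filter_ringOfSetsType mu) _ _ _ E) => x h Dx.
    rewrite /damped_Re (PsiE y' x) (h Dx) cReM/= mulr0 subr0 -!mulrA Er//.
  apply: (ae_eq_rint (m := mu) mD _ _ h2.2); last exact: (measurable_funX 2 mi).
  apply: (@filterS _ _ (ae_filter_ringOfSetsType mu) _ _ _ E) => x h Dx.
  rewrite /damped_Im (PsiE y' x) (h Dx) cImM/= mulr0 add0r -!mulrA Er//.
have aPsi : laplace_admissible Psi.
  split => // y yp; have [h1 h2] := sqPsi _ (divr_gt0 yp (ltr0n R 2)).
  have s1 : L2_half_line (damp (y / 2) Psi).
    apply/L2_half_lineP; split.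
      by rewrite (_ : (fun x => _) = damped_Re Psi (y / 2))//; apply/funext => x; rewrite /damp /damped_Re cReM/= mulr0 subr0.
    by rewrite (_ : (fun x => _) = damped_Im Psi (y / 2))//; apply/funext => x; rewrite /damp /damped_Im cImM/= mulr0 add0r.
  have [[_ h] _] := L2_laplace_admissible s1.
  apply: (Leq_rint mD _ (h _ (divr_gt0 yp (ltr0n R 2)))) => x _.
  by rewrite /damp cabsM cabs_real ger0_norm ?expR_ge0// -mulrA -expRD; congr (_ * expR _); field.
exists Psi; split => // z z0.
have [y' [Phi' [y'0 y'z sPhi' fz E]]] := good (Im z) z0.
have [aPhi' _] := L2_laplace_admissible sPhi'.
have z'0 : 0 < Im (z - (0 +i* y')) by rewrite ImB/= subr_gt0.
have := fz _ z'0; rewrite subrK => ->.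
have aD : laplace_admissible (damp y' Psi).
  have [h1 h2] := sqPsi _ y'0; apply: (L2_laplace_admissible _).1; apply/L2_half_lineP; split.
    by rewrite (_ : (fun x => _) = damped_Re Psi y')//; apply/funext => x; rewrite /damp /damped_Re cReM/= mulr0 subr0.
  by rewrite (_ : (fun x => _) = damped_Im Psi y')//; apply/funext => x; rewrite /damp /damped_Im cImM/= mulr0 add0r.
by rewrite -(ae_eq_laplace aD aPhi' z'0 E) laplace_damp subrK.
Qed.

End paley_wiener.

(** * The unitary operator R and its adjoint *)

Section weighted_L2.
Context {R : realType} {d} {T : measurableType d}.
Local Notation C := R[i].
Variables (m : {measure set T -> \bar R}) (A : set T) (w : T -> R).
Hypotheses (mA : measurable A) (mw : measurable_fun A w) (w0 : forall x, A x -> 0 <= w x).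
Implicit Types f g : T -> C.
Local Notation sq f := (csquare_integrable m A w f).
Local Notation ip f g := (cintegral m A (fun x => f x * conjc (g x) * (w x)%:C)).

Definition sq_norm f : R := Rintegral m A (fun x => cabs (f x) ^+ 2 * w x).

Lemma sq_norm_integrable f : sq f -> m.-integrable A (EFin \o (fun x => cabs (f x) ^+ 2 * w x)).
Proof.
move=> [mf]; under eq_integral do rewrite -cabs_sqr.
apply: rint_ge0_lty; last by move=> x Ax; rewrite mulr_ge0 ?exprn_ge0 ?cabs_ge0 ?w0.
by apply: measurable_funM => //; apply: (measurable_funX 2); exact: measurable_cabs.
Qed.

Lemma sq_lin (c : C) f g : sq f -> sq g -> sq (fun x => c * f x + g x).
Proof. by move=> hf hg; exact: csquare_integrable_lin. Qed.

Lemma sq_ip f g : sq f -> sq g -> cintegrable m A (fun x => f x * conjc (g x) * (w x)%:C).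
Proof.
move=> hf hg; have i1 := sq_norm_integrable hf; have i2 := sq_norm_integrable hg.
apply: (cintegrable_dominated mA _ (rintD mA i1 i2)).
  apply: cmeasurableM; last exact: cmeasurable_real.
  by apply: cmeasurableM; [exact: hf.1|exact: (cmeasurable_conj hg.1)].
move=> x Ax; rewrite !cabsM cabs_conj cabs_real ger0_norm ?w0// -mulrDl ler_wpM2r ?w0//.
have := le_prod_sqr (cabs (f x)) (cabs (g x)).
by rewrite ger0_norm// mulr_ge0 ?cabs_ge0.
Qed.

Lemma ip_linl (c : C) f g h : sq f -> sq g -> sq h ->
  ip (fun x => c * f x + g x) h = c * ip f h + ip g h.
Proof.
move=> hf hg hh; rewrite -(cintegral_lin mA c (sq_ip hf hh) (sq_ip hg hh)).
by apply: eq_cintegral => x _; move: (f x) (g x) (conjc _) (_%:C) => *; ring.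
Qed.

Lemma ip_self f : ip f f = (sq_norm f)%:C.
Proof.
rewrite cintegralE (_ : Rintegral m A (fun x => Im _) = 0); last first.
  rewrite (eq_Rint m (g := fun=> 0)) => [|x _]; first by rewrite /Rintegral integral0.
  by case: (f x) => a b /=; ring.
congr (_ +i* _); apply: eq_Rint => x _.
by rewrite cabs_sqr; case: (f x) => a b /=; ring.
Qed.

Lemma sq_normD (c : C) f g : sq f -> sq g ->
  sq_norm (fun x => c * f x + g x) = cabs c ^+ 2 * sq_norm f + 2 * Re (c * ip f g) + sq_norm g.
Proof.
move=> hf hg; have ifg := sq_ip hf hg.
have i1 := sq_norm_integrable hf; have i2 := sq_norm_integrable hg.
have [j1 _] := cintegrableZ mA c ifg.
rewrite -(cintegralZ mA c ifg) cintegralE /= /sq_norm -(RintZ mA _ i1) -(RintZ mA _ j1).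
rewrite -(RintD mA (rintZ mA _ i1) (rintZ mA _ j1)) -(RintD mA (rintD mA (rintZ mA _ i1) (rintZ mA _ j1)) i2).
apply: eq_Rint => x _; rewrite !cabs_sqr; case: (c) (f x) (g x) => [a b] [a1 b1] [a2 b2] /=; ring.
Qed.

End weighted_L2.

(** Polarization between two different spaces: comparing the squared norms of c f + g for c = 1 and
    c = -i gives the real and the imaginary part of the scalar product. *)
Lemma eq_sq_ip (R : realType) d1 d2 (T1 : measurableType d1) (T2 : measurableType d2)
    (m1 : {measure set T1 -> \bar R}) (m2 : {measure set T2 -> \bar R}) (A1 : set T1) (A2 : set T2)
    (w1 : T1 -> R) (w2 : T2 -> R) (f1 g1 : T1 -> R[i]) (f2 g2 : T2 -> R[i]) :
  measurable A1 -> measurable A2 -> measurable_fun A1 w1 -> measurable_fun A2 w2 ->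
  (forall x, A1 x -> 0 <= w1 x) -> (forall x, A2 x -> 0 <= w2 x) ->
  csquare_integrable m1 A1 w1 f1 -> csquare_integrable m1 A1 w1 g1 ->
  csquare_integrable m2 A2 w2 f2 -> csquare_integrable m2 A2 w2 g2 ->
  (forall c : R[i], sq_norm m1 A1 w1 (fun x => c * f1 x + g1 x) = sq_norm m2 A2 w2 (fun x => c * f2 x + g2 x)) ->
  sq_norm m1 A1 w1 f1 = sq_norm m2 A2 w2 f2 -> sq_norm m1 A1 w1 g1 = sq_norm m2 A2 w2 g2 ->
  cintegral m1 A1 (fun x => f1 x * conjc (g1 x) * (w1 x)%:C) =
  cintegral m2 A2 (fun x => f2 x * conjc (g2 x) * (w2 x)%:C).
Proof.
move=> mA1 mA2 mw1 mw2 w10 w20 sf1 sg1 sf2 sg2 N Nf Ng.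
have H c : Re (c * cintegral m1 A1 (fun x => f1 x * conjc (g1 x) * (w1 x)%:C)) =
    Re (c * cintegral m2 A2 (fun x => f2 x * conjc (g2 x) * (w2 x)%:C)).
  have := N c; rewrite !sq_normD// Nf Ng; move: (Re _) (Re _) => p q; lra.
have := H 1; have := H (0 -i* 1); rewrite !mul1r.
case: (cintegral _ _ _) (cintegral _ _ _) => [a b] [a' b'] /= h1 h2.
by congr (_ +i* _) => //; move: h1; lra.
Qed.

(* Locked: unification would otherwise unfold the subtype coercions. *)
HB.lock Definition of_half_line (R : realType) (lambda : R) (psi : R -> R[i]) : bergman lambda :=
  to_bergman lambda (bergman_Radj lambda psi).
Canonical of_half_line_unlockable := Unlockable of_half_line.unlock.

Section Radj.
Context {R : realType}.
Local Notation C := R[i].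
Local Notation mu := (@lebesgue_measure R).
Local Notation D := (`]0, +oo[%classic : set R).
Local Notation H := (@half_plane R).
Let mD : measurable D. Proof. by []. Qed.
Variable lambda : R.
Hypothesis hlambda : -1 < lambda.
Local Notation p := (lambda + 1).
Implicit Types psi phi : R -> C.
Let p0 : 0 < p. Proof. by rewrite -ltrBlDr sub0r. Qed.
Let G0 : 0 < Gamma (lambda + 2).
Proof. by rewrite (_ : lambda + 2 = p + 1); [exact: Gamma_gt0|ring]. Qed.

(** Half of the damping leaves a square integrable function, and the other half is itself square
    integrable; their product is integrable. *)
Lemma sq_damped_admissible (Psi : R -> C) : cmeasurable_fun D Psi ->
  (forall y, 0 < y -> sq_int mu D (damped_Re Psi y) /\ sq_int mu D (damped_Im Psi y)) -> laplace_admissible Psi.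
Proof.
move=> mPsi sqPsi; split => // y yp; have [h1 h2] := sqPsi _ (divr_gt0 yp (ltr0n R 2)).
have s1 : L2_half_line (damp (y / 2) Psi).
  apply/L2_half_lineP; split.
    by rewrite (_ : (fun x => _) = damped_Re Psi (y / 2))//; apply/funext => x; rewrite /damp /damped_Re cReM/= mulr0 subr0.
  by rewrite (_ : (fun x => _) = damped_Im Psi (y / 2))//; apply/funext => x; rewrite /damp /damped_Im cImM/= mulr0 add0r.
have [[_ h] _] := L2_laplace_admissible s1.
apply: (Leq_rint mD _ (h _ (divr_gt0 yp (ltr0n R 2)))) => x _.
by rewrite /damp cabsM cabs_real ger0_norm ?expR_ge0// -mulrA -expRD; congr (_ * expR _); field.
Qed.

Definition Radj_weight psi (xi : R) : C := psi xi * (xi `^ (p / 2))%:C.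

Lemma Radj_weight_admissible psi : L2_half_line psi -> laplace_admissible (Radj_weight psi) /\
  forall y, 0 < y -> sq_int mu D (damped_Re (Radj_weight psi) y) /\ sq_int mu D (damped_Im (Radj_weight psi) y).
Proof.
move=> L2psi; have [s1 s2] := (L2_half_lineP psi).1 L2psi.
have mpw : measurable_fun D (fun xi : R => xi `^ (p / 2)).
  by apply: measurable_funTS; exact: measurable_powR.
have bnd (y : R) : 0 < y -> exists M : R, forall xi, D xi -> `|xi `^ (p / 2) * expR (- y * xi)| <= M.
  move=> yp; have [K K0 hK] := gamma_bound p0.
  have y2 : 0 < 2 * y by rewrite mulr_gt0.
  (* [gamma_bound] at 2 y xi bounds the square of b = xi^{p/2} e^{-y xi} by K / (2 y)^p, and b <= 1
     + b^2. *)
  exists (1 + K / (2 * y) `^ p) => xi; rewrite /= in_itv/= andbT => xi0.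
  rewrite ger0_norm ?mulr_ge0 ?powR_ge0 ?expR_ge0//.
  set b := _ * _; have b0 : 0 <= b by rewrite mulr_ge0 ?powR_ge0 ?expR_ge0.
  have b2 : b ^+ 2 <= K / (2 * y) `^ p.
    rewrite ler_pdivlMr ?powR_gt0//.
    have := hK (2 * y * xi) (mulr_gt0 y2 xi0); rewrite powRM ?(ltW y2) ?(ltW xi0)// => h.
    have -> : b ^+ 2 * (2 * y) `^ p = (2 * y) `^ p * xi `^ p * expR (- (2 * y * xi)).
      rewrite /b exprMn -powR_mulrn ?powR_ge0// -powRrM (_ : p / 2 * 2%:R = p); last by field.
      by rewrite expr2 -expRD (_ : - y * xi + - y * xi = - (2 * y * xi)); [ring|ring].
    apply: le_trans h _; rewrite ler_piMr ?(ltW K0)// -expR0 ler_expR mulNr oppr_le0.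
    by rewrite !mulr_ge0// ltW.
  rewrite (le_trans _ (lerD (lexx 1) b2))// -subr_ge0.
  by rewrite (_ : _ - _ = (b - 2^-1) ^+ 2 + 3 / 4); [rewrite addr_ge0 ?sqr_ge0|field].
have sqd y : 0 < y -> sq_int mu D (damped_Re (Radj_weight psi) y) /\ sq_int mu D (damped_Im (Radj_weight psi) y).
  move=> /bnd[M hM]; split.
    have := @sq_int_bounded _ _ (fun xi => xi `^ (p / 2) * expR (- y * xi)) M s1.
    rewrite (_ : (fun x => Re (psi x) * _) = damped_Re (Radj_weight psi) y).
      by apply => //; apply: measurable_funM => //; mfun.
    by apply/funext => x; rewrite /damped_Re /Radj_weight cReM/= mulr0 subr0 mulrA.
  have := @sq_int_bounded _ _ (fun xi => xi `^ (p / 2) * expR (- y * xi)) M s2.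
  rewrite (_ : (fun x => Im (psi x) * _) = damped_Im (Radj_weight psi) y).
    by apply => //; apply: measurable_funM => //; mfun.
  by apply/funext => x; rewrite /damped_Im /Radj_weight cImM/= mulr0 add0r mulrA.
split => //; apply: sq_damped_admissible => //.
by apply: cmeasurableM; [exact: L2psi.1|exact: cmeasurable_real].
Qed.

Lemma RadjE psi (z : C) : 0 < Im z -> bergman_Radj lambda psi z =
  ((Num.sqrt (Gamma (lambda + 2)))^-1)%:C * laplace (Radj_weight psi) z.
Proof. by rewrite /bergman_Radj => ->. Qed.

Let mH : measurable H. Proof. exact: measurable_half_plane. Qed.
Let mw : measurable_fun H (bergman_weight lambda). Proof. exact: measurable_bergman_weight. Qed.
Let w0 z : H z -> 0 <= bergman_weight lambda z.
Proof. by move=> _; rewrite mulr_ge0 ?powR_ge0// divr_ge0 ?pi_ge0 ?ltW. Qed.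

Lemma Radj_plane_norm psi : L2_half_line psi ->
  (\int[plane_measure]_(z in H) (cabs (bergman_Radj lambda psi (to_complex z)) ^+ 2 * bergman_weight lambda z)%:E =
   \int[mu]_(xi in D) (cabs (psi xi) ^+ 2 * 1)%:E)%E.
Proof.
move=> L2psi; have [aW sW] := Radj_weight_admissible L2psi.
have [mL1 mL2] := measurable_laplace aW.
have mL : measurable_fun H (fun z => cabs (laplace (Radj_weight psi) (to_complex z)) ^+ 2 * bergman_weight lambda z).
  by apply: measurable_funM => //; apply: (measurable_funX 2); apply: measurable_cabs.
transitivity ((Gamma (lambda + 2))^-1%:E * \int[plane_measure]_(z in H) (cabs (laplace (Radj_weight psi) (to_complex z)) ^+ 2 * bergman_weight lambda z)%:E)%E.
  rewrite -ge0_integralZl//; last 3 first.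
  - exact/measurable_EFinP.
  - by move=> z Hz; rewrite lee_fin mulr_ge0 ?exprn_ge0 ?cabs_ge0 ?w0.
  - by rewrite lee_fin invr_ge0 ltW.
  apply: eq_integral => z; rewrite inE => Hz; rewrite -EFinM RadjE// cabsM cabs_real.
  rewrite exprMn real_normK ?num_real// exprVn sqr_sqrtr ?(ltW G0)//; congr EFin; ring.
rewrite laplace_plane_norm// -ge0_integralZl//; last 3 first.
- apply/measurable_EFinP; apply: measurable_funM.
    by apply: (measurable_funX 2); apply: measurable_cabs; exact: aW.1.
  apply: measurable_funM; first exact: measurable_cst.
  apply: measurable_funTS; apply: measurableT_comp; first exact: measurable_invr.
  exact: measurable_powR.
- by move=> x _; rewrite lee_fin mulr_ge0 ?exprn_ge0 ?cabs_ge0// divr_ge0 ?powR_ge0// ltW.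
- by rewrite lee_fin invr_ge0 ltW.
apply: eq_integral => x; rewrite inE/= in_itv/= andbT => x0.
rewrite -EFinM; congr EFin; rewrite /Radj_weight cabsM cabs_real (ger0_norm (powR_ge0 _ _)) exprMn.
rewrite -[(x `^ (p / 2)) ^+ 2]powR_mulrn ?powR_ge0// -powRrM (_ : p / 2 * 2%:R = p); last by field.
have x1 : x `^ p != 0 by rewrite gt_eqF ?powR_gt0.
move: (Gamma _) G0 (x `^ p) x1 => G GG a a0; field.
by rewrite a0 gt_eqF.
Qed.

Lemma analytic_at_near (f g : C -> C) (z : C) : (forall x, 0 < Im x -> f x = g x) -> 0 < Im z ->
  analytic_at (f : (C : numFieldType) -> (C : numFieldType)) z ->
  analytic_at (g : (C : numFieldType) -> (C : numFieldType)) z.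
Proof.
move=> fg z0 [a fa]; exists a.
move/near_cabsP : fa => [r r0 fa]; apply/near_cabsP; exists (Num.min r (Im z)); first by rewrite lt_min r0.
move=> x; rewrite lt_min => /andP[xr xz].
have x0 : 0 < Im x.
  by have := le_lt_trans (abs_Im _) xz; rewrite ImB ltr_norml; lra.
by rewrite -(fg x x0); exact: fa.
Qed.

Lemma Radj_bergman psi : L2_half_line psi -> bergman_set lambda (bergman_Radj lambda psi).
Proof.
move=> L2psi; have [aW sW] := Radj_weight_admissible L2psi.
have [mL1 mL2] := measurable_laplace aW.
have E (z : R * R) : H z -> bergman_Radj lambda psi (to_complex z) =
    ((Num.sqrt (Gamma (lambda + 2)))^-1)%:C * laplace (Radj_weight psi) (to_complex z) by move=> Hz; rewrite RadjE.
split.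
- by move=> z /negbTE z0; rewrite /bergman_Radj z0.
- move=> z z0.
  apply: (@analytic_at_near (fun z => ((Num.sqrt (Gamma (lambda + 2)))^-1)%:C * laplace (Radj_weight psi) z + 0)) => //.
    by move=> x x0; rewrite RadjE// addr0.
  by apply: analytic_at_lin; [exact: laplace_analytic|exact: analytic_at0].
split.
  have m := cmeasurableM (cmeasurable_cst H ((Num.sqrt (Gamma (lambda + 2)))^-1)%:C) (conj mL1 mL2).
  by split; [apply: (eq_measurable_fun _ _ m.1)|apply: (eq_measurable_fun _ _ m.2)];
    move=> z; rewrite inE => Hz; rewrite /= E.
under eq_integral do rewrite -cabs_sqr.
rewrite Radj_plane_norm//; have := L2psi.2.
by under eq_integral do rewrite -cabs_sqr.
Qed.

Lemma to_bergmanE (f : C -> C) : bergman_set lambda f -> (to_bergman lambda f : C -> C) = f.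
Proof. by move=> fb; rewrite /to_bergman insubdK// inE. Qed.

Local Notation V := (of_half_line lambda).

Lemma VE psi : L2_half_line psi -> (V psi : C -> C) = bergman_Radj lambda psi.
Proof. by move=> L2psi; rewrite unlock to_bergmanE//; exact: Radj_bergman. Qed.

Lemma bergman_inj (f g : bergman lambda) : (f : C -> C) = g -> f = g.
Proof. exact: val_inj. Qed.

Lemma bergmanP (f : bergman lambda) : bergman_set lambda f.
Proof. exact: (set_mem (valP f)). Qed.

(** Dividing the Paley-Wiener function by xi^{(lambda+1)/2}, up to the constant, gives the preimage.
    [laplace_plane_norm] then turns the finite Bergman norm of [f] into square integrability. *)
Lemma Radj_surj (f : bergman lambda) : exists psi, L2_half_line psi /\ bergman_Radj lambda psi = f.
Proof.
have [f0 fa f2] := bergmanP f.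
have [Psi [aP sP fP]] := paley_wiener hlambda fa f2.
pose g := Num.sqrt (Gamma (lambda + 2)).
have g0 : 0 < g by rewrite sqrtr_gt0.
exists (fun xi => Psi xi * (g / xi `^ (p / 2))%:C).
have W xi : D xi -> Radj_weight (fun xi => Psi xi * (g / xi `^ (p / 2))%:C) xi = g%:C * Psi xi.
  rewrite /= in_itv/= andbT => x0; rewrite /Radj_weight -mulrA -rmorphM/= divfK ?gt_eqF ?powR_gt0//.
  by rewrite mulrC.
split; last first.
  apply/funext => z; have [z0|z0] := boolP (0 < Im z); last by rewrite f0// /bergman_Radj (negbTE z0).
  rewrite RadjE// fP//.
  have -> : laplace (Radj_weight (fun xi => Psi xi * (g / xi `^ (p / 2))%:C)) z = g%:C * laplace Psi z.
    rewrite /laplace -(LcintegralZ mD _ (laplace_integrable aP z0)).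
    by apply: Leq_cintegral => xi Dxi; rewrite W// mulrA.
  by rewrite mulrA -rmorphM/= mulVf ?gt_eqF// mul1r.
have mg : measurable_fun D (fun xi : R => g / xi `^ (p / 2)).
  apply: measurable_funM; first exact: measurable_cst.
  apply: measurable_funTS; apply: measurableT_comp; first exact: measurable_invr.
  exact: measurable_powR.
split.
  by apply: cmeasurableM; [exact: aP.1|exact: cmeasurable_real].
have := f2.2; under eq_integral do rewrite -cabs_sqr.
have -> : (\int[plane_measure]_(z in H) (cabs ((f \o to_complex) z) ^+ 2 * bergman_weight lambda z)%:E =
    \int[plane_measure]_(z in H) (cabs (laplace Psi (to_complex z)) ^+ 2 * bergman_weight lambda z)%:E)%E.
  by apply: eq_integral => z; rewrite inE => Hz; rewrite /= fP.
rewrite laplace_plane_norm//; apply: le_lt_trans; rewrite le_eqVlt; apply/orP; left; apply/eqP.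
apply: eq_integral => x; rewrite inE/= in_itv/= andbT => x0.
rewrite -cabs_sqr cabsM cabs_real ger0_norm ?divr_ge0 ?powR_ge0 ?(ltW g0)//; congr EFin.
rewrite mulr1 exprMn; congr (_ * _); rewrite exprMn exprVn sqr_sqrtr ?(ltW G0)//.
by rewrite -[(x `^ (p / 2)) ^+ 2]powR_mulrn ?powR_ge0// -powRrM (_ : p / 2 * 2%:R = p)//; field.
Qed.

Lemma bergman_RP (f : bergman lambda) : L2_half_line (bergman_R f) /\ bergman_Radj lambda (bergman_R f) = f.
Proof.
have [psi h] := Radj_surj f; rewrite /bergman_R; case: xgetP => [phi -> //|/(_ psi)[]].
exact: h.
Qed.

Lemma VR (f : bergman lambda) : V (bergman_R f) = f.
Proof. by have [h1 h2] := bergman_RP f; apply: bergman_inj; rewrite VE. Qed.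

Lemma Radj_weight_ae psi phi : ae_eq mu D (Radj_weight psi) (Radj_weight phi) <-> ae_eq mu D psi phi.
Proof.
split => E; apply: (@filterS _ _ (ae_filter_ringOfSetsType mu) _ _ _ E) => x h Dx; last first.
  by rewrite /Radj_weight (h Dx).
have := h Dx; rewrite /Radj_weight; apply: mulIf.
by move: Dx; rewrite /= in_itv/= andbT => x0; rewrite eq_complex/= eqxx andbT gt_eqF ?powR_gt0.
Qed.

Lemma Radj_inj psi phi : L2_half_line psi -> L2_half_line phi ->
  bergman_Radj lambda psi = bergman_Radj lambda phi <-> ae_eq mu D psi phi.
Proof.
move=> L1 L2; have [a1 _] := Radj_weight_admissible L1; have [a2 _] := Radj_weight_admissible L2.
split => [E|E].
  apply/Radj_weight_ae; apply: (laplace_inj a1 a2 (@ltr01 R)) => x.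
  have := congr1 (fun f => f (x +i* 1)) E; rewrite !RadjE//=; apply: mulfI.
  by rewrite eq_complex/= eqxx andbT invr_eq0 gt_eqF// sqrtr_gt0.
apply/funext => z; have [z0|z0] := boolP (0 < Im z); last by rewrite /bergman_Radj (negbTE z0).
by rewrite !RadjE//; congr (_ * _); apply: ae_eq_laplace => //; exact/Radj_weight_ae.
Qed.

Lemma V_ae psi phi : L2_half_line psi -> L2_half_line phi -> ae_eq mu D psi phi -> V psi = V phi.
Proof. by move=> L1 L2 E; have h1 := VE L1; have h2 := VE L2; apply: bergman_inj; rewrite h1 h2 ((Radj_inj L1 L2).2 E). Qed.

(** [bergman_R] picks some representative of the class, so recovery is only up to a null set. *)
Lemma RV psi : L2_half_line psi -> ae_eq mu D (bergman_R (V psi)) psi.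
Proof.
move=> L2psi; have [h1 h2] := bergman_RP (V psi).
by apply/(Radj_inj h1 L2psi); rewrite h2 VE.
Qed.

Lemma L2_lin (c : C) psi phi : L2_half_line psi -> L2_half_line phi -> L2_half_line (fun xi => c * psi xi + phi xi).
Proof. by move=> L1 L2; apply: (sq_lin (m := mu)) => //; exact: measurable_cst. Qed.

Lemma V_lin (c : C) psi phi : L2_half_line psi -> L2_half_line phi ->
  V (fun xi => c * psi xi + phi xi) = c *: V psi + V phi.
Proof.
move=> L1 L2; have [a1 _] := Radj_weight_admissible L1; have [a2 _] := Radj_weight_admissible L2.
apply: bergman_inj; rewrite VE; last exact: L2_lin.
apply/funext => z; transitivity (c * (V psi : C -> C) z + (V phi : C -> C) z); last by [].
have h1 := VE L1; have h2 := VE L2; rewrite h1 h2; have [z0|z0] := boolP (0 < Im z); last by rewrite /bergman_Radj (negbTE z0) mulr0 addr0.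
rewrite !RadjE// mulrCA -mulrDr; congr (_ * _); rewrite -laplace_lin//.
by apply: Leq_cintegral => xi _; congr (_ * _); rewrite /Radj_weight; ring.
Qed.

Definition ip2 psi phi : C := cintegral mu D (fun xi => psi xi * conjc (phi xi) * (1 : R)%:C).

Lemma V_inner psi phi : L2_half_line psi -> L2_half_line phi -> bergman_inner lambda (V psi) (V phi) = ip2 psi phi.
Proof.
move=> L1 L2.
have N chi : L2_half_line chi -> sq_norm plane_measure H (bergman_weight lambda) ((V chi : C -> C) \o to_complex) = sq_norm mu D (fun=> 1) chi.
  by move=> L3; rewrite VE// /sq_norm /Rintegral Radj_plane_norm.
have sV chi : L2_half_line chi -> csquare_integrable plane_measure H (bergman_weight lambda) ((V chi : C -> C) \o to_complex).
  by move=> _; have [] := bergmanP (V chi).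
apply: (@eq_sq_ip R _ _ _ _ plane_measure mu H D (bergman_weight lambda) (fun=> 1)
  ((V psi : C -> C) \o to_complex) ((V phi : C -> C) \o to_complex) psi phi mH mD mw _ w0 _
  (sV _ L1) (sV _ L2) L1 L2 _ (N _ L1) (N _ L2)) => //.
move=> c; rewrite -N; last exact: L2_lin.
by rewrite V_lin.
Qed.

End Radj.

(** * Multiplication operators *)

Section multiplication_operators.
Context {R : realType}.
Local Notation C := R[i].
Local Notation mu := (@lebesgue_measure R).
Local Notation D := (`]0, +oo[%classic : set R).
Let mD : measurable D. Proof. by []. Qed.
Variable lambda : R.
Hypothesis hlambda : -1 < lambda.
Implicit Types (psi phi chi : R -> C).
Local Notation V := (of_half_line lambda).
Local Notation ip := (bergman_inner lambda).
Local Notation bergman := (bergman lambda).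
Implicit Types f g : bergman.

Lemma RP f : L2_half_line (bergman_R f). Proof. exact: (bergman_RP hlambda f).1. Qed.

Lemma cintegral_conj d (T : measurableType d) (m : {measure set T -> \bar R}) (A : set T) (F : T -> C) :
  measurable A -> cintegrable m A F -> cintegral m A (fun x => conjc (F x)) = conjc (cintegral m A F).
Proof.
move=> mA [_ i2]; rewrite !cintegralE /=; congr (_ +i* _).
  by apply: eq_Rint => x _; case: (F x).
by rewrite -(RintN mA i2); apply: eq_Rint => x _; case: (F x).
Qed.

Lemma ip2_conj psi phi : L2_half_line psi -> L2_half_line phi -> ip2 phi psi = conjc (ip2 psi phi).
Proof.
move=> L1 L2; rewrite /ip2 -(cintegral_conj (m := mu) mD); last first.
  by apply: (sq_ip (m := mu)) => //; exact: measurable_cst.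
apply: Leq_cintegral => x _; rewrite !rmorphM/= conjcK.
by case: (psi x) (phi x) => [a b] [a' b'] /=; apply/eqP; rewrite eq_complex/=; apply/andP; split; apply/eqP; ring.
Qed.

Lemma ip2_lin (c : C) psi phi chi : L2_half_line psi -> L2_half_line phi -> L2_half_line chi ->
  ip2 (fun x => c * psi x + phi x) chi = c * ip2 psi chi + ip2 phi chi.
Proof. by move=> L1 L2 L3; apply: (ip_linl (m := mu)) => //; exact: measurable_cst. Qed.

Lemma innerE f g : ip f g = ip2 (bergman_R f) (bergman_R g).
Proof. by rewrite -(V_inner hlambda (RP f) (RP g)) !VR. Qed.

Lemma inner_conj f g : ip g f = conjc (ip f g).
Proof. by rewrite !innerE ip2_conj//; exact: RP. Qed.

Lemma inner_linl (c : C) f g h : ip (c *: f + g) h = c * ip f h + ip g h.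
Proof.
rewrite -{1}(VR hlambda f) -{1}(VR hlambda g) -(V_lin hlambda c (RP f) (RP g)) -{1}(VR hlambda h).
rewrite (V_inner hlambda) ?ip2_lin ?innerE//; [exact: RP..|exact: L2_lin (RP f) (RP g)|exact: RP].
Qed.

Lemma inner_linr (c : C) f g h : ip h (c *: f + g) = conjc c * ip h f + ip h g.
Proof.
by rewrite (inner_conj (c *: f + g) h) (inner_conj f h) (inner_conj g h) inner_linl rmorphD rmorphM.
Qed.

Lemma ip2_self psi : ip2 psi psi = (sq_norm mu D (fun=> 1) psi)%:C.
Proof. exact: ip_self. Qed.

Lemma V0 : V (fun=> 0) = 0.
Proof.
have L0 : L2_half_line (fun=> 0 : C) by exact: csquare_integrable0.
have := V_lin hlambda (-1) L0 L0; rewrite scaleN1r addNr => <-.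
by congr V; apply/funext => x; rewrite mulr0 addr0.
Qed.

Lemma L2_int psi : L2_half_line psi -> mu.-integrable D (EFin \o (fun x => cabs (psi x) ^+ 2 * 1)).
Proof.
by apply: (sq_norm_integrable (m := mu)) => //; exact: measurable_cst.
Qed.

Lemma ae_eq_same psi : ae_eq mu D psi psi. Proof. by apply: aeW => x. Qed.

Lemma L2_ae psi phi : cmeasurable_fun D phi -> L2_half_line psi -> ae_eq mu D psi phi -> L2_half_line phi.
Proof.
move=> [m1 m2] /L2_half_lineP[s1 s2] E; apply/L2_half_lineP; split; split => //.
  apply: (ae_eq_rint (m := mu) mD _ _ s1.2); last exact: (measurable_funX 2 m1).
  by apply: (@filterS _ _ (ae_filter_ringOfSetsType mu) _ _ _ E) => x h Dx; rewrite (h Dx).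
apply: (ae_eq_rint (m := mu) mD _ _ s2.2); last exact: (measurable_funX 2 m2).
by apply: (@filterS _ _ (ae_filter_ringOfSetsType mu) _ _ _ E) => x h Dx; rewrite (h Dx).
Qed.

Lemma L2_null psi : L2_half_line psi -> sq_norm mu D (fun=> 1) psi = 0 -> ae_eq mu D psi (fun=> 0).
Proof.
move=> L N; have i := L2_int L.
have p0 x : D x -> 0 <= cabs (psi x) ^+ 2 * 1 by rewrite mulr1 exprn_ge0 ?cabs_ge0.
have h := Rint0_ae (m := mu) mD i p0 N.
apply: (@filterS _ _ (ae_filter_ringOfSetsType mu) _ _ _ h) => x hx Dx.
by move/eqP : (hx Dx); rewrite mulr1 sqrf_eq0 cabs_eq0 => /eqP.
Qed.

Lemma inner_eq0 f : ip f f = 0 -> f = 0.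
Proof.
rewrite innerE ip2_self => /(congr1 (@complex.Re R))/= N.
rewrite -(VR hlambda f) -V0; apply: (V_ae hlambda (RP f)); last exact: L2_null (RP f) N.
exact: csquare_integrable0.
Qed.

Lemma inner_ext f g : (forall h, ip f h = ip g h) -> f = g.
Proof.
move=> fg; apply/eqP; rewrite -subr_eq0; apply/eqP/inner_eq0.
have -> : f - g = (-1) *: g + f by rewrite scaleN1r addrC.
by rewrite inner_linl fg mulN1r addNr.
Qed.

Definition bounded_symbol phi := cmeasurable_fun D phi /\ exists M : R, forall x, D x -> cabs (phi x) <= M.

Lemma bounded_symbolM phi chi : bounded_symbol phi -> bounded_symbol chi -> bounded_symbol (fun x => phi x * chi x).
Proof.
move=> [m1 [M1 h1]] [m2 [M2 h2]]; split; first exact: cmeasurableM.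
by exists (M1 * M2) => x Dx; apply: cabsM_le; [exact: h1|exact: h2].
Qed.

Lemma bounded_symbol_conj phi : bounded_symbol phi -> bounded_symbol (fun x => conjc (phi x)).
Proof.
move=> [m1 [M1 h1]]; split; first exact: cmeasurable_conj.
by exists M1 => x Dx; rewrite cabs_conj h1.
Qed.

Lemma L2_dominated phi psi (M : R) : cmeasurable_fun D phi -> L2_half_line psi ->
  (forall x, D x -> cabs (phi x) <= M * cabs (psi x)) -> L2_half_line phi.
Proof.
move=> mp L2p h; have i := L2_int L2p.
split => //; under eq_integral do rewrite -cabs_sqr.
have mc : measurable_fun D (fun x => cabs (phi x) ^+ 2 * 1).
  by apply: measurable_funM => //; apply: (measurable_funX 2); exact: measurable_cabs.
apply: (Lrint_lty mD); last by move=> x _; rewrite mulr1 exprn_ge0 ?cabs_ge0.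
apply: (Lintegrable_dominated mD mc (LrintZ mD (M ^+ 2) i)) => x Dx.
rewrite !mulr1 ger0_norm ?exprn_ge0 ?cabs_ge0// -exprMn lerXn2r ?nnegrE ?cabs_ge0 ?h//.
exact: le_trans (cabs_ge0 _) (h x Dx).
Qed.

Lemma L2_symbol phi psi : bounded_symbol phi -> L2_half_line psi -> L2_half_line (fun x => phi x * psi x).
Proof.
move=> [mp [M h]] L2p; apply: (L2_dominated (M := M) _ L2p); first by apply: cmeasurableM => //; exact: L2p.1.
by move=> x Dx; rewrite cabsM ler_wpM2r ?cabs_ge0 ?h.
Qed.

(** The operator R^* phi R. As [V] ignores null sets, the representative chosen by [bergman_R] does
    not affect it. *)
Definition Mop phi f : bergman := V (fun xi => phi xi * bergman_R f xi).

Lemma ae_eqM phi psi chi : ae_eq mu D psi chi -> ae_eq mu D (fun x => phi x * psi x) (fun x => phi x * chi x).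
Proof.
move=> E; apply: (@filterS _ _ (ae_filter_ringOfSetsType mu) _ _ _ E) => x h Dx.
by rewrite (h Dx).
Qed.

Lemma MopV phi psi : bounded_symbol phi -> L2_half_line psi -> Mop phi (V psi) = V (fun x => phi x * psi x).
Proof.
move=> bp L2p; apply: (V_ae hlambda (L2_symbol bp (RP _)) (L2_symbol bp L2p)).
exact: ae_eqM (RV hlambda L2p).
Qed.

Lemma R_Mop phi f : bounded_symbol phi -> ae_eq mu D (bergman_R (Mop phi f)) (fun x => phi x * bergman_R f x).
Proof. by move=> bp; apply: (RV hlambda); apply: L2_symbol => //; exact: RP. Qed.

Lemma MopM phi chi f : bounded_symbol phi -> bounded_symbol chi -> Mop phi (Mop chi f) = Mop (fun x => phi x * chi x) f.
Proof.
move=> b1 b2; rewrite {2}/Mop MopV//; last by apply: L2_symbol => //; exact: RP.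
by congr V; apply/funext => x; rewrite mulrA.
Qed.

Lemma Mop_comm phi chi : bounded_symbol phi -> bounded_symbol chi -> Mop phi \o Mop chi = Mop chi \o Mop phi.
Proof.
move=> b1 b2; apply/funext => f; rewrite /= !MopM//; congr Mop; apply/funext => x; exact: mulrC.
Qed.

Lemma Mop_linear phi : bounded_symbol phi -> linear (Mop phi).
Proof.
move=> bp c f g; rewrite -{1}(VR hlambda f) -{1}(VR hlambda g) -(V_lin hlambda c (RP f) (RP g)).
rewrite MopV//; last exact: L2_lin (RP f) (RP g).
rewrite /Mop -(V_lin hlambda c (L2_symbol bp (RP f)) (L2_symbol bp (RP g))).
by congr V; apply/funext => x; ring.
Qed.

Lemma Mop_ae phi chi : bounded_symbol phi -> bounded_symbol chi -> ae_eq mu D phi chi -> Mop phi = Mop chi.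
Proof.
move=> b1 b2 E; apply/funext => f; apply: (V_ae hlambda (L2_symbol b1 (RP f)) (L2_symbol b2 (RP f))).
by apply: (@filterS _ _ (ae_filter_ringOfSetsType mu) _ _ _ E) => x h Dx; rewrite (h Dx).
Qed.

Lemma ip2_ae psi1 psi2 phi1 phi2 : L2_half_line psi1 -> L2_half_line psi2 -> L2_half_line phi1 -> L2_half_line phi2 ->
  ae_eq mu D psi1 psi2 -> ae_eq mu D phi1 phi2 -> ip2 psi1 phi1 = ip2 psi2 phi2.
Proof.
by move=> L1 L2 L3 L4 E1 E2; rewrite -!(V_inner hlambda)// (V_ae hlambda L1 L2 E1) (V_ae hlambda L3 L4 E2).
Qed.

Lemma Mop_inner phi f g : bounded_symbol phi ->
  ip (Mop phi f) g = ip2 (fun x => phi x * bergman_R f x) (bergman_R g).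
Proof. by move=> bp; rewrite -{1}(VR hlambda g) (V_inner hlambda)//; [exact: L2_symbol (RP f)|exact: RP]. Qed.

Lemma Mop_adjoint phi : bounded_symbol phi -> adjoint_of ip (Mop phi) (Mop (fun x => conjc (phi x))).
Proof.
move=> bp f g; have bc := bounded_symbol_conj bp.
rewrite Mop_inner// inner_conj Mop_inner// -ip2_conj; [|exact: L2_symbol (RP g)|exact: RP].
apply: Leq_cintegral => x _; rewrite rmorphM/= conjcK.
by move: (conjc _) => *; ring.
Qed.

Lemma Mop_bounded phi : bounded_symbol phi -> bounded_operator ip (Mop phi).
Proof.
move=> bp; split; first exact: Mop_linear.
have [mp [M h]] := bp; exists `|M| => f.
rewrite /hnorm Mop_inner//.
have -> : ip2 (fun x => phi x * bergman_R f x) (bergman_R (Mop phi f)) = ip2 (fun x => phi x * bergman_R f x) (fun x => phi x * bergman_R f x).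
  by apply: ip2_ae (L2_symbol bp (RP f)) (L2_symbol bp (RP f)) (RP _) (L2_symbol bp (RP f)) (ae_eq_same _) (R_Mop f bp).
rewrite ip2_self innerE ip2_self /=.
rewrite -sqrtr_sqr -sqrtrM ?sqr_ge0// ler_wsqrtr//.
have i1 := L2_int (RP f).
have i2 := L2_int (L2_symbol bp (RP f)).
rewrite /sq_norm -(LRintZ mD _ i1); apply: Lle_Rint => //; first exact: LrintZ.
move=> x Dx; rewrite !mulr1 cabsM exprMn ler_wpM2r ?exprn_ge0 ?cabs_ge0//.
rewrite -(real_normK (num_real M)) lerXn2r ?nnegrE ?cabs_ge0//.
exact: le_trans (h x Dx) (ler_norm M).
Qed.

Definition shift_symbol (h xi : R) : C := cexp ((0 +i* (- (h * xi)))).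

Lemma shift_symbol_bounded h : bounded_symbol (shift_symbol h).
Proof.
split; last by exists 1 => x _; rewrite /shift_symbol cabs_cexp/= expR0.
by apply: cmeasurable_cexp; split; [exact: measurable_cst|rewrite /=; mfun].
Qed.

Lemma translation_V (h : R) psi : L2_half_line psi -> translation h (V psi) = V (fun x => shift_symbol h x * psi x).
Proof.
move=> L2p; have Ls := L2_symbol (shift_symbol_bounded h) L2p.
have E : (fun z => (V psi : C -> C) (z - h%:C)) = bergman_Radj lambda (fun x => shift_symbol h x * psi x).
  have h1 := VE hlambda L2p; rewrite h1; apply/funext => z.
  have Iz : Im (z - h%:C) = Im z by rewrite ImB/= subr0.
  have [z0|z0] := boolP (0 < Im z); last by rewrite /bergman_Radj Iz (negbTE z0).
  rewrite !RadjE ?Iz//; congr (_ * _); apply: Leq_cintegral => x _.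
  rewrite /Radj_weight /shift_symbol [in RHS]mulrAC -[RHS]mulrA.
  have -> : cexp ((0 +i* 1) * (z - h%:C) * x%:C) = cexp (0 +i* (- (h * x))) * cexp ((0 +i* 1) * z * x%:C).
    rewrite -cexpD; congr cexp; case: (z) => a b.
    by apply/eqP; rewrite eq_complex/=; apply/andP; split; apply/eqP; ring.
  by move: (cexp _) (cexp _) (_%:C) => *; ring.
apply: bergman_inj; rewrite /translation E to_bergmanE; first by rewrite (VE hlambda Ls).
exact: Radj_bergman.
Qed.

Lemma translationE h : translation h = Mop (shift_symbol h) :> (bergman -> bergman).
Proof. by apply/funext => f; rewrite -{1}(VR hlambda f) translation_V//; exact: RP. Qed.

Lemma Mop_vertical phi : bounded_symbol phi -> vertical (Mop phi).
Proof. by move=> bp h; rewrite translationE Mop_comm//; exact: shift_symbol_bounded. Qed.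

(** Differentiating the Laplace integral brings down i xi, so (1/i) f' is the transform of xi times
    the function of [f]. If this is a Bergman function [g], injectivity on one line equates xi R f
    with R g almost everywhere, which also shows that xi R f is square integrable. *)
Lemma K_spectral f g : bergman_K f g <-> bergman_xi f g.
Proof.
have [L1 E1] := bergman_RP hlambda f; have [L2 E2] := bergman_RP hlambda g.
have [a1 s1] := Radj_weight_admissible hlambda L1; have [a2 _] := Radj_weight_admissible hlambda L2.
have aX : laplace_admissible (fun xi => xi%:C * Radj_weight lambda (bergman_R f) xi).
  by have := laplace_admissibleX 1 a1; under eq_fun do rewrite expr1.
pose G := ((Num.sqrt (Gamma (lambda + 2)))^-1)%:C : C.
have dE z : 0 < Im z -> (0 +i* 1)^-1 * derive1 (f : C -> C^o) z =
    G * laplace (fun xi => xi%:C * Radj_weight lambda (bergman_R f) xi) z.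
  move=> z0.
  have d := sderivZ G (sderiv_laplace a1 z0).
  have {}d : sderiv (f : C -> C) z (G * ((0 +i* 1) * laplace (fun xi => xi%:C * Radj_weight lambda (bergman_R f) xi) z)).
    apply: sderiv_eq d; exists (Im z) => // x xz.
    have x0 : 0 < Im x by have := le_lt_trans (abs_Im _) xz; rewrite ImB ltr_norml; lra.
    by rewrite -E1 RadjE.
  have i0 : (0 +i* 1) != 0 :> C by rewrite eq_complex/= eqxx oner_eq0.
  by rewrite (sderiv_derive1 d) mulrCA mulKf.
have XW : (fun xi => xi%:C * Radj_weight lambda (bergman_R f) xi) = Radj_weight lambda (fun xi => xi%:C * bergman_R f xi).
  by apply/funext => x; rewrite /Radj_weight mulrA.
split => [Kfg|[LX EX] z z0].
  have E : ae_eq mu D (fun xi => xi%:C * bergman_R f xi) (bergman_R g).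
    apply/(Radj_weight_ae lambda); rewrite -XW; apply: (laplace_inj aX a2 (@ltr01 R)) => x.
    have z0 : 0 < Im (x +i* 1) by rewrite /=.
    have := Kfg _ z0; rewrite dE// -E2 RadjE// => /esym; apply: mulfI.
    rewrite eq_complex/= eqxx andbT invr_eq0 gt_eqF// sqrtr_gt0.
    by rewrite (_ : lambda + 2 = lambda + 1 + 1); [apply: Gamma_gt0; rewrite -ltrBlDr sub0r|ring].
  have LX : L2_half_line (fun xi => xi%:C * bergman_R f xi).
    apply: L2_ae L2 _; last by apply: (@filterS _ _ (ae_filter_ringOfSetsType mu) _ _ _ E) => x h Dx; rewrite h.
    by apply: cmeasurableM; [exact: cmeasurable_id|exact: L1.1].
  by split => //; rewrite -E2; apply/(Radj_inj hlambda LX L2).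
by rewrite dE// XW -RadjE// EX.
Qed.

End multiplication_operators.

(** * Integrals against the spectral measure *)

Section spectral_integrals.
Context {R : realType}.
Local Notation C := R[i].
Local Notation mu := (@lebesgue_measure R).
Local Notation D := (`]0, +oo[%classic : set R).
Let mD : measurable D. Proof. by []. Qed.
Variable lambda : R.
Hypothesis hlambda : -1 < lambda.
Implicit Types (psi phi chi : R -> C).
Local Notation V := (of_half_line lambda).
Local Notation ip := (bergman_inner lambda).
Local Notation bergman := (bergman lambda).
Implicit Types f g : bergman.
Local Notation w f xi := (cabs (bergman_R f xi) ^+ 2).

Let w0 f xi : 0 <= w f xi. Proof. by rewrite exprn_ge0 ?cabs_ge0. Qed.

Lemma integrable_spectral_density f : mu.-integrable D (EFin \o (fun xi => w f xi)).
Proof. by apply: (Leq_rint mD _ (L2_int (RP hlambda f))) => x _; rewrite mulr1. Qed.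

Let mw f : measurable_fun D (fun xi => w f xi). Proof. exact: Lrint_measurable (integrable_spectral_density f). Qed.

Definition spectral_null (S : set R) := {ae mu, forall x, D x -> ~ S x}.

Lemma bounded_symbol_indic (S : set R) : measurable S -> bounded_symbol (fun xi => (\1_S xi)%:C : C).
Proof.
move=> mS; split; first by apply: cmeasurable_real; apply: measurable_funTS; exact: measurable_indic.
by exists 1 => x _; rewrite cabs_real ger0_norm// indicE; case: (_ \in _).
Qed.

Lemma spectral_measureE (S : set R) : spectral_measure S = Mop (fun xi => (\1_S xi)%:C) :> (bergman -> bergman).
Proof. by apply/funext => f; rewrite /Mop unlock. Qed.

Lemma measurable_indic_density f (S : set R) : measurable S -> measurable_fun D (fun xi => \1_S xi * w f xi).
Proof.
by move=> mS; apply: measurable_funM; [apply: measurable_funTS; exact: measurable_indic|exact: mw].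
Qed.

Lemma spectral_rhoE f (S : set R) : measurable S ->
  spectral_rho f S = (\int[mu]_(xi in D) (\1_S xi * w f xi)%:E)%E.
Proof.
move=> mS; have bS := bounded_symbol_indic mS.
rewrite /spectral_rho spectral_measureE inner_conj// Mop_inner// /ip2 cintegralE/=.
have i1 : mu.-integrable D (EFin \o (fun xi => \1_S xi * w f xi)).
  apply: (Lintegrable_dominated mD _ (integrable_spectral_density f)).
    exact: measurable_indic_density.
  move=> x _; rewrite normrM (ger0_norm (w0 f x)) ler_piMl// indicE.
  by case: (_ \in _); rewrite ?normr1 ?normr0.
rewrite (LRintE mD i1); congr EFin; apply: Leq_Rint => x _.
by rewrite cabs_sqr; case: (bergman_R f x) => a b /=; ring.
Qed.

(** On each level set the value of [spectral_rho f] is an integral with density |R f|^2, and the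
    finite sum over the levels is taken under that integral. *)
Lemma sintegral_spectral_rho f (h : {nnsfun R >-> R}) :
  sintegral (spectral_rho f) h = (\int[mu]_(xi in D) (h xi * w f xi)%:E)%E.
Proof.
have mh (y : R) : measurable (h @^-1` [set y]).
  by rewrite -[X in measurable X]setTI; apply: (measurable_funP h) => //; exact: measurable_set1.
rewrite /sintegral -(@fsbig_widen _ _ _ _ (range h) setT)//=; last first.
  move=> x [_ Nfx] /=; rewrite preimage10//.
  rewrite spectral_rhoE//; under eq_integral do rewrite indic0 mul0r.
  by rewrite integral0 mule0.
transitivity (\sum_(y \in range h) \int[mu]_(xi in D) (y%:E * (\1_(h @^-1` [set y]) xi * w f xi)%:E))%E.
  apply: eq_fsbigr => y; rewrite inE => -[x _ <-].
  rewrite ge0_integralZl//.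
  - by rewrite spectral_rhoE.
  - by apply/measurable_EFinP; exact: measurable_indic_density.
  - by move=> t _; rewrite lee_fin mulr_ge0.
  - by rewrite lee_fin.
rewrite -ge0_integral_fsum//=; last 2 first.
- by move=> y; apply: measurable_funeM; apply/measurable_EFinP; exact: measurable_indic_density.
- move=> y x _; rewrite indicE; case: (boolP (x \in h @^-1` [set y])) => [/set_mem/= <-|_].
    by rewrite mul1r -EFinM lee_fin mulr_ge0.
  by rewrite mul0r mule0.
apply: eq_integral => xi _.
have rF : finite_set (range h) by exact: fimfunP.
rewrite (fsbigD1 (h xi) (range h) _ rF); last by exists xi.
rewrite fsbig1; first by rewrite indicE mem_set//= mul1r adde0.
by move=> y [fy /= /nesym yfx]; rewrite indicE memNset ?mul0r ?mule0.
Qed.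

(* [spectral_rho f] is not bundled as a measure: the supremum is what its integral
   unfolds to. *)
Lemma nnintegral_spectral_rho f (u u0 : R -> R) (Z : set R) :
  (forall x, 0 <= u x) -> spectral_null Z -> measurable_fun setT u0 -> (forall x, u0 x = u x * \1_(~` Z) x) ->
  ereal_sup [set sintegral (spectral_rho f) h | h in
    [set h : {nnsfun R >-> R} | forall x, ((h x)%:E <= (u x)%:E)%E]] = (\int[mu]_(xi in D) (u0 xi * w f xi)%:E)%E.
Proof.
move=> pu Z0 mu0 E.
have pu0 x : 0 <= u0 x by rewrite E mulr_ge0.
have u0u x : u0 x <= u x by rewrite E ler_piMr// indicE; case: (_ \in _).
have mu0w : measurable_fun D (fun xi => (u0 xi * w f xi)%:E).
  by apply/measurable_EFinP; apply: measurable_funM; [exact: measurable_funTS|exact: mw].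
have mhw (h : {nnsfun R >-> R}) : measurable_fun D (fun xi => (h xi * w f xi)%:E).
  by apply/measurable_EFinP; apply: measurable_funM; [exact: measurable_funTS|exact: mw].
(* A simple function below [u] is below [u0] off the null set [Z]. Conversely, simple functions
   increasing to the Borel function [u0] compete in the supremum, because u0 <= u. *)
apply/eqP; rewrite eq_le; apply/andP; split.
  apply: ub_ereal_sup => _ [h /= hu <-]; rewrite sintegral_spectral_rho.
  apply: ae_ge0_le_integral => //.
  - by move=> x _; rewrite lee_fin mulr_ge0.
  - exact: mhw.
  - by move=> x _; rewrite lee_fin mulr_ge0.
  - apply: (@filterS _ _ (ae_filter_ringOfSetsType mu) _ _ _ Z0) => x Zx Dx.
    rewrite lee_fin ler_wpM2r// E indicE mem_set ?mulr1; last exact: Zx.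
    by have := hu x; rewrite lee_fin.
have mu0' : measurable_fun [set: R] (EFin \o u0) by exact/measurable_EFinP.
pose h := nnsfun_approx measurableT mu0'.
have hu0 n x : ((h n x)%:E <= (u0 x)%:E)%E.
  by rewrite nnsfun_approxE; apply: (le_approx (f := EFin \o u0)) => // t _; rewrite lee_fin.
have hc : (\int[mu]_(xi in D) (h n xi * w f xi)%:E @[n --> \oo] --> \int[mu]_(xi in D) (u0 xi * w f xi)%:E)%E.
  have -> : (\int[mu]_(xi in D) (u0 xi * w f xi)%:E = \int[mu]_(xi in D) limn (fun n => (h n xi * w f xi)%:E))%E.
    apply: eq_integral => x _; apply/esym/cvg_lim => //; apply: cvg_EFin; first exact: nearW.
    apply: cvgMl.
    by have := cvg_nnsfun_approx measurableT mu0' (fun x _ => pu0 x) (x := x) I => /fine_cvgP[].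
  apply: cvg_monotone_convergence => //.
  - by move=> n; exact: mhw.
  - by move=> n x _; rewrite lee_fin mulr_ge0.
  - by move=> x _ n m nm; rewrite lee_fin ler_wpM2r//; move: x; apply/lefP; exact: (nd_nnsfun_approx measurableT mu0' nm).
rewrite -(cvg_lim _ hc)//; apply: lime_le; first by apply/cvg_ex; eexists; exact: hc.
apply: nearW => n; apply: ereal_sup_ubound; exists (h n); last by rewrite sintegral_spectral_rho.
by move=> x; apply: le_trans (hu0 n x) _; rewrite lee_fin.
Qed.

Lemma integral_spectral_rho f (u u0 : R -> R) (Z : set R) (M : R) :
  spectral_null Z -> measurable_fun setT u0 -> (forall x, `|u0 x| <= M) -> (forall x, u0 x = u x * \1_(~` Z) x) ->
  fine (\int[spectral_rho f]_x (u x)%:E) = \int[mu]_(xi in D) (u0 xi * w f xi) /\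
  mu.-integrable D (EFin \o (fun xi => u0 xi * w f xi)).
Proof.
move=> Z0 mu0 bu0 E.
have i0 : mu.-integrable D (EFin \o (fun xi => u0 xi * w f xi)).
  apply: (Lintegrable_dominated mD _ (LrintZ mD M (integrable_spectral_density f))).
    by apply: measurable_funM; [exact: measurable_funTS|exact: mw].
  by move=> x _; rewrite normrM (ger0_norm (w0 f x)) ler_wpM2r.
split => //; rewrite /Rintegral [in RHS]integralE {1}/integral patch_setT; congr (fine (_ - _)%E).
  rewrite (_ : (fun x => (u x)%:E)^\+%E = EFin \o (fun x => Num.max (u x) 0)); last first.
    by apply/funext => x; rewrite funeposE/= EFin_max.
  rewrite (@nnintegral_spectral_rho f _ (fun x => Num.max (u0 x) 0) Z)//.
  - apply: eq_integral => x _; rewrite funeposE/= -EFin_max.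
    by rewrite maxr_pMl ?mul0r.
  - by move=> x; rewrite le_max lexx orbT.
  - by apply: measurable_maxr => //; exact: measurable_cst.
  - by move=> x; rewrite E maxr_pMl ?mul0r.
rewrite (_ : (fun x => (u x)%:E)^\-%E = EFin \o (fun x => Num.max (- u x) 0)); last first.
  by apply/funext => x; rewrite funenegE/= EFin_max.
rewrite (@nnintegral_spectral_rho f _ (fun x => Num.max (- u0 x) 0) Z)//.
- apply: eq_integral => x _; rewrite funenegE/= -EFin_max.
  by rewrite maxr_pMl ?mul0r// mulNr.
- by move=> x; rewrite le_max lexx orbT.
- by apply: measurable_maxr; [exact: measurable_funN|exact: measurable_cst].
- by move=> x; rewrite E maxr_pMl ?mul0r// mulNr.
Qed.

Let cReM_real (z : C) (x : R) : Re (z * x%:C) = Re z * x. Proof. by case: z => a b /=; ring. Qed.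

Let cImM_real (z : C) (x : R) : Im (z * x%:C) = Im z * x. Proof. by case: z => a b /=; ring. Qed.

Lemma cintegral_spectral_rho f phi phi0 (Z : set R) (M : R) : spectral_null Z -> cmeasurable_fun setT phi0 ->
  (forall x, cabs (phi0 x) <= M) -> (forall x, phi0 x = phi x * (\1_(~` Z) x)%:C) ->
  cintegral (spectral_rho f) setT phi = ip2 (fun x => phi0 x * bergman_R f x) (bergman_R f).
Proof.
move=> Z0 [m1 m2] bM E.
have [e1 i1] := @integral_spectral_rho f (fun x => Re (phi x)) (fun x => Re (phi0 x)) Z M Z0 m1
  (fun x => le_trans (abs_Re _) (bM x)) (fun x => etrans (congr1 Re (E x)) (cReM_real _ _)).
have [e2 i2] := @integral_spectral_rho f (fun x => Im (phi x)) (fun x => Im (phi0 x)) Z M Z0 m2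
  (fun x => le_trans (abs_Im _) (bM x)) (fun x => etrans (congr1 Im (E x)) (cImM_real _ _)).
rewrite /cintegral e1 e2 /ip2 cintegralE; congr (_ +i* _); apply: Leq_Rint => x _.
  by rewrite cabs_sqr; case: (phi0 x) (bergman_R f x) => [a b] [a' b'] /=; ring.
by rewrite cabs_sqr; case: (phi0 x) (bergman_R f x) => [a b] [a' b'] /=; ring.
Qed.

Lemma inner0r f : ip f 0 = 0.
Proof.
have -> : 0 = (-1) *: f + f by rewrite scaleN1r addNr.
by rewrite inner_linr// rmorphN rmorph1 mulN1r addNr.
Qed.

Definition exp_weight (xi : R) : C := (expR (- xi))%:C.

Lemma L2_exp_weight : L2_half_line exp_weight.
Proof.
apply/L2_half_lineP; split; last by split; [exact: measurable_cst|rewrite (_ : _ \o _ = cst 0%E); [exact: integrable0|by apply/funext => x /=; rewrite expr0n]].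
rewrite (_ : (fun x => _) = (fun x => expR (-1 * x))); first exact: sq_int_expR.
by apply/funext => x; rewrite mulN1r.
Qed.

(** e^{-xi} never vanishes, so [V exp_weight] is a separating vector: its measure alone detects the
    null sets. *)
Lemma spectral_rho_null (S : set R) : measurable S -> spectral_rho (V exp_weight) S = 0%E -> spectral_null S.
Proof.
move=> mS; set f := V exp_weight; rewrite spectral_rhoE// => N.
have i1 : mu.-integrable D (EFin \o (fun xi => \1_S xi * w f xi)).
  apply: (Lintegrable_dominated mD _ (integrable_spectral_density f)).
    exact: measurable_indic_density.
  move=> x _; rewrite normrM (ger0_norm (w0 f x)) ler_piMl// indicE.
  by case: (_ \in _); rewrite ?normr1 ?normr0.
have N' : \int[mu]_(xi in D) (\1_S xi * w f xi) = 0 by rewrite /Rintegral N.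
have p0 x : D x -> 0 <= \1_S x * w f x by rewrite mulr_ge0.
have h1 := Rint0_ae (m := mu) mD i1 p0 N'.
have h2 := RV hlambda L2_exp_weight.
apply: (@filterS2 _ _ (ae_filter_ringOfSetsType mu) _ _ _ _ h1 h2) => x p1 p2 Dx Sx.
have := p1 Dx; rewrite p2// indicE mem_set// mul1r /exp_weight cabs_real ger0_norm ?expR_ge0//.
by move/eqP; rewrite expf_eq0/= gt_eqF ?expR_gt0.
Qed.

Lemma spectral_measure_null (S : set R) : measurable S -> spectral_measure S = (fun=> 0) :> (bergman -> bergman) -> spectral_null S.
Proof. by move=> mS S0; apply: spectral_rho_null => //; rewrite /spectral_rho S0 inner0r. Qed.

(** For rational q the set u > q is Borel up to a null set, and [Z] is the union of these countably
    many null sets. Any larger Borel set [Z'] is allowed, so that real part, imaginary part and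
    essential bound can share one exceptional set. *)
Lemma completed_measurable (u : R -> R) :
  (forall B, measurable B -> completed_algebra_gen (spectral_rho (V exp_weight)) (u @^-1` B)) ->
  exists2 Z, measurable Z /\ spectral_null Z & forall Z', measurable Z' -> Z `<=` Z' ->
    measurable_fun setT (fun x => u x * \1_(~` Z') x).
Proof.
move=> mu_.
have /choice[N hN] : forall q : rat, exists N : set R, [/\ measurable N, spectral_null N &
    exists A : set R, [/\ measurable A, A `<=` u @^-1` `]ratr q, +oo[ & u @^-1` `]ratr q, +oo[ `<=` A `|` N]].
  move=> q; have [//|A mA [N0 [N [mN N0' NN]]] E] := mu_ `]ratr q, +oo[%classic.
  exists N; split => //; first exact: spectral_rho_null.
  by exists A; rewrite -E; split; [exact: mA|by move=> x Ax; left|by move=> x [Ax|/NN Nx]; [left|right]].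
(* [unpickle] enumerates the rationals; an index coding none of them falls back on 0. *)
pose Z := \bigcup_n N (odflt 0 (choice.unpickle n)).
have NZ q : N q `<=` Z by move=> x Nx; exists (choice.pickle q); rewrite // choice.pickleK.
exists Z.
  split; first by apply: bigcup_measurable => n _; have [] := hN (odflt 0 (choice.unpickle n)).
  have h : forall n, {ae mu, forall x, D x -> ~ N (odflt 0 (choice.unpickle n)) x}.
    by move=> n; have [_] := hN (odflt 0 (choice.unpickle n)).
  apply: (@filterS _ _ (ae_filter_ringOfSetsType mu) _ _ _ (ae_foralln h)) => x hx Dx [n _].
  exact: hx.
move=> Z' mZ' ZZ'; pose v x := u x * \1_(~` Z') x.
have mq (q : rat) : measurable (v @^-1` `]ratr q, +oo[).
  have [_ _ [A [mA A1 A2]]] := hN q.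
  (* On Z' the function is 0, which exceeds q exactly when q is negative; off Z' the set coincides
     with [A], the uncertainty [N q] having been absorbed by Z'. *)
  have -> : v @^-1` `]ratr q, +oo[ = (A `\` Z') `|` (if (ratr q : R) < 0 then Z' else set0).
    apply/seteqP; split => x /=; rewrite /v in_itv/= andbT indicE.
      have [Zx|Zx] := pselect (Z' x).
        by rewrite memNset// mulr0 => ->; right.
      rewrite mem_set// mulr1 => ux; left; split => //.
      have := A2 x; rewrite /= in_itv/= andbT => /(_ ux) [//|/NZ/ZZ'//].
    move=> [[/A1 /=]|].
      by rewrite in_itv/= andbT => ux Zx; rewrite mem_set// mulr1.
    by case: ifPn => // q0 Zx; rewrite memNset// mulr0.
  by apply: measurableU; [exact: measurableD|case: ifP].
apply: (measurability _ (RGenOInfty.measurableE R)).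
move=> _ [_ [r ->] <-]; rewrite setTI.
have -> : v @^-1` `]r, +oo[ = \bigcup_q (if r <= ratr q then v @^-1` `]ratr q, +oo[ else set0).
  apply/seteqP; split => x /=; rewrite in_itv/= andbT.
    move=> rv; have [q] := rat_in_itvoo rv; rewrite in_itv/= => /andP[rq qv].
    by exists q => //; rewrite ltW//= in_itv/= qv.
  by move=> [q _]; case: ifPn => // rq; rewrite /= in_itv/= andbT; exact: le_lt_trans.
by apply: bigcupT_measurable_rat => q; case: ifP.
Qed.

(** Setting [phi] to 0 on a null set that contains all its defects makes it Borel and bounded
    everywhere, so that it can be used as a multiplier. *)
Lemma L_infty_E_rep phi : L_infty_E lambda phi -> exists Z phi0 M,
  [/\ spectral_null Z, cmeasurable_fun setT phi0, forall x, cabs (phi0 x) <= M &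
      forall x, phi0 x = phi x * (\1_(~` Z) x)%:C].
Proof.
move=> [mphi [M [S [mS S0 hS]]]].
have [Z1 [mZ1 N1] h1] := completed_measurable (fun B mB => (mphi (V exp_weight) B mB).1).
have [Z2 [mZ2 N2] h2] := completed_measurable (fun B mB => (mphi (V exp_weight) B mB).2).
pose Z := Z1 `|` Z2 `|` S; pose phi0 x := phi x * (\1_(~` Z) x)%:C.
have mZ : measurable Z by apply: measurableU => //; exact: measurableU.
exists Z, phi0, `|M|; split => //.
- have N3 := spectral_measure_null mS S0.
  apply: (@filterS3 _ _ (ae_filter_ringOfSetsType mu) _ _ _ _ _ N1 N2 N3) => x n1 n2 n3 Dx.
  by move=> [[]|]; [exact: n1|exact: n2|exact: n3].
- split.
    rewrite (_ : _ \o _ = fun x => Re (phi x) * \1_(~` Z) x); first by apply: h1 => // x Zx; left; left.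
    by apply/funext => x; exact: cReM_real.
  rewrite (_ : _ \o _ = fun x => Im (phi x) * \1_(~` Z) x); first by apply: h2 => // x Zx; left; right.
  by apply/funext => x; exact: cImM_real.
- move=> x; rewrite /phi0 cabsM cabs_real indicE.
  have [Zx|Zx] := pselect (Z x); first by rewrite memNset// normr0 mulr0.
  rewrite mem_set// normr1 mulr1; apply: (le_trans _ (ler_norm M)).
  apply: contrapT => nM; apply: Zx; right; apply: hS => /=; apply/negP => h; apply: nM.
  by move: h; rewrite normcabs lecR.
Qed.

Lemma bounded_symbolT phi (M : R) : cmeasurable_fun setT phi -> (forall x, cabs (phi x) <= M) -> bounded_symbol phi.
Proof.
by move=> [m1 m2] h; split; [split; exact: measurable_funTS|exists M].
Qed.

(* <T(cf + g), cf + g> for c = 1 and c = i *)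
Lemma linear_polarization (T T' : bergman -> bergman) : linear T -> linear T' ->
  (forall f, ip (T f) f = ip (T' f) f) -> T = T'.
Proof.
move=> lT lT' h; apply/funext => f; apply: (inner_ext hlambda) => g.
have E c : c * ip (T f) g + conjc c * ip (T g) f = c * ip (T' f) g + conjc c * ip (T' g) f.
  have := h (c *: f + g); rewrite lT lT' !inner_linl// !inner_linr// (h f) (h g).
  move: (conjc c) => d; move: (ip _ _) (ip _ _) (ip _ _) (ip _ _) (ip _ _) (ip _ _) => x1 x2 x3 x4 x5 x6 H.
  by apply/eqP; move/eqP: H; rewrite -subr_eq0 => /eqP H; rewrite -subr_eq0 -H; apply/eqP; ring.
have := E 1; have := E (0 +i* 1); rewrite rmorph1 !mul1r.
have -> : conjc (0 +i* 1 : C) = - (0 +i* 1) by apply/eqP; rewrite eq_complex/= oppr0 !eqxx.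
rewrite !mulNr -!mulrBr => /mulfI; rewrite eq_complex/= oner_eq0 andbF => /(_ isT) E1 E2.
have : 2 * ip (T f) g = 2 * ip (T' f) g.
  transitivity ((ip (T f) g - ip (T g) f) + (ip (T f) g + ip (T g) f)); first by ring.
  by rewrite E1 E2; ring.
by apply: mulfI; rewrite pnatr_eq0.
Qed.

Lemma spectral_integral_Mop phi phi0 (Z : set R) (M : R) : spectral_null Z -> cmeasurable_fun setT phi0 ->
  (forall x, cabs (phi0 x) <= M) -> (forall x, phi0 x = phi x * (\1_(~` Z) x)%:C) ->
  spectral_integral lambda phi (Mop phi0).
Proof.
move=> Z0 m0 b0 E; have bs := bounded_symbolT m0 b0; split; first exact: Mop_linear.
by move=> f; rewrite Mop_inner// (cintegral_spectral_rho f Z0 m0 b0 E).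
Qed.

Lemma phi_KE phi (T : bergman -> bergman) : spectral_integral lambda phi T -> phi_K lambda phi = T.
Proof.
move=> ST; have [l1 e1] := xgetPex (fun=> 0) (ex_intro _ T ST); have [l2 e2] := ST.
by apply: linear_polarization => // f; rewrite e1 e2.
Qed.

Lemma phi_K_unique phi : L_infty_E lambda phi -> unique (spectral_integral lambda phi) (phi_K lambda phi).
Proof.
move=> /L_infty_E_rep[Z [phi0 [M [Z0 m0 b0 E]]]].
have S := spectral_integral_Mop Z0 m0 b0 E.
by rewrite (phi_KE S); split => // T /phi_KE <-; rewrite (phi_KE S).
Qed.

Lemma phi_K_Mop phi : L_infty_E lambda phi -> exists2 phi0, bounded_symbol phi0 & phi_K lambda phi = Mop phi0.
Proof.
move=> /L_infty_E_rep[Z [phi0 [M [Z0 m0 b0 E]]]].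
exists phi0; first exact: bounded_symbolT b0.
exact: phi_KE (spectral_integral_Mop Z0 m0 b0 E).
Qed.

Lemma phi_K_ext phi chi : L_infty_E lambda phi -> L_infty_E lambda chi -> E_equal lambda phi chi ->
  phi_K lambda phi = phi_K lambda chi.
Proof.
move=> /L_infty_E_rep[Z1 [phi0 [M1 [N1 m1 b1 E1]]]] /L_infty_E_rep[Z2 [chi0 [M2 [N2 m2 b2 E2]]]].
move=> [S [mS S0 hS]]; have N3 := spectral_measure_null mS S0.
rewrite (phi_KE (spectral_integral_Mop N1 m1 b1 E1)) (phi_KE (spectral_integral_Mop N2 m2 b2 E2)).
apply: Mop_ae => //; [exact: bounded_symbolT b1|exact: bounded_symbolT b2|].
apply: (@filterS3 _ _ (ae_filter_ringOfSetsType mu) _ _ _ _ _ N1 N2 N3) => x n1 n2 n3 Dx.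
rewrite E1 E2 !indicE !mem_set ?mulr1; [|exact: n2|exact: n1].
by apply: contrapT => h; apply: (n3 Dx); apply: hS; apply/eqP.
Qed.

Lemma L_infty_E_Borel phi (M : R) : cmeasurable_fun setT phi -> (forall x, cabs (phi x) <= M) -> L_infty_E lambda phi.
Proof.
have S0 : spectral_measure set0 = (fun=> 0) :> (bergman -> bergman).
  apply/funext => f; rewrite spectral_measureE /Mop -[RHS](V0 hlambda).
  by congr V; apply/funext => x; rewrite indic0 mul0r.
move=> [m1 m2] b; split.
  have h (u : R -> R) f B : measurable_fun setT u -> measurable B -> completed_algebra_gen (spectral_rho f) (u @^-1` B).
    move=> m mB; exists (u @^-1` B); first by rewrite -[X in measurable X]setTI; exact: m.
    exists set0; last by rewrite setU0.
    by exists set0; split => //; rewrite /spectral_rho S0 inner0r.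
  by move=> f B mB; split; [exact: h m1 mB|exact: h m2 mB].
by exists M, set0; split => // x /=; rewrite normcabs lecR b.
Qed.

Lemma phi_K_Borel phi (M : R) : cmeasurable_fun setT phi -> (forall x, cabs (phi x) <= M) -> phi_K lambda phi = Mop phi.
Proof.
move=> m b; apply/phi_KE/(spectral_integral_Mop (Z := set0) _ m b).
  by apply: aeW => x _ [].
by move=> x; rewrite setC0 indicT mulr1.
Qed.

End spectral_integrals.

(** * Vertical operators *)

Section fourier_injectivity.
Context {R : realType}.
Local Notation C := R[i].
Local Notation mu := (@lebesgue_measure R).
Local Notation D := (`]0, +oo[%classic : set R).
Let mD : measurable D. Proof. by []. Qed.

Lemma cfourier_inj (F : R -> C) : cintegrable mu D F ->
  (forall h, cintegral mu D (fun x => shift_symbol h x * F x) = 0) -> ae_eq mu D F (fun=> 0).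
Proof.
move=> [iu iv] H.
have [U W] : ae_eq mu D (fun x => Re (F x)) (fun=> 0) /\ ae_eq mu D (fun x => Im (F x)) (fun=> 0).
  apply: trig_transform_inj => // h.
  have [uc us] := (trig_kernel_int measurable_cos (@cos_max R) h iu, trig_kernel_int measurable_sin (@sin_max R) h iu).
  have [vc vs] := (trig_kernel_int measurable_cos (@cos_max R) h iv, trig_kernel_int measurable_sin (@sin_max R) h iv).
  rewrite /trig_transform -(LRintB mD uc vs) -(LRintD mD us vc).
  have sE x : shift_symbol (- h) x = cos (h * x) +i* sin (h * x).
    by rewrite /shift_symbol /cexp/= expR0 mul1r mulNr opprK.
  have h1 := congr1 Re (H (- h)); have h2 := congr1 Im (H (- h)).
  rewrite cintegralE/= in h1 h2.
  split; [rewrite -[RHS]h1|rewrite -[RHS]h2]; apply: Leq_Rint => x _; rewrite sE/=.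
    by case: (F x) => a b /=; ring.
  by case: (F x) => a b /=; ring.
apply: (@filterS2 _ _ (ae_filter_ringOfSetsType mu) _ _ _ _ U W) => x h1 h2 Dx.
by rewrite [LHS]complexE h1 ?h2.
Qed.

End fourier_injectivity.

Section vertical_operators.
Context {R : realType}.
Local Notation C := R[i].
Local Notation mu := (@lebesgue_measure R).
Local Notation D := (`]0, +oo[%classic : set R).
Let mD : measurable D. Proof. by []. Qed.
Variable lambda : R.
Hypothesis hlambda : -1 < lambda.
Implicit Types (psi phi chi : R -> C).
Local Notation V := (of_half_line lambda).
Local Notation ip := (bergman_inner lambda).
Local Notation bergman := (bergman lambda).
Implicit Types f g : bergman.
Local Notation N f := (Re (ip f f)).
Local Notation g0 := (fun x : R => expR (- x)).

Lemma norm_ge0 f : 0 <= N f.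
Proof.
rewrite innerE// ip2_self/=; apply: Rintegral_ge0 => x _; by rewrite mulr1 exprn_ge0 ?cabs_ge0.
Qed.

Lemma normV psi : L2_half_line psi -> N (V psi) = \int[mu]_(x in D) cabs (psi x) ^+ 2.
Proof.
move=> L; rewrite V_inner// ip2_self/= /sq_norm; by apply: Leq_Rint => x _; rewrite mulr1.
Qed.

Lemma inner0l f : ip 0 f = 0. Proof. by rewrite (inner_conj hlambda f 0) inner0r// rmorph0. Qed.

Lemma inner_cauchy_schwarz f g : (Re (ip f g)) ^+ 2 <= N g * N f.
Proof.
apply: quadratic_ge0; [exact: norm_ge0|exact: norm_ge0|].
move=> t; have := norm_ge0 (t%:C *: f + g).
rewrite inner_linl// !inner_linr// (inner_conj hlambda f g).
move: (ip f f) (ip g g) (ip f g) => [a a'] [b b'] [c c'] /= /le_trans; apply.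
by rewrite le_eqVlt; apply/orP; left; apply/eqP; ring.
Qed.

Lemma L2_real (u : R -> R) : sq_int mu D u -> L2_half_line (fun x => (u x)%:C).
Proof.
move=> su; apply/L2_half_lineP; split => //; split; first exact: measurable_cst.
rewrite (_ : _ \o _ = cst 0%E); [exact: integrable0|by apply/funext => x /=; rewrite expr0n].
Qed.

Lemma bounded_operatorP (T : bergman -> bergman) : bounded_operator ip T ->
  linear T /\ exists2 M : R, 0 <= M & forall f, N (T f) <= M ^+ 2 * N f.
Proof.
move=> [lT [M hM]]; split => //; exists `|M| => // f; have := hM f; rewrite /hnorm => h.
rewrite real_normK ?num_real// -(sqr_sqrtr (norm_ge0 f)) -(sqr_sqrtr (norm_ge0 (T f))) -exprMn.
rewrite lerXn2r ?nnegrE ?sqrtr_ge0//; exact: le_trans (sqrtr_ge0 _) h.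
Qed.

Lemma L2_prod psi phi : L2_half_line psi -> L2_half_line phi -> cintegrable mu D (fun x => psi x * phi x).
Proof.
move=> /L2_half_lineP[a1 a2] /L2_half_lineP[b1 b2]; split.
  by apply: (Leq_rint mD _ (LrintB mD (Lsq_int_mul mD a1 b1) (Lsq_int_mul mD a2 b2))) => x _; rewrite cReM.
by apply: (Leq_rint mD _ (LrintD mD (Lsq_int_mul mD a1 b2) (Lsq_int_mul mD a2 b1))) => x _; rewrite cImM.
Qed.

Let g0_gt0 (x : R) : D x -> 0 < g0 x. Proof. by rewrite expR_gt0. Qed.

Let sg0 : sq_int mu D g0. Proof. by have /L2_half_lineP[] := @L2_exp_weight R. Qed.

Section operator.
Variable T : bergman -> bergman.
Hypotheses (bT : bounded_operator ip T) (vT : vertical T).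

Let lT : linear T. Proof. by case: bT. Qed.

(** The Riesz theorem available is real: it is applied to real functions, with k = 1 for the real
    part of the functional and k = -i for its imaginary part. *)
Lemma functional_real (k : C) : cabs k = 1 -> exists chi : R -> R, sq_int mu D chi /\
  forall u, sq_int mu D u ->
    Re (k * ip (T (V (fun x => (u x)%:C))) (V exp_weight)) = \int[mu]_(x in D) (u x * chi x).
Proof.
move=> k1; have [_ [M M0 hM]] := bounded_operatorP bT.
pose l u := Re (k * ip (T (V (fun x => (u x)%:C))) (V exp_weight)).
have bnd (f : R -> R) (A : R) : measurable_fun D f -> (forall x, D x -> `|f x| <= A * g0 x) -> sq_int mu D f.
  move=> mf fA; apply: (sq_int_le (m := mu) mD mf (sq_intZ (m := mu) mD A sg0)) => x Dx.
  exact: le_trans (fA x Dx) (ler_norm _).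
have lin (a : R) (f g : R -> R) : sq_int mu D f -> sq_int mu D g -> sq_int mu D (fun x => a * f x + g x) /\
    l (fun x => a * f x + g x) = a * l f + l g.
  move=> sf sg; split; first by apply: sq_intD => //; exact: sq_intZ.
  rewrite /l (_ : (fun x => _) = (fun x => a%:C * (f x)%:C + (g x)%:C)); last first.
    by apply/funext => x; rewrite rmorphD rmorphM.
  rewrite V_lin//; [|exact: L2_real..].
  rewrite lT inner_linl//.
  by case: (k) (ip _ _) (ip _ _) => [x1 y1] [x2 y2] [x3 y3] /=; ring.
have lb (f : R -> R) : sq_int mu D f -> l f ^+ 2 <= (N (V exp_weight) * M ^+ 2) * \int[mu]_(x in D) f x ^+ 2.
  move=> sf; have E : l f = Re (ip (k *: T (V (fun x => (f x)%:C)) + 0) (V exp_weight)).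
    by rewrite /l inner_linl// inner0l addr0.
  rewrite E; apply: le_trans (inner_cauchy_schwarz _ _) _; rewrite -mulrA ler_wpM2l ?norm_ge0//.
  have -> : N (k *: T (V (fun x => (f x)%:C)) + 0) = N (T (V (fun x => (f x)%:C))).
    rewrite inner_linl// inner_linr// inner0l inner0r// !addr0.
    have kk : k * conjc k = 1.
      have := cabs_sqr k; rewrite k1 expr1n; case: (k) => a b /= ab; apply/eqP; rewrite eq_complex/=.
      by apply/andP; split; apply/eqP; [rewrite ab; ring|ring].
    by rewrite mulrA kk mul1r.
  apply: le_trans (hM _) _; rewrite normV; last exact: L2_real.
  by under eq_Rintegral do rewrite cabs_real real_normK ?num_real//.
have [chi [schi hchi]] := @riesz _ _ _ mu D mD _ g0_gt0 sg0 (sq_int mu D) l _ (fun u h => h) bnd lin lb.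
by exists chi; split => // u su; exact: hchi.
Qed.

Lemma functional_vertical : exists chi, L2_half_line chi /\
  forall psi, L2_half_line psi -> ip (T (V psi)) (V exp_weight) = cintegral mu D (fun x => psi x * chi x).
Proof.
have [c1 [s1 h1]] := functional_real (@cabs1 R).
have k1 : cabs (0 -i* 1 : C) = 1 by rewrite -cabsN -[RHS](@cabs_i R); congr cabs; apply/eqP; rewrite eq_complex/= oppr0 opprK !eqxx.
have [c2 [s2 h2]] := functional_real k1.
have hr u : sq_int mu D u -> ip (T (V (fun x => (u x)%:C))) (V exp_weight) =
    (\int[mu]_(x in D) (u x * c1 x)) +i* (\int[mu]_(x in D) (u x * c2 x)).
  move=> su; rewrite -h1// -h2//; case: (ip _ _) => a b /=.
  by apply/eqP; rewrite eq_complex/=; apply/andP; split; apply/eqP; ring.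
exists (fun x => c1 x +i* c2 x); split; first exact/L2_half_lineP.
move=> psi /L2_half_lineP[p1 p2].
have -> : psi = (fun x => (0 +i* 1) * (Im (psi x))%:C + (Re (psi x))%:C).
  apply/funext => x; case: (psi x) => a b.
  by apply/eqP; rewrite eq_complex/=; apply/andP; split; apply/eqP; ring.
rewrite V_lin//; [|exact: L2_real..].
rewrite lT inner_linl// !hr// cintegralE/=.
have [[[i1 i2] i3] i4] := (Lsq_int_mul mD p1 s1, Lsq_int_mul mD p1 s2, Lsq_int_mul mD p2 s1, Lsq_int_mul mD p2 s2).
apply/eqP; rewrite eq_complex/=; apply/andP; split; apply/eqP.
  transitivity (\int[mu]_(x in D) (Re (psi x) * c1 x - Im (psi x) * c2 x)).
    by rewrite (LRintB mD i1 i4); ring.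
  by apply: Leq_Rint => x _; ring.
transitivity (\int[mu]_(x in D) (Re (psi x) * c2 x + Im (psi x) * c1 x)).
  by rewrite (LRintD mD i2 i3); ring.
by apply: Leq_Rint => x _; ring.
Qed.

(** Pairing with e^{-xi} makes both sides integrable, so they have Fourier integrals. At [h] the
    left one pairs the translate of T V psi with V e^{-xi}; verticality moves the translation onto
    psi, where [functional_vertical] evaluates it. *)
Lemma vertical_multiplier : exists chi, L2_half_line chi /\
  forall psi, L2_half_line psi ->
    ae_eq mu D (fun x => bergman_R (T (V psi)) x * exp_weight x) (fun x => psi x * chi x).
Proof.
have [chi [L2c hchi]] := functional_vertical; exists chi; split => // psi L2p.
have Le := @L2_exp_weight R; have Lr := RP hlambda (T (V psi)).
pose F x := -1 * (bergman_R (T (V psi)) x * exp_weight x) + psi x * chi x.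
have bs h := @shift_symbol_bounded R h.
have F0 : ae_eq mu D F (fun=> 0).
  apply: cfourier_inj.
    by apply: (cintegrable_lin (m := mu)) => //; exact: L2_prod.
  move=> h; have L1 := L2_symbol (bs h) Lr; have L3 := L2_symbol (bs h) L2p.
  have E : cintegral mu D (fun x => shift_symbol h x * bergman_R (T (V psi)) x * exp_weight x) =
      cintegral mu D (fun x => shift_symbol h x * psi x * chi x).
    have tT : T (translation h (V psi)) = translation h (T (V psi)) by have := congr1 (@^~ (V psi)) (vT h).
    rewrite -(hchi _ L3) -translation_V// tT translationE// V_inner//.
    apply: Leq_cintegral => x _; rewrite /exp_weight mulr1.
    by congr (_ * _); apply/eqP; rewrite eq_complex/= oppr0 !eqxx.
  transitivity (-1 * cintegral mu D (fun x => shift_symbol h x * bergman_R (T (V psi)) x * exp_weight x) +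
     cintegral mu D (fun x => shift_symbol h x * psi x * chi x)); last by rewrite E mulN1r addNr.
  rewrite -(cintegral_lin (m := mu) _ _ (L2_prod L1 Le) (L2_prod L3 L2c))//.
  by apply: Leq_cintegral => x _; rewrite /F; ring.
apply: (@filterS _ _ (ae_filter_ringOfSetsType mu) _ _ _ F0) => x hx Dx.
by apply/eqP; rewrite -subr_eq0 -oppr_eq0 opprB addrC -mulN1r; apply/eqP/hx.
Qed.

Lemma vertical_symbol : exists phi M, [/\ cmeasurable_fun setT phi, forall x, cabs (phi x) <= M & T = Mop phi].
Proof.
have [chi [L2c hchi]] := vertical_multiplier.
have [_ [M M0 hM]] := bounded_operatorP bT.
pose q x := chi x * (expR x)%:C.
have [m1 m2] : cmeasurable_fun D q.
  apply: cmeasurableM; [exact: L2c.1|apply: cmeasurable_real; apply: measurable_funTS; exact: measurable_expR].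
have mcq : measurable_fun D (fun x => cabs (q x)) by exact: measurable_cabs.
have R_T psi : L2_half_line psi -> ae_eq mu D (bergman_R (T (V psi))) (fun x => q x * psi x).
  move=> /hchi E; apply: (@filterS _ _ (ae_filter_ringOfSetsType mu) _ _ _ E) => x hx Dx.
  rewrite /q mulrC mulrA -hx// -mulrA /exp_weight -rmorphM/= -expRD addNr expR0.
  by rewrite mulr1.
have qM : {ae mu, forall x, D x -> cabs (q x) <= M}.
  (* Testing [T] on the part of e^{-xi} carried by the set where |q| > M: there |q psi|^2 - M^2
     |psi|^2 is positive, while the bound on [T] makes its integral at most 0. So that set is
     null. *)
  pose psi x : C := if M < cabs (q x) then exp_weight x else 0.
  have L2p : L2_half_line psi.
    apply: (L2_dominated (M := 1) _ (@L2_exp_weight R)).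
      split; rewrite /psi.
        rewrite (_ : _ \o _ = fun x => if M < cabs (q x) then expR (- x) else 0); last first.
          by apply/funext => x /=; case: ifP.
        apply: measurable_fun_if => //; first by apply: measurable_fun_ltr.
          by mfun.
      rewrite (_ : _ \o _ = fun=> 0) //.
      by apply/funext => x /=; case: ifP.
    by move=> x _; rewrite /psi mul1r; case: ifP => // _; rewrite cabs0 cabs_ge0.
  have L2q : L2_half_line (fun x => q x * psi x).
    apply: (L2_ae _ (RP hlambda _) (R_T _ L2p)).
    by apply: cmeasurableM => //; exact: L2p.1.
  have : N (T (V psi)) <= M ^+ 2 * N (V psi) by exact: hM.
  rewrite normV// -(VR hlambda (T (V psi))) (V_ae hlambda (RP hlambda _) L2q (R_T _ L2p)) normV// => le.
  have i1 : mu.-integrable D (EFin \o (fun x => cabs (q x * psi x) ^+ 2)).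
    by apply: (Leq_rint mD _ (L2_int L2q)) => x _; rewrite mulr1.
  have i2 : mu.-integrable D (EFin \o (fun x => cabs (psi x) ^+ 2)).
    by apply: (Leq_rint mD _ (L2_int L2p)) => x _; rewrite mulr1.
  pose G x := cabs (q x * psi x) ^+ 2 - M ^+ 2 * cabs (psi x) ^+ 2.
  have iG : mu.-integrable D (EFin \o G) by exact: (LrintB mD i1 (LrintZ mD _ i2)).
  have GE x : G x = (cabs (q x) ^+ 2 - M ^+ 2) * cabs (psi x) ^+ 2.
    by rewrite /G cabsM exprMn mulrBl.
  have G0 x : D x -> 0 <= G x.
    move=> _; rewrite GE /psi; case: ifP => [Mq|_]; last by rewrite cabs0 expr0n mulr0.
    by rewrite mulr_ge0 ?exprn_ge0 ?cabs_ge0// subr_ge0 lerXn2r ?nnegrE ?cabs_ge0// ltW.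
  have IG : \int[mu]_(x in D) G x = 0.
    apply/eqP; rewrite eq_le Rintegral_ge0// andbT.
    by rewrite (LRintB mD i1 (LrintZ mD _ i2)) (LRintZ mD _ i2) subr_le0.
  apply: (@filterS _ _ (ae_filter_ringOfSetsType mu) _ _ _ (Rint0_ae (m := mu) mD iG G0 IG)) => x hx Dx.
  rewrite leNgt; apply/negP => Mq; move/eqP: (hx Dx); rewrite GE /psi Mq /exp_weight cabs_real.
  rewrite mulf_eq0 subr_eq0 expf_eq0/= normr_eq0 (gt_eqF (expR_gt0 _)) orbF eqrXn2 ?cabs_ge0//.
  by move=> /eqP e; rewrite e ltxx in Mq.
(* The symbol must be Borel and bounded at every point of the real line, so it is set to 0 off the
   half-line and on the null set where the bound fails. *)
pose ok x := `[< D x >] && (cabs (q x) <= M).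
pose phi x : C := if ok x then q x else 0.
have mok (u : R -> R) : measurable_fun D u -> measurable_fun setT (fun x => if ok x then u x else 0).
  move=> mu_; rewrite (_ : (fun x => _) = (fun x => if cabs (q x) <= M then u x else 0) \_ D).
    apply/measurable_restrict => //; rewrite setTI.
    by apply: measurable_fun_if => //; [exact: measurable_fun_ler|exact: measurable_funS mu_].
  apply/funext => x; rewrite patchE /ok; have [Dx|Dx] := pselect (D x).
    by rewrite asboolT//= mem_set.
  by rewrite asboolF//= memNset.
have mphi : cmeasurable_fun setT phi.
  split.
    rewrite (_ : _ \o _ = fun x => if ok x then Re (q x) else 0); first exact: mok.
    by apply/funext => x; rewrite /phi /=; case: ifP.
  rewrite (_ : _ \o _ = fun x => if ok x then Im (q x) else 0); first exact: mok.
  by apply/funext => x; rewrite /phi /=; case: ifP.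
have bphi x : cabs (phi x) <= M by rewrite /phi; case: ifP => [/andP[]//|_]; rewrite cabs0.
exists phi, M; split => //; apply/funext => f.
have bs := bounded_symbolT mphi bphi.
have Lf := RP hlambda f; have L1 := L2_symbol bs Lf.
rewrite -[LHS](VR hlambda) -{1}(VR hlambda f); apply: (V_ae hlambda (RP hlambda _) L1).
apply: (@filterS2 _ _ (ae_filter_ringOfSetsType mu) _ _ _ _ (R_T _ Lf) qM) => x h1 h2 Dx.
by rewrite h1// /phi /ok asboolT// h2.
Qed.

End operator.
End vertical_operators.

(** * The algebra of functions of K *)

Section spectral_algebra.
Context {R : realType}.
Local Notation C := R[i].
Variable lambda : R.
Hypothesis hlambda : -1 < lambda.
Local Notation ip := (bergman_inner lambda).
Local Notation bergman := (bergman lambda).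
Local Notation JL := (phi_K lambda @` L_infty_E lambda).
Implicit Types (phi chi : R -> C) (S T : bergman -> bergman).

Lemma phi_K_imageE : JL = [set T | bounded_operator ip T /\ vertical T].
Proof.
apply/seteqP; split => [_ [phi /(phi_K_Mop hlambda)[phi0 b0 ->] <-]|T [bT vT]] /=.
  by split; [exact: Mop_bounded|exact: Mop_vertical].
have [phi [M [mphi bphi ->]]] := vertical_symbol hlambda bT vT.
by exists phi; [exact: L_infty_E_Borel bphi|exact: phi_K_Borel bphi].
Qed.

Lemma phi_K_imageP T : JL T <-> exists2 phi, bounded_symbol phi & T = Mop phi.
Proof.
split=> [[phi /(phi_K_Mop hlambda)[phi0 b0 E] <-]|[phi bphi ->]]; first by exists phi0.
by rewrite phi_K_imageE; split; [exact: Mop_bounded|exact: Mop_vertical].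
Qed.

Lemma phi_K_image_comm S T : JL S -> JL T -> S \o T = T \o S.
Proof. by move=> /phi_K_imageP[phi b1 ->] /phi_K_imageP[chi b2 ->]; exact: Mop_comm. Qed.

Lemma Mop_lin (c : C) phi chi : bounded_symbol phi -> bounded_symbol chi ->
  bounded_symbol (fun x => c * phi x + chi x) /\
  (fun f => c *: Mop phi f + Mop chi f) = Mop (fun x => c * phi x + chi x) :> (bergman -> bergman).
Proof.
move=> b1 b2; split.
  have [[m1 [M1 h1]] [m2 [M2 h2]]] := (b1, b2); split.
    by apply: cmeasurableD => //; apply: cmeasurableM => //; exact: cmeasurable_cst.
  by exists (cabs c * M1 + M2) => x Dx; apply: cabsD_le; [apply: cabsM_le; [|exact: h1]|exact: h2].
apply/funext => f; rewrite /Mop -(V_lin hlambda c (L2_symbol b1 (RP hlambda f)) (L2_symbol b2 (RP hlambda f))).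
by congr of_half_line; apply/funext => x; ring.
Qed.

(** The two pairs (tau_h f, g) and (f, tau_h^* g) are approximated at once by a vertical [S], for
    which the corresponding scalar products agree; each approximation costs e / 2. Together with
    [phi_K_imageE] this gives closedness for the weak operator topology. *)
Lemma wot_adherent_vertical T : wot_adherent ip JL T -> vertical T.
Proof.
move=> hT h; apply/funext => f; apply: (inner_ext hlambda) => g /=.
set a := shift_symbol h; have ba : bounded_symbol a by exact: shift_symbol_bounded.
pose g' := Mop (fun x => conjc (a x)) g : bergman.
have adj k : ip (translation h k) g = ip k g' by rewrite translationE//; exact: Mop_adjoint.
rewrite adj; apply/eqP; rewrite -subr_eq0 -cabs_eq0 eq_le cabs_ge0 andbT.
apply/ler_addgt0Pl => e e0; rewrite addr0.
have [S JS hS] := hT [:: (translation h f, g); (f, g')] (e / 2) (divr_gt0 e0 (ltr0n _ 2)).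
have SE : ip (S (translation h f)) g = ip (S f) g'.
  by move: JS; rewrite phi_K_imageE => -[_ /(_ h)/(congr1 (@^~ f))/= ->]; rewrite adj.
have h1 := hS (translation h f, g) (mem_head _ _).
have h2 : `|ip (T f) g' - ip (S f) g'| < (e / 2)%:C by apply: (hS (f, g')); rewrite !inE eqxx orbT.
move: h1 h2; rewrite /= SE !normcabs !ltcR => h1 h2.
rewrite (_ : _ - _ = (ip (T (translation h f)) g - ip (S f) g') - (ip (T f) g' - ip (S f) g')); last by ring.
by rewrite (le_trans (cabsB _ _))// [leRHS]splitr ltW// ltrD.
Qed.

Lemma phi_K_von_neumann : von_neumann_algebra ip JL.
Proof.
split.
- by rewrite phi_K_imageE => T [].
- rewrite phi_K_imageE; split => //; split => //; exists 1 => f; by rewrite mul1r.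
- move=> c S T /phi_K_imageP[phi b1 ->] /phi_K_imageP[chi b2 ->].
  have [b3 E] := Mop_lin c b1 b2; split; apply/phi_K_imageP; first by eexists; [exact: b3|].
  exists (fun x => phi x * chi x); first exact: bounded_symbolM.
  by apply/funext => f; exact: MopM.
- move=> T /phi_K_imageP[phi b ->]; exists (Mop (fun x => conjc (phi x))); last exact: Mop_adjoint.
  by apply/phi_K_imageP; eexists; [exact: bounded_symbol_conj b|].
- by move=> T bT /wot_adherent_vertical vT; rewrite phi_K_imageE.
Qed.

End spectral_algebra.

Theorem corollary4p3 (R : realType) (lambda : R) (hlambda : -1 < lambda) :
  let J : (R -> R[i]) -> (bergman lambda -> bergman lambda) := phi_K lambda in
  let JL : set (bergman lambda -> bergman lambda) := J @` L_infty_E lambda in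
  [/\ (* E is the spectral measure of K, and J is well defined on classes *)
      (forall f g : bergman lambda, bergman_K f g <-> bergman_xi f g),
      (forall phi, L_infty_E lambda phi ->
         unique (spectral_integral lambda phi) (J phi)),
      (forall phi psi, L_infty_E lambda phi -> L_infty_E lambda psi ->
         E_equal lambda phi psi -> J phi = J psi) &
      [/\ JL = [set T | bounded_operator (bergman_inner lambda) T /\ vertical T],
          (forall S T, JL S -> JL T -> S \o T = T \o S) &
          von_neumann_algebra (bergman_inner lambda) JL]].
Proof.
split; [exact: K_spectral|exact: phi_K_unique|exact: phi_K_ext|split].
- exact: phi_K_imageE.
- exact: phi_K_image_comm.
- exact: phi_K_von_neumann.
Qed.
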